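(* Let $X\subset\mathbb{P}^N$ be a non-degenerate manifold of dimension $n$, let $SX\subset\mathbb{P}^N$ be its secant variety, let $c:=N-\dim SX$, and let $n^*:=\dim X^*$ be the dimension of the dual variety $X^*\subset\mathbb{P}^{N*}$ of $X$. If $SX\neq\mathbb{P}^N$, then $n^*\geq n+c+1$, with equality if and only if $X$ is either a curve or the Veronese surface in $\mathbb{P}^5$.
   Context: We work over the complex numbers. A manifold $X\subset\mathbb{P}^N$ means an irreducible non-singular closed projective subvariety of $\mathbb{P}^N$; it is non-degenerate if it is not contained in any hyperplane of $\mathbb{P}^N$. For $x\in X$, $T_xX\subset\mathbb{P}^N$ denotes the embedded (projective) tangent space to $X$ at $x$, a linear subspace of dimension $\dim X$. The secant variety $SX\subset\mathbb{P}^N$ is the closure of the union of all lines $\langle x,x'\rangle$ with $x,x'\in X$, $x\neq x'$. The dual variety $X^*\subset\mathbb{P}^{N*}$ is the set of hyperplanes $H\subset\mathbb{P}^N$ such that $T_xX\subset H$ for some $x\in X$. The Veronese surface in $\mathbb{P}^5$ is the image of $\mathbb{P}^2$ under the embedding given by the complete linear system of conics, up to projective equivalence. *)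

(* Defs.v *)
From mathcomp Require Import all_boot all_order all_algebra.
From mathcomp Require Import mpoly.
From mathcomp Require Import boolp classical_sets reals.
From mathcomp Require Import complex.

Set Implicit Arguments.
Unset Strict Implicit.
Unset Printing Implicit Defensive.

Import GRing.Theory.
Local Open Scope classical_set_scope.
Local Open Scope ring_scope.

(* Points of P^N are the lines through the origin of K^(N+1). *)
Definition pspace (K : fieldType) (N : nat) : Type :=
  {L : {vspace 'rV[K]_N.+1} | \dim L == 1%N}.

(* One choice of homogeneous coordinates of x, i.e. a nonzero vector of the
   line x.  Every use below is invariant under rescaling it. *)
Definition coords (K : fieldType) (N : nat) (x : pspace K N) : 'rV[K]_N.+1 :=
  vpick (val x).

Section ProjectiveGeometry.
Variables (K : fieldType) (N : nat).
Local Notation P := (pspace K N).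
Implicit Types (A X : set P) (x y a : P) (p : {mpoly K[N.+1]}).

Definition homogeneous p : Prop := exists d : nat, p \is d.-homog.

Definition zero_at p x : Prop := p.@[coords x 0] = 0.

Definition zariski_closed A : Prop :=
  exists2 S : set {mpoly K[N.+1]}, S `<=` homogeneous &
    A = [set x | forall p, S p -> zero_at p x].

Definition zariski_closure A : set P :=
  \bigcap_(C in [set C | zariski_closed C /\ A `<=` C]) C.

Definition irreducible A : Prop :=
  A !=set0 /\
  forall C D, zariski_closed C -> zariski_closed D -> A `<=` C `|` D ->
    A `<=` C \/ A `<=` D.

(* A strictly increasing chain Z 0, ..., Z k of irreducible subsets of A that
   are closed in the topology induced on A. *)
Definition irreducible_chain A (k : nat) : Prop :=
  exists Z : nat -> set P,
    (forall i, (i <= k)%N ->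
       irreducible (Z i) /\
       exists2 C, zariski_closed C & Z i = A `&` C) /\
    (forall i, (i < k)%N -> Z i `<` Z i.+1).

(* Krull dimension of A as a topological space.  The default value 0 is only
   taken by the empty set, since chains in P^N have length at most N. *)
Definition krull_dim A : nat :=
  xget 0%N [set k | irreducible_chain A k /\
                    forall m, irreducible_chain A m -> (m <= k)%N].

Definition linear_subspace A (k : nat) : Prop :=
  exists2 L : {vspace 'rV[K]_N.+1}, \dim L = k.+1 &
    A = [set x | (val x <= L)%VS].

(* The hyperplane with equation sum_i a_i X_i = 0.  Thus P^N also serves as the
   dual projective space, a point being identified with the hyperplane whose
   coefficients are its homogeneous coordinates. *)
Definition hyperplane a : set P :=
  [set x | \sum_i coords a 0 i * coords x 0 i = 0].

Definition non_degenerate X : Prop := forall a, ~ (X `<=` hyperplane a).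

(* Embedded tangent space: p ranges over the homogeneous elements of the ideal
   of X. *)
Definition tangent_space X x : set P :=
  [set y | forall p, homogeneous p -> (forall z, X z -> zero_at p z) ->
     \sum_i (p^`M(i)).@[coords x 0] * coords y 0 i = 0].

Definition nonsingular X : Prop :=
  forall x, X x -> linear_subspace (tangent_space X x) (krull_dim X).

Definition manifold X : Prop :=
  [/\ zariski_closed X, irreducible X & nonsingular X].

Definition join_line x y : set P := [set z | (val z <= val x + val y)%VS].

Definition secant_variety X : set P :=
  zariski_closure
    [set z | exists x y, [/\ X x, X y, x <> y & join_line x y z]].

Definition dual_variety X : set P :=
  [set a | exists2 x, X x & tangent_space X x `<=` hyperplane a].

End ProjectiveGeometry.

(* Row-free and row-full together say that M is square and invertible, so this
   forces N = N'; the rectangular format avoids a cast along that equality. *)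
Definition projectively_equivalent (K : fieldType) (N N' : nat)
    (X : set (pspace K N)) (Y : set (pspace K N')) : Prop :=
  exists M : 'M[K]_(N.+1, N'.+1), [/\ row_free M, row_full M &
    Y = [set y | exists2 x, X x & val y = <[coords x *m M]>%VS]].

Definition conics_at (K : fieldType) (u : 'rV[K]_3) : 'rV[K]_6 :=
  let u0 := u 0 (inord 0) in
  let u1 := u 0 (inord 1) in
  let u2 := u 0 (inord 2) in
  \row_(k < 6) [:: u0 ^+ 2; u0 * u1; u0 * u2; u1 ^+ 2; u1 * u2; u2 ^+ 2]`_k.

Definition standard_veronese (K : fieldType) : set (pspace K 5) :=
  [set y | exists u : pspace K 2, val y = <[conics_at (coords u)]>%VS].

Definition veronese_surface (K : fieldType) (N : nat)
    (X : set (pspace K N)) : Prop :=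
  projectively_equivalent (@standard_veronese K) X.

(* Main.v *)
(* Let A be the affine cone over X, d = n + 1, and let x, mu, y be generic: x in A,
   then a conormal vector mu at x, then y in A.  Points are generic over countable
   subrings k of the base field, and the tangent space at a point that is generic over
   a ring of definition consists of its velocities D x, for the derivations D vanishing
   on k.  Hence dim SX + 1 = dim (T_x + T_y) (Terracini), and nstar + 1 is N + 1 minus
   the dimension of the kernel L of the second fundamental form of X at x in the
   direction mu, which is the cone over the contact locus.

   For e in L and w in T_y there is a derivation moving x by e and y by w while fixing
   mu.  Since x is isolated among the points z of A at which mu is normal and for which
   z + (y - x) lies in A, a derivation that also fixes y - x kills x, so L and T_y meet
   in 0.  And L + T_y is not all of T_x + T_y, since otherwise x + y would remain generic
   in the secant cone over k(mu); the equations of the secant cone would then have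
   zero gradient at x + y, and SX would be the whole space.  Hence
   dim L + d < dim (T_x + T_y), which is the inequality.

   When equality holds and d > 2, general normals of T_x + T_y have a kernel which is
   transverse to general tangent spaces.  If dim L > 1, then T_x and T_y meet in one
   line, d = dim L + 2, and A contains linear spaces U in T_x and U' in T_y of dimension
   dim L + 1 through a common vector t; but U + U' is too large for T_t.  If dim L = 1,
   then d = 3 and N = 5, and at a general point there are three linear forms spanning
   the conormal space whose values on A satisfy p r = q^2.  For three general points
   these relations fit together into six linear forms on A which are the products
   of three coordinates, so that X is a Veronese surface. *)
From mathcomp Require Import all_boot all_order all_algebra.
From mathcomp Require Import perm mpoly ring lra zify.
From mathcomp Require Import boolp classical_sets functions cardinality reals complex.
Set Implicit Arguments.
Unset Strict Implicit.
Unset Printing Implicit Defensive.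
Import Order.TTheory GRing.Theory Num.Theory.
Local Open Scope classical_set_scope.
Local Open Scope ring_scope.
Require Import Defs.

(** Generic points are taken in the field itself: over an uncountable algebraically closed field
    every irreducible zero set has a point outside countably many given proper subsets, so rings of
    definition can be enlarged repeatedly by coordinates and coefficients. Derivations of the whole
    field serve as tangent vectors, and second order data come from differentiating twice. In
    characteristic zero a derivation extends from any subring, and at a point generic over [k1] its
    value can be prescribed without changing it on [k1]; hence the order of the choices [x], [mu],
    [y].

    Smoothness at every point serves to show that the tangency system has no solution at infinity.
    Normality and the Taylor expansion of the equations at [x] yield, by Cramer's rule, an equation
    whose leading form is the square of a Jacobian minor, and these minors have no common zero on
    the cone but the vertex. So the solutions are finitely many, and a derivation killing the
    coefficients kills them.

    With [d = n + 1] and [dim L = N - nstar], the bound [dim L + d < dim (T_x + T_y) = N - c + 1]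
    reads [n + c + 1 <= nstar]. *)

Lemma Zorn_above (T : Type) (P : set (set T)) (A0 : set T) :
  P A0 -> A0 !=set0 ->
  (forall F : set (set T), F !=set0 -> F `<=` P -> total_on F subset ->
     P (\bigcup_(X in F) X)) ->
  exists A, P A /\ forall B, A `<` B -> ~ P B.
Proof.
move=> PA0 A0n0 chP.
have [|A [[A0'|PA] Amax]] := @Zorn_bigcup T [set X | X = set0 \/ P X].
- move=> F FP totF.
  have [[X [FX PX]]|noX] := pselect (exists X, F X /\ P X); last first.
    left; rewrite eqEsubset; split=> // t [X FX Xt].
    case: (FP _ FX) => [X0|PX]; first by rewrite X0 in Xt.
    by case: noX; exists X.
  right; have -> : \bigcup_(X in F) X = \bigcup_(X in F `&` P) X.
    rewrite eqEsubset; split=> t [Y FY Yt]; last by exists Y => //; case: FY.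
    exists Y => //; split=> //; case: (FP _ FY) => // Y0.
    by rewrite Y0 in Yt.
  apply: chP; first by exists X.
    by move=> Y [].
  by move=> Y Z [FY _] [FZ _]; exact: totF.
- exfalso; apply: (Amax A0); last by right.
  by rewrite A0'; split=> // h; case: A0n0 => t /h.
- by exists A; split=> // B AB PB; apply: (Amax B) => //; right.
Qed.

Definition is_ideal (A : comNzRingType) (I : set A) : Prop :=
  [/\ I 0, forall x y, I x -> I y -> I (x + y) & forall a x, I x -> I (a * x)].

Lemma is_ideal_sum (A : comNzRingType) (I : set A) (J : Type) (r : seq J)
    (P : pred J) (F : J -> A) :
  is_ideal I -> (forall j, P j -> I (F j)) -> I (\sum_(j <- r | P j) F j).
Proof. by move=> [I0 ID IM] h; apply: (big_ind (fun x => I x) I0 ID h). Qed.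

Lemma is_idealN (A : comNzRingType) (I : set A) x : is_ideal I -> I x -> I (- x).
Proof. by case=> I0 ID IM h; rewrite -mulN1r; exact: IM. Qed.

Lemma is_idealB (A : comNzRingType) (I : set A) x y :
  is_ideal I -> I x -> I y -> I (x - y).
Proof. by move=> hI hx hy; case: (hI) => _ ID _; apply: ID => //; exact: is_idealN. Qed.

Lemma mpoly_ring_ind (n : nat) (A : comNzRingType) (P : {mpoly A[n]} -> Prop) :
  (forall c, P c%:MP) -> (forall i, P 'X_i) ->
  (forall p q, P p -> P q -> P (p + q)) ->
  (forall p q, P p -> P q -> P (p * q)) -> forall p, P p.
Proof.
move=> PC PX PD PM p.
have P0 : P 0 by rewrite -mpolyC0; exact: PC.
have P1 : P 1 by rewrite -mpolyC1; exact: PC.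
rewrite [p]mpolyE; apply: (big_ind (fun x => P x) P0 PD) => m _.
rewrite -mul_mpolyC; apply: (PM); first exact: PC.
rewrite mpolyXE_id; apply: (big_ind (fun x => P x) P1 PM) => i _.
by elim: (m i) => [|k IHk]; rewrite ?expr0 // exprS; exact: PM.
Qed.

(** * Zeros over an uncountable field *)

Section GenericPoint.
Variables (K : numClosedFieldType) (n : nat).
Hypothesis Kunc : ~ countable [set: K].
Implicit Types (I Q S : set {mpoly K[n]}).

Lemma infinite_uniq_seq (T : eqType) (B : set T) (k : nat) :
  ~ countable B -> exists s : seq T, [/\ uniq s, size s = k & forall x, x \in s -> B x].
Proof.
move=> Bn; elim: k => [|k [s [us ss sB]]]; first by exists [::].
have [x [Bx xs]] : exists x, B x /\ x \notin s.
  apply: contrapT => h; apply: Bn; apply: finite_set_countable.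
  apply: (sub_finite_set (B := [set` s])); last exact: finite_seq.
  move=> x Bx /=; apply: contrapT => /negP xs; apply: h; by exists x.
by exists (x :: s); split=> /=; rewrite ?xs ?ss // => y; rewrite inE => /orP[/eqP->|/sB].
Qed.

Lemma mpoly_dependent (d : nat) (I : finType) (g : I -> {mpoly K[n]}) :
  (forall i, msize (g i) <= d)%N -> (#|{: 'X_{1..n < d}}| < #|I|)%N ->
  exists c : I -> K, (exists i, c i != 0) /\ \sum_i c i *: g i = 0.
Proof.
move=> gd cI; pose M := \matrix_(i < #|I|, j < #|{: 'X_{1..n < d}}|)
  (g (enum_val i))@_(enum_val j : 'X_{1..n < d}).
have : kermx M != 0.
  rewrite kermx_eq0 /row_free neq_ltn; apply/orP; left.
  exact: leq_ltn_trans (rank_leq_col _) cI.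
case/rowV0Pn => v /sub_kermxP vM v0.
exists (fun i => v 0 (enum_rank i)); split.
  case/matrix0Pn: v0 => i [j vij]; exists (enum_val j).
  by rewrite enum_valK -(ord1 i).
apply/mpolyP => m; rewrite mcoeff0 raddf_sum /=.
have [md|md] := ltnP (mdeg m) d; last first.
  apply: big1 => i _; rewrite mcoeffZ memN_msupp_eq0 ?mulr0 //.
  by apply: msize_mdeg_ge; exact: leq_trans md.
have := congr1 (fun A : 'M_(_, _) => A 0 (enum_rank (BMultinom md))) vM.
rewrite !mxE => vm; rewrite -[RHS]vm (reindex (enum_val : 'I_#|I| -> I)) /=; last first.
  by apply: onW_bij; exact: enum_val_bij.
by apply: eq_bigr => i _; rewrite mcoeffZ mxE enum_valK enum_rankK.
Qed.

(** [P] splits into linear factors over [K], and a prime ideal without constants contains one of the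
    factors. *)
Lemma ideal_poly_root Q (i : 'I_n) (P : {poly K}) :
  is_ideal Q -> ~ Q 1 -> (forall p q, Q (p * q) -> Q p \/ Q q) -> P != 0 ->
  Q (map_poly (@mpolyC n K) P).['X_i] -> exists a, Q ('X_i - a%:MP).
Proof.
move=> hQ Q1 Qpr P0; have [rs ->] := closed_field_poly_normal P.
rewrite -mul_polyC rmorphM /= map_polyC /= hornerM hornerC => /Qpr[].
  move=> hc; exfalso; apply: Q1; case: hQ => _ _ /(_ (lead_coef P)^-1%:MP _ hc).
  by rewrite -mpolyCM mulVf ?lead_coef_eq0 // mpolyC1.
elim: rs => [|r rs IH]; first by rewrite big_nil rmorph1 hornerC => /Q1.
rewrite big_cons rmorphM hornerM => /Qpr[|/IH//].
rewrite rmorphB /= map_polyX map_polyC /= hornerD hornerN hornerX hornerC.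
by exists r.
Qed.

(* A prime ideal maximal among those disjoint from [S] contains some ['X_i - a]
   for every [i]: otherwise each [a] gives [g_a] with [(X_i - a) g_a] in [S]
   modulo the ideal; as [K] is uncountable, uncountably many [g_a] share the
   same element of [S] and the same degree bound, so they are dependent. *)
Theorem exists_zero_avoiding I S :
  is_ideal I -> S 1 -> (forall s t, S s -> S t -> S (s * t)) -> countable S ->
  (forall s, S s -> ~ I s) ->
  exists a : 'I_n -> K, (forall p, I p -> p.@[a] = 0) /\
    forall s, S s -> s.@[a] != 0.
Proof.
move=> hI S1 SM Sc SI.
pose good (J : set {mpoly K[n]}) := [/\ is_ideal J, I `<=` J & forall s, S s -> ~ J s].
have [||F [J0 FJ0] FP totF|Q [[hQ IQ QS] Qmax]] := @Zorn_above _ good I.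
- by split.
- by exists 0; case: hI.
- split.
  + split; first by exists J0 => //; have [[]] := FP _ FJ0.
      move=> x y [J1 F1 J1x] [J2 F2 J2y].
      have [J12|J21] := totF _ _ F1 F2.
        by exists J2 => //; have [[_ D _] _ _] := FP _ F2; apply: D => //; exact: J12.
      by exists J1 => //; have [[_ D _] _ _] := FP _ F1; apply: D => //; exact: J21.
    by move=> a x [J1 F1 J1x]; exists J1 => //; have [[_ _ M] _ _] := FP _ F1; exact: M.
  + by move=> x Ix; exists J0 => //; have [_ h _] := FP _ FJ0; exact: h.
  + by move=> s Ss [J1 F1 J1s]; have [_ _ h] := FP _ F1; apply: h Ss J1s.
have [Q0 QD QM] := hQ.
have out f : ~ Q f -> exists s g, S s /\ Q (s - g * f).
  move=> Qf; apply: contrapT => h.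
  pose J := [set x | exists q g, Q q /\ x = q + g * f].
  apply: (Qmax J).
    split; last first.
      move=> JQ; apply: Qf; apply: JQ; exists 0, 1; split=> //; ring.
    by move=> x Qx; exists x, 0; split=> //; ring.
  split.
  - split; first by exists 0, 0; split=> //; ring.
      move=> _ _ [q [g [Qq ->]]] [q' [g' [Qq' ->]]]; exists (q + q'), (g + g').
      by split; [exact: QD | ring].
    move=> a _ [q [g [Qq ->]]]; exists (a * q), (a * g).
    by split; [exact: QM | ring].
  - by move=> x Ix; exists x, 0; split; [exact: IQ | ring].
  - move=> s Ss [q [g [Qq sE]]]; apply: h; exists s, g; split=> //.
    by rewrite sE addrK.
have Q1 : ~ Q 1 by exact: QS.
have Qpr p q : Q (p * q) -> Q p \/ Q q.
  move=> Qpq; apply: contrapT => /not_orP[/out[s [g [Ss h1]]] /out[t [g' [St h2]]]].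
  apply: (QS (s * t)); first exact: SM.
  have -> : s * t = (s - g * p) * t + g * p * (t - g' * q) + g * g' * (p * q) by ring.
  by apply: (QD); [apply: (QD); [rewrite mulrC|]|]; exact: QM.
have pt i : exists a, Q ('X_i - a%:MP).
  apply: contrapT => h.
  have /choice[sg sgP] a : exists sg : {mpoly K[n]} * {mpoly K[n]},
      S sg.1 /\ Q (sg.1 - sg.2 * ('X_i - a%:MP)).
    have [|s [g [Ss hs]]] := out ('X_i - a%:MP); last by exists (s, g).
    by move=> Qa; apply: h; exists a.
  pose B (sd : {mpoly K[n]} * nat) := [set a | (sg a).1 = sd.1 /\ (msize (sg a).2 <= sd.2)%N].
  have [[s d] nB] : exists sd, ~ countable (B sd).
    apply: contrapT => hc; apply: Kunc.
    have -> : [set: K] = \bigcup_(sd in S `*` [set: nat]) B sd.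
      rewrite eqEsubset; split=> // a _.
      by exists ((sg a).1, msize (sg a).2) => //; split=> //=; have [] := sgP a.
    apply: bigcup_countable; first exact: countableX.
    by move=> sd _; apply: contrapT => hsd; apply: hc; exists sd.
  have [l [ul sl lB]] := infinite_uniq_seq #|{: 'X_{1..n < d}}|.+1 nB.
  pose a (j : 'I_(size l)) := l`_j.
  have ainj : injective a.
    by move=> j k /eqP; rewrite nth_uniq // => /eqP /ord_inj.
  have aB j : B (s, d) (a j) by apply: lB; exact: mem_nth.
  have [j||c [[j0 cj0] csum]] := @mpoly_dependent d _ (fun j => (sg (a j)).2).
  - by have [] := aB j.
  - by rewrite card_ord sl.
  (* Modulo [Q], [s] equals [g_j ('X_i - a_j)] for every [j]; so [s P('X_i)] is the product of all
     ['X_i - a_k] times [\sum_j c_j g_j], which is [0]. And [P] is nonzero because its value at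
     [a_j0] is [c_j0] times nonzero differences. *)
  pose P : {poly K} := \sum_j c j *: \prod_(k | k != j) ('X - (a k)%:P).
  have PE : (map_poly (@mpolyC n K) P).['X_i] =
      \sum_j (c j)%:MP * \prod_(k | k != j) ('X_i - (a k)%:MP).
    rewrite rmorph_sum horner_sum; apply: eq_bigr => j _.
    rewrite -mul_polyC rmorphM /= map_polyC /= hornerM hornerC rmorph_prod horner_prod.
    congr (_ * _); apply: eq_bigr => k _.
    by rewrite rmorphB /= map_polyX map_polyC /= hornerD hornerN hornerX hornerC.
  have P0 : P != 0.
    have PjE : P.[a j0] = c j0 * \prod_(k | k != j0) (a j0 - a k).
      rewrite horner_sum (bigD1 j0) //= [X in _ + X]big1 ?addr0 => [|j jj0].
        rewrite hornerZ horner_prod; congr (_ * _).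
        by apply: eq_bigr => k _; rewrite hornerXsubC.
      rewrite hornerZ horner_prod (bigD1 j0) 1?eq_sym //=.
      by rewrite hornerXsubC subrr mul0r mulr0.
    apply/eqP => P0; move: PjE; rewrite P0 horner0 => /esym/eqP.
    rewrite mulf_eq0 (negPf cj0) /= prodf_seq_eq0 => /hasP[k _ /andP[kj]].
    by rewrite subr_eq0 (inj_eq ainj) eq_sym (negPf kj).
  have [|x Qx] := @ideal_poly_root Q i P hQ Q1 Qpr P0; last by apply: h; exists x.
  suff [Qs|//] : Q s \/ Q (map_poly (@mpolyC n K) P).['X_i].
    by case: (QS s _ Qs); have [/= <- _] := aB j0; have [] := sgP (a j0).
  have prodE j : \prod_k ('X_i - (a k)%:MP) =
      ('X_i - (a j)%:MP) * \prod_(k | k != j) ('X_i - (a k)%:MP).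
    by rewrite (bigD1 j).
  apply: Qpr; rewrite PE mulr_sumr.
  have -> : \sum_j s * ((c j)%:MP * \prod_(k | k != j) ('X_i - (a k)%:MP)) =
    \sum_j (c j)%:MP * \prod_(k | k != j) ('X_i - (a k)%:MP)
       * (s - (sg (a j)).2 * ('X_i - (a j)%:MP))
    + (\prod_k ('X_i - (a k)%:MP)) * \sum_j c j *: (sg (a j)).2.
    rewrite mulr_sumr -big_split /=; apply: eq_bigr => j _.
    by rewrite (prodE j) -mul_mpolyC; ring.
  rewrite csum mulr0 addr0; apply: is_ideal_sum => // j _; apply: QM.
  by have [/= <- _] := aB j; have [] := sgP (a j).
have /choice[a aP] := pt.
(* Each variable is a scalar modulo [Q], hence so is each polynomial: [Q] is the ideal of the point
   [a]. *)
have Qa p : Q (p - p.@[a]%:MP).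
  elim/mpoly_ring_ind: p => [c|i|p q hp hq|p q hp hq].
  - by rewrite mevalC subrr.
  - by rewrite mevalXU.
  - by rewrite mevalD mpolyCD opprD addrACA; exact: QD.
  - rewrite mevalM mpolyCM.
    have -> : p * q - p.@[a]%:MP * q.@[a]%:MP =
      q * (p - p.@[a]%:MP) + p.@[a]%:MP * (q - q.@[a]%:MP) by ring.
    by apply: QD; exact: QM.
exists a; split=> [p Ip|s Ss].
  apply/eqP/negP => /negP pa; apply: Q1.
  have -> : 1 = (p.@[a]^-1)%:MP * (p - (p - p.@[a]%:MP)) :> {mpoly K[n]}.
    by rewrite opprB addrC subrK -mpolyCM mulVf // mpolyC1.
  by apply: QM; apply: is_idealB => //; exact: IQ.
apply/eqP => sa; apply: (QS s Ss).
by have := Qa s; rewrite sa mpolyC0 subr0.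
Qed.

Definition ideal_gen (E : set {mpoly K[n]}) : set {mpoly K[n]} :=
  [set p | forall J, is_ideal J -> E `<=` J -> J p].

Lemma ideal_genP E : is_ideal (ideal_gen E).
Proof.
split=> [J [J0 _ _] _ //|x y hx hy J hJ EJ|a x hx J hJ EJ]; case: (hJ) => _ D M.
  by apply: D; [exact: hx | exact: hy].
by apply: M; exact: hx.
Qed.

Lemma sub_ideal_gen E : E `<=` ideal_gen E.
Proof. by move=> p Ep J _; apply. Qed.

Lemma ideal_gen_eval (E : set {mpoly K[n]}) (a : 'I_n -> K) p :
  (forall e, E e -> e.@[a] = 0) -> ideal_gen E p -> p.@[a] = 0.
Proof.
move=> Ea /(_ [set p | p.@[a] = 0]); apply=> //.
split=> [|x y /= hx hy|b x /= hx]; rewrite /= ?meval0 ?mevalD ?mevalM //.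
  by rewrite hx hy addr0.
by rewrite hx mulr0.
Qed.

(** If no power of [f] lay in the ideal, the powers of [f] would be a countable multiplicative set
    disjoint from it, and [exists_zero_avoiding] would give a zero of [E] at which [f] does not
    vanish. *)
Theorem nullstellensatz (E : set {mpoly K[n]}) f :
  (forall a : 'I_n -> K, (forall e, E e -> e.@[a] = 0) -> f.@[a] = 0) ->
  exists m, ideal_gen E (f ^+ m).
Proof.
move=> h; apply: contrapT => nf.
have [|||||a [aI aS]] := @exists_zero_avoiding (ideal_gen E) [set f ^+ m | m in [set: nat]].
- exact: ideal_genP.
- by exists 0%N => //; rewrite expr0.
- by move=> _ _ [m _ <-] [m' _ <-]; exists (m + m')%N => //; rewrite exprD.
- exact: (card_le_trans (card_image_le _ _)).
- by move=> _ [m _ <-] hm; apply: nf; exists m.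
have := aS f; rewrite h ?eqxx => [/(_ _)/negP|e Ee]; last by apply: aI; exact: sub_ideal_gen.
by case; first by exists 1%N.
Qed.

End GenericPoint.

(** * Derivations *)

Section Derivations.
Variable K : numClosedFieldType.
Implicit Types (D : K -> K) (k : set K).

Definition derivation D : Prop :=
  (forall a b, D (a + b) = D a + D b) /\ (forall a b, D (a * b) = D a * b + a * D b).

Definition Der k D : Prop := derivation D /\ forall c, k c -> D c = 0.

Lemma der0 D : derivation D -> D 0 = 0.
Proof. by move=> [hD _]; apply: (addrI (D 0)); rewrite -hD !addr0. Qed.

Lemma der1 D : derivation D -> D 1 = 0.
Proof.
move=> [_ hM]; have := hM 1 1; rewrite !mulr1 mul1r => h.
by apply: (addrI (D 1)); rewrite addr0 -h.
Qed.

Lemma derN D a : derivation D -> D (- a) = - D a.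
Proof.
move=> hD; apply: (addrI (D a)); rewrite subrr.
by case: (hD) => <- _; rewrite subrr der0.
Qed.

Lemma derB D a b : derivation D -> D (a - b) = D a - D b.
Proof. by move=> hD; case: (hD) => -> _; rewrite derN. Qed.

Lemma der_sum D (I : Type) (r : seq I) (P : pred I) (F : I -> K) :
  derivation D -> D (\sum_(i <- r | P i) F i) = \sum_(i <- r | P i) D (F i).
Proof.
move=> hD; case: (hD) => hA _; elim: r => [|i r IH]; first by rewrite !big_nil der0.
by rewrite !big_cons; case: (P i); rewrite ?hA IH.
Qed.

Lemma der_nat D n : derivation D -> D n%:R = 0.
Proof.
move=> hD; elim: n => [|n IH]; first exact: der0.
by rewrite -natr1; case: (hD) => -> _; rewrite IH der1 ?addr0.
Qed.

Lemma der_add D E : derivation D -> derivation E -> derivation (fun a => D a + E a).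
Proof.
by move=> [hA hM] [kA kM]; split=> a b; rewrite ?hA ?kA ?hM ?kM; ring.
Qed.

Lemma der_scale D c : derivation D -> derivation (fun a => c * D a).
Proof. by move=> [hA hM]; split=> a b; rewrite ?hA ?hM; ring. Qed.

Lemma der_bracket D E : derivation D -> derivation E ->
  derivation (fun a => D (E a) - E (D a)).
Proof.
move=> hD hE; case: (hD) (hE) => [hA hM] [kA kM]; split=> a b.
  by rewrite kA hA hA kA; ring.
by rewrite kM hM !hA !kA !hM !kM; ring.
Qed.

Definition subring k : Prop :=
  [/\ k 1, forall a b, k a -> k b -> k (a - b) & forall a b, k a -> k b -> k (a * b)].

Lemma subring0 k : subring k -> k 0.
Proof. by move=> [k1 kB _]; rewrite -(subrr 1); exact: kB. Qed.

Lemma subringN k a : subring k -> k a -> k (- a).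
Proof. by move=> hk ka; rewrite -sub0r; case: (hk) => _ kB _; apply: kB => //; exact: subring0. Qed.

Lemma subringD k a b : subring k -> k a -> k b -> k (a + b).
Proof.
by move=> hk ka kb; rewrite -[b]opprK; case: (hk) => _ kB _; apply: kB => //; exact: subringN.
Qed.

Lemma subring_sum k (I : Type) (r : seq I) (P : pred I) (F : I -> K) :
  subring k -> (forall i, P i -> k (F i)) -> k (\sum_(i <- r | P i) F i).
Proof.
move=> hk; apply: (big_ind (fun x => k x)); first exact: subring0.
by move=> x y; exact: subringD.
Qed.

Lemma subring_prod k (I : Type) (r : seq I) (P : pred I) (F : I -> K) :
  subring k -> (forall i, P i -> k (F i)) -> k (\prod_(i <- r | P i) F i).
Proof. by move=> [k1 _ kM]; apply: (big_ind (fun x => k x)). Qed.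

Lemma subring_exp k a n : subring k -> k a -> k (a ^+ n).
Proof. by move=> [k1 _ kM] ka; elim: n => [|n IH]; rewrite ?expr0 // exprS; exact: kM. Qed.

Lemma subring_nat k n : subring k -> k n%:R.
Proof.
move=> hk; elim: n => [|n IH]; first exact: subring0.
by rewrite -natr1; apply: subringD => //; case: hk.
Qed.

Section MPoly.
Variable n : nat.
Implicit Types (p q : {mpoly K[n]}) (x w : 'I_n -> K).

Definition over k p : Prop := forall m, k p@_m.

Lemma overC k c : subring k -> k c -> over k (c%:MP : {mpoly K[n]}).
Proof.
by move=> hk kc m; rewrite mcoeffC; case: (hk) => _ _; apply => //; exact: subring_nat.
Qed.

Lemma over0 k : subring k -> over k (0 : {mpoly K[n]}).
Proof. by move=> hk m; rewrite mcoeff0; exact: subring0. Qed.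

Lemma over1 k : subring k -> over k (1 : {mpoly K[n]}).
Proof. by move=> hk; rewrite -mpolyC1; apply: overC => //; case: hk. Qed.

Lemma overX k m : subring k -> over k ('X_[m] : {mpoly K[n]}).
Proof. by move=> hk m'; rewrite mcoeffX; exact: subring_nat. Qed.

Lemma overD k p q : subring k -> over k p -> over k q -> over k (p + q).
Proof. by move=> hk hp hq m; rewrite mcoeffD; exact: subringD. Qed.

Lemma overN k p : subring k -> over k p -> over k (- p).
Proof. by move=> hk hp m; rewrite mcoeffN; exact: subringN. Qed.

Lemma overB k p q : subring k -> over k p -> over k q -> over k (p - q).
Proof. by move=> hk hp hq; apply: overD => //; exact: overN. Qed.

Lemma overM k p q : subring k -> over k p -> over k q -> over k (p * q).
Proof.
move=> hk hp hq m; rewrite mcoeffM; apply: subring_sum => // i _.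
by case: hk => _ _; apply.
Qed.

Lemma overZ k c p : subring k -> k c -> over k p -> over k (c *: p).
Proof. by move=> hk kc hp; rewrite -mul_mpolyC; apply: overM => //; exact: overC. Qed.

Lemma over_sum k (I : Type) (r : seq I) (P : pred I) (F : I -> {mpoly K[n]}) :
  subring k -> (forall i, P i -> over k (F i)) -> over k (\sum_(i <- r | P i) F i).
Proof.
by move=> hk h m; rewrite raddf_sum /=; apply: subring_sum => // i Pi; exact: h.
Qed.

Lemma over_prod k (I : Type) (r : seq I) (P : pred I) (F : I -> {mpoly K[n]}) :
  subring k -> (forall i, P i -> over k (F i)) -> over k (\prod_(i <- r | P i) F i).
Proof.
move=> hk h; apply: (big_ind (over k)) => // [|x y]; first exact: over1.
exact: overM.
Qed.

Lemma over_exp k p j : subring k -> over k p -> over k (p ^+ j).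
Proof.
by move=> hk hp; elim: j => [|j IH]; rewrite ?expr0 ?exprS; [exact: over1|exact: overM].
Qed.

Lemma over_deriv k p i : subring k -> over k p -> over k p^`M(i).
Proof.
move=> hk hp m; rewrite mcoeff_deriv -mulr_natr.
by case: (hk) => _ _; apply => //; exact: subring_nat.
Qed.

Lemma over_eval k p x : subring k -> over k p -> (forall i, k (x i)) -> k p.@[x].
Proof.
move=> hk hp hx; rewrite mevalE; apply: subring_sum => // m _.
case: (hk) => _ _; apply => //; apply: subring_prod => // i _.
exact: subring_exp.
Qed.

Definition dird p x w := \sum_i p^`M(i).@[x] * w i.

Lemma dirdD p q x w : dird (p + q) x w = dird p x w + dird q x w.
Proof.
by rewrite /dird -big_split; apply: eq_bigr => i _; rewrite mderivD mevalD mulrDl.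
Qed.

Lemma dirdZ c p x w : dird (c *: p) x w = c * dird p x w.
Proof.
by rewrite /dird mulr_sumr; apply: eq_bigr => i _; rewrite mderivZ mevalZ mulrA.
Qed.

Lemma dirdN p x w : dird (- p) x w = - dird p x w.
Proof. by rewrite -scaleN1r dirdZ mulN1r. Qed.

Lemma dirdB p q x w : dird (p - q) x w = dird p x w - dird q x w.
Proof. by rewrite dirdD dirdN. Qed.

Lemma dird_sum (I : Type) (r : seq I) (P : pred I) (F : I -> {mpoly K[n]}) x w :
  dird (\sum_(i <- r | P i) F i) x w = \sum_(i <- r | P i) dird (F i) x w.
Proof.
elim: r => [|i r IH]; first by rewrite !big_nil /dird big1 // => i _; rewrite mderiv0 meval0 mul0r.
by rewrite !big_cons; case: (P i); rewrite ?dirdD IH.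
Qed.

Lemma dirdM p q x w : dird (p * q) x w = dird p x w * q.@[x] + p.@[x] * dird q x w.
Proof.
rewrite /dird mulr_suml mulr_sumr -big_split; apply: eq_bigr => i _.
by rewrite mderivM mevalD !mevalM /=; ring.
Qed.

Lemma dirdC c x w : dird c%:MP x w = 0.
Proof. by rewrite /dird big1 // => i _; rewrite mderivC meval0 mul0r. Qed.

Lemma dirdXU i x w : dird 'X_i x w = w i.
Proof.
rewrite /dird (bigD1 i) //= mderivX mnmE eqxx scale1r.
have -> : (U_(i) - U_(i) = 0)%MM by apply/mnmP => j; rewrite !mnmE subnn.
rewrite mpolyX0 meval1 mul1r big1 ?addr0 // => j ji.
by rewrite mderivX mnmE eq_sym (negPf ji) scale0r meval0 mul0r.
Qed.

Definition dpoly D p : {mpoly K[n]} := \sum_(m <- msupp p) D p@_m *: 'X_[m].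

Lemma mcoeff_dpoly D p m : derivation D -> (dpoly D p)@_m = D p@_m.
Proof.
move=> hD; rewrite /dpoly raddf_sum /=.
have [mp|mp] := boolP (m \in msupp p); last first.
  rewrite (memN_msupp_eq0 mp) (der0 hD) big_seq big1 // => m' m'p.
  rewrite mcoeffZ mcoeffX; case: eqP => [e|_]; last by rewrite mulr0.
  by rewrite -e m'p in mp.
rewrite (bigD1_seq m) ?msupp_uniq //= mcoeffZ mcoeffX eqxx mulr1.
by rewrite big1 ?addr0 // => m' m'm; rewrite mcoeffZ mcoeffX (negPf m'm) mulr0.
Qed.

Lemma dpolyD D p q : derivation D -> dpoly D (p + q) = dpoly D p + dpoly D q.
Proof.
move=> hD; apply/mpolyP => m; rewrite mcoeffD !mcoeff_dpoly // mcoeffD.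
by case: hD => ->.
Qed.

Lemma dpolyC D c : derivation D -> dpoly D c%:MP = (D c)%:MP.
Proof.
move=> hD; apply/mpolyP => m; rewrite mcoeff_dpoly // !mcoeffC.
by case: (m == 0%MM); rewrite ?mulr1 // !mulr0 der0.
Qed.

Lemma dpolyX D m : derivation D -> dpoly D 'X_[m] = 0.
Proof.
move=> hD; apply/mpolyP => m'; rewrite mcoeff_dpoly // mcoeff0 mcoeffX.
exact: der_nat.
Qed.

Lemma dpolyM D p q : derivation D -> dpoly D (p * q) = dpoly D p * q + p * dpoly D q.
Proof.
move=> hD; apply/mpolyP => m; rewrite mcoeff_dpoly // mcoeffD !mcoeffM der_sum //.
rewrite -big_split; apply: eq_bigr => i _; rewrite /= !mcoeff_dpoly //.
by case: hD => _ ->.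
Qed.

Lemma der_eval D p (a : 'I_n -> K) : derivation D ->
  D p.@[a] = (dpoly D p).@[a] + dird p a (fun i => D (a i)).
Proof.
move=> hD; case: (hD) => hA hM; elim/mpoly_ring_ind: p => [c|i|p q hp hq|p q hp hq].
- by rewrite dpolyC // !mevalC dirdC addr0.
- by rewrite dpolyX // mevalXU meval0 dirdXU add0r.
- by rewrite dpolyD // dirdD !mevalD hA hp hq; ring.
- by rewrite dpolyM // dirdM mevalD !mevalM hM hp hq; ring.
Qed.

Lemma dpoly_over k D p : Der k D -> over k p -> dpoly D p = 0.
Proof.
by move=> [hD hk] hp; apply/mpolyP => m; rewrite mcoeff_dpoly // mcoeff0 hk.
Qed.

End MPoly.

(** The graph of a derivation defined on a subring of [K]. As a graph it is a set, to which Zorn's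
    lemma applies; the last clause and the closure under subtraction make it single valued. *)
Definition partial_der (G : set (K * K)) : Prop :=
  [/\ G (1, 0), forall x y, G x -> G y -> G (x.1 - y.1, x.2 - y.2),
      forall x y, G x -> G y -> G (x.1 * y.1, x.2 * y.1 + x.1 * y.2) &
      forall b, G (0, b) -> b = 0].

Section Extend.
Variable G : set (K * K).
Hypothesis hG : partial_der G.

(** The coefficients of [P] lie in the domain of the partial derivation, and [Q] is the result of
    applying it to each of them. *)
Definition gpoly (P Q : {poly K}) : Prop := forall i, G (P`_i, Q`_i).

Lemma pd0 : G (0, 0).
Proof. by case: hG => G1 GB _ _; have := GB _ _ G1 G1; rewrite /= !subrr. Qed.

Lemma pdN a b : G (a, b) -> G (- a, - b).
Proof. by case: hG => G1 GB _ _ /(GB _ _ pd0); rewrite /= !sub0r. Qed.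

Lemma pdB a b a' b' : G (a, b) -> G (a', b') -> G (a - a', b - b').
Proof. by case: hG => G1 GB _ _ h /(GB _ _ h). Qed.

Lemma pdD a b a' b' : G (a, b) -> G (a', b') -> G (a + a', b + b').
Proof. by move=> h /pdN /(pdB h); rewrite !opprK. Qed.

Lemma pdM a b a' b' : G (a, b) -> G (a', b') -> G (a * a', b * a' + a * b').
Proof. by case: hG => G1 _ GM _ h /(GM _ _ h). Qed.

Lemma pd_sum (I : Type) (r : seq I) (P : pred I) (F H : I -> K) :
  (forall i, P i -> G (F i, H i)) ->
  G (\sum_(i <- r | P i) F i, \sum_(i <- r | P i) H i).
Proof.
move=> h; elim: r => [|i r IH]; first by rewrite !big_nil; exact: pd0.
by rewrite !big_cons; case: ifP => // Pi; apply: pdD => //; exact: h.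
Qed.

Lemma pd_natmul a b n : G (a, b) -> G (a *+ n, b *+ n).
Proof. by move=> h; elim: n => [|n IH]; rewrite ?mulr0n ?mulrS; [exact: pd0|exact: pdD]. Qed.

Lemma gpolyB P Q P' Q' : gpoly P Q -> gpoly P' Q' -> gpoly (P - P') (Q - Q').
Proof. by move=> h h' i; rewrite !coefB; exact: pdB. Qed.

Lemma gpolyM P Q P' Q' : gpoly P Q -> gpoly P' Q' -> gpoly (P * P') (Q * P' + P * Q').
Proof.
move=> h h' i; rewrite coefD !coefM -big_split; apply: pd_sum => j _.
exact: pdM.
Qed.

Lemma gpolyC a b : G (a, b) -> gpoly a%:P b%:P.
Proof. by move=> h [|i]; rewrite !coefC //=; apply: pd0. Qed.

Lemma gpolyXn j : gpoly 'X^j 0.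
Proof.
move=> i; rewrite coefXn coef0; case: eqP => _ /=; last exact: pd0.
by case: hG.
Qed.

Lemma gpoly_deriv P Q : gpoly P Q -> gpoly P^`() Q^`().
Proof. by move=> h i; rewrite !coef_deriv; exact: pd_natmul. Qed.

(** Differentiating [P.[a] = 0] shows which equations the value [b] at [a] of an extension of [G]
    must satisfy. If [a] is transcendental over the domain there are none; otherwise the equation
    for a polynomial of least size determines [b], and pseudo-division by that polynomial yields all
    the others. *)
Lemma deriv_value (a : K) : exists b, forall P Q, gpoly P Q -> P.[a] = 0 ->
  Q.[a] + P^`().[a] * b = 0.
Proof.
have G0 b : G (0, b) -> b = 0 by move=> Gb; case: hG => _ _ _; apply.
have [[P0 hP0]|noP] := pselect (exists P, (exists Q, gpoly P Q) /\ P != 0 /\ P.[a] = 0); last first.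
  exists 0 => P Q hPQ Pa; rewrite mulr0 addr0.
  have P0 : P = 0.
    by apply/eqP/negP => /negP P0; apply: noP; exists P; split; [exists Q|].
  suff -> : Q = 0 by rewrite horner0.
  by apply/polyP => i; rewrite coef0; apply: G0; have := hPQ i; rewrite P0 coef0.
pose sz := [pred s | `[< exists P, [/\ exists Q, gpoly P Q, P != 0, P.[a] = 0 & size P = s] >]].
have exsz : exists s, sz s.
  by exists (size P0); apply/asboolP; exists P0; case: hP0 => ? [].
case: (ex_minnP exsz) => s /asboolP[P [[Q hPQ] Pn0 Pa sP]] smin.
have Pmin U W : gpoly U W -> U.[a] = 0 -> (size U < s)%N -> U = 0.
  move=> hU Ua sU; apply/eqP/negP => /negP Un0.
  have : sz (size U) by apply/asboolP; exists U; split=> //; exists W.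
  by move/smin; rewrite leqNgt sU.
have P'a : P^`().[a] != 0.
  apply/eqP => P'a; have P'0 := Pmin _ _ (gpoly_deriv hPQ) P'a.
  have : P^`() = 0 by apply: P'0; rewrite -sP lt_size_deriv.
  move=> P'e; have sP1 : (size P <= 1)%N.
    rewrite leqNgt; apply/negP => sP2.
    have := congr1 (fun p : {poly K} => p`_(size P).-2) P'e.
    rewrite coef_deriv coef0 prednK ?ltn_predRL // => /eqP.
    by rewrite -mulr_natr mulf_eq0 pnatr_eq0 -/(lead_coef P) lead_coef_eq0 (negPf Pn0) /= eqn0Ngt ltn_predRL sP2.
  by move: Pa Pn0; rewrite (size1_polyC sP1) hornerC => ->; rewrite eqxx.
exists (- Q.[a] / P^`().[a]) => U W; set b := - Q.[a] / _.
have hb : Q.[a] + P^`().[a] * b = 0 by rewrite /b mulrCA mulfV // mulr1 subrr.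
clearbody b.
have [m] := ubnP (size U); elim: m U W => // m IH U W; rewrite ltnS => sU hU Ua.
have [sUs|sUs] := ltnP (size U) s.
  have U0 := Pmin _ _ hU Ua sUs; rewrite U0 deriv0 horner0 mul0r addr0.
  suff -> : W = 0 by rewrite horner0.
  by apply/polyP => i; rewrite coef0; apply: G0; have := hU i; rewrite U0 coef0.
have Un0 : U != 0 by rewrite -size_poly_gt0 (leq_trans _ sUs) // -sP size_poly_gt0.
set lp := lead_coef P; set lu := lead_coef U.
have hlp : G (lp, Q`_(size P).-1) by exact: hPQ.
have hlu : G (lu, W`_(size U).-1) by exact: hU.
set qp := Q`_ _ in hlp; set qu := W`_ _ in hlu.
pose j := (size U - size P)%N.
(* One step of pseudo-division: [lp U - lu X^j P] vanishes at [a] and is smaller than [U]. The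
   equation for it and the one for [P] give the equation for [U], because [lp] is nonzero. *)
have h1 := gpolyM (gpolyC hlp) hU.
have h2 := gpolyM (gpolyC hlu) (gpolyM (gpolyXn j) hPQ).
have h3 := gpolyB h1 h2.
have lp0 : lp != 0 by rewrite lead_coef_eq0.
have := IH _ _ _ h3.
have -> : (lp%:P * U - lu%:P * ('X^j * P)).[a] = 0.
  by rewrite hornerD hornerN !hornerM Ua Pa !mulr0 subr0.
have sj : (size U = size P + j)%N by rewrite /j subnKC // sP.
have sz3 : (size (lp%:P * U - lu%:P * ('X^j * P))%R < m)%N.
  apply: leq_trans sU; rewrite -[X in (_ < X)%N]prednK ?size_poly_gt0 // ltnS.
  apply/leq_sizeP => i; rewrite leq_eqVlt => /orP[/eqP <-|hi].
    rewrite coefB !coefCM coefXnM ltnNge sj.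
    have -> : (j <= (size P + j).-1)%N.
      by rewrite -(prednK (n := size P)) ?size_poly_gt0 // addSn /= leq_addl.
    have -> : ((size P + j).-1 - j)%N = (size P).-1.
      by rewrite -(prednK (n := size P)) ?size_poly_gt0 // addSn /= addnK.
    by rewrite /= -sj mulrC subrr.
  rewrite coefB !coefCM coefXnM.
  have hU0 : U`_i = 0 by rewrite nth_default // -ltnS; case: (size U) hi.
  rewrite hU0 mulr0 sub0r; case: ifP => _; first by rewrite mulr0 oppr0.
  rewrite [P`__]nth_default ?mulr0 ?oppr0 //.
  move: hi; rewrite sj -(prednK (n := size P)) ?size_poly_gt0 // addSn /= => hi.
  by rewrite ltn_subRL addnC.
move=> /(_ sz3 erefl); rewrite !(derivE, hornerE) Ua Pa /= => h.
have : lp * (W.[a] + U^`().[a] * b) = 0.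
  rewrite -[RHS]h.
  transitivity (lp * (W.[a] + U^`().[a] * b) - lu * a ^+ j * (Q.[a] + P^`().[a] * b)).
    by rewrite hb mulr0 subr0.
  by ring.
by move/eqP; rewrite mulf_eq0 (negPf lp0) => /eqP.
Qed.

End Extend.
End Derivations.

(** * Extension of derivations to the whole field *)

Section Extension.
Variable K : numClosedFieldType.
Implicit Types (D : K -> K) (k : set K).

(** A maximal partial derivation is total, since [deriv_value] extends it to the polynomial
    expressions in any further element. *)
Theorem der_extend (G : set (K * K)) : partial_der G ->
  exists D, derivation D /\ forall a b, G (a, b) -> D a = b.
Proof.
move=> hG0.
have [||F [G0 FG0] FP totF|M [[hM GM] Mmax]] :=
  @Zorn_above _ [set H | partial_der H /\ G `<=` H] G.
- by split.
- by exists (1, 0); case: hG0.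
- split; last by move=> x Gx; exists G0 => //; have [_ h] := FP _ FG0; exact: h.
  have two x y : (\bigcup_(X in F) X) x -> (\bigcup_(X in F) X) y ->
      exists2 H, F H & H x /\ H y.
    move=> [H1 F1 h1] [H2 F2 h2]; have [H12|H21] := totF _ _ F1 F2.
      by exists H2 => //; split=> //; exact: H12.
    by exists H1 => //; split=> //; exact: H21.
  split.
  + by exists G0 => //; have [[]] := FP _ FG0.
  + move=> x y hx hy; have [H FH [h1 h2]] := two _ _ hx hy.
    by exists H => //; have [[_ hB _ _] _] := FP _ FH; exact: hB.
  + move=> x y hx hy; have [H FH [h1 h2]] := two _ _ hx hy.
    by exists H => //; have [[_ _ hB _] _] := FP _ FH; exact: hB.
  + by move=> b [H FH hb]; have [[_ _ _ h] _] := FP _ FH; exact: h.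
have ex a : exists b, M (a, b).
  have [b hb] := deriv_value hM a.
  exists b; apply: contrapT => nab.
  pose M' := [set x : K * K | exists P Q, gpoly M P Q /\
    x = (P.[a], Q.[a] + P^`().[a] * b)].
  have MM' : M `<=` M'.
    move=> [c d] Mcd; exists c%:P, d%:P; split; first exact: gpolyC.
    by rewrite derivC horner0 mul0r addr0 !hornerC.
  apply: (Mmax M'); first split=> //.
    move=> h; apply: nab; apply: h; exists 'X, 0; split.
      by rewrite -['X]expr1; exact: gpolyXn.
    by rewrite hornerX derivX horner0 hornerC add0r mul1r.
  split; last by move=> x /GM /MM'.
  split.
  - by apply: MM'; case: hM.
  - move=> _ _ [P [Q [h ->]]] [P' [Q' [h' ->]]] /=; exists (P - P'), (Q - Q').
    by split; [exact: gpolyB | rewrite !derivE !hornerE; congr (_, _); ring].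
  - move=> _ _ [P [Q [h ->]]] [P' [Q' [h' ->]]] /=; exists (P * P'), (Q * P' + P * Q').
    by split; [exact: gpolyM | rewrite !derivE !hornerE; congr (_, _); ring].
  - by move=> c [P [Q [h [/esym Pa ->]]]]; exact: hb.
have [D hD] := choice ex.
have uniq a b b' : M (a, b) -> M (a, b') -> b = b'.
  move=> h h'; apply/eqP; rewrite -subr_eq0; apply/eqP.
  case: (hM) => _ hB _ h0; apply: h0.
  by have := hB _ _ h h'; rewrite /= subrr.
exists D; split; last by move=> a b Gab; exact: uniq (hD a) (GM _ Gab).
split=> a b; first exact: uniq (hD _) (pdD hM (hD a) (hD b)).
exact: uniq (hD _) (pdM hM (hD a) (hD b)).
Qed.

(** The hypothesis says that the pairs [(p.@[x], dird p x w)], for [p] over [k], form the graph of a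
    partial derivation. *)
Theorem Der_prescribe k n (x w : 'I_n -> K) : subring k ->
  (forall p : {mpoly K[n]}, over k p -> p.@[x] = 0 -> dird p x w = 0) ->
  exists D, Der k D /\ forall i, D (x i) = w i.
Proof.
move=> hk h.
pose G := [set y : K * K | exists p : {mpoly K[n]}, over k p /\ y = (p.@[x], dird p x w)].
have [|D [hD DG]] := @der_extend G.
  split.
  - by exists 1; rewrite meval1 -mpolyC1 dirdC; split=> //; rewrite mpolyC1; exact: over1.
  - move=> _ _ [p [hp ->]] [q [hq ->]]; exists (p - q).
    by rewrite mevalB dirdB; split=> //; exact: overB.
  - move=> _ _ [p [hp ->]] [q [hq ->]]; exists (p * q).
    by rewrite mevalM dirdM; split=> //; exact: overM.
  - by move=> b [p [hp [/esym px ->]]]; exact: h.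
exists D; split; first split=> // c kc.
  by apply: DG; exists c%:MP; rewrite mevalC dirdC; split=> //; exact: overC.
by move=> i; apply: DG; exists 'X_i; rewrite mevalXU dirdXU; split=> //; exact: overX.
Qed.

(** If [b] were transcendental over [k], formal differentiation of polynomials in [b] would be well
    defined and would extend to a derivation over [k] with value [1] at [b]. *)
Theorem Der_algebraic k (b : K) : subring k -> (forall D, Der k D -> D b = 0) ->
  exists P : {poly K}, [/\ P != 0, forall i, k P`_i & P.[b] = 0].
Proof.
move=> hk hb; apply: contrapT => h.
pose G := [set y : K * K | exists P : {poly K}, (forall i, k P`_i) /\ y = (P.[b], P^`().[b])].
have kpB (P Q : {poly K}) : (forall i, k P`_i) -> (forall i, k Q`_i) -> forall i, k (P - Q)`_i.
  by move=> hP hQ i; rewrite coefB; case: hk => _ h' _; apply: h'.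
have kpM (P Q : {poly K}) : (forall i, k P`_i) -> (forall i, k Q`_i) -> forall i, k (P * Q)`_i.
  by move=> hP hQ i; rewrite coefM; apply: subring_sum => // j _; case: hk => _ _; apply.
have kpC (c : K) : k c -> forall i, k (c%:P)`_i.
  by move=> kc i; rewrite coefC; case: ifP => // _; exact: subring0.
have [|D [hD DG]] := @der_extend G.
  split.
  - by exists 1%:P; rewrite derivC horner0 hornerC; split=> //; apply: kpC; case: hk.
  - move=> _ _ [P [hP ->]] [Q [hQ ->]] /=; exists (P - Q).
    by split; [exact: kpB | rewrite !derivE !hornerE].
  - move=> _ _ [P [hP ->]] [Q [hQ ->]] /=; exists (P * Q).
    by split; [exact: kpM | rewrite !derivE !hornerE].
  - move=> c [P [hP [/esym Pb ->]]]; have [->|P0] := eqVneq P 0; first by rewrite deriv0 horner0.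
    by case: h; exists P.
have := hb D; rewrite (DG b 1) => [/(_ _)/eqP|].
  rewrite oner_eq0 => h'; suff : false by [].
  apply: h'; split=> // c kc; apply: DG; exists c%:P; rewrite derivC horner0 hornerC.
  by split=> //; exact: kpC.
exists 'X; rewrite derivX hornerX hornerC; split=> // i; rewrite coefX.
exact: subring_nat.
Qed.

End Extension.

(** * Subspaces and orthogonals *)

Section LinearAlgebra.
Variables (K : numClosedFieldType) (m : nat).
Implicit Types (u v w : 'rV[K]_m) (U W : {vspace 'rV[K]_m}) (P : set 'rV[K]_m).

Definition dot u v : K := \sum_i u 0 i * v 0 i.

Lemma dotC u v : dot u v = dot v u.
Proof. by apply: eq_bigr => i _; rewrite mulrC. Qed.

Lemma dotDl u u' v : dot (u + u') v = dot u v + dot u' v.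
Proof. by rewrite /dot -big_split; apply: eq_bigr => i _; rewrite mxE mulrDl. Qed.

Lemma dotZl c u v : dot (c *: u) v = c * dot u v.
Proof. by rewrite /dot mulr_sumr; apply: eq_bigr => i _; rewrite mxE mulrA. Qed.

Lemma dot0l v : dot 0 v = 0.
Proof. by rewrite -(scale0r (0 : 'rV[K]_m)) dotZl mul0r. Qed.

Lemma dotNl u v : dot (- u) v = - dot u v.
Proof. by rewrite -scaleN1r dotZl mulN1r. Qed.

Lemma dotDr u v v' : dot u (v + v') = dot u v + dot u v'.
Proof. by rewrite dotC dotDl dotC (dotC v'). Qed.

Lemma dotZr c u v : dot u (c *: v) = c * dot u v.
Proof. by rewrite dotC dotZl dotC. Qed.

Lemma dot0r u : dot u 0 = 0.
Proof. by rewrite dotC dot0l. Qed.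

Lemma dotNr u v : dot u (- v) = - dot u v.
Proof. by rewrite dotC dotNl dotC. Qed.

Lemma dotBr u v v' : dot u (v - v') = dot u v - dot u v'.
Proof. by rewrite dotDr dotNr. Qed.

Lemma dot_suml (I : Type) (r : seq I) (Q : pred I) (F : I -> 'rV[K]_m) v :
  dot (\sum_(i <- r | Q i) F i) v = \sum_(i <- r | Q i) dot (F i) v.
Proof.
elim: r => [|i r IH]; first by rewrite !big_nil dot0l.
by rewrite !big_cons; case: (Q i); rewrite ?dotDl IH.
Qed.

Lemma dot_sumr (I : Type) (r : seq I) (Q : pred I) (F : I -> 'rV[K]_m) v :
  dot v (\sum_(i <- r | Q i) F i) = \sum_(i <- r | Q i) dot v (F i).
Proof. by rewrite dotC dot_suml; apply: eq_bigr => i _; rewrite dotC. Qed.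

Definition is_subspace P : Prop := P 0 /\ forall c u v, P u -> P v -> P (c *: u + v).

Lemma is_subspace_vspace P : is_subspace P -> exists U, forall v, v \in U <-> P v.
Proof.
move=> [P0 PL].
pose dims := [pred d | `[< exists U, (forall v, v \in U -> P v) /\ \dim U = d >]].
have ex0 : exists d, dims d.
  by exists 0%N; apply/asboolP; exists 0%VS; rewrite dimv0; split=> // v /[!memv0]/eqP->.
have bd d : dims d -> (d <= m)%N.
  by move/asboolP => [U [_ <-]]; rewrite (leq_trans (dimvS (subvf U))) // dimvf /dim /= mul1n.
case: (ex_maxnP ex0 bd) => d /asboolP[U [UP dU]] dmax.
exists U => v; split; first exact: UP.
move=> Pv; apply: contrapT => /negP vU.
have : dims (\dim (U + <[v]>)).
  apply/asboolP; exists (U + <[v]>)%VS; split=> // x /memv_addP[u uU [y /vlineP[c ->] ->]].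
  by rewrite addrC; apply: PL => //; exact: UP.
move/dmax; rewrite leqNgt dimv_disjoint_sum; last first.
  apply/eqP; rewrite -subv0; apply/subvP => x; rewrite memv_cap => /andP[xU /vlineP[c xE]].
  have [c0|c0] := eqVneq c 0; first by rewrite xE c0 scale0r mem0v.
  by move: xU; rewrite xE rpredZeq (negPf c0) (negPf vU).
have v0 : v != 0 by apply: contraNneq vU => ->; exact: mem0v.
by rewrite dim_vline v0 dU addn1 leqnn.
Qed.

(** The default value is taken only when [P] is not a linear subspace. *)
Definition vs P : {vspace 'rV[K]_m} := xget 0%VS [set U : {vspace 'rV[K]_m} | forall v, v \in U <-> P v].

Lemma vsP P v : is_subspace P -> (v \in vs P) <-> P v.
Proof.
move=> hP; rewrite /vs; case: xgetP => [U _ h|h]; first exact: h.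
by have [U hU] := is_subspace_vspace hP; case: (h U).
Qed.

Definition bmx U : 'M[K]_(\dim U, m) := \matrix_i (vbasis U)`_i.

Lemma bmxP U v : reflect (exists c, v = c *m bmx U) (v \in U).
Proof.
apply: (iffP idP) => [/coord_vbasis vE|[c ->]].
  exists (\row_i coord (vbasis U) i v); rewrite [LHS]vE; apply/rowP => j.
  rewrite summxE mxE; apply: eq_bigr => i _; by rewrite !mxE.
rewrite mulmx_sum_row memv_suml // => i _; rewrite rowK memvZ //.
by rewrite vbasis_mem // mem_nth // size_tuple.
Qed.

Lemma bmx_free U : row_free (bmx U).
Proof.
rewrite -kermx_eq0; apply/rowV0P => c /sub_kermxP h.
have /freeP hf := basis_free (vbasisP U).
apply/rowP => i; rewrite mxE; apply: (hf (fun i => c 0 i)).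
move: h; rewrite mulmx_sum_row => h; rewrite -[RHS]h.
by apply: eq_bigr => j _; rewrite rowK.
Qed.

Lemma bmx_row U i : row i (bmx U) \in U.
Proof. by rewrite rowK vbasis_mem // mem_nth // size_tuple. Qed.

Definition orth U : {vspace 'rV[K]_m} := vs [set v | forall u, u \in U -> dot u v = 0].

Lemma orthP U v : reflect (forall u, u \in U -> dot u v = 0) (v \in orth U).
Proof.
apply/(iffP idP) => [|h]; first by move=> /vsP; apply; split=> [u|c x y hx hy u uU];
  rewrite ?dot0r // dotDr dotZr hx // hy // mulr0 addr0.
by apply/vsP => //; split=> [u|c x y hx hy u uU];
  rewrite ?dot0r // dotDr dotZr hx // hy // mulr0 addr0.
Qed.

Lemma dim_full_row : \dim {: 'rV[K]_m} = m.
Proof. by rewrite dimvf /dim /= mul1n. Qed.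

Lemma dim_leq U : (\dim U <= m)%N.
Proof. by rewrite -[X in (_ <= X)%N]dim_full_row dimvS // subvf. Qed.

Lemma dim_image n (f : {linear 'rV[K]_m -> 'rV[K]_n}) U :
  (\dim (U :&: lker (linfun f)) + \dim (linfun f @: U) = \dim U)%N.
Proof. exact: limg_ker_dim. Qed.

Lemma row_free_dim r (M : 'M[K]_(r, m)) : row_free M ->
  \dim (limg (linfun (mulmxr M : 'rV[K]_r -> 'rV[K]_m))) = r.
Proof.
move=> hM; rewrite limg_dim_eq; first by rewrite dimvf /dim /= mul1n.
apply/eqP; rewrite -subv0; apply/subvP => v; rewrite memv_cap => /andP[_].
rewrite memv_ker lfunE /= memv0 => /eqP h.
by apply/eqP; apply: (row_free_inj hM); rewrite h mul0mx.
Qed.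

Lemma dim_orth U : (\dim (orth U) = m - \dim U)%N.
Proof.
pose f := linfun (mulmxr (bmx U)^T : 'rV[K]_m -> 'rV[K]_(\dim U)).
have kf : lker f = orth U.
  apply/vspaceP => v; rewrite memv_ker lfunE /=; apply/eqP/orthP.
    move=> h u /bmxP[c ->].
    have -> : dot (c *m bmx U) v = (c *m (v *m (bmx U)^T)^T) 0 0.
      rewrite trmx_mul trmxK mulmxA mxE; apply: eq_bigr => i _; by rewrite [v^T i 0]mxE.
    by rewrite h trmx0 mulmx0 mxE.
  move=> h; apply/rowP => i; rewrite !mxE -[RHS](h (row i (bmx U))) ?bmx_row //.
  by rewrite dotC; apply: eq_bigr => j _; rewrite !mxE.
have fs : limg f = fullv.
  apply/vspaceP => c; rewrite memvf; apply/memv_imgP.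
  exists (c *m (pinvmx (bmx U))^T); first exact: memvf.
  by rewrite lfunE /= -mulmxA -trmx_mul (mulmxVp (bmx_free U)) trmx1 mulmx1.
have := limg_ker_dim f fullv; rewrite fs kf capfv !dimvf /dim /= !mul1n => e.
by rewrite -[X in (X - _)%N]e addnK.
Qed.

Lemma orthK U : orth (orth U) = U.
Proof.
apply/esym/eqP; rewrite eqEdim !dim_orth subKn ?dim_leq // leqnn andbT.
by apply/subvP => v vU; apply/orthP => u /orthP h; rewrite dotC; exact: h.
Qed.

Lemma orthS U W : (U <= W)%VS -> (orth W <= orth U)%VS.
Proof. by move=> /subvP h; apply/subvP => v /orthP hv; apply/orthP => u /h; exact: hv. Qed.

(** A basis of the span of [P] chosen inside [P], so that each basis vector keeps the polynomial or
    the derivation from which it arises. *)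
Lemma spanning_rows P : exists r (M : 'M[K]_(r, m)),
  [/\ row_free M, forall i, P (row i M) & forall v, P v -> (v <= M)%MS].
Proof.
pose good := [pred r | `[< exists M : 'M[K]_(r, m), row_free M /\ forall i, P (row i M) >]].
have ex0 : exists r, good r.
  exists 0%N; apply/asboolP; exists (0 : 'M[K]_(0, m)).
  by split; [rewrite /row_free mxrank0 | case].
have bd r : good r -> (r <= m)%N.
  by move/asboolP => [M [/eqP h _]]; rewrite -[X in (X <= _)%N]h rank_leq_col.
case: (ex_maxnP ex0 bd) => r /asboolP[M [Mf MP]] rmax.
exists r, M; split=> // v Pv; apply: contrapT => /negP vM.
suff /rmax : good (r + 1)%N by rewrite addn1 ltnn.
apply/asboolP; exists (col_mx M v); split.
  rewrite /row_free eqn_leq rank_leq_row /= -addsmxE.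
  have rM : \rank M = r by apply/eqP.
  have : (M < M + v)%MS.
    by rewrite ltmxE addsmxSl /= addsmx_sub submx_refl.
  by move/rank_ltmx; rewrite rM addn1.
move=> i; case: (split_ordP i) => j ->.
  have -> : row (lshift 1 j) (col_mx M v) = row j M; last exact: MP.
  by apply/rowP => k; rewrite mxE col_mxEu mxE.
have -> : row (rshift r j) (col_mx M v) = v by apply/rowP => k; rewrite mxE col_mxEd (ord1 j).
exact: Pv.
Qed.

End LinearAlgebra.

Section RowSpaces.
Variables (K : numClosedFieldType) (m : nat).
Implicit Types (u v w : 'rV[K]_m) (U W : {vspace 'rV[K]_m}).

Definition rowvs r (M : 'M[K]_(r, m)) : {vspace 'rV[K]_m} :=
  limg (linfun (mulmxr M : 'rV[K]_r -> 'rV[K]_m)).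

Lemma rowvsP r (M : 'M[K]_(r, m)) v : reflect (exists c, v = c *m M) (v \in rowvs M).
Proof.
apply: (iffP memv_imgP) => [[c _ ->]|[c ->]]; first by exists c; rewrite lfunE.
by exists c; rewrite ?memvf // lfunE.
Qed.

Lemma rowvs_submx r (M : 'M[K]_(r, m)) v : (v \in rowvs M) = (v <= M)%MS.
Proof. by apply/rowvsP/submxP. Qed.

Lemma dim_rowvs r (M : 'M[K]_(r, m)) : row_free M -> \dim (rowvs M) = r.
Proof. exact: row_free_dim. Qed.

Lemma row_in_rowvs r (M : 'M[K]_(r, m)) i : row i M \in rowvs M.
Proof. by rewrite rowvs_submx row_sub. Qed.

Lemma orth_rowvs r (M : 'M[K]_(r, m)) v :
  (v \in orth (rowvs M)) <-> forall i, dot (row i M) v = 0.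
Proof.
split=> [/orthP h i|h]; first by apply: h; exact: row_in_rowvs.
apply/orthP => _ /rowvsP[c ->].
by rewrite mulmx_sum_row dot_suml big1 // => i _; rewrite dotZl h mulr0.
Qed.

Lemma row_free_cols r (B : 'M[K]_(r, m)) : row_free B ->
  exists f : 'I_r -> 'I_m, colsub f B \in unitmx.
Proof.
move=> hB; have hBT : row_full B^T by rewrite /row_full mxrank_tr.
exists (fullrankfun hBT); rewrite -unitmx_tr.
have -> : (colsub (fullrankfun hBT) B)^T = rowsub (fullrankfun hBT) B^T.
  by apply/matrixP => i j; rewrite !mxE.
exact: fullrowsub_unit.
Qed.

Lemma unit_cols_row_free r (B : 'M[K]_(r, m)) (f : 'I_r -> 'I_m) :
  colsub f B \in unitmx -> row_free B.
Proof.
move=> hu; rewrite -kermx_eq0; apply/rowV0P => c /sub_kermxP h.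
have : c *m colsub f B = 0.
  by apply/rowP => j; have := congr1 (fun A : 'rV_m => A 0 (f j)) h; rewrite !mxE => e;
     rewrite -[RHS]e; apply: eq_bigr => i _; rewrite mxE.
by move/(congr1 (fun A => A *m invmx (colsub f B))); rewrite mulmxK // mul0mx.
Qed.

(** Selects coordinates that parametrize [U]; for the velocity space of a point these give a
    transcendence basis. *)
Lemma coords_surj U : exists f : 'I_(\dim U) -> 'I_m,
  forall s : 'I_(\dim U) -> K, exists u, u \in U /\ forall j, u 0 (f j) = s j.
Proof.
have [f hf] := row_free_cols (bmx_free U).
exists f => s; exists ((\row_j s j) *m invmx (colsub f (bmx U)) *m bmx U).
split; first by apply/bmxP; exists ((\row_j s j) *m invmx (colsub f (bmx U))).
move=> j; have e := mulmxKV hf (\row_j s j).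
transitivity ((\row_j s j : 'rV_(\dim U)) 0 j); last by rewrite mxE.
rewrite -[in RHS]e [in LHS]mxE [in RHS]mxE.
by apply: eq_bigr => i _; rewrite [colsub _ _ _ _]mxE.
Qed.

End RowSpaces.

(** * Velocities of a point *)

Section VectorDerivations.
Variable K : numClosedFieldType.
Implicit Types (D : K -> K) (k : set K).

Section Dim.
Variable m : nat.
Implicit Types (a u v w : 'rV[K]_m) (p q : {mpoly K[m]}).

Definition vder D v : 'rV[K]_m := map_mx D v.

Lemma vderE D v i : vder D v 0 i = D (v 0 i).
Proof. by rewrite mxE. Qed.

Lemma vderD D u v : derivation D -> vder D (u + v) = vder D u + vder D v.
Proof. by move=> [hD _]; apply/rowP => i; rewrite !mxE hD. Qed.

Lemma vderZ D c v : derivation D -> vder D (c *: v) = D c *: v + c *: vder D v.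
Proof. by move=> [_ hD]; apply/rowP => i; rewrite !mxE hD. Qed.

Lemma vder0 D : derivation D -> vder D (0 : 'rV[K]_m) = 0.
Proof. by move=> hD; apply/rowP => i; rewrite !mxE der0. Qed.

Lemma vderB D u v : derivation D -> vder D (u - v) = vder D u - vder D v.
Proof. by move=> hD; apply/rowP => i; rewrite !mxE derB. Qed.

Lemma vder_dot D u v : derivation D -> D (dot u v) = dot (vder D u) v + dot u (vder D v).
Proof.
move=> hD; rewrite der_sum // -big_split; apply: eq_bigr => i _.
by rewrite !mxE; case: hD.
Qed.

Definition grad p a : 'rV[K]_m := \row_i p^`M(i).@[a 0].

Lemma dird_dot p a w : dird p (a 0) (w 0) = dot (grad p a) w.
Proof. by apply: eq_bigr => i _; rewrite mxE. Qed.

Lemma der_eval_grad D p a : derivation D ->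
  D p.@[a 0] = (dpoly D p).@[a 0] + dot (grad p a) (vder D a).
Proof.
move=> hD; rewrite der_eval // -dird_dot; congr (_ + _).
by apply: eq_bigr => i _; rewrite mxE.
Qed.

Lemma der_eval_grad_over k D p a : Der k D -> over k p ->
  D p.@[a 0] = dot (grad p a) (vder D a).
Proof.
move=> hD hp; rewrite der_eval_grad; last by case: hD.
by rewrite (dpoly_over hD hp) meval0 add0r.
Qed.

(** By [tsp_prescribe] this is the tangent space at [a] of the smallest zero set of polynomials over
    [k] containing [a]. *)
Definition tsp k a : {vspace 'rV[K]_m} :=
  vs [set v | exists D, Der k D /\ v = vder D a].

Lemma tspP k a v : (v \in tsp k a) <-> exists D, Der k D /\ v = vder D a.
Proof.
apply: vsP; split=> [|c u w [D [[hD kD] ->]] [E [[hE kE] ->]]].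
  exists (fun _ => 0); split; last by apply/rowP => i; rewrite !mxE.
  by split=> //; split=> x y; rewrite ?addr0 // mulr0 mul0r addr0.
exists (fun x => c * D x + E x); split; last by apply/rowP => i; rewrite !mxE.
split; first by apply: der_add => //; exact: der_scale.
by move=> x kx; rewrite kD // kE // mulr0 addr0.
Qed.

Lemma tsp_prescribe k a v : subring k ->
  (v \in tsp k a) <-> (forall p, over k p -> p.@[a 0] = 0 -> dot (grad p a) v = 0).
Proof.
move=> hk; split=> [/tspP[D [hD ->]] p hp pa|h].
  rewrite -(der_eval_grad_over _ hD hp) pa; apply: der0.
  by case: hD.
have [p hp pa|D [hD Da]] := @Der_prescribe K k m (a 0) (v 0) hk.
  by rewrite dird_dot; exact: h.
by apply/tspP; exists D; split=> //; apply/rowP => i; rewrite mxE Da.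
Qed.

(** Normalize a basis of [U] to have an identity block in suitable columns. The derivative of a
    basis vector is in [U] and vanishes in these columns, hence is zero. This replaces descent of a
    subspace to the constants. *)
Lemma stable_const_basis (U : {vspace 'rV[K]_m}) (Ds : set (K -> K)) :
  (forall D, Ds D -> derivation D) ->
  (forall D v, Ds D -> v \in U -> vder D v \in U) ->
  exists B : 'M[K]_(\dim U, m), [/\ row_free B, forall v, v \in U <-> exists c, v = c *m B
    & forall D, Ds D -> forall i j, D (B i j) = 0].
Proof.
move=> hDs hU; have [f hf] := row_free_cols (bmx_free U).
pose G := colsub f (bmx U); pose B := invmx G *m bmx U.
have BU v : v \in U <-> exists c, v = c *m B.
  split=> [/bmxP|] [c ->].
    by exists (c *m G); rewrite /B mulmxA mulmxK.
  by apply/bmxP; exists (c *m invmx G); rewrite /B mulmxA.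
have Bf : colsub f B = 1%:M.
  rewrite -(mulVmx hf) /B; apply/matrixP => i j; rewrite !mxE.
  by apply: eq_bigr => l _; rewrite [in RHS]mxE.
exists B; split=> //.
  by apply: (@unit_cols_row_free _ _ _ _ f); rewrite Bf unitmx1.
move=> D hD i j.
have : vder D (row i B) \in U.
  by apply: hU => //; apply/BU; exists (delta_mx 0 i); rewrite rowE.
case/BU => c cE.
have c0 : c = 0.
  apply/rowP => l; have := congr1 (fun A : 'rV_m => A 0 (f l)) cE.
  have -> : (c *m B) 0 (f l) = c 0 l.
    rewrite -[in RHS](mulmx1 c) -Bf [in RHS]mxE [in LHS]mxE.
    by apply: eq_bigr => z _; rewrite [in RHS]mxE.
  rewrite mxE mxE => <-.
  have -> : B i (f l) = (i == l)%:R.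
    by have := congr1 (fun A : 'M_(_, _) => A i l) Bf; rewrite !mxE.
  by rewrite mxE der_nat //; exact: hDs.
have := congr1 (fun A : 'rV_m => A 0 j) cE.
by rewrite c0 mul0mx !mxE.
Qed.

End Dim.
End VectorDerivations.

(** * Generic points *)

Section Subrings.
Variable K : numClosedFieldType.
Implicit Types (D : K -> K) (k : set K).

Definition csubring k : Prop := subring k /\ countable k.

Fixpoint subring_step (C : set K) (j : nat) : set K :=
  match j with
  | 0 => C `|` [set 1]
  | j'.+1 => let S := subring_step C j' in
      S `|` ([set x.1 - x.2 | x in S `*` S] `|` [set x.1 * x.2 | x in S `*` S])
  end.

Lemma countableU (T : Type) (A B : set T) : countable A -> countable B -> countable (A `|` B).
Proof.
move=> hA hB; have -> : A `|` B = \bigcup_(b in [set: bool]) (if b then A else B).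
  rewrite eqEsubset; split=> x; first by case=> h; [exists true | exists false].
  by case=> [[] _ h]; [left | right].
by apply: bigcup_countable => // -[].
Qed.

Lemma countable_image (T U : Type) (f : T -> U) (A : set T) :
  countable A -> countable (f @` A).
Proof. by move=> hA; exact: (card_le_trans (card_image_le f A)). Qed.

Lemma exists_csubring (C : set K) : countable C -> exists k, csubring k /\ C `<=` k.
Proof.
move=> hC; exists (\bigcup_(j in [set: nat]) subring_step C j).
have mono i j : (i <= j)%N -> subring_step C i `<=` subring_step C j.
  by move=> /subnK <-; elim: (j - i)%N => // l IH x /IH h; rewrite addSn; left.
split; last by move=> c Cc; exists 0%N => //; left.
split; last first.
  apply: bigcup_countable => // j _; elim: j => [|j IH] /=.
    by apply: countableU => //; exact: countable1.
  by apply: (countableU IH); apply: countableU; apply: countable_image; exact: countableX.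
split.
- by exists 0%N => //; right.
- move=> a b [i _ ha] [j _ hb]; exists (maxn i j).+1 => //.
  right; left; exists (a, b) => //; split=> /=.
    by apply: (mono i) ha; exact: leq_maxl.
  by apply: (mono j) hb; exact: leq_maxr.
- move=> a b [i _ ha] [j _ hb]; exists (maxn i j).+1 => //.
  right; right; exists (a, b) => //; split=> /=.
    by apply: (mono i) ha; exact: leq_maxl.
  by apply: (mono j) hb; exact: leq_maxr.
Qed.

Lemma countable_over k n : countable k -> countable [set p : {mpoly K[n]} | over k p].
Proof.
case/countable_injP => f finj.
apply/countable_injP.
exists (fun p => pickle [seq (tval (multinom_val m), f p@_m) | m <- msupp p]).
move=> p q; rewrite !inE /= => hp hq /(pcan_inj pickleK) e.
have e1 : msupp p = msupp q.
  have : map (fun l : 'X_{1..n} => tval (multinom_val l)) (msupp p) =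
      map (fun l : 'X_{1..n} => tval (multinom_val l)) (msupp q).
    by have := congr1 (map (@fst (seq nat) nat)) e; rewrite -!map_comp.
  by apply: inj_map => l l' /= h; apply/val_inj/val_inj.
apply/mpolyP => m; have [mp|mp] := boolP (m \in msupp p); last first.
  by rewrite !memN_msupp_eq0 // -e1.
apply: finj; rewrite ?inE //; move: e; rewrite -e1 => /eq_in_map /(_ m mp).
by case.
Qed.

Section Adjoin.
Variables (k : set K) (m : nat) (v : 'rV[K]_m).
Definition adj : set K := [set c | exists p : {mpoly K[m]}, over k p /\ c = p.@[v 0]].

Lemma adj_subring : subring k -> subring adj.
Proof.
move=> hk; split.
- by exists 1; rewrite meval1; split=> //; exact: over1.
- move=> _ _ [p [hp ->]] [q [hq ->]]; exists (p - q); rewrite mevalB.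
  by split=> //; exact: overB.
- move=> _ _ [p [hp ->]] [q [hq ->]]; exists (p * q); rewrite mevalM.
  by split=> //; exact: overM.
Qed.

Lemma sub_adj : subring k -> k `<=` adj.
Proof. by move=> hk c kc; exists c%:MP; rewrite mevalC; split=> //; exact: overC. Qed.

Lemma mem_adj i : subring k -> adj (v 0 i).
Proof. by move=> hk; exists 'X_i; rewrite mevalXU; split=> //; exact: overX. Qed.

Lemma adj_csubring : csubring k -> csubring adj.
Proof.
move=> [hk ck]; split; first exact: adj_subring.
have -> : adj = (fun p : {mpoly K[m]} => p.@[v 0]) @` [set p | over k p].
  by rewrite eqEsubset; split=> c [p]; [case=> hp ->; exists p | move=> hp <-; exists p].
by apply: countable_image; exact: countable_over.
Qed.

Lemma Der_adj D : subring k -> Der adj D <-> (Der k D /\ vder D v = 0).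
Proof.
move=> hk; split=> [[hD h]|[[hD kD] h]].
  split; first by split=> // c kc; apply: h; exact: sub_adj.
  by apply/rowP => i; rewrite !mxE h //; exact: mem_adj.
split=> // _ [p [hp ->]]; rewrite (@der_eval_grad_over _ _ k) // h dot0r //.
Qed.

End Adjoin.

Section Generic.
Variable m : nat.
Implicit Types (a u v w : 'rV[K]_m) (p q : {mpoly K[m]}) (A : set 'rV[K]_m).

Definition vanish A : set {mpoly K[m]} := [set p | forall v, A v -> p.@[v 0] = 0].

Lemma vanish_ideal A : is_ideal (vanish A).
Proof.
split=> [v _|p q hp hq v Av|p q hq v Av]; first by rewrite meval0.
  by rewrite mevalD hp // hq // addr0.
by rewrite mevalM hq // mulr0.
Qed.

Definition algclosed A : Prop := forall v, (forall p, vanish A p -> p.@[v 0] = 0) -> A v.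

Definition algprime A : Prop :=
  A !=set0 /\ forall p q, vanish A (p * q) -> vanish A p \/ vanish A q.

Definition generic k A a : Prop :=
  A a /\ forall p, over k p -> p.@[a 0] = 0 -> vanish A p.

Lemma generic_sub k k' A a : k `<=` k' -> generic k' A a -> generic k A a.
Proof. by move=> kk' [Aa h]; split=> // p hp; apply: h => x; exact: kk'. Qed.

(** The polynomials over [k] that do not vanish on [A] are countably many and closed under products
    because [A] is prime; a zero of the ideal of [A] which avoids all of them is generic. *)
Lemma exists_generic k A : ~ countable [set: K] -> csubring k -> algclosed A -> algprime A ->
  exists a, generic k A a.
Proof.
move=> Kunc [hk ck] Acl [[a0 Aa0] Apr].
have [|||||a [aI aS]] := @exists_zero_avoiding K m Kunc (vanish A)
  [set p | over k p /\ ~ vanish A p].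
- exact: vanish_ideal.
- split; first exact: over1.
  by move=> /(_ _ Aa0); rewrite meval1 => /eqP; rewrite oner_eq0.
- move=> p q [hp np] [hq nq]; split; first exact: overM.
  by case/Apr.
- apply: (sub_countable (subset_card_le _) (countable_over m ck)).
  by move=> p [].
- by move=> p [].
have aE : (\row_i a i : 'rV_m) 0 =1 a by move=> i; rewrite mxE.
exists (\row_i a i); split; first by apply: Acl => p /aI; rewrite (meval_eq _ aE).
move=> p hp; rewrite (meval_eq _ aE) => pa; apply: contrapT => np.
by have := aS p (conj hp np); rewrite pa eqxx.
Qed.

(** [A] is defined over [k], in the differential form that is needed to make velocities tangent. *)
Definition kdef k A : Prop := forall D, Der k D -> forall p, vanish A p -> vanish A (dpoly D p).

Lemma kdef_sub k k' A : k `<=` k' -> kdef k A -> kdef k' A.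
Proof. by move=> kk' h D [hD kD]; apply: h; split=> // c /kk'; exact: kD. Qed.

Definition coefrow (d : nat) p : 'rV[K]_(#|{: 'X_{1..m < d}}|) :=
  \row_j p@_(enum_val j : 'X_{1..m < d}).

Lemma coefrow_inj d p q : (msize p <= d)%N -> (msize q <= d)%N ->
  coefrow d p = coefrow d q -> p = q.
Proof.
move=> hp hq e; apply/mpolyP => l; have [ld|ld] := ltnP (mdeg l) d; last first.
  by rewrite !memN_msupp_eq0 //; apply: msize_mdeg_ge; apply: leq_trans ld.
have := congr1 (fun A : 'rV_ _ => A 0 (enum_rank (BMultinom ld))) e.
by rewrite !mxE enum_rankK.
Qed.

(** [A] is defined over [k] in the usual sense: its ideal is spanned by polynomials over [k]. By
    [ratl_kdef] this implies [kdef]. *)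
Definition ratl k A : Prop := forall p, vanish A p ->
  exists r (c : 'I_r -> K) (g : 'I_r -> {mpoly K[m]}),
    (forall i, over k (g i) /\ vanish A (g i)) /\ p = \sum_i c i *: g i.

Lemma ratl_sub k k' A : k `<=` k' -> ratl k A -> ratl k' A.
Proof.
move=> kk' h p /h[r [c [g [hg ->]]]]; exists r, c, g; split=> // i.
by have [h1 h2] := hg i; split=> // l; exact: kk'.
Qed.

Lemma ratl_kdef k A : ratl k A -> kdef k A.
Proof.
move=> h D hD p /h[r [c [g [hg pE]]]]; have [dD _] := hD.
have -> : dpoly D p = \sum_i D (c i) *: g i.
  apply/mpolyP => l; rewrite mcoeff_dpoly // {1}pE !raddf_sum /= der_sum //.
  apply: eq_bigr => i _; rewrite !mcoeffZ; case: (dD) => _ ->.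
  have [gk _] := hg i; have := congr1 (mcoeff l) (dpoly_over hD gk).
  by rewrite mcoeff_dpoly // mcoeff0 => ->; rewrite mulr0 addr0.
have hI := vanish_ideal A; apply: (is_ideal_sum _ hI) => i _.
by rewrite -mul_mpolyC; case: hI => _ _; apply; case: (hg i).
Qed.

(** In each degree the ideal has a finite basis, and the coefficients of these bases together are
    countably many. *)
Lemma exists_ratl A : exists C : set K, countable C /\
  forall k, subring k -> C `<=` k -> ratl k A.
Proof.
have ex d : exists g : seq {mpoly K[m]}, (forall p, p \in g -> vanish A p) /\
    forall p, vanish A p -> (msize p <= d)%N ->
      exists c : nat -> K, p = \sum_(i < size g) c i *: g`_i.
  pose P := [set x | exists p, [/\ vanish A p, (msize p <= d)%N & x = coefrow d p]].
  have [r [M [_ MP MS]]] := spanning_rows P.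
  have /choice[f fP] := MP.
  exists [seq f i | i <- enum 'I_r]; split; first by move=> p /mapP[i _ ->]; have [] := fP i.
  move=> p hp sp.
  have [|c pE] := submxP (MS (coefrow d p) _); first by exists p.
  exists (fun i => if insub i is Some j then c 0 j else 0).
  have -> : \sum_(i < size [seq f i | i <- enum 'I_r])
      (if insub (val i) is Some j then c 0 j else 0) *: [seq f i | i <- enum 'I_r]`_i =
      \sum_(i < r) c 0 i *: f i.
    rewrite size_map size_enum_ord; apply: eq_bigr => i _.
    by rewrite (nth_map i) ?size_enum_ord // nth_ord_enum valK.
  apply: (@coefrow_inj d) => //.
    apply: (leq_trans (msize_sum _ _ _)); apply/bigmax_leqP => i _.
    by apply: (leq_trans (msizeZ_le _ _)); have [] := fP i.
  rewrite pE mulmx_sum_row; apply/rowP => j; rewrite summxE mxE raddf_sum /=.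
  apply: eq_bigr => i _; rewrite mcoeffZ mxE; have [_ _ e] := fP i.
  by congr (_ * _); have := congr1 (fun x : 'rV_ _ => x 0 j) e; rewrite [RHS]mxE.
have [g gP] := choice ex.
pose C := \bigcup_(d in [set: nat]) \bigcup_(p in [set` g d]) [set p@_l | l in [set` msupp p]].
exists C; split.
  apply: bigcup_countable => // d _; apply: bigcup_countable => [|p _].
    exact/finite_set_countable/finite_seq.
  exact/countable_image/finite_set_countable/finite_seq.
move=> k hk Ck p hp.
have [gA gS] := gP (msize p).
have [c pE] := gS p hp (leqnn _).
exists (size (g (msize p))), (fun i => c i), (fun i => (g (msize p))`_i); split=> // i.
split=> [l|]; last by apply: gA; exact: mem_nth.
have [lp|lp] := boolP (l \in msupp (g (msize p))`_i); last first.
  by rewrite memN_msupp_eq0 //; exact: subring0.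
by apply: Ck; exists (msize p) => //; exists (g (msize p))`_i; [exact: mem_nth | exists l].
Qed.

End Generic.
End Subrings.

(** * Specializations and the dimension at generic points *)

Section Specialization.
Variable K : numClosedFieldType.
Implicit Types (D : K -> K) (k : set K).

Lemma grad_is_additive m (p q : {mpoly K[m]}) a : grad (p + q) a = grad p a + grad q a.
Proof. by apply/rowP => i; rewrite !mxE mderivD mevalD. Qed.

Lemma gradZ m c (p : {mpoly K[m]}) a : grad (c *: p) a = c *: grad p a.
Proof. by apply/rowP => i; rewrite !mxE mderivZ mevalZ. Qed.

Section Dim.
Variable m : nat.
Implicit Types (a u v w : 'rV[K]_m) (p q : {mpoly K[m]}) (A : set 'rV[K]_m).

Definition tang A a : {vspace 'rV[K]_m} :=
  vs [set w | forall p, vanish A p -> dot (grad p a) w = 0].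

Lemma tangP A a w : (w \in tang A a) <-> forall p, vanish A p -> dot (grad p a) w = 0.
Proof.
apply: vsP; split=> [p _|c u v hu hv p hp]; first by rewrite dot0r.
by rewrite dotDr dotZr hu // hv // mulr0 addr0.
Qed.

Lemma vder_tang k A a D : kdef k A -> Der k D -> A a -> vder D a \in tang A a.
Proof.
move=> hA hD Aa; apply/tangP => p hp; have [dD _] := hD.
have := der_eval_grad p a dD; rewrite hp // der0 // (hA D hD p hp) // add0r.
by move->.
Qed.

Lemma tsp_sub_tang k A a : kdef k A -> A a -> (tsp k a <= tang A a)%VS.
Proof. by move=> hA Aa; apply/subvP => v /tspP[D [hD ->]]; exact: vder_tang hD Aa. Qed.

Lemma generic_tsp k A a : subring k -> kdef k A -> generic k A a -> tsp k a = tang A a.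
Proof.
move=> hk hA [Aa ga]; apply/eqP; rewrite eqEsubv tsp_sub_tang //=.
apply/subvP => v /tangP hv; apply/tsp_prescribe => // p hp pa.
by apply: hv; exact: ga.
Qed.

Lemma msize_deriv (p : {mpoly K[m]}) j s : (msize p <= s.+1)%N -> (msize p^`M(j) <= s)%N.
Proof.
move=> sp; rewrite msizeE; apply/bigmax_leqP_seq => l; rewrite mcoeff_msupp mcoeff_deriv => h _.
have : (l + U_(j))%MM \in msupp p.
  by rewrite mcoeff_msupp; apply: contraNneq h => ->; rewrite mul0rn.
by move/msize_mdeg_lt => /leq_trans /(_ sp); rewrite ltnS mdegD mdeg1 addn1.
Qed.

(** If every direction is a velocity of [x], its coordinates are algebraically independent over [k]:
    the partial derivatives of a relation are relations of smaller size, hence zero, and in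
    characteristic zero the relation is a constant. *)
Lemma over_partials_indep k (x : 'rV[K]_m) (q : {mpoly K[m]}) : subring k ->
  tsp k x = fullv -> over k q -> q.@[x 0] = 0 -> q = 0.
Proof.
move=> hk tx; move: (leqnn (msize q)); move: {2}(msize q) => s.
elim: s q => [|s IH] q sq hq qx; first by apply/eqP; rewrite -msize_poly_eq0 -leqn0.
have dq j : q^`M(j) = 0.
  apply: IH; [exact: msize_deriv | exact: over_deriv |].
  have /tspP[D [hD dx]] : (delta_mx 0 j : 'rV_m) \in tsp k x by rewrite tx memvf.
  have := der_eval_grad_over x hD hq; rewrite qx (der0 hD.1) -dx => /esym.
  rewrite /dot (bigD1 j) //= !mxE !eqxx mulr1 big1 ?addr0 // => i ij.
  by rewrite !mxE (negPf ij) andbF mulr0.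
have q0 : q = (q@_0)%:MP.
  apply/mpolyP => l; rewrite mcoeffC; have [->|l0] := eqVneq l 0%MM; first by rewrite mulr1.
  rewrite mulr0; have [j lj] : exists j, l j != 0%N.
    apply: contrapT => h; move/eqP: l0; apply; apply/mnmP => j; rewrite mnm0E.
    by apply/eqP/negPn/negP => lj; apply: h; exists j.
  have := congr1 (mcoeff (l - U_(j))%MM) (dq j); rewrite mcoeff_deriv mcoeff0.
  rewrite submK ?lep1mP // => /eqP; rewrite mulrn_eq0 /=.
  by move/eqP.
by move: qx; rewrite q0 mevalC => ->; rewrite mpolyC0.
Qed.

End Dim.

Section Spec.
Variable m : nat.
Implicit Types (a u v w : 'rV[K]_m) (p q : {mpoly K[m]}) (A : set 'rV[K]_m).

Definition specializes k a a' : Prop := forall p, over k p -> p.@[a 0] = 0 -> p.@[a' 0] = 0.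

Definition subv_coords d (f : 'I_d -> 'I_m) (a : 'rV[K]_m) : 'rV[K]_d := \row_j a 0 (f j).

Definition subst_coords d (f : 'I_d -> 'I_m) (q : {mpoly K[d]}) : {mpoly K[m]} :=
  q \mPo [tuple 'X_(f j) | j < d].

Lemma subst_coords_eval d (f : 'I_d -> 'I_m) (q : {mpoly K[d]}) a :
  (subst_coords f q).@[a 0] = q.@[(subv_coords f a) 0].
Proof.
by rewrite comp_mpoly_meval; apply: meval_eq => j; rewrite tnth_mktuple mevalXU mxE.
Qed.

Lemma subst_coords_over k d (f : 'I_d -> 'I_m) (q : {mpoly K[d]}) : subring k ->
  over k q -> over k (subst_coords f q).
Proof.
move=> hk hq; rewrite /subst_coords comp_mpolyEX; apply: over_sum => // l _.
apply: overZ => //; rewrite comp_mpolyX; apply: over_prod => // i _.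
by apply: over_exp => //; rewrite tnth_mktuple; exact: overX.
Qed.

Lemma tsp_coords_full k d (f : 'I_d -> 'I_m) a : subring k ->
  (forall s : 'I_d -> K, exists u, u \in tsp k a /\ forall j, u 0 (f j) = s j) ->
  tsp k (subv_coords f a) = fullv.
Proof.
move=> hk h; apply/vspaceP => v; rewrite memvf; apply/idP.
have [u [/tspP[D [hD ->]] hu]] := h (v 0).
by apply/tspP; exists D; split=> //; apply/rowP => j; rewrite -hu !mxE.
Qed.

(** A specialization that does not lower the dimension can be reversed. Coordinates independent at
    [a'] are independent at [a], and by the dimension they form a transcendence basis there. If [p]
    is nonzero at [a], its value there satisfies an equation over these coordinates with nonzero
    constant term; this equation passes to [a'], where [p = 0] would kill the constant term against
    independence. *)
Theorem specializes_sym k a a' : subring k -> specializes k a a' ->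
  (\dim (tsp k a) <= \dim (tsp k a'))%N -> specializes k a' a.
Proof.
move=> hk sp hd.
have [f hf] := coords_surj (tsp k a').
have ta' := tsp_coords_full hk hf.
have ind (q : {mpoly K[\dim (tsp k a')]}) : over k q -> q.@[(subv_coords f a) 0] = 0 -> q = 0.
  move=> hq; rewrite -subst_coords_eval => /(sp _ (subst_coords_over f hk hq)).
  by rewrite subst_coords_eval; exact: (over_partials_indep hk ta' hq).
have ta : tsp k (subv_coords f a) = fullv.
  apply/vspaceP => v; rewrite memvf; apply/idP/tsp_prescribe => // q hq /(ind _ hq) ->.
  by rewrite /dot big1 // => i _; rewrite !mxE mderiv0 meval0 mul0r.
have inj D : Der k D -> vder D (subv_coords f a) = 0 -> vder D a = 0.
  move=> hD Df; pose g := linfun (colsub f : 'rV[K]_m -> 'rV[K]_(\dim (tsp k a'))).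
  have gE v : g v = subv_coords f v by rewrite lfunE; apply/rowP => j; rewrite !mxE.
  have gs : (g @: tsp k a)%VS = fullv.
    apply/vspaceP => v; rewrite memvf; apply/memv_imgP.
    have /tspP[E [hE ->]] : v \in tsp k (subv_coords f a) by rewrite ta memvf.
    exists (vder E a); first by apply/tspP; exists E.
    by rewrite gE; apply/rowP => j; rewrite !mxE.
  have := limg_ker_dim g (tsp k a); rewrite gs dim_full_row => e.
  have k0 : (tsp k a :&: lker g)%VS = 0%VS.
    by apply/eqP; rewrite -dimv_eq0 -leqn0 -(leq_add2r (\dim (tsp k a'))) add0n e.
  apply/eqP; rewrite -memv0 -k0 memv_cap memv_ker gE.
  apply/andP; split; first by apply/tspP; exists D.
  by apply/eqP; rewrite -Df; apply/rowP => j; rewrite !mxE.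
move=> p hp pa'; apply/eqP/negPn/negP => pa; set b := p.@[a 0] in pa.
set k1 := adj k (subv_coords f a).
have hk1 : subring k1 by exact: adj_subring.
have [D /(Der_adj _ _ hk)[hD Df]|P [P0 kP Pb]] := Der_algebraic (b := b) hk1.
  by rewrite /b (der_eval_grad_over a hD hp) (inj D hD Df) dot0r.
have /choice[g gP] i : exists q : {mpoly K[\dim (tsp k a')]}, over k q /\ P`_i = q.@[(subv_coords f a) 0] by exact: kP.
have exi : exists i, P`_i != 0.
  by exists (size P).-1; rewrite -/(lead_coef P) lead_coef_eq0.
(* [P] is divided by its lowest power ['X^e], which is possible because [b] is nonzero; thus [Phi]
   has a nonzero constant term [g e]. *)
have [e Pe emin] := ex_minnP exi.
pose Phi := \sum_(i < size P) subst_coords f (g (i + e)%N) * p ^+ i.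
have hPhi : over k Phi.
  apply: over_sum => // i _; apply: overM => //; last exact: over_exp.
  by apply: subst_coords_over => //; have [] := gP (i + e)%N.
have PhiE (c : 'rV[K]_m) : Phi.@[c 0] = \sum_(i < size P) (g (i + e)%N).@[(subv_coords f c) 0] * p.@[c 0] ^+ i.
  by rewrite raddf_sum; apply: eq_bigr => i _; rewrite /= mevalM rmorphXn /= subst_coords_eval.
have Phia : Phi.@[a 0] = 0.
  rewrite PhiE; apply: (mulfI (expf_neq0 e pa)); rewrite mulr0 -[RHS]Pb.
  rewrite (horner_coef_wide _ (leq_addr e (size P))) addnC big_split_ord /=.
  rewrite [X in _ = X + _]big1 ?add0r => [|i _]; last first.
    have [->|Pi] := eqVneq P`_i 0; first by rewrite mul0r.
    by have := emin i Pi; rewrite leqNgt ltn_ord.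
  rewrite mulr_sumr; apply: eq_bigr => i _.
  by have [_ <-] := gP (i + e)%N; rewrite addnC exprD -/b; ring.
have := sp _ hPhi Phia; rewrite PhiE.
have sP : (0 < size P)%N by rewrite size_poly_gt0.
rewrite (bigD1 (Ordinal sP)) //= expr0 mulr1 big1 ?addr0 => [|i i0]; last first.
  rewrite pa' expr0n; case: eqP => [i0'|_]; last by rewrite mulr0.
  by move/eqP: i0; case; apply/val_inj.
have [hg Pg] := gP e; rewrite add0n => /(over_partials_indep hk ta' hg) ge0.
by move: Pe; rewrite Pg ge0 meval0 eqxx.
Qed.

Lemma tsp_rows k a : subring k -> exists r (F : 'I_r -> {mpoly K[m]}),
  [/\ forall i, over k (F i), forall i, (F i).@[a 0] = 0,
      row_free (\matrix_i grad (F i) a), (r + \dim (tsp k a) = m)%N &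
      forall p, over k p -> p.@[a 0] = 0 -> grad p a \in rowvs (\matrix_i grad (F i) a)].
Proof.
move=> hk.
pose P := [set u | exists p, [/\ over k p, p.@[a 0] = 0 & u = grad p a]].
have [r [M [Mf MP MS]]] := spanning_rows P.
have [F hF] := choice MP.
have ME : \matrix_i grad (F i) a = M.
  by apply/row_matrixP => i; rewrite rowK; have [] := hF i.
exists r, F; split=> [i|i|||p hp pa].
- by have [] := hF i.
- by have [] := hF i.
- by rewrite ME.
- have -> : tsp k a = orth (rowvs M).
    apply/vspaceP => v; apply/idP/idP => [/tspP[D [hD ->]]|/orthP h].
      apply/orth_rowvs => i; have [h1 h2 ->] := hF i.
      by rewrite -(der_eval_grad_over a hD h1) h2 der0 //; case: hD.
    apply/tsp_prescribe => // p hp pa; rewrite h // rowvs_submx MS //.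
    by exists p.
  by rewrite dim_orth dim_rowvs // subnKC // -(dim_rowvs Mf) dim_leq.
- by rewrite ME rowvs_submx MS //; exists p.
Qed.

Definition jac r (F : 'I_r -> {mpoly K[m]}) (f : 'I_r -> 'I_m) : {mpoly K[m]} :=
  \det (\matrix_(i, j) (F i)^`M(f j)).

Lemma jac_eval r (F : 'I_r -> {mpoly K[m]}) f a :
  (jac F f).@[a 0] = \det (colsub f (\matrix_i grad (F i) a)).
Proof.
rewrite /jac -det_map_mx; congr (\det _).
by apply/matrixP => i j; rewrite !mxE.
Qed.

Lemma jac_over k r (F : 'I_r -> {mpoly K[m]}) f : subring k ->
  (forall i, over k (F i)) -> over k (jac F f).
Proof.
move=> hk hF; apply: over_sum => // s _; apply: overM => //.
  by apply: over_exp => //; apply: overN => //; exact: over1.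
by apply: over_prod => // i _; rewrite mxE; exact: over_deriv.
Qed.

(** A Jacobian minor that is nonzero at [a] is nonzero at [a'], because [a'] specializes back to
    [a]. *)
Lemma specializes_dim k a a' : subring k -> specializes k a a' -> specializes k a' a ->
  (\dim (tsp k a') = \dim (tsp k a))%N.
Proof.
suff h : forall a a', subring k -> specializes k a a' -> specializes k a' a ->
    (\dim (tsp k a') <= \dim (tsp k a))%N.
  by move=> hk s s'; apply/eqP; rewrite eqn_leq !h.
move=> {}a {}a' hk s s'.
have [r [F [hF Fa Ff rd _]]] := tsp_rows a hk.
have [f fu] := row_free_cols Ff.
have F'f : row_free (\matrix_i grad (F i) a').
  apply: (@unit_cols_row_free _ _ _ _ f); rewrite unitmxE unitfE -jac_eval.
  apply: contraTneq fu => j0; rewrite unitmxE unitfE -jac_eval negbK.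
  by apply/eqP/s' => //; exact: jac_over.
have : (tsp k a' <= orth (rowvs (\matrix_i grad (F i) a')))%VS.
  apply/subvP => v /(tsp_prescribe _ _ hk) h; apply/orth_rowvs => i.
  by rewrite rowK; apply: h => //; exact: s.
move/dimvS; rewrite dim_orth dim_rowvs //; lia.
Qed.

Lemma generic_specializes k A a a' : generic k A a -> A a' -> specializes k a a'.
Proof. by move=> [_ h] Aa' p hp /(h _ hp); apply. Qed.

Lemma specializes_generic k A a a' : generic k A a -> A a' -> specializes k a' a ->
  generic k A a'.
Proof. by move=> [_ h] Aa' s; split=> // p hp /(s _ hp) /(h _ hp). Qed.

Lemma generic_dim k A a a' : subring k -> generic k A a -> generic k A a' ->
  (\dim (tsp k a) = \dim (tsp k a'))%N.
Proof.
move=> hk g g'; apply: specializes_dim => //.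
  by apply: generic_specializes g' _; case: g.
by apply: generic_specializes g _; case: g'.
Qed.

Lemma generic_of_dim k A a a' : subring k -> generic k A a -> A a' ->
  (\dim (tsp k a) <= \dim (tsp k a'))%N -> generic k A a'.
Proof.
move=> hk g Aa' hd; apply: (specializes_generic g Aa').
by apply: specializes_sym => //; exact: (generic_specializes g Aa').
Qed.

(** Genericity survives an enlargement of the constants that does not shrink the velocity space: the
    comparison is with a point generic over [k'], whose velocity space has the same dimension. *)
Lemma generic_extend k k' A a : ~ countable [set: K] -> algclosed A -> algprime A ->
  subring k -> csubring k' -> k `<=` k' -> kdef k A -> generic k A a ->
  (\dim (tsp k a) <= \dim (tsp k' a))%N -> generic k' A a.
Proof.
move=> Kunc Acl Apr hk hk' kk' hA ga hd.
have [a' ga'] := exists_generic Kunc hk' Acl Apr.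
have Aa : A a by case: ga.
apply: (generic_of_dim _ ga' Aa); first by case: hk'.
apply: leq_trans hd; rewrite (generic_tsp _ (kdef_sub kk' hA) ga'); last by case: hk'.
rewrite -(generic_tsp hk hA (generic_sub kk' ga')).
by rewrite (generic_dim hk (generic_sub kk' ga') ga).
Qed.

End Spec.
End Specialization.

(** * Finite solution sets and derivations *)

Section Finiteness.
Variables (K : numClosedFieldType) (m : nat).
Hypothesis Kunc : ~ countable [set: K].
Implicit Types (v w : 'rV[K]_m) (p q t : {mpoly K[m]}) (T E : set {mpoly K[m]}).

Lemma mcoeff_pihomog d p l : (pihomog mdeg d p)@_l = if mdeg l == d then p@_l else 0.
Proof.
elim/mpolyind: p => [|c l' p _ _ IH]; first by rewrite pihomog0 mcoeff0 if_same.
rewrite linearD linearZ /= pihomogX !mcoeffD IH !mcoeffZ mcoeffX.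
have [<-|ll] := eqVneq l' l; first by case: ifP; rewrite ?mcoeffX ?eqxx ?mcoeff0 ?mulr0 ?addr0.
by case: ifP => _; case: ifP => _; rewrite ?mcoeffX ?(negPf ll) ?mcoeff0 ?mulr0 ?addr0.
Qed.

Lemma pihomogXU d p i :
  pihomog mdeg d ('X_i * p) = if d is d'.+1 then 'X_i * pihomog mdeg d' p else 0.
Proof.
have h e q : q \is e.-homog -> 'X_i * q \is e.+1.-homog.
  by move=> hq; rewrite -add1n; apply: dhomogM => //; rewrite dhomogX /= mdeg1.
rewrite {1}(pihomog_partitionE (leqnn (mmeasure mdeg p))) mulr_sumr raddf_sum /=.
case: d => [|d].
  apply: big1 => j _; apply: (@pihomog_ne0 _ _ mdeg j.+1) => //.
  by apply: (h); exact: pihomogP.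
rewrite [in RHS](pihomog_partitionE (leqnn (mmeasure mdeg p))) raddf_sum mulr_sumr /=.
apply: eq_bigr => j _.
have hj := pihomogP mdeg j p.
have [jd|jd] := eqVneq (val j) d.
  by rewrite -jd /= (pihomog_dE (h _ _ hj)) (pihomog_dE hj).
rewrite (@pihomog_ne0 _ _ mdeg j d) // mulr0.
by apply: (@pihomog_ne0 _ _ mdeg j.+1) => //; exact: (h).
Qed.

Lemma msize_mul_leq p q : (msize (p * q) <= (msize p + msize q).-1)%N.
Proof.
have [->|p0] := eqVneq p 0; first by rewrite mul0r msize0.
have [->|q0] := eqVneq q 0; first by rewrite mulr0 msize0.
by rewrite msizeM.
Qed.

Definition zeros E : set 'rV[K]_m := [set v | forall e, E e -> e.@[v 0] = 0].

(** There are no solutions at infinity. [msize g <= d] means degree less than [d], so on [Q] the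
    leading forms [T] may be replaced by polynomials of lower degree. As they have only [0] in
    common, all functions on [Q] come from polynomials of bounded degree, and the powers of each
    coordinate satisfy a linear relation. *)
Theorem finite_of_top (Q : set 'rV[K]_m) T :
  (forall t, T t -> exists d g, [/\ t \is d.-homog, (msize g <= d)%N &
     forall v, Q v -> t.@[v 0] = g.@[v 0]]) ->
  (forall v, (forall t, T t -> t.@[v 0] = 0) -> v = 0) ->
  exists s : seq 'rV[K]_m, forall v, Q v -> v \in s.
Proof.
move=> hT hz.
pose agree p q := forall v, Q v -> p.@[v 0] = q.@[v 0].
(* The polynomials all of whose homogeneous parts drop in degree on [Q]. They form an ideal
   containing [T], so by the Nullstellensatz a power of each variable belongs to it. *)
pose J := [set p | forall d, exists g, (msize g <= d)%N /\ agree (pihomog mdeg d p) g].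
have J0 : J 0 by move=> d; exists 0; rewrite msize0 pihomog0.
have JD p q : J p -> J q -> J (p + q).
  move=> hp hq d; have [g [sg ag]] := hp d; have [h [sh ah]] := hq d.
  exists (g + h); split; last by move=> v Qv; rewrite pihomogD !mevalD ag ?ah.
  by apply: leq_trans (msizeD_le _ _) _; rewrite geq_max sg.
have JM a p : J p -> J (a * p).
  elim/mpoly_ring_ind: a p => [c|i|a b ha hb|a b ha hb] p hp.
  - move=> d; have [g [sg ag]] := hp d; exists (c *: g); split; first exact: leq_trans (msizeZ_le _ _) sg.
    move=> v Qv.
    by rewrite mul_mpolyC linearZ /= !mevalZ ag.
  - move=> d; rewrite pihomogXU; case: d => [|d]; first by exists 0; rewrite msize0.
    have [g [sg ag]] := hp d; exists ('X_i * g); split; last by move=> v Qv; rewrite !mevalM ag.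
    by apply: leq_trans (msize_mul_leq _ _) _; rewrite msizeX mdeg1.
  - by rewrite mulrDl; apply: JD; [exact: ha | exact: hb].
  - by rewrite -mulrA; apply: ha; exact: hb.
have hJ : is_ideal J by split.
have TJ : T `<=` J.
  move=> t /hT[d0 [g [ht sg ag]]] d; have [->|dd] := eqVneq d d0.
    by exists g; rewrite pihomog_dE.
  by exists 0; rewrite msize0 (@pihomog_ne0 _ _ mdeg d0) // eq_sym.
have ex i : exists M, forall N, (M <= N)%N -> J ('X_i ^+ N).
  have [|M hM] := @nullstellensatz K m Kunc T 'X_i.
    move=> a ha; have : \row_i a i = 0 :> 'rV_m.
      apply: hz => t /ha; have aE : (\row_i a i : 'rV_m) 0 =1 a by move=> j; rewrite mxE.
      by rewrite (meval_eq _ aE).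
    by move=> /(congr1 (fun A : 'rV_m => A 0 i)); rewrite !mxE mevalXU.
  exists M => N /subnK <-; rewrite exprD; apply: JM; exact: hM.
have [Mf hMf] := choice ex.
pose M := \max_i Mf i.
have gM i : exists g, (msize g <= M)%N /\ agree ('X_i ^+ M) g.
  have := hMf i M (leq_bigmax _) M; rewrite pihomog_dE //.
  by rewrite -[X in X ^+ _]/(mpolyX _ U_(i)) mpolyXn dhomogX /= mdegMn mdeg1 mul1n.
(* A monomial of degree at least [B] has some exponent at least [M], so its degree can be lowered on
   [Q]. *)
pose B := (m * M).+1.
pose R := [set p | exists g, (msize g <= B)%N /\ agree p g].
have RD p q : R p -> R q -> R (p + q).
  move=> [g [sg ag]] [h [sh ah]]; exists (g + h); split.
    by apply: leq_trans (msizeD_le _ _) _; rewrite geq_max sg.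
  by move=> v Qv; rewrite !mevalD ag ?ah.
have RZ c p : R p -> R (c *: p).
  move=> [g [sg ag]]; exists (c *: g); split; first exact: leq_trans (msizeZ_le _ _) sg.
  by move=> v Qv; rewrite !mevalZ ag.
have R0 : R 0 by exists 0; rewrite msize0.
have Rmon d : forall l : 'X_{1..m}, (mdeg l <= d)%N -> R 'X_[l].
  elim: d => [|d IH] l ld.
    by exists 'X_[l]; rewrite msizeX ltnS (leq_trans ld).
  have [lB|lB] := ltnP (mdeg l) B; first by exists 'X_[l]; rewrite msizeX.
  have [i li] : exists i, (M <= l i)%N.
    apply: contrapT => h; move: lB; rewrite ltnNge mdegE => /negP; apply.
    apply: leq_trans (_ : \sum_(i < m) M <= _)%N; last by rewrite sum_nat_const card_ord.
    apply: leq_sum => i _; rewrite leqNgt; apply/negP => /ltnW li; apply: h.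
    by exists i.
  have [g [sg ag]] := gM i.
  have lE : l = (U_(i) *+ M + (l - U_(i) *+ M))%MM.
    rewrite addmC submK //; apply/mnm_lepP => j; rewrite mulmnE mnm1E.
    by case: eqP => [<-|_]; rewrite ?mul1n // mul0n.
  have : R (g * 'X_[l - U_(i) *+ M]).
    rewrite [X in R X]mpolyE.
    have RS (r : seq 'X_{1..m}) (F : 'X_{1..m} -> {mpoly K[m]}) :
        (forall l, l \in r -> R (F l)) -> R (\sum_(l <- r) F l).
      elim: r => [|l0 r IHr] h; first by rewrite big_nil.
      rewrite big_cons; apply: RD; first by apply: h; rewrite mem_head.
      by apply: IHr => l1 l1r; apply: h; rewrite inE l1r orbT.
    apply: RS => l' l'g; apply: RZ; apply: IH; rewrite -ltnS.
    apply: leq_trans (msize_mdeg_lt l'g) _.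
    apply: leq_trans (msize_mul_leq _ _) _; rewrite msizeX addnS /=.
    apply: leq_trans (_ : M + mdeg (l - U_(i) *+ M)%MM <= _)%N; first by rewrite leq_add2r.
    by apply: leq_trans ld; rewrite [in X in (_ <= X)%N]lE mdegD mdegMn mdeg1 mul1n.
  case=> g' [sg' ag']; exists g'; split=> // v Qv.
  by rewrite -ag' // [in LHS]lE mpolyXD -mpolyXn !mevalM; congr (_ * _); exact: ag.
have Rall p : R p.
  rewrite [p]mpolyE; apply: (big_ind R) => // l _; apply: RZ; exact: Rmon (leqnn _).
have root i : exists P : {poly K}, P != 0 /\ forall v, Q v -> P.[v 0 i] = 0.
  have /choice[g gP] j : exists g, (msize g <= B)%N /\ agree ('X_i ^+ j) g by exact: Rall.
  have [j||c [[j0 cj0] csum]] := @mpoly_dependent K m B 'I_(#|{: 'X_{1..m < B}}|.+1) (fun j => g j).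
  - by have [] := gP j.
  - by rewrite card_ord.
  exists (\poly_(j < #|{: 'X_{1..m < B}}|.+1) c (inord j)); split.
    apply/eqP => /(congr1 (fun P : {poly K} => P`_j0)); rewrite coef0 coef_poly ltn_ord inord_val.
    by move/eqP; rewrite (negPf cj0).
  move=> v Qv; rewrite horner_poly -[RHS](meval0 (v 0)) -csum raddf_sum /=.
  apply: eq_bigr => j _; rewrite inord_val mevalZ; have [_ <- //] := gP j.
  by rewrite rmorphXn /= mevalXU.
have /choice[rs rsP] i : exists r : seq K, forall v, Q v -> v 0 i \in r.
  have [P [P0 hP]] := root i; have [r PE] := closed_field_poly_normal P.
  exists r => v Qv; have := hP v Qv; rewrite PE hornerZ => /eqP.
  rewrite mulf_eq0 lead_coef_eq0 (negPf P0) /= horner_prod prodf_seq_eq0.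
  by case/hasP => z zr; rewrite hornerXsubC subr_eq0 => /eqP ->.
pose rr := flatten [seq rs i | i <- enum 'I_m].
exists (map (fun f : {ffun 'I_m -> seq_sub rr} => \row_i val (f i)) (enum {ffun 'I_m -> seq_sub rr})) => v Qv.
have vr i : v 0 i \in rr.
  by apply/flattenP; exists (rs i); [apply: map_f; rewrite mem_enum | exact: rsP].
apply/mapP; exists [ffun i => SeqSub (vr i)]; rewrite ?mem_enum //.
by apply/rowP => i; rewrite mxE ffunE.
Qed.

(** Ritt's argument: let [f ^+ n] be in the ideal and [g = D f]. Applying [D] to [f^(e+1) g^(2j)]
    and multiplying by [g] gives [(e+1) f^e g^(2j+2)] up to a multiple of the same element; division
    by [e+1] and induction lead to [g^(2n)]. *)
Lemma ritt E (D : K -> K) f : derivation D -> (forall e, E e -> dpoly D e = 0) ->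
  vanish (zeros E) f -> vanish (zeros E) (dpoly D f).
Proof.
move=> hD hE hf.
have hI := ideal_genP E; have [I0 ID IM] := hI.
have stab p : ideal_gen E p -> ideal_gen E (dpoly D p).
  move=> /(_ [set p | ideal_gen E p /\ ideal_gen E (dpoly D p)]) h; apply h.
    split.
    - by split=> //; rewrite -mpolyC0 dpolyC // der0 // mpolyC0.
    - by move=> x y [hx1 hx2] [hy1 hy2]; split; rewrite ?dpolyD //; exact: ID.
    - move=> a x [hx1 hx2]; split; first exact: IM.
      by rewrite dpolyM //; apply: ID; [|exact: IM]; apply: IM.
  by move=> e Ee; split; [exact: sub_ideal_gen | rewrite hE].
have [|n hn] := @nullstellensatz K m Kunc E f.
  move=> a ha; have aE : (\row_i a i : 'rV_m) 0 =1 a by move=> j; rewrite mxE.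
  by rewrite -(meval_eq _ aE); apply: hf => e /ha; rewrite (meval_eq _ aE).
set g := dpoly D f.
have dX p j : dpoly D (p ^+ j.+1) = j.+1%:R *: (p ^+ j * dpoly D p).
  elim: j => [|j IH]; first by rewrite expr1 expr0 mul1r scale1r.
  rewrite exprS dpolyM // IH -scalerAr mulrA -exprS -[in RHS]natr1 scalerDl scale1r addrC.
  by congr (_ + _); rewrite mulrC.
have gD i : g * dpoly D (g ^+ i) = (i%:R *: dpoly D g) * g ^+ i.
  case: i => [|i]; first by rewrite expr0 -mpolyC1 dpolyC // der1 // mpolyC0 scale0r mulr0 mul0r.
  by rewrite dX -scalerAr -scalerAl exprS; congr (_ *: _); ring.
have step j : (j <= n)%N -> ideal_gen E (f ^+ (n - j) * g ^+ (j * 2)).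
  elim: j => [_|j IH jn]; first by rewrite subn0 mul0n expr0 mulr1.
  have := IH (ltnW jn); have -> : (n - j = (n - j.+1).+1)%N by rewrite subnSK.
  set e := (n - j.+1)%N; set G := g ^+ (j * 2) => h.
  have -> : f ^+ e * g ^+ (j.+1 * 2) = (e.+1%:R^-1)%:MP *
     (g * dpoly D (f ^+ e.+1 * G) - ((j * 2)%:R *: dpoly D g) * (f ^+ e.+1 * G)).
    have -> : g * dpoly D (f ^+ e.+1 * G) =
       e.+1%:R *: (f ^+ e * g * g * G) + f ^+ e.+1 * (g * dpoly D G).
      rewrite dpolyM // dX -/g -!mul_mpolyC; set cc := _%:MP; clearbody cc e G g.
      by rewrite exprS; ring.
    have -> : f ^+ e * g ^+ (j.+1 * 2) = f ^+ e * g * g * G.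
      by rewrite /G mulSn exprD expr2; ring.
    rewrite gD -/G -!mul_mpolyC.
    have -> : e.+1%:R%:MP * (f ^+ e * g * g * G) + f ^+ e.+1 * ((j * 2)%:R%:MP * dpoly D g * G) -
      (j * 2)%:R%:MP * dpoly D g * (f ^+ e.+1 * G) = e.+1%:R%:MP * (f ^+ e * g * g * G) by ring.
    by rewrite [RHS]mulrA -mpolyCM mulVf ?pnatr_eq0 // mpolyC1 mul1r.
  apply: (IM); apply: (is_idealB hI); apply: (IM); last exact: h.
  exact: stab.
have := step n (leqnn n); rewrite subnn expr0 mul1r => hg v Zv.
have := ideal_gen_eval Zv hg; rewrite rmorphXn /= => /eqP.
by rewrite expf_eq0 => /andP[_ /eqP].
Qed.

(** Multiply ['X_i - x_i] by a polynomial vanishing at the other zeros but not at [x]. The product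
    vanishes on the zero set, and its differential applied to [vder D x] is a nonzero multiple of
    the derivative of [x_i]. *)
Lemma finite_zeros_const E (D : K -> K) (s : seq 'rV[K]_m) x :
  derivation D -> (forall e, E e -> dpoly D e = 0) ->
  (forall v, zeros E v -> v \in s) -> zeros E x -> vder D x = 0.
Proof.
move=> hD hE hs Zx.
have key f : vanish (zeros E) f -> dot (grad f x) (vder D x) = 0.
  move=> hf; have := der_eval_grad f x hD.
  by rewrite hf // der0 // (ritt hD hE hf) // add0r => <-.
have sep (q : 'rV[K]_m) : exists l : {mpoly K[m]}, l.@[q 0] = 0 /\ (q != x -> l.@[x 0] != 0).
  have [->|qx] := eqVneq q x; first by exists 0; rewrite meval0.
  have [j qj] : exists j, q 0 j != x 0 j.
    apply: contrapT => h; move/eqP: qx; apply; apply/rowP => j; apply/eqP/negPn/negP => e.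
    by apply: h; exists j.
  exists ('X_j - (q 0 j)%:MP); rewrite !mevalB !mevalXU !mevalC subrr; split=> // _.
  by rewrite subr_eq0 eq_sym.
have [l lP] := choice sep.
apply/rowP => i; rewrite [RHS]mxE; pose P := \prod_(q <- s | q != x) l q.
have Px : P.@[x 0] != 0.
  rewrite rmorph_prod /= prodf_seq_neq0; apply/allP => q _; apply/implyP.
  by have [_] := lP q; apply.
have := key (('X_i - (x 0 i)%:MP) * P).
rewrite -dird_dot dirdM mevalB mevalXU mevalC subrr mul0r addr0 dirdB dirdXU dirdC subr0.
move=> h; apply/eqP; rewrite -(mulIr_eq0 _ (mulIf Px)); apply/eqP/h.
move=> v Zv; rewrite mevalM; have [->|vx] := eqVneq v x.
  by rewrite mevalB mevalXU mevalC subrr mul0r.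
apply/eqP; rewrite mulf_eq0 rmorph_prod /=; apply/orP; right.
rewrite prodf_seq_eq0; apply/hasP; exists v; first exact: hs.
by have [-> _] := lP v; rewrite vx eqxx.
Qed.

End Finiteness.

(** * Dimension of cones *)

Section Elimination.
Variables (K : numClosedFieldType) (q m : nat).
Hypothesis Kunc : ~ countable [set: K].
Implicit Types (a : 'rV[K]_q) (x v : 'rV[K]_m).

Definition polyfun (F : 'rV[K]_q -> K) : Prop := exists P : {mpoly K[q]}, forall a, F a = P.@[a 0].

Lemma polyfun_det r (T : 'rV[K]_q -> 'M[K]_r) : (forall i j, polyfun (fun a => T a i j)) ->
  polyfun (fun a => \det (T a)).
Proof.
move=> h; have /choice[P hP] (ij : 'I_r * 'I_r) := h ij.1 ij.2.
exists (\det (\matrix_(i, j) P (i, j))) => a; rewrite -det_map_mx; congr (\det _).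
by apply/matrixP => i j; rewrite !mxE (hP (i, j)).
Qed.

Definition monrow d x : 'rV[K]_(#|{: 'X_{1..m < d}}|) :=
  \row_j ('X_[(enum_val j : 'X_{1..m < d})] : {mpoly K[m]}).@[x 0].

Lemma dot_coefrow d (p : {mpoly K[m]}) x : (msize p <= d)%N ->
  dot (coefrow d p) (monrow d x) = p.@[x 0].
Proof.
move=> sp; rewrite {2}(mpolywE sp) raddf_sum /= (reindex (enum_val : 'I_#|{: 'X_{1..m < d}}| -> _)) /=.
  by apply: eq_bigr => j _; rewrite !mxE mevalZ.
by apply: onW_bij; exact: enum_val_bij.
Qed.

Lemma coefrow_sum d (I : Type) (r : seq I) (c : I -> K) (g : I -> {mpoly K[m]}) :
  coefrow d (\sum_(i <- r) c i *: g i) = \sum_(i <- r) c i *: coefrow d (g i).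
Proof.
by apply/rowP => j; rewrite summxE mxE raddf_sum /=; apply: eq_bigr => i _; rewrite mcoeffZ !mxE.
Qed.

(* For [a] in the complement the products [X^b g^a] span all forms of some large
   degree; [F] is a minor witnessing this. *)
Theorem elimination (G : set (nat * ('rV[K]_q -> {mpoly K[m]}))) a0 :
  (forall g, G g -> (forall a, g.2 a \is g.1.-homog) /\ forall l, polyfun (fun a => (g.2 a)@_l)) ->
  (forall x, (forall g, G g -> (g.2 a0).@[x 0] = 0) -> x = 0) ->
  exists F, [/\ polyfun F, F a0 != 0 &
    forall a x, x != 0 -> (forall g, G g -> (g.2 a).@[x 0] = 0) -> F a = 0].
Proof.
move=> hG h0.
pose E := [set p | exists g, G g /\ p = g.2 a0].
have /choice[e he] (i : 'I_m) : exists e, ideal_gen E ('X_i ^+ e).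
  apply: (nullstellensatz Kunc) => b hb.
  have bE : (\row_i b i : 'rV_m) 0 =1 b by move=> j; rewrite mxE.
  have := h0 (\row_i b i); rewrite mevalXU => h; rewrite -bE h ?mxE // => g Gg.
  by rewrite (meval_eq _ bE); apply: hb; exists g.
(* Every monomial of degree [M] is divisible by some ['X_i ^+ e i], so all forms of degree [M] lie
   in the ideal at [a0]. *)
pose M := (m * \max_i e i).+1.
pose prods := [set u | exists b g, [/\ G g, (mdeg b + g.1 = M)%N & u = coefrow M.+1 ('X_[b] * g.2 a0)]].
have [r [B [Bf BP BS]]] := spanning_rows prods.
have sM (b : 'X_{1..m}) g a : G g -> (mdeg b + g.1 = M)%N -> 'X_[b] * g.2 a \is M.-homog.
  by move=> /hG[hg _] <-; apply: dhomogM => //; rewrite dhomogX.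
have sz (p : {mpoly K[m]}) : p \is M.-homog -> (msize p <= M.+1)%N.
  move=> hp; rewrite msizeE; apply/bigmax_leqP_seq => l lp _; rewrite ltnS.
  by move/dhomogP: hp => /(_ l lp) /= ->.
have idl p : ideal_gen E p -> (coefrow M.+1 (pihomog mdeg M p) <= B)%MS.
  move=> /(_ [set p | forall b, (coefrow M.+1 (pihomog mdeg M ('X_[b] * p)) <= B)%MS]) h.
  have := h _ _ 0%MM; rewrite mpolyX0 mul1r; apply.
    split=> [b|x y hx hy b|c x hx b].
    - rewrite mulr0 pihomog0 (_ : coefrow _ _ = 0) ?sub0mx //.
      by apply/rowP => j; rewrite !mxE mcoeff0.
    - rewrite mulrDr pihomogD (_ : coefrow _ (_ + _) = coefrow M.+1 (pihomog mdeg M ('X_[b] * x)) + coefrow M.+1 (pihomog mdeg M ('X_[b] * y))) ?addmx_sub //.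
      by apply/rowP => j; rewrite !mxE mcoeffD.
    - rewrite [c]mpolyE mulr_suml mulr_sumr raddf_sum /=.
      have -> : \sum_(l <- msupp c) pihomog mdeg M ('X_[b] * (c@_l *: 'X_[l] * x)) =
        \sum_(l <- msupp c) c@_l *: pihomog mdeg M ('X_[b + l] * x).
        by apply: eq_bigr => l _; rewrite -linearZ /= mpolyXD -scalerAl -scalerAr mulrA.
      by rewrite coefrow_sum; apply: summx_sub => l _; apply: scalemx_sub.
  move=> _ [g [Gg ->]] b; have [bM|bM] := eqVneq (mdeg b + g.1)%N M.
    rewrite pihomog_dE; last exact: sM.
    by apply: BS; exists b, g.
  rewrite (@pihomog_ne0 _ _ mdeg (mdeg b + g.1)) //.
    by rewrite (_ : coefrow _ _ = 0) ?sub0mx //; apply/rowP => j; rewrite !mxE mcoeff0.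
  by apply: dhomogM; rewrite ?dhomogX //; have [] := hG g Gg.
have monB (l : 'X_{1..m}) : mdeg l = M -> (coefrow M.+1 ('X_[l] : {mpoly K[m]}) <= B)%MS.
  move=> lM; have [i li] : exists i, (e i <= l i)%N.
    apply: contrapT => h; have : (m * \max_i e i < mdeg l)%N by rewrite lM.
    rewrite ltnNge mdegE => /negP; apply.
    apply: leq_trans (_ : \sum_(i < m) \max_i e i <= _)%N; last by rewrite sum_nat_const card_ord.
    apply: leq_sum => i _; apply: leq_trans (leq_bigmax i); rewrite leqNgt.
    by apply/negP => /ltnW li; apply: h; exists i.
  rewrite -[X in coefrow _ X](@pihomog_dE _ _ mdeg M); last by rewrite dhomogX /= lM.
  apply: idl; have lE : l = (U_(i) *+ e i + (l - U_(i) *+ e i))%MM.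
    rewrite addmC submK //; apply/mnm_lepP => j; rewrite mulmnE mnm1E.
    by case: eqP => [<-|_]; rewrite ?mul1n // mul0n.
  have [_ _ hI] := ideal_genP E.
  by rewrite lE mpolyXD mulrC -mpolyXn; apply: hI.
have homB (p : {mpoly K[m]}) : p \is M.-homog -> (coefrow M.+1 p <= B)%MS.
  move=> hp; rewrite [p]mpolyE coefrow_sum big_seq; apply: summx_sub => l lp; apply: scalemx_sub.
  by apply: monB; move/dhomogP: hp => /(_ l lp).
have /choice[bg bgP] i : exists bg : 'X_{1..m} * (nat * ('rV[K]_q -> {mpoly K[m]})),
    [/\ G bg.2, (mdeg bg.1 + bg.2.1 = M)%N & row i B = coefrow M.+1 ('X_[bg.1] * bg.2.2 a0)].
  by have [b [g h]] := BP i; exists (b, g).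
pose T a := \matrix_i coefrow M.+1 ('X_[(bg i).1] * (bg i).2.2 a).
have [f hf] := row_free_cols Bf.
have TB : T a0 = B by apply/row_matrixP => i; rewrite rowK; have [_ _ ->] := bgP i.
exists (fun a => \det (colsub f (T a))); split.
- apply: polyfun_det => i j; have [Gg _ _] := bgP i; have [_ hl] := hG _ Gg.
  set w := enum_val (f j).
  have /choice[P hP] := hl.
  exists (\sum_(k : 'X_{1..m < (mdeg w).+1, (mdeg w).+1} | (w : 'X_{1..m}) == (k.1 + k.2)%MM)
    ('X_[(bg i).1] : {mpoly K[m]})@_k.1 *: P k.2) => a.
  rewrite !mxE mcoeffM raddf_sum /=; apply: eq_bigr => k _.
  by rewrite mevalZ -hP.
- by rewrite TB -unitfE -unitmxE.
move=> a x x0 hx; apply/eqP; apply: contraNT x0; rewrite -unitfE -unitmxE => hu.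
have Tf := unit_cols_row_free hu.
have TleB : (T a <= B)%MS.
  apply/row_subP => i; rewrite rowK; have [Gg gM _] := bgP i.
  by apply: homB; exact: sM.
have BT : (B <= T a)%MS.
  by rewrite -(geq_leqif (mxrank_leqif_sup TleB)) (eqP Bf) (eqP Tf).
have Tx : forall u, (u <= T a)%MS -> dot u (monrow M.+1 x) = 0.
  move=> u /submxP[c ->]; rewrite mulmx_sum_row dot_suml big1 // => i _.
  have [Gg gM _] := bgP i.
  by rewrite dotZl rowK dot_coefrow ?mevalM ?hx ?mulr0 //; apply: sz; exact: sM.
apply/eqP/rowP => i; rewrite mxE; apply/eqP.
have : ('X_[U_(i) *+ M] : {mpoly K[m]}).@[x 0] = 0.
  have hX : ('X_[U_(i) *+ M] : {mpoly K[m]}) \is M.-homog by rewrite dhomogX /= mdegMn mdeg1 mul1n.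
  rewrite -(dot_coefrow _ (sz _ hX)); apply: Tx; apply: submx_trans BT; exact: homB.
by rewrite -mpolyXn rmorphXn /= mevalXU => /eqP; rewrite expf_eq0 => /andP[].
Qed.

End Elimination.

Section Lines.
Variable K : numClosedFieldType.

Lemma poly_nat_roots (P : {poly K}) : (forall j : nat, P.[j%:R] = 0) -> P = 0.
Proof.
move=> h; apply/eqP/negPn/negP => P0.
have := @max_poly_roots K P [seq j%:R | j <- iota 0 (size P)] P0; rewrite size_map size_iota ltnn.
move=> H; suff : false by []; apply: H; first by apply/allP => _ /mapP[j _ ->]; apply/eqP; exact: h.
by rewrite map_inj_uniq ?iota_uniq // => i j /eqP; rewrite eqr_nat => /eqP.
Qed.

Lemma line_poly m (p : {mpoly K[m]}) (a w : 'rV[K]_m) : exists Q : {poly K}, forall t,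
  p.@[(a + t *: w) 0] = Q.[t] /\ dot (grad p (a + t *: w)) w = Q^`().[t].
Proof.
have step (p1 p2 : {mpoly K[m]}) (Q1 Q2 : {poly K}) t : dot (grad (p1 * p2) (a + t *: w)) w =
    dot (grad p1 (a + t *: w)) w * p2.@[(a + t *: w) 0] + p1.@[(a + t *: w) 0] * dot (grad p2 (a + t *: w)) w.
  by rewrite -!dird_dot dirdM.
elim/mpoly_ring_ind: p => [c|i|p1 p2 [Q1 h1] [Q2 h2]|p1 p2 [Q1 h1] [Q2 h2]].
- by exists c%:P => t; rewrite mevalC hornerC -dird_dot dirdC derivC horner0.
- exists ((a 0 i)%:P + w 0 i *: 'X) => t; rewrite mevalXU !mxE -dird_dot dirdXU.
  by rewrite derivD derivC derivZ derivX !hornerE; split=> //; rewrite mulrC.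
- exists (Q1 + Q2) => t; have [e1 f1] := h1 t; have [e2 f2] := h2 t.
  by rewrite mevalD e1 e2 grad_is_additive dotDl f1 f2 derivD !hornerD.
- exists (Q1 * Q2) => t; have [e1 f1] := h1 t; have [e2 f2] := h2 t.
  by rewrite mevalM step // e1 e2 f1 f2 derivM hornerD !hornerM.
Qed.

Lemma meval_homog_scale m d (p : {mpoly K[m]}) c (v : 'rV[K]_m) : p \is d.-homog ->
  p.@[(c *: v) 0] = c ^+ d * p.@[v 0].
Proof.
move=> /dhomogP hp; rewrite !mevalE mulr_sumr !big_seq; apply: eq_bigr => l lp.
rewrite mulrCA; congr (_ * _); rewrite -(hp l lp) /= mdegE -prodrXr.
by rewrite -big_split; apply: eq_bigr => i _; rewrite mxE exprMn.
Qed.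

End Lines.

Section Cones.
Variables (K : numClosedFieldType) (m : nat).
Hypothesis Kunc : ~ countable [set: K].
Implicit Types (a u v w : 'rV[K]_m) (p q : {mpoly K[m]}) (A B C : set 'rV[K]_m) (k : set K).

Definition ccone A : Prop := [/\ algclosed A, A 0 & forall c v, A v -> A (c *: v)].

Lemma zeros_algclosed (E : set {mpoly K[m]}) : algclosed (zeros E).
Proof. by move=> v h e Ee; apply: h => w; apply. Qed.

Lemma zeros_vanish A : algclosed A -> zeros (vanish A) = A.
Proof. by move=> h; rewrite eqEsubset; split=> v; [move=> /h | move=> Av p; apply]. Qed.

Definition ray p v : {poly K} := \poly_(d < msize p) (pihomog mdeg d p).@[v 0].

Lemma ray_eval p v c : (ray p v).[c] = p.@[(c *: v) 0].
Proof.
rewrite horner_poly [in RHS](pihomog_partitionE (leqnn (mmeasure mdeg p))) raddf_sum /=.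
by apply: eq_bigr => d _; rewrite (meval_homog_scale c v (pihomogP mdeg d p)) mulrC.
Qed.

Lemma ray0 p v : ray p v = 0 <-> forall d, (pihomog mdeg d p).@[v 0] = 0.
Proof.
split=> [h d|h]; last by apply/polyP => d; rewrite coef_poly coef0 h if_same.
have := congr1 (fun P : {poly K} => P`_d) h; rewrite coef_poly coef0.
have [//|le _] := ltnP d (msize p); rewrite (_ : pihomog _ _ _ = 0) ?meval0 //.
apply/mpolyP => l; rewrite mcoeff_pihomog mcoeff0; case: eqP => // ld.
by apply: memN_msupp_eq0; apply: msize_mdeg_ge; rewrite ld.
Qed.

Lemma vanish_homog A p d : (forall c v, A v -> A (c *: v)) -> vanish A p ->
  vanish A (pihomog mdeg d p).
Proof.
move=> hA hp v Av; suff /ray0 : ray p v = 0 by apply.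
by apply: poly_nat_roots => j; rewrite ray_eval; apply: hp; exact: hA.
Qed.

Lemma over_pihomog k p d : subring k -> over k p -> over k (pihomog mdeg d p).
Proof. by move=> hk hp l; rewrite mcoeff_pihomog; case: ifP => // _; exact: subring0. Qed.

Lemma ratl_homog k A v : subring k -> ratl k A -> ccone A ->
  (forall g d, over k g -> g \is d.-homog -> vanish A g -> g.@[v 0] = 0) -> A v.
Proof.
move=> hk hA [Acl _ Asc] h; apply: Acl => p /hA[r [c [g [hg ->]]]].
rewrite raddf_sum /= big1 // => i _; rewrite mevalZ; have [gk gA] := hg i.
rewrite (pihomog_partitionE (leqnn (mmeasure mdeg (g i)))) raddf_sum big1 ?mulr0 // => d _.
apply: (h _ d); [exact: over_pihomog | exact: pihomogP | exact: vanish_homog].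
Qed.

Lemma tang_cone A a : (forall c v, A v -> A (c *: v)) -> A a -> a \in tang A a.
Proof.
move=> hA Aa; apply/tangP => p hp; have [Q hQ] := line_poly p 0 a.
have Q0 : Q = 0.
  by apply: poly_nat_roots => j; have [<- _] := hQ j%:R; rewrite add0r; apply: hp; exact: hA.
by have [_] := hQ 1; rewrite scale1r add0r Q0 deriv0 horner0.
Qed.

(** The zero set of a polynomial [p] need not be a cone, so it is replaced by the cone [S p] of
    vectors whose whole ray is killed by [p]. A cone on which [p] vanishes is contained in [S p],
    and along a ray a product vanishes only if a factor does. *)
Lemma algprime_cone A : ccone A ->
  (forall B C, ccone B -> ccone C -> A `<=` B `|` C -> A `<=` B \/ A `<=` C) -> algprime A.
Proof.
move=> [Acl A0 Asc] h; split; first by exists 0.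
pose S p : set 'rV[K]_m := A `&` [set v | ray p v = 0].
have hS p : p.@[(0 : 'rV_m) 0] = 0 -> ccone (S p).
  move=> p0; split.
  - move=> v hv; split; first by apply: Acl => f fA; apply: hv => w [Aw _]; exact: fA.
    by apply/ray0 => d; apply: hv => w [_ /ray0]; apply.
  - by split=> //; apply: poly_nat_roots => j; rewrite ray_eval scaler0.
  - move=> c v [Av /= rv]; split; first exact: Asc.
    by apply: poly_nat_roots => j; rewrite ray_eval scalerA -ray_eval rv horner0.
have SP p : A `<=` S p -> vanish A p.
  by move=> h1 v /h1[_ /= rv]; rewrite -[v]scale1r -ray_eval rv horner0.
have cov p q : vanish A (p * q) -> A `<=` S p `|` S q.
  move=> pq v Av; have /eqP : ray p v * ray q v = 0.
    apply: poly_nat_roots => j; rewrite hornerM !ray_eval -mevalM; apply: pq; exact: Asc.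
  by rewrite mulf_eq0 => /orP[] /eqP e; [left | right].
have nz p v : p.@[(0 : 'rV_m) 0] != 0 -> ray p v <> 0.
  by move=> p0 e; move/eqP: p0; apply; rewrite -(scale0r v) -ray_eval e horner0.
(* If the constant term of [p] is nonzero then [S p] is empty, so [S q] alone covers [A]. *)
move=> p q pq; have [p0|p0] := eqVneq p.@[(0 : 'rV_m) 0] 0; last first.
  by right; apply: SP => v Av; case: (cov _ _ pq v Av) => // -[_ /(nz _ _ p0)].
have [q0|q0] := eqVneq q.@[(0 : 'rV_m) 0] 0; last first.
  by left; apply: SP => v Av; case: (cov _ _ pq v Av) => // -[_ /(nz _ _ q0)].
by have [] := h _ _ (hS p p0) (hS q q0) (cov _ _ pq) => /SP; [left | right].
Qed.

(** Project from a subspace [W] of maximal dimension among those meeting [A] only in [0]. If [w] is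
    outside [W], then [W + <[w]>] meets [A] by maximality, and this gives a preimage of the image of
    [w]. *)
Lemma cone_projection A : ccone A -> exists r (P : 'M[K]_(m, r)),
  (forall v, A v -> v *m P = 0 -> v = 0) /\ forall u : 'rV[K]_r, exists v, A v /\ v *m P = u.
Proof.
move=> [Acl A0 Asc].
pose good d := `[< exists W : {vspace 'rV[K]_m}, \dim W = d /\ forall v, v \in W -> A v -> v = 0 >].
have ex0 : exists d, good d.
  by exists 0%N; apply/asboolP; exists 0%VS; rewrite dimv0; split=> // v; rewrite memv0 => /eqP.
have bd d : good d -> (d <= m)%N by move=> /asboolP[W [<- _]]; exact: dim_leq.
have [d /asboolP[W [Wd hW]] dmax] := ex_maxnP ex0 bd.
pose U := orth W; exists (\dim U), (bmx U)^T.
have PE v j : (v *m (bmx U)^T) 0 j = dot v (row j (bmx U)).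
  by rewrite mxE; apply: eq_bigr => i _; rewrite !mxE.
have P0 v : v *m (bmx U)^T = 0 -> v \in W.
  move=> h; rewrite -[W]orthK; apply/orthP => _ /bmxP[c ->].
  rewrite mulmx_sum_row dot_suml big1 // => j _.
  by rewrite dotZl dotC -PE h mxE mulr0.
split=> [v Av /P0 vW|u]; first exact: hW.
have [w wu] : exists w, w *m (bmx U)^T = u.
  have : (u <= (bmx U)^T)%MS by apply: submx_full; rewrite /row_full mxrank_tr; exact: (bmx_free U).
  by move=> /submxP[w ->]; exists w.
have [u0|u0] := eqVneq u 0; first by exists 0; rewrite mul0mx u0.
have wW : w \notin W.
  apply: contra u0 => wW; rewrite -wu; apply/eqP/rowP => j; rewrite PE mxE.
  by have /orthP := bmx_row (U := U) j; apply.
have [v [vW Av v0]] : exists v, [/\ v \in (W + <[w]>)%VS, A v & v != 0].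
  apply: contrapT => h; suff /dmax : good d.+1 by rewrite ltnn.
  apply/asboolP; exists (W + <[w]>)%VS; split.
    rewrite dimv_disjoint_sum ?Wd ?dim_vline; last first.
      apply/eqP; rewrite -subv0; apply/subvP => x; rewrite memv_cap => /andP[xW /vlineP[c xc]].
      rewrite memv0 xc; move: xW; rewrite xc; have [->|c0] := eqVneq c 0; first by rewrite scale0r.
      by move=> /(memvZ c^-1); rewrite scalerA mulVf // scale1r (negPf wW).
    by rewrite (_ : w != 0) ?addn1 //; apply: contraNneq wW => ->; rewrite mem0v.
  by move=> v vW Av; apply/eqP/negPn/negP => v0; apply: h; exists v.
have [x xW [y /vlineP[c ->] vE]] := memv_addP vW.
have c0 : c != 0.
  by apply: contraNneq v0 => c0; rewrite (hW v) // vE c0 scale0r addr0.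
have xP : x *m (bmx U)^T = 0.
  by apply/rowP => j; rewrite PE mxE; have /orthP := bmx_row (U := U) j; apply.
exists (c^-1 *: v); split; first exact: Asc.
by rewrite vE scalerDr mulmxDl -!scalemxAl xP scaler0 add0r scalerA mulVf // scale1r.
Qed.

Section Projection.
Variables (A : set 'rV[K]_m) (r : nat) (P : 'M[K]_(m, r)).
Hypothesis hA : ccone A.
Hypothesis PA : forall v, A v -> v *m P = 0 -> v = 0.

Definition lin_form (c : 'rV[K]_m) : {mpoly K[m]} := \sum_i c 0 i *: 'X_i.

Lemma lin_form_eval c v : (lin_form c).@[v 0] = dot c v.
Proof. by rewrite /lin_form raddf_sum; apply: eq_bigr => i _ /=; rewrite mevalZ mevalXU. Qed.

Lemma lin_form_homog c : lin_form c \is 1.-homog.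
Proof. by apply: rpred_sum => i _; apply: rpredZ; rewrite dhomogX /= mdeg1. Qed.

Lemma lin_form_over k (c : 'rV[K]_m) : subring k -> (forall i, k (c 0 i)) -> over k (lin_form c).
Proof. by move=> hk hc; apply: over_sum => // i _; apply: overZ => //; exact: overX. Qed.

Lemma lin_form_col v j : (lin_form (col j P)^T).@[v 0] = (v *m P) 0 j.
Proof. by rewrite lin_form_eval mxE; apply: eq_bigr => i _; rewrite !mxE mulrC. Qed.

(** The leading forms of the equations of a fibre are those of [A] and the linear forms given by
    [P], which have only [0] in common. *)
Lemma finite_fibre (Q : set 'rV[K]_m) (u : 'rV[K]_r) : Q `<=` A `&` [set v | v *m P = u] ->
  exists s : seq 'rV[K]_m, forall v, Q v -> v \in s.
Proof.
move=> QA; have [Acl A0 Asc] := hA.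
pose T := [set t : {mpoly K[m]} | (exists2 d, t \is d.-homog & vanish A t) \/ exists j, t = lin_form (col j P)^T].
apply: (@finite_of_top K m Kunc _ T) => [t [[d hd tA]|[j ->]]|v hv].
- by exists d, 0; rewrite msize0; split=> // v /QA[Av _]; rewrite meval0 tA.
- exists 1%N, (u 0 j)%:MP; rewrite lin_form_homog msizeC leq_b1; split=> // v /QA[_ /= <-].
  by rewrite lin_form_col mevalC.
- apply: PA; last by apply/rowP => j; rewrite -lin_form_col mxE; apply: hv; right; exists j.
  apply: Acl => p hp; rewrite (pihomog_partitionE (leqnn (mmeasure mdeg p))) raddf_sum big1 // => d _.
  by apply: hv; left; exists d; [exact: pihomogP | exact: vanish_homog].
Qed.

(** A derivation that fixes the image of [a] kills the equations of a finite set containing [a],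
    hence kills [a]; so the velocities of [a] inject into the target of the projection. *)
Lemma tsp_dim_le k a : subring k -> ratl k A -> (forall i j, k (P i j)) -> A a ->
  (\dim (tsp k a) <= r)%N.
Proof.
move=> hk rA kP Aa; pose f : {linear 'rV[K]_m -> 'rV[K]_r} := mulmxr P.
rewrite -(dim_image f) (_ : (tsp k a :&: lker (linfun f))%VS = 0%VS).
  by rewrite dimv0; exact: dim_leq.
apply/eqP; rewrite -subv0; apply/subvP => v; rewrite memv_cap memv_ker lfunE /= memv0.
case/andP=> /tspP[D [hD ->]] /eqP vP; have [dD kD] := hD.
pose E := [set e | (over k e /\ vanish A e) \/
  exists j, e = lin_form (col j P)^T + (- (a *m P) 0 j)%:MP].
have kl j : over k (lin_form (col j P)^T) by apply: lin_form_over => // i; rewrite !mxE.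
have ZE w : zeros E w -> A w /\ w *m P = a *m P.
  have [Acl _ _] := hA; move=> hw; split.
    apply: Acl => p /rA[n [c [g [hg ->]]]]; rewrite raddf_sum big1 // => i _ /=.
    by rewrite mevalZ (hw (g i)) ?mulr0 //; left.
  apply/rowP => j; have /eqP := hw (lin_form (col j P)^T + (- (a *m P) 0 j)%:MP) (or_intror (ex_intro _ j erefl)).
  by rewrite mevalD lin_form_col mevalC subr_eq0 => /eqP.
have [s hs] := @finite_fibre (zeros E) (a *m P) ZE.
apply/eqP; apply: (finite_zeros_const Kunc dD _ hs).
  move=> e [[ek _]|[j ->]]; first exact: dpoly_over hD ek.
  rewrite dpolyD // dpolyC // (dpoly_over hD (kl j)) add0r derN //.
  have -> : D ((a *m P) 0 j) = (vder D a *m P) 0 j.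
    rewrite !mxE der_sum //; apply: eq_bigr => i _; case: (dD) => _ ->.
    by rewrite (kD (P i j)) // mulr0 addr0 !mxE.
  by rewrite vP mxE oppr0 mpolyC0.
move=> e [[_ eA]|[j ->]]; first exact: eA.
by rewrite mevalD lin_form_col mevalC subrr.
Qed.

End Projection.
End Cones.

(** * Chains of irreducible cones *)

Section Flags.
Variables (K : numClosedFieldType) (m : nat).
Hypothesis Kunc : ~ countable [set: K].
Implicit Types (a v w : 'rV[K]_m) (p q : {mpoly K[m]}) (A B C : set 'rV[K]_m) (k : set K).

(** Elimination for the equations of [B] and the 2 by 2 minors of [(v *m P, u)], with [u] as
    parameter: at the missed [u] only [v = 0] solves them, whereas for [u = v *m P] the vector [v]
    does. *)
Lemma image_closed B r (P : 'M[K]_(m, r)) (u : 'rV[K]_r) : ccone B ->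
  (forall v, B v -> v *m P = 0 -> v = 0) -> (forall v, B v -> v *m P <> u) ->
  exists F : {mpoly K[r]}, F.@[u 0] != 0 /\ forall v, B v -> v != 0 -> F.@[(v *m P) 0] = 0.
Proof.
move=> [Bcl B0 Bsc] PB hu.
pose l j := lin_form (col j P)^T.
pose G := [set g : nat * ('rV[K]_r -> {mpoly K[m]}) |
  (exists e, [/\ e \is g.1.-homog, vanish B e & g.2 = fun=> e]) \/
  exists i j, g = (1%N, fun x : 'rV[K]_r => x 0 j *: l i - x 0 i *: l j)].
have pc (c : K) : polyfun (fun _ : 'rV[K]_r => c) by exists c%:MP => a; rewrite mevalC.
have [g|x hx|F [[F' hF] Fu F0]] := @elimination K r m Kunc G u.
- case=> [[e [he _ ->]]|[i [j ->]]] /=; first by split=> // b; exact: pc.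
  split=> [a|b]; first by apply: rpredB; apply: rpredZ; exact: lin_form_homog.
  exists ((l i)@_b *: 'X_j - (l j)@_b *: 'X_i) => a.
  by rewrite mcoeffB !mcoeffZ mevalB !mevalZ !mevalXU; ring.
- have Bx : B x.
    apply: Bcl => p hp; rewrite (pihomog_partitionE (leqnn (mmeasure mdeg p))) raddf_sum big1 // => d _.
    apply: (hx (val d, fun=> pihomog mdeg d p)); left; exists (pihomog mdeg d p).
    by split=> //=; [exact: pihomogP | exact: vanish_homog].
  have prop i j : u 0 j * (x *m P) 0 i = u 0 i * (x *m P) 0 j.
    have /eqP := hx _ (or_intror (ex_intro _ i (ex_intro _ j erefl))).
    by rewrite /= mevalB !mevalZ !lin_form_col subr_eq0 => /eqP.
  apply: PB => //; apply/eqP/negPn/negP => xP.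
  have [i xi] : exists i, (x *m P) 0 i != 0.
    by case/matrix0Pn: xP => i [j h]; exists j; rewrite (ord1 i) in h.
  apply: (hu ((u 0 i / (x *m P) 0 i) *: x)); first exact: Bsc.
  apply/rowP => j; rewrite -scalemxAl mxE.
  by rewrite mulrAC -prop -mulrA mulfV // mulr1.
- exists F'; rewrite -hF; split=> // v Bv v0; rewrite -hF; apply: (F0 _ _ v0).
  move=> g [[e [_ eB ->]]|[i [j ->]]] /=; first exact: eB.
  by rewrite mevalB !mevalZ !lin_form_col; ring.
Qed.

Section Onto.
Variables (A : set 'rV[K]_m) (r : nat) (P : 'M[K]_(m, r)).
Hypothesis hA : ccone A.
Hypothesis PA : forall v, A v -> v *m P = 0 -> v = 0.

Definition flag i : set 'rV[K]_r := [set u | forall j : 'I_r, (i <= j)%N -> u 0 j = 0].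

Definition onto B i : Prop := [/\ ccone B, forall v, B v -> flag i (v *m P) &
  forall u, flag i u -> exists v, B v /\ v *m P = u].

(** Zorn's lemma on the equations. The intersection of a chain of cones still maps onto the flag
    because fibres are finite: on a given fibre, some member of the chain already agrees with the
    intersection. *)
Lemma exists_min_onto C i j : C `<=` A -> onto C j -> (i <= j)%N ->
  exists B, [/\ B `<=` C, onto B i & forall B', B' `<=` B -> onto B' i -> B' = B].
Proof.
move=> CA [[Ccl C0 Csc] Cj Cu] ij.
pose B0 := C `&` [set v | flag i (v *m P)].
have oB0 : onto B0 i.
  split; last 1 first.
  - move=> u ui; have [|v [Cv vu]] := Cu u; first by move=> x jx; apply: ui; exact: leq_trans jx.
    by exists v; rewrite /B0 /= vu.
  - split.
    + move=> v hv; split; first by apply: Ccl => p hp; apply: hv => w [Cw _]; exact: hp.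
      move=> x ix; rewrite -lin_form_col; apply: hv => w [_ /(_ x ix)].
      by rewrite lin_form_col.
    + by split=> // x ix; rewrite mul0mx mxE.
    + move=> c v [Cv hv]; split; first exact: Csc.
      by move=> x ix; rewrite -scalemxAl mxE hv // mulr0.
  - by move=> v [].
pose good (I : set {mpoly K[m]}) := [/\ I 0, zeros I `<=` C & onto (zeros I) i].
have [||F [I0 FI0] FP totF|I [[I_0 IC oI] Imax]] := @Zorn_above _ good (vanish B0).
- have B0cl : algclosed B0 by case: oB0 => -[].
  by split; rewrite ?zeros_vanish //; [move=> v _; rewrite meval0 | move=> v []].
- by exists 0 => v _; rewrite meval0.
- have Zm I : F I -> zeros (\bigcup_(X in F) X) `<=` zeros I.
    by move=> FI v hv e Ie; apply: hv; exists I.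
  have Zi v : (forall I, F I -> zeros I v) -> zeros (\bigcup_(X in F) X) v.
    by move=> h e [I FI Ie]; exact: (h I).
  have pick (s : seq 'rV[K]_m) : exists I, F I /\ forall v, v \in s -> zeros I v ->
      zeros (\bigcup_(X in F) X) v.
    elim: s => [|v s [I [FI hI]]]; first by exists I0.
    have [Zv|] := pselect (zeros (\bigcup_(X in F) X) v).
      by exists I; split=> // w; rewrite inE => /orP[/eqP->|/hI].
    move=> nZ; have [J FJ nJ] : exists2 J, F J & ~ zeros J v.
      by apply: contrapT => h; apply: nZ; apply: Zi => J FJ; apply: contrapT => nJ; apply: h; exists J.
    have [IJ|JI] := totF _ _ FI FJ.
      exists J; split=> // w; rewrite inE => /orP[/eqP->//|ws hw]; apply: hI => // e /IJ; exact: hw.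
    exists I; split=> // w; rewrite inE => /orP[/eqP-> hw|]; last exact: hI.
    by case: nJ => e /JI; exact: hw.
  have [g0 gC [gc gf gu]] := FP _ FI0.
  split; first by exists I0.
    by move=> v /(Zm _ FI0) /gC.
  split.
  + split; first exact: zeros_algclosed.
      by apply: Zi => I /FP[_ _ [[]]].
    by move=> c v hv; apply: Zi => I FI; have [_ _ [[_ _ h] _ _]] := FP _ FI; apply: h; exact: Zm hv.
  + by move=> v /(Zm _ FI0); exact: gf.
  + move=> u ui; have [s hs] := @finite_fibre K m Kunc A r P hA PA (C `&` [set v | v *m P = u]) u (setSI CA).
    have [I [FI hI]] := pick s; have [_ IC [_ _ /(_ u ui)[v [Iv vu]]]] := FP _ FI.
    by exists v; split=> //; apply: hI => //; apply: hs; split=> //; exact: IC.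
exists (zeros I); split=> // B' B'I oB'.
have B'cl : algclosed B' by case: oB' => -[].
rewrite eqEsubset; split=> // v Iv; apply: (B'cl) => p pB'; apply: Iv.
apply: contrapT => nI; apply: (Imax (vanish B')).
  split; last by move=> h; apply: nI; exact: h.
  by move=> e Ie w B'w; exact: (B'I w B'w e Ie).
split; first by move=> w _; rewrite meval0.
  by rewrite zeros_vanish // => w B'w; exact: (IC w (B'I w B'w)).
by rewrite zeros_vanish.
Qed.

(** Let two cones cover [B]. By minimality, a proper one misses some [u] of the flag, and a
    polynomial nonzero at [u] vanishes on its image. If both were proper, the product of the two
    polynomials would vanish along the line through the two missed points, although neither factor
    is zero there. *)
Lemma min_onto_prime B i : B `<=` A -> onto B i ->
  (forall B', B' `<=` B -> onto B' i -> B' = B) -> algprime B.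
Proof.
move=> BA oB Bmin; have [cB Bf Bu] := oB.
have PB v : B v -> v *m P = 0 -> v = 0 by move=> /BA; exact: PA.
apply: algprime_cone => // B1 B2 c1 c2 B12.
have cI B' : ccone B' -> ccone (B `&` B').
  case: (cB) => Bcl B0 Bsc [cl c0 sc]; split=> //; last by move=> c v [? ?]; split; [exact: Bsc | exact: sc].
  by move=> v hv; split; [apply: Bcl => p hp; apply: hv => w [Bw _] | apply: cl => p hp; apply: hv => w [_ Bw]];
    exact: hp.
have alt B' : ccone B' -> B `<=` B' \/ exists (u : 'rV[K]_r) (F : {mpoly K[r]}), [/\ flag i u, u <> 0, F.@[u 0] != 0 &
    forall v, B v -> B' v -> v != 0 -> F.@[(v *m P) 0] = 0].
  move=> c'; have [oB'|noB'] := pselect (onto (B `&` B') i).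
    by left=> v; rewrite -(Bmin (B `&` B') _ oB') => [[]|w []].
  right; have [u [ui hu]] : exists u, flag i u /\ forall v, (B `&` B') v -> v *m P <> u.
    apply: contrapT => h; apply: noB'; split=> [|v [/Bf]//|u ui]; first exact: cI.
    apply: contrapT => h'; apply: h; exists u; split=> // v Bv vu; apply: h'; by exists v.
  have [|F [Fu F0]] := image_closed (cI _ c') _ hu; first by move=> v [/PB].
  exists u, F; split=> // [u0|v Bv B'v]; last exact: F0.
  by apply: (hu 0); rewrite ?mul0mx //; case: (cI _ c').
have [|[u1 [F1 [f1 u10 n1 z1]]]] := alt _ c1; first by left.
have [|[u2 [F2 [f2 u20 n2 z2]]]] := alt _ c2; first by right.
have [x [j u1j]] : exists x j, u1 x j != 0 by apply/matrix0Pn/eqP.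
rewrite (ord1 x) in u1j.
have lin t : flag i (u1 + t *: (u2 - u1)).
  by move=> y iy; rewrite !mxE f1 // f2 // subrr mulr0 addr0.
have [Q1 hQ1] := line_poly F1 u1 (u2 - u1).
have [Q2 hQ2] := line_poly F2 u1 (u2 - u1).
(* The factor ['X_j] takes care of parameters where the lift [v] is [0], for which [F1] and [F2]
   give no information. *)
have [Q3 hQ3] := line_poly ('X_j) u1 (u2 - u1).
have QE : Q1 * Q2 * Q3 = 0.
  apply: poly_nat_roots => t; rewrite !hornerM.
  have [<- _] := hQ1 t%:R; have [<- _] := hQ2 t%:R; have [<- _] := hQ3 t%:R.
  have [v [Bv vu]] := Bu _ (lin t%:R); rewrite -vu.
  have [->|v0] := eqVneq v 0; first by rewrite mul0mx mevalXU mxE mulr0.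
  by case: (B12 v Bv) => Bv'; rewrite ?(z1 v Bv Bv' v0) ?(z2 v Bv Bv' v0) ?mul0r ?mulr0 ?mul0r.
exfalso; move/eqP: QE; rewrite !mulf_eq0 => /orP[/orP[]|] /eqP Q0.
- by have [] := hQ1 0; rewrite Q0 horner0 scale0r addr0 => e; rewrite e eqxx in n1.
- by have [] := hQ2 1; rewrite Q0 horner0 scale1r addrC subrK => e; rewrite e eqxx in n2.
- by have [] := hQ3 0; rewrite Q0 horner0 scale0r addr0 mevalXU => e; rewrite e eqxx in u1j.
Qed.

Hypothesis Psurj : forall u : 'rV[K]_r, exists v, A v /\ v *m P = u.

Lemma cone_flag : exists C : nat -> set 'rV[K]_m,
  (forall i, (i <= r)%N -> [/\ ccone (C i), algprime (C i) & C i `<=` A]) /\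
  forall i, (i < r)%N -> C i `<` C i.+1.
Proof.
pose minonto B i := onto B i /\ forall B', B' `<=` B -> onto B' i -> B' = B.
have /choice[nx hnx] (Ci : set 'rV[K]_m * nat) : exists B, Ci.1 `<=` A -> forall j, onto Ci.1 j ->
    (Ci.2 <= j)%N -> B `<=` Ci.1 /\ minonto B Ci.2.
  have [CA|nCA] := pselect (Ci.1 `<=` A); last by exists set0.
  have [[j0 [oj0 le0]]|no] := pselect (exists j, onto Ci.1 j /\ (Ci.2 <= j)%N); last first.
    by exists set0 => _ j oj ij; case: no; exists j.
  have [B [BC oB Bmin]] := exists_min_onto CA oj0 le0.
  by exists B => _ j _ _; split.
have oA : onto A r.
  split; [exact: hA | | by move=> u _; exact: Psurj].
  by move=> v _ j; rewrite leqNgt ltn_ord.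
(* The chain is built downwards: [g j] lies over the flag of dimension [r - j] and is minimal inside
   [g j.-1]. *)
pose g := fix g j := if j is j'.+1 then nx (g j', (r - j)%N) else nx (A, r).
have gP j : (j <= r)%N -> g j `<=` A /\ minonto (g j) (r - j)%N.
  elim: j => [_|j IH jr] /=.
    by rewrite subn0; apply: (hnx (A, r) _ r).
  have [gA [og _]] := IH (ltnW jr).
  have [|h1 h2] := hnx (g j, (r - j.+1)%N) gA (r - j)%N og; first by rewrite leq_sub2l.
  by split=> // v /h1 /gA.
have gS j : (j < r)%N -> g j.+1 `<=` g j.
  move=> jr; have [gA [og _]] := gP j (ltnW jr).
  by have [|h1 h2] := hnx (g j, (r - j.+1)%N) gA (r - j)%N og; first by rewrite leq_sub2l.
exists (fun i => g (r - i)%N); split=> i ir.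
  have [gA [og gmin]] := gP (r - i)%N (leq_subr _ _).
  by have [cg _ _] := og; split=> //; exact: min_onto_prime gA og gmin.
have e1 : (r - i = (r - i.+1).+1)%N by rewrite subnSK.
split; first by rewrite e1; apply: gS; rewrite -e1 leq_subr.
move=> sub; have [_ [[_ gf _] _]] := gP (r - i)%N (leq_subr _ _); rewrite subKn in gf; last exact: ltnW.
have [_ [[_ _ gu] _]] := gP (r - i.+1)%N (leq_subr _ _); rewrite subKn // in gu.
have [|v [gv vE]] := gu (delta_mx 0 (Ordinal ir)).
  by move=> j ij; rewrite mxE /= (_ : j == Ordinal ir = false) // -val_eqE /= gtn_eqF.
have := gf v (sub v gv) (Ordinal ir) (leqnn _); rewrite vE mxE !eqxx => /eqP.
by rewrite oner_eq0.
Qed.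

End Onto.

(** The velocity spaces at generic points of the successive members grow strictly: with equal
    dimensions the generic point of [C i] would be generic in [C i.+1], yet [f i] vanishes only on
    the former. *)
Lemma chain_dim A k a l (C : nat -> set 'rV[K]_m) : csubring k -> ccone A -> algprime A ->
  ratl k A -> generic k A a -> (exists2 v, C 0%N v & v != 0) ->
  (forall i, (i <= l)%N -> [/\ ccone (C i), algprime (C i) & C i `<=` A]) ->
  (forall i, (i < l)%N -> C i `<` C i.+1) -> (l < \dim (tsp k a))%N.
Proof.
move=> hk [Acl A0 Asc] Apr rA ga [v0 C0v v0n] hC Cs.
have /choice[f hf] i : exists p, (i < l)%N -> vanish (C i) p /\ ~ vanish (C i.+1) p.
  have [il|] := boolP (i < l)%N; last by exists 0.
  apply: contrapT => h; have [_] := Cs i il; apply=> v Cv.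
  have [[cl _ _] _ _] := hC i (ltnW il); apply: cl => p hp; apply: contrapT => pv.
  by apply: h; exists p => _; split=> // hp'; apply: pv; exact: hp'.
have /choice[E hE] i := exists_ratl (C i).
pose S := k `|` (\bigcup_(i in [set: nat]) E i `|` \bigcup_(i in [set: nat]) [set (f i)@_x | x in [set` msupp (f i)]]).
have [k' [hk' Sk']] : exists k', csubring k' /\ S `<=` k'.
  apply: exists_csubring; apply: countableU; first by case: hk.
  apply: countableU; apply: bigcup_countable => // i _; first by case: (hE i).
  exact/countable_image/finite_set_countable/finite_seq.
have kk' : k `<=` k' by move=> x kx; apply: Sk'; left.
have [rk' ck'] := hk'; have [rk _] := hk.
have rC i : ratl k' (C i).
  by have [_ h] := hE i; apply: h => // x Ex; apply: Sk'; right; left; exists i.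
have fk i : over k' (f i).
  move=> x; have [xf|xf] := boolP (x \in msupp (f i)); last by rewrite memN_msupp_eq0 //; exact: subring0.
  by apply: Sk'; right; right; exists i => //; exists x.
have /choice[b hb] i : exists b, (i <= l)%N -> generic k' (C i) b.
  have [il|] := boolP (i <= l)%N; last by exists 0.
  have [[cl _ _] pr _] := hC i il; have [b gb] := exists_generic Kunc hk' cl pr.
  by exists b.
have dims i : (i <= l)%N -> (i < \dim (tsp k' (b i)))%N.
  elim: i => [_|i IH il].
    have [[cl c0 sc] _ _] := hC 0%N (leq0n _); have gb := hb 0%N (leq0n _).
    rewrite lt0n dimv_eq0; apply: contraNneq v0n => t0.
    have : b 0%N \in tsp k' (b 0%N).
      by rewrite (generic_tsp rk' (ratl_kdef (rC 0%N)) gb); apply: tang_cone => //; case: gb.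
    rewrite t0 memv0 => /eqP b0; apply/eqP/rowP => j; rewrite mxE.
    have [_ /(_ 'X_j)] := gb; rewrite mevalXU b0 mxE => h.
    by have := h (overX _ rk') erefl v0 C0v; rewrite mevalXU.
  apply: leq_ltn_trans (IH (ltnW il)) _; rewrite ltnNge; apply/negP => le.
  have [CS _] := Cs i il; have gi := hb i (ltnW il).
  have gi1 : generic k' (C i.+1) (b i).
    by apply: (generic_of_dim rk' (hb _ il) _ le); apply: CS; case: gi.
  have [f1 f2] := hf i il; apply: f2; have [_ h] := gi1; apply: (h (f i) (fk i)).
  by apply: f1; case: gi.
have [a' ga'] := exists_generic Kunc hk' Acl Apr.
have gk := generic_sub kk' ga'.
rewrite (generic_dim rk ga gk) (generic_tsp rk (ratl_kdef rA) gk).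
rewrite -(generic_tsp rk' (kdef_sub kk' (ratl_kdef rA)) ga').
apply: leq_trans (dims l (leqnn _)) _.
have [_ _ CA] := hC l (leqnn _); have gl := hb l (leqnn _); have [Cb _] := gl.
rewrite leqNgt; apply/negP => lt.
by have := generic_dim rk' ga' (generic_of_dim rk' ga' (CA _ Cb) (ltnW lt)) => e; rewrite e ltnn in lt.
Qed.

(* The finite linear projection of maximal rank gives both a bound for the
   dimension and a chain realising it. *)
Lemma chain_exists A k a : csubring k -> ccone A -> algprime A -> ratl k A -> generic k A a ->
  exists r (C : nat -> set 'rV[K]_m), [/\ (\dim (tsp k a) <= r)%N,
    forall i, (i <= r)%N -> [/\ ccone (C i), algprime (C i) & C i `<=` A] &
    forall i, (i < r)%N -> C i `<` C i.+1].
Proof.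
move=> hk cA Apr rA ga; have [Acl _ _] := cA.
have [r [P [PA Ps]]] := cone_projection cA.
have [C [hC1 hC2]] := cone_flag cA PA Ps.
exists r, C; split=> //.
have [k' [hk' Sk']] : exists k', csubring k' /\ k `|` [set P x.1 x.2 | x in [set: 'I_m * 'I_r]] `<=` k'.
  apply: exists_csubring; apply: countableU; first by case: hk.
  exact/countable_image/finite_set_countable/finite_finset.
have kk' : k `<=` k' by move=> x kx; apply: Sk'; left.
have [rk' ck'] := hk'; have [rk _] := hk.
have [a' ga'] := exists_generic Kunc hk' Acl Apr.
have gk := generic_sub kk' ga'.
rewrite (generic_dim rk ga gk) (generic_tsp rk (ratl_kdef rA) gk).
rewrite -(generic_tsp rk' (kdef_sub kk' (ratl_kdef rA)) ga').
apply: (tsp_dim_le Kunc cA PA rk' (ratl_sub kk' rA)); last by case: ga'.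
by move=> i j; apply: Sk'; right; exists (i, j).
Qed.

End Flags.

(** * Affine cones of projective sets *)

Section Cone_of_projective_set.
Variables (K : numClosedFieldType) (N : nat).
Hypothesis Kunc : ~ countable [set: K].
Local Notation pt := (pspace K N).
Implicit Types (x y : pt) (X Y Z : set pt) (v w : 'rV[K]_N.+1) (A B C : set 'rV[K]_N.+1)
  (p q : {mpoly K[N.+1]}) (k : set K).

Lemma coords_neq0 x : coords x != 0.
Proof. by rewrite /coords vpick0 -dimv_eq0 (eqP (valP x)). Qed.

Lemma val_coords x : val x = <[coords x]>%VS.
Proof.
apply/esym/eqP; rewrite eqEdim dim_vline coords_neq0 (eqP (valP x)) leqnn andbT.
by rewrite -memvE memv_pick.
Qed.

Lemma point_of v : v != 0 -> exists x, val x = <[v]>%VS.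
Proof.
by move=> v0; have h : \dim <[v]>%VS == 1%N by [rewrite dim_vline v0]; exists (exist _ <[v]>%VS h).
Qed.

Lemma coords_of x v : val x = <[v]>%VS -> v != 0 -> exists c, c != 0 /\ coords x = c *: v.
Proof.
move=> xv v0; have : coords x \in val x by rewrite val_coords memv_line.
rewrite xv => /vlineP[c cE]; exists c; split=> //.
by apply: contraNneq (coords_neq0 x) => c0; rewrite cE c0 scale0r.
Qed.

Lemma point_eq x v : v \in val x -> v != 0 -> val x = <[v]>%VS.
Proof.
move=> vx v0; apply/esym/eqP; rewrite eqEdim dim_vline v0 (eqP (valP x)) leqnn andbT.
by rewrite -memvE.
Qed.

Definition cone Z : set 'rV[K]_N.+1 := [set v | v = 0 \/ exists2 x, Z x & v \in val x].

Definition proj A : set pt := [set x | A (coords x)].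

Lemma cone_coords Z x : cone Z (coords x) <-> Z x.
Proof.
split=> [[/eqP|[y Zy xy]]|Zx]; first by rewrite (negPf (coords_neq0 x)).
  by rewrite (_ : x = y) //; apply: val_inj; rewrite /= (point_eq xy) ?coords_neq0 // val_coords.
by right; exists x => //; rewrite val_coords memv_line.
Qed.

Lemma coneK Z : proj (cone Z) = Z.
Proof. by rewrite eqEsubset; split=> x /cone_coords. Qed.

Lemma cone_mono Y Z : Y `<=` Z -> cone Y `<=` cone Z.
Proof. by move=> YZ v [->|[x /YZ Zx vx]]; [left | right; exists x]. Qed.

Lemma proj_mono A B : A `<=` B -> proj A `<=` proj B.
Proof. by move=> AB x /AB. Qed.

Lemma projK A : ccone A -> cone (proj A) = A.
Proof.
move=> [_ A0 Asc]; rewrite eqEsubset; split=> v.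
  by case=> [->//|[x xA]]; rewrite val_coords => /vlineP[c ->]; exact: Asc.
move=> Av; have [->|v0] := eqVneq v 0; first by left.
right; have [x xv] := point_of v0; exists x; last by rewrite xv memv_line.
by have [c [_ cE]] := coords_of xv v0; rewrite /proj /= cE; exact: Asc.
Qed.

Lemma cone_scale Z c v : cone Z v -> cone Z (c *: v).
Proof. by case=> [->|[x Zx vx]]; [left; rewrite scaler0 | right; exists x => //; exact: memvZ]. Qed.

Lemma closed_ccone Z : zariski_closed Z -> ccone (cone Z).
Proof.
case=> S Sh ->; set Z' := [set x | _]; split; [|by left|by move=> c v; exact: cone_scale].
move=> v hv; have [->|v0] := eqVneq v 0; first by left.
right; have [x xv] := point_of v0; exists x; last by rewrite xv memv_line.
have [j vj] : exists j, v 0 j != 0.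
  by case/matrix0Pn: v0 => i [j h]; exists j; rewrite (ord1 i) in h.
move=> p Sp; have [d hd] := Sh p Sp; have [c [c0 cE]] := coords_of xv v0.
rewrite /zero_at cE (meval_homog_scale c v hd).
(* The factor ['X_j] ensures vanishing at the vertex, where a constant [p] need not vanish. *)
have /hv : vanish (cone Z') ('X_j * p).
  move=> w [->|[y Zy]]; first by rewrite mevalM mevalXU mxE mul0r.
  rewrite val_coords => /vlineP[b ->]; rewrite mevalM (meval_homog_scale b _ hd).
  by rewrite (Zy p Sp) !mulr0.
by rewrite mevalM mevalXU => /eqP; rewrite mulf_eq0 (negPf vj) => /eqP ->; rewrite mulr0.
Qed.

Lemma proj_closed A : ccone A -> zariski_closed (proj A).
Proof.
move=> [Acl A0 Asc]; exists [set p | homogeneous p /\ vanish A p]; first by move=> p [].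
rewrite eqEsubset; split=> x; first by move=> Ax p [_ /(_ _ Ax)].
move=> hx; apply: Acl => p hp.
rewrite (pihomog_partitionE (leqnn (mmeasure mdeg p))) raddf_sum big1 // => d _.
by apply: hx; split; [exists d; exact: pihomogP | exact: vanish_homog].
Qed.

Lemma proj_closedP Z : zariski_closed Z <-> exists2 A, ccone A & Z = proj A.
Proof.
split=> [hZ|[A cA ->]]; last exact: proj_closed.
by exists (cone Z); [exact: closed_ccone | rewrite coneK].
Qed.

Lemma ccone_bigcap (I : Type) (F : I -> set 'rV[K]_N.+1) (P : set I) :
  (forall i, P i -> ccone (F i)) -> ccone (\bigcap_(i in P) F i).
Proof.
move=> h; split.
- by move=> v hv i Pi; have [cl _ _] := h i Pi; apply: cl => p hp; apply: hv => w /(_ i Pi); exact: hp.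
- by move=> i /h[].
- by move=> c v hv i Pi; have [_ _ sc] := h i Pi; apply: sc; exact: hv.
Qed.

Lemma zariski_closedI Y Z : zariski_closed Y -> zariski_closed Z -> zariski_closed (Y `&` Z).
Proof.
move=> /closed_ccone cY /closed_ccone cZ; apply/proj_closedP.
exists (\bigcap_(i in [set: bool]) cone (if i then Y else Z)).
  by apply: ccone_bigcap => -[].
rewrite eqEsubset; split=> x; first by move=> [Yx Zx] [] _; apply/cone_coords.
by move=> h; split; apply/cone_coords; [exact: (h true) | exact: (h false)].
Qed.

Lemma irreducible_cone Z : zariski_closed Z -> irreducible Z ->
  algprime (cone Z) /\ exists2 v, cone Z v & v != 0.
Proof.
move=> hZ [[x Zx] irr]; split; last by exists (coords x); [apply/cone_coords | exact: coords_neq0].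
apply: algprime_cone; first exact: closed_ccone.
move=> B C cB cC h; have [||y Zy|h1|h1] := irr (proj B) (proj C); first exact: proj_closed.
- exact: proj_closed.
- by apply: h; apply/cone_coords.
- by left; rewrite -(projK cB); exact: cone_mono.
- by right; rewrite -(projK cC); exact: cone_mono.
Qed.

Lemma proj_irreducible A : ccone A -> algprime A -> (exists2 v, A v & v != 0) -> irreducible (proj A).
Proof.
move=> cA [_ pr] [v Av v0]; split.
  have [x xv] := point_of v0; exists x; have [c [_ cE]] := coords_of xv v0.
  by rewrite /proj /= cE; case: cA => _ _; apply.
move=> C D cC cD h.
have [cC1 _ _] := closed_ccone cC; have [cD1 _ _] := closed_ccone cD.
have h' : A `<=` cone C `|` cone D.
  rewrite -(projK cA) => w [->|[x Ax wx]]; first by left; left.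
  by case: (h x Ax) => ?; [left | right]; right; exists x.
have [AC|nAC] := pselect (A `<=` cone C); first by left; rewrite -(coneK C); exact: proj_mono.
right; rewrite -(coneK D); apply: proj_mono => w Aw; apply: (cD1) => q hq.
have [p [hp np]] : exists p, vanish (cone C) p /\ ~ vanish A p.
  apply: contrapT => no; apply: nAC => u Au; apply: (cC1) => p hp; apply: contrapT => pu.
  by apply: no; exists p; split=> // hA; apply: pu; exact: hA.
case: (pr p q) => [u Au|//|hA]; last exact: hA.
by rewrite mevalM; case: (h' u Au) => [/hp ->|/hq ->]; rewrite ?mul0r ?mulr0.
Qed.

Theorem krull_dimE Z k a : zariski_closed Z -> irreducible Z -> csubring k ->
  ratl k (cone Z) -> generic k (cone Z) a -> (krull_dim Z).+1 = \dim (tsp k a).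
Proof.
move=> hZ irr hk rZ ga.
have cZ := closed_ccone hZ; have [pZ nZ] := irreducible_cone hZ irr.
have up l : irreducible_chain Z l -> (l < \dim (tsp k a))%N.
  move=> [Zs [h1 h2]].
  have cl i : (i <= l)%N -> zariski_closed (Zs i).
    by move=> il; have [_ [C cC ->]] := h1 i il; exact: zariski_closedI.
  apply: (@chain_dim _ _ Kunc (cone Z) k a l (fun i => cone (Zs i))) => //.
  - by have [irr0 _] := h1 0%N (leq0n _); have [] := irreducible_cone (cl 0%N (leq0n _)) irr0.
  - move=> i il; have [irri [C _ e]] := h1 i il; split; first exact/closed_ccone/cl.
      by have [] := irreducible_cone (cl i il) irri.
    by apply: cone_mono; rewrite e; exact: subIsetl.
  - move=> i il; have [s1 s2] := h2 i il; split; first exact: cone_mono.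
    by move=> h; apply: s2; rewrite -(coneK (Zs i)) -(coneK (Zs i.+1)); exact: proj_mono.
have d0 : (0 < \dim (tsp k a))%N.
  by apply: (@chain_dim _ _ Kunc (cone Z) k a 0 (fun=> cone Z)) => // i _; split.
have [r [C [dr hC Cs]]] := chain_exists Kunc hk cZ pZ rZ ga.
have r0 : (0 < r)%N by exact: leq_trans dr.
(* [C 0] may be reduced to the vertex and is dropped; the projective chain comes from [C 1], ...,
   [C r], which accounts for the shift by one. *)
have lo : irreducible_chain Z r.-1.
  exists (fun i => proj (C i.+1)); split=> i ir.
    have ir' : (i < r)%N by rewrite -(prednK r0).
    have [c1 p1 s1] := hC i.+1 ir'.
    split; last first.
      exists (proj (C i.+1)); first exact: proj_closed.
      by rewrite eqEsubset; split=> [x Cx|x []//]; split=> //; rewrite -(coneK Z); exact: proj_mono Cx.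
    apply: proj_irreducible => //; have [t1 t2] := Cs i ir'.
    apply: contrapT => no; apply: t2 => v Cv; have [->|v0] := eqVneq v 0.
      by have [[]] := hC i (ltnW ir').
    by case: no; exists v.
  have ir' : (i.+1 < r)%N by rewrite -(prednK r0).
  have [s1 s2] := Cs _ ir'; split; first exact: proj_mono.
  have [c1 _ _] := hC i.+1 (ltnW ir'); have [c2 _ _] := hC i.+2 ir'.
  by move=> h; apply: s2; rewrite -(projK c1) -(projK c2); exact: cone_mono.
have rE : r = \dim (tsp k a) by apply/eqP; rewrite eqn_leq dr andbT -(prednK r0); exact: up.
rewrite /krull_dim; case: xgetP => [l _ [h1 h2]|h].
  by apply/eqP; rewrite eqn_leq (up _ h1) /= -rE -(prednK r0) ltnS; exact: h2.
exfalso; apply: (h r.-1); split=> // l /up; rewrite -rE.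
by rewrite -{1}(prednK r0).
Qed.

End Cone_of_projective_set.

(** * Finiteness of the tangency locus *)

Section Taylor.
Variables (K : numClosedFieldType) (m : nat).
Implicit Types (k : set K) (f p : {mpoly K[m]}) (s v : 'rV[K]_m).

Lemma msize_homog d p : p \is d.-homog -> (msize p <= d.+1)%N.
Proof.
move=> hp; rewrite msizeE; apply/bigmax_leqP_seq => l lp _; rewrite ltnS.
by move/dhomogP: hp => /(_ l lp) /= ->.
Qed.

Lemma mderiv_homog d p i : p \is d.-homog -> p^`M(i) \is d.-1.-homog.
Proof.
move=> /dhomogP hp; apply/dhomogP => l; rewrite mcoeff_msupp mcoeff_deriv => h.
have : (l + U_(i))%MM \in msupp p by rewrite mcoeff_msupp; apply: contraNneq h => ->; rewrite mul0rn.
by move/hp => /= <-; rewrite mdegD mdeg1 addn1.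
Qed.

Lemma prod_homog (r : nat) (F : 'I_r -> {mpoly K[m]}) (e : 'I_r -> nat) :
  (forall i, F i \is (e i).-homog) -> \prod_i F i \is (\sum_i e i).-homog.
Proof.
move=> h; apply: (big_rec2 (fun (p : {mpoly K[m]}) (d : nat) => p \is d.-homog)).
  exact: dhomog1.
by move=> i d p _ hp; apply: dhomogM.
Qed.

Lemma det_homog (r : nat) (M : 'M[{mpoly K[m]}]_r) (e : 'I_r -> nat) :
  (forall i j, M i j \is (e i).-homog) -> \det M \is (\sum_i e i).-homog.
Proof.
move=> h; apply: rpred_sum => s _; have hp := prod_homog (fun i => h i (s i)).
by case: (odd_perm s); rewrite ?expr1 ?expr0 ?mulN1r ?mul1r // rpredN.
Qed.

Lemma det_over k r (M : 'M[{mpoly K[m]}]_r) : subring k -> (forall i j, over k (M i j)) ->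
  over k (\det M).
Proof.
move=> hk hM; apply: over_sum => // s _; apply: overM => //.
  by apply: over_exp => //; apply: overN => //; exact: over1.
by apply: over_prod => // i _.
Qed.

Definition repl_row (R : Type) (r : nat) (M : 'M[R]_r) (i0 : 'I_r) (u : 'I_r -> R) : 'M[R]_r :=
  \matrix_(i, j) if i == i0 then u j else M i j.

Lemma det_repl_row (R : comNzRingType) r (M : 'M[R]_r) i0 u :
  \det (repl_row M i0 u) = \sum_j u j * cofactor M i0 j.
Proof.
rewrite (expand_det_row _ i0); apply: eq_bigr => j _; rewrite mxE eqxx; congr (_ * _).
rewrite /cofactor; congr (_ * \det _); apply/matrixP => a b; rewrite !mxE.
by rewrite eq_sym (negPf (neq_lift i0 a)).
Qed.

(** Cramer's rule without division, valid also for a singular matrix. *)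
Lemma cramer_row (R : comNzRingType) r (M : 'M[R]_r) (c : 'rV[R]_r) i0 :
  \det (repl_row M i0 (fun j => (c *m M) 0 j)) = c 0 i0 * \det M.
Proof.
rewrite det_repl_row.
have -> : \sum_j (c *m M) 0 j * cofactor M i0 j = (c *m M *m \adj M) 0 i0.
  by rewrite [RHS]mxE; apply: eq_bigr => j _; rewrite !mxE.
by rewrite -mulmxA mul_mx_adj mul_mx_scalar mxE mulrC.
Qed.

(** The bound on [msize R] means that the remainder after the linear term has degree at most
    [d - 2]; this is what keeps the correction in [tangency] below the leading form. *)
Lemma taylor k s f d : subring k -> (forall i, k (s 0 i)) -> over k f -> f \is d.-homog ->
  exists R, [/\ over k R, (msize R <= d.-1)%N &
    forall v, f.@[(v + s) 0] = f.@[v 0] + dot (grad f v) s + R.@[v 0]].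
Proof.
move=> hk ks.
pose P d f := exists R, [/\ over k R, (msize R <= d.-1)%N &
    forall v, f.@[(v + s) 0] = f.@[v 0] + dot (grad f v) s + R.@[v 0]].
have mon e : forall l : 'X_{1..m}, mdeg l = e -> P e 'X_[l].
  elim: e => [|e IH] l le.
    have -> : l = 0%MM by apply/eqP; rewrite -mdeg_eq0 le.
    exists 0; rewrite msize0; split=> // [|v]; first exact: over0.
    by rewrite mpolyX0 -mpolyC1 !mevalC -dird_dot dirdC ?meval0 !addr0.
  have [i li] : exists i, (0 < l i)%N.
    apply: contrapT => h; move: le; rewrite mdegE big1 // => i _.
    by apply/eqP; rewrite -leqn0 leqNgt; apply/negP => li; apply: h; exists i.
  have lE : l = (U_(i) + (l - U_(i)))%MM.
    rewrite addmC submK //; apply/mnm_lepP => j; rewrite mnm1E.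
    by case: eqP => [<-|_].
  have le' : mdeg (l - U_(i))%MM = e.
    by move: le; rewrite {1}lE mdegD mdeg1 add1n => -[].
  have [R [Rk Rs RE]] := IH _ le'; set p := 'X_[l - U_(i)] in RE.
  have -> : 'X_[l] = 'X_i * p by rewrite {1}lE mpolyXD.
  pose dp := \sum_j s 0 j *: p^`M(j).
  have pk : over k p by exact: overX.
  have dpE v : dp.@[v 0] = dot (grad p v) s.
    by rewrite /dp raddf_sum; apply: eq_bigr => j _ /=; rewrite mevalZ mxE mulrC.
  have dpk : over k dp by apply: over_sum => // j _; apply: overZ => //; exact: over_deriv.
  have hp : p \is e.-homog by rewrite dhomogX /= le'.
  have dps : (msize dp <= e)%N.
    apply: (leq_trans (msize_sum _ _ _)); apply/bigmax_leqP => j _.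
    by apply: (leq_trans (msizeZ_le _ _)); apply: msize_deriv; exact: msize_homog.
  exists (s 0 i *: dp + ('X_i + (s 0 i)%:MP) * R); split.
  - apply: overD => //; first exact: overZ.
    by apply: overM => //; apply: overD => //; [exact: overX | exact: overC].
  - apply: leq_trans (msizeD_le _ _) _; rewrite geq_max (leq_trans (msizeZ_le _ _)) //=.
    have [->|R0] := eqVneq R 0; first by rewrite mulr0 msize0.
    apply: leq_trans (msize_mul_leq _ _) _.
    have : (msize ('X_i + (s 0 i)%:MP : {mpoly K[m]})%R <= 2)%N.
      apply: leq_trans (msizeD_le _ _) _; rewrite geq_max msizeX mdeg1 /= msizeC.
      by case: eqP.
    by move: Rs R0; rewrite -msize_poly_eq0; lia.
  - move=> v; rewrite !mevalM mevalXU RE mevalD mevalZ mevalM mevalD mevalXU mevalC dpE !mxE.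
    by rewrite -!dird_dot dirdM dirdXU mevalXU; ring.
move=> fk /dhomogP hf; rewrite [f]mpolyE.
have : forall l, l \in msupp f -> k f@_l /\ mdeg l = d by move=> l lf; split=> //; exact: hf.
elim: (msupp f) => [_|l r IH h]; rewrite ?big_nil ?big_cons.
  exists 0; rewrite msize0; split=> // [|v]; first exact: over0.
  by rewrite -mpolyC0 !mevalC -dird_dot dirdC !addr0.
have [|R1 [k1 s1 h1]] := IH; first by move=> l' lr; apply: h; rewrite inE lr orbT.
have [kl ld] := h l (mem_head _ _); have [R2 [k2 s2 h2]] := mon d l ld.
exists (f@_l *: R2 + R1); split.
- by apply: overD => //; exact: overZ.
- by apply: leq_trans (msizeD_le _ _) _; rewrite geq_max s1 (leq_trans (msizeZ_le _ _)).
move=> v; rewrite !mevalD h1 !mevalZ h2 grad_is_additive gradZ dotDl dotZl.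
by ring.
Qed.

End Taylor.

(** * Isolated solutions of the tangency system *)

Section Tangency.
Variables (K : numClosedFieldType) (m d : nat).
Hypothesis Kunc : ~ countable [set: K].
Variables (A : set 'rV[K]_m) (k : set K).
Hypotheses (cA : ccone A) (hk : subring k) (rA : ratl k A).
Hypothesis smooth : forall v, A v -> v != 0 -> \dim (tang A v) = d.

(** Homogeneous equations are taken so that their Jacobian minors are homogeneous and can serve as
    leading forms. *)
Lemma equations_at v : A v -> v != 0 -> exists (f : 'I_(m - d) -> {mpoly K[m]}) (e : 'I_(m - d) -> nat),
  [/\ forall i, over k (f i) /\ vanish A (f i), forall i, f i \is (e i).-homog,
   row_free (\matrix_i grad (f i) v) & orth (tang A v) = rowvs (\matrix_i grad (f i) v)].
Proof.
move=> Av v0.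
pose P := [set u | exists g e, [/\ over k g, vanish A g, g \is e.-homog & u = grad g v]].
have [r [M [Mf MP MS]]] := spanning_rows P.
have tE : orth (rowvs M) = tang A v.
  apply/vspaceP => w; apply/idP/idP => [/orth_rowvs h|/tangP h].
    apply/tangP => p /rA[n [c [g [hg ->]]]].
    rewrite (_ : grad _ v = \sum_i c i *: grad (g i) v); last first.
      elim/big_rec2: _ => [|i y1 y2 _ <-]; last by rewrite grad_is_additive gradZ.
      by apply/rowP => j; rewrite !mxE mderiv0 meval0.
    rewrite dot_suml big1 // => i _; rewrite dotZl; have [gk gA] := hg i.
    rewrite (pihomog_partitionE (leqnn (mmeasure mdeg (g i)))).
    rewrite (_ : grad _ v = \sum_(j < mmeasure mdeg (g i)) grad (pihomog mdeg j (g i)) v); last first.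
      elim/big_rec2: _ => [|j y1 y2 _ <-]; last by rewrite grad_is_additive.
      by apply/rowP => j; rewrite !mxE mderiv0 meval0.
    rewrite dot_suml big1 ?mulr0 // => j _.
    have /submxP[a ->] : (grad (pihomog mdeg j (g i)) v <= M)%MS.
      apply: MS; exists (pihomog mdeg j (g i)), (val j); split=> //.
      - exact: over_pihomog.
      - by apply: vanish_homog => //; case: cA.
      - exact: pihomogP.
    by rewrite mulmx_sum_row dot_suml big1 // => b _; rewrite dotZl h mulr0.
  apply/orth_rowvs => i; have [g [e [_ gA _ ->]]] := MP i; exact: h.
have rE : r = (m - d)%N.
  rewrite -(smooth Av v0) -tE dim_orth dim_rowvs // subKn //.
  by rewrite -(dim_rowvs Mf); exact: dim_leq.
move: M Mf MP MS tE; rewrite rE => M Mf MP MS tE.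
have /choice[fe hfe] i : exists fe : {mpoly K[m]} * nat,
    [/\ over k fe.1, vanish A fe.1, fe.1 \is fe.2.-homog & row i M = grad fe.1 v].
  by have [g [e h]] := MP i; exists (g, e).
have ME : \matrix_i grad (fe i).1 v = M by apply/row_matrixP => i; rewrite rowK; have [_ _ _ ->] := hfe i.
exists (fun i => (fe i).1), (fun i => (fe i).2); rewrite ME -tE orthK.
by split=> // i; have [] := hfe i.
Qed.

(* [x] is isolated among the points [l] of the cone such that [l + (y - x)] is
   in the cone and [eta] is normal at [l]. *)
Theorem tangency D x y (eta : 'rV[K]_m) : Der k D -> A x -> A y ->
  (forall w, w \in tang A x -> dot eta w = 0) -> vder D eta = 0 -> vder D (y - x) = 0 ->
  dot eta y != 0 -> vder D x = 0.
Proof.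
move=> hD Ax Ay etaT Deta Ds etay; have [dD kD] := hD.
have [->|x0] := eqVneq x 0; first exact: vder0.
(* With [dot h s = 1] and [h] equal to the sum of the [c_i grad (f_i)] at [x], the Taylor expansions
   at [x] give [\sum_i c_i R_i = -1]. *)
pose s := y - x; pose c0 := dot eta s; pose h := c0^-1 *: eta.
have etax : dot eta x = 0 by apply: etaT; apply: tang_cone => //; case: cA.
have c0E : c0 = dot eta y by rewrite /c0 dotBr etax subr0.
have c0n : c0 != 0 by rewrite c0E.
have hs : dot h s = 1 by rewrite dotZl mulVf.
pose kD' := [set c | D c = 0].
have sk : subring kD'.
  by split=> [|a b ha hb|a b ha hb]; rewrite /kD' /= ?der1 ?derB ?ha ?hb ?subrr //;
    case: (dD) => _ ->; rewrite ha hb mul0r mulr0 addr0.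
have kk : k `<=` kD' by move=> c /kD.
have vk (v : 'rV[K]_m) : vder D v = 0 -> forall i, kD' (v 0 i).
  by move=> e i; rewrite /kD' /= -vderE e mxE.
have sks : forall i, kD' (s 0 i) by exact: vk.
have hsk : forall i, kD' (h 0 i).
  apply: vk; rewrite vderZ // Deta scaler0 addr0.
  have Dc : D c0 = 0 by rewrite vder_dot // Deta Ds dot0l dot0r addr0.
  have : D (c0^-1 * c0) = 0 by rewrite mulVf // der1.
  case: (dD) => _ ->; rewrite Dc mulr0 addr0 => /eqP; rewrite mulf_eq0 (negPf c0n) orbF => /eqP ->.
  exact: scale0r.
pose r := (m - d)%N.
pose J (f : 'I_r -> {mpoly K[m]}) (g : 'I_r -> 'I_m) : 'M[{mpoly K[m]}]_r := \matrix_(i, j) (f i)^`M(g j).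
pose hJ (g : 'I_r -> 'I_m) (j : 'I_r) : {mpoly K[m]} := (h 0 (g j))%:MP.
pose rem (f : 'I_r -> {mpoly K[m]}) (R : 'I_r -> {mpoly K[m]}) :=
  forall i v, (f i).@[(v + s) 0] = (f i).@[v 0] + dot (grad (f i) v) s + (R i).@[v 0].
(* Cramer's rule turns [c_i] into a quotient of minors, so that
   [\det J + \sum_i \det (repl_row i) R_i] vanishes at [x] if [\det J] does not; the extra factor
   [\det J] gives an equation valid in both cases. Replacing row [i] lowers the degree by [e_i - 1]
   and [R_i] has degree at most [e_i - 2], so [low] has smaller degree than [\det J ^+ 2]. *)
pose low f g R := \det (J f g) * \sum_i \det (repl_row (J f g) i (hJ g)) * R i.
pose good f e R := [/\ forall i, over k (f i) /\ vanish A (f i), forall i, f i \is (e i).-homog,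
  forall i, over kD' (R i) /\ (msize (R i) <= (e i).-1)%N & rem f R].
pose E := [set p : {mpoly K[m]} | (over k p /\ vanish A p) \/
  exists f g e R, good f e R /\ p = \det (J f g) ^+ 2 + low f g R].
(* The leading forms. A common zero is a vector of the cone where all these Jacobian minors vanish,
   so it is [0] by smoothness. *)
pose T := [set p : {mpoly K[m]} | (exists e, [/\ over k p, vanish A p & p \is e.-homog]) \/
  exists f g e R, good f e R /\ p = \det (J f g) ^+ 2].
have Jhom f g e R : good f e R -> forall i j, J f g i j \is (e i).-1.-homog.
  by move=> [_ he _ _] i j; rewrite mxE; exact: mderiv_homog.
have Jk f g e R : good f e R -> forall i j, over kD' (J f g i j).
  by move=> [fk _ _ _] i j; rewrite mxE; apply: over_deriv => // l; apply: kk; case: (fk i).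
have arith (a b r' z S e' dl : nat) : (a <= S.+1 -> b <= dl.+1 -> r' <= e' -> dl = e' + S ->
    0 < r' -> z <= (a + r').-1 -> (b + z).-1 <= dl + dl)%N by clear; lia.
have [|v hv|fin hfin] := @finite_of_top K m Kunc (zeros E) T.
- move=> t [[e [tk tA te]]|[f [g [e [R [gd ->]]]]]].
    by exists e, 0; rewrite msize0; split=> // v Zv; rewrite meval0; apply: Zv; left.
  have dh := det_homog (Jhom f g e R gd).
  set dl := (\sum_i (e i).-1)%N in dh.
  exists (dl + dl)%N, (- low f g R); split; first by rewrite expr2; exact: dhomogM.
    rewrite /low -mulrN -sumrN mulr_sumr.
    apply: (leq_trans (msize_sum _ _ _)); apply/bigmax_leqP => i _.
    have [_ _ /(_ i)[_ Rs] _] := gd.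
    have ch : \det (repl_row (J f g) i (hJ g)) \is (\sum_j (if j == i then 0 else (e j).-1))%N.-homog.
      apply: det_homog => a b; rewrite mxE; case: eqP => _.
        by rewrite /hJ -[X in X \is _]mulr1 mul_mpolyC; apply: rpredZ; exact: dhomog1.
      exact: Jhom gd _ _.
    have sE : dl = ((e i).-1 + \sum_j (if j == i then 0 else (e j).-1))%N.
      rewrite /dl (bigD1 i) //= [in RHS](bigD1 i) //= eqxx add0n; congr (_ + _)%N.
      by apply: eq_bigr => j /negPf ->.
    move: (msize_homog ch) (msize_homog dh).
    set S := (\sum_j _)%N in sE *; set c := \det (repl_row _ _ _); set Dl := \det _.
    move=> hc hDl; have [R0|R0] := eqVneq (R i) 0; first by rewrite R0 mulr0 oppr0 mulr0 msize0.
    rewrite -mulrN; apply: (leq_trans (msize_mul_leq _ _)).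
    have := msize_mul_leq c (- R i); rewrite mmeasureN.
    move: R0; rewrite -msize_poly_eq0 -lt0n.
    by move=> R0 hcR; exact: arith hc hDl Rs sE R0 hcR.
  move=> v Zv; apply/eqP; rewrite mevalN eq_sym -subr_eq0 -opprD oppr_eq0 -mevalD addrC; apply/eqP.
  by apply: Zv; right; exists f, g, e, R.
- have Av : A v.
    apply: (ratl_homog hk rA cA) => p e pk pe pA; apply: hv; left; exists e; by split.
  apply/eqP/negPn/negP => v0.
  have [f [e [fk fe fr _]]] := equations_at Av v0.
  have [g hg] := row_free_cols fr.
  have /choice[R hR] i : exists R, [/\ over kD' R, (msize R <= (e i).-1)%N &
     forall v, (f i).@[(v + s) 0] = (f i).@[v 0] + dot (grad (f i) v) s + R.@[v 0]].
    by apply: taylor => // l; apply: kk; case: (fk i).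
  have gd : good f e R by split=> // i; have [] := hR i.
  have /eqP : (\det (J f g) ^+ 2).@[v 0] = 0 by apply: hv; right; exists f, g, e, R.
  rewrite rmorphXn expf_eq0 /=; apply/negP.
  move: hg; rewrite unitmxE unitfE; congr (is_true (~~ _)); congr (_ == 0).
  by rewrite -det_map_mx; congr (\det _); apply/matrixP => i j; rewrite !mxE.
apply: (finite_zeros_const Kunc dD _ hfin).
  have hD' : Der kD' D by split.
  move=> p [[pk _]|[f [g [e [R [gd ->]]]]]]; first exact: dpoly_over hD pk.
  apply: (dpoly_over hD'); have dk := det_over sk (Jk f g e R gd).
  apply: overD => //; first exact: over_exp.
  apply: overM => //; apply: over_sum => // i _; apply: overM => //; last by case: gd => _ _ /(_ i)[].
  apply: det_over => // a b; rewrite mxE; case: eqP => _; first exact: overC.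
  exact: Jk gd _ _.
move=> p [[_ pA]|[f [g [e [R [gd ->]]]]]]; first exact: pA.
rewrite mevalD /low rmorphXn /= mevalM expr2 -mulrDr; apply/eqP; rewrite mulf_eq0.
set Dx := _.@[x 0]; have [//|Dx0] := eqVneq Dx 0; rewrite orFb; apply/eqP.
pose G := \matrix_i grad (f i) x.
have DxE : Dx = \det (colsub g G).
  by rewrite /Dx -det_map_mx; congr (\det _); apply/matrixP => i j; rewrite !mxE.
have Gf : row_free G by apply: (unit_cols_row_free (f := g)); rewrite unitmxE unitfE -DxE.
have [fk fe fR hrem] := gd.
have : h \in orth (tang A x).
  by apply/orthP => w wT; rewrite dotC dotZl etaT // mulr0.
have -> : orth (tang A x) = rowvs G.
  apply/esym/eqP; rewrite eqEdim; apply/andP; split.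
    apply/subvP => _ /rowvsP[c ->]; apply/orthP => w /tangP wT.
    rewrite dotC mulmx_sum_row dot_suml big1 // => i _; rewrite dotZl rowK wT ?mulr0 //.
    by case: (fk i).
  by rewrite dim_orth dim_rowvs // smooth.
case/rowvsP => c hc.
have step i : (\det (repl_row (J f g) i (hJ g))).@[x 0] = c 0 i * Dx.
  rewrite DxE -(cramer_row (colsub g G) c i) -det_map_mx; congr (\det _).
  apply/matrixP => a b; rewrite !mxE; case: eqP => _; rewrite ?mxE //.
  by rewrite /= /hJ mevalC hc mxE; apply: eq_bigr => j _; rewrite !mxE.
have step2 i : (R i).@[x 0] = - dot (grad (f i) x) s.
  have := hrem i x; rewrite addrC /s subrK; case: (fk i) => _ fA; rewrite !fA // add0r.
  by rewrite addrC => /esym/eqP; rewrite addr_eq0 => /eqP.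
rewrite raddf_sum /=; under eq_bigr => i _ do rewrite mevalM step step2.
have : dot (c *m G) s = 1 by rewrite -hc.
rewrite mulmx_sum_row dot_suml => h1.
have -> : \sum_i c 0 i * Dx * - dot (grad (f i) x) s = - Dx * \sum_i dot (c 0 i *: row i G) s.
  by rewrite mulr_sumr; apply: eq_bigr => i _; rewrite dotZl rowK; ring.
by rewrite h1 mulr1 subrr.
Qed.

End Tangency.

(** * Generic points of products *)

Section Products.
Variable K : numClosedFieldType.
Hypothesis Kunc : ~ countable [set: K].
Implicit Types (k : set K) (D : K -> K).

Lemma comp_poly k M q (P : {mpoly K[M]}) (t : 'I_M -> {mpoly K[q]}) : subring k -> over k P ->
  (forall i, over k (t i)) -> exists Q : {mpoly K[q]}, over k Q /\
    forall v : 'rV[K]_q, Q.@[v 0] = P.@[fun i => (t i).@[v 0]].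
Proof.
move=> hk hP ht; exists (P \mPo [tuple t j | j < M]); split.
  rewrite comp_mpolyEX; apply: over_sum => // l _.
  apply: overZ => //; rewrite comp_mpolyX; apply: over_prod => // i _.
  by apply: over_exp => //; rewrite tnth_mktuple.
by move=> v; rewrite comp_mpoly_meval; apply: meval_eq => j; rewrite tnth_mktuple.
Qed.

Section Pair.
Variables m q : nat.
Implicit Types (A : set 'rV[K]_m) (B : set 'rV[K]_q).

Definition prodset A B : set 'rV[K]_(m + q) := [set w | A (lsubmx w) /\ B (rsubmx w)].

Lemma prodset_row A B x y : prodset A B (row_mx x y) <-> A x /\ B y.
Proof. by rewrite /prodset /= row_mxKl row_mxKr. Qed.

Lemma split_eval (P : {mpoly K[m + q]}) (w : 'I_(m + q) -> K) (x : 'rV[K]_m) (y : 'rV[K]_q) :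
  (forall i, w (lshift q i) = x 0 i) -> (forall j, w (rshift m j) = y 0 j) ->
  P.@[w] = P.@[(row_mx x y) 0].
Proof.
move=> h1 h2; apply: meval_eq => i; case: (split_ordP i) => j ->.
  by rewrite h1 row_mxEl.
by rewrite h2 row_mxEr.
Qed.

Lemma plug_left k (P : {mpoly K[m + q]}) (x : 'rV[K]_m) : subring k -> over k P ->
  exists Q : {mpoly K[q]}, over (adj k x) Q /\ forall y : 'rV[K]_q, Q.@[y 0] = P.@[(row_mx x y) 0].
Proof.
move=> hk hP; have hk' := adj_subring x hk.
pose t (i : 'I_(m + q)) : {mpoly K[q]} := match fintype.split i with inl j => (x 0 j)%:MP | inr j => 'X_j end.
have [|i|Q [Qk hQ]] := @comp_poly (adj k x) _ _ P t hk'.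
- by move=> l; apply: sub_adj.
- by rewrite /t; case: fintype.split => j; [apply: overC => //; exact: mem_adj | exact: overX].
exists Q; split=> // y; rewrite hQ; apply: split_eval => j; rewrite /t.
  by rewrite (unsplitK (inl j)) mevalC.
by rewrite (unsplitK (inr j)) mevalXU.
Qed.

Lemma plug_right k (P : {mpoly K[m + q]}) (y : 'rV[K]_q) : subring k -> over k P ->
  exists Q : {mpoly K[m]}, over (adj k y) Q /\ forall x : 'rV[K]_m, Q.@[x 0] = P.@[(row_mx x y) 0].
Proof.
move=> hk hP; have hk' := adj_subring y hk.
pose t (i : 'I_(m + q)) : {mpoly K[m]} := match fintype.split i with inl j => 'X_j | inr j => (y 0 j)%:MP end.
have [|i|Q [Qk hQ]] := @comp_poly (adj k y) _ _ P t hk'.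
- by move=> l; apply: sub_adj.
- by rewrite /t; case: fintype.split => j; [exact: overX | apply: overC => //; exact: mem_adj].
exists Q; split=> // x; rewrite hQ; apply: split_eval => j; rewrite /t.
  by rewrite (unsplitK (inl j)) mevalXU.
by rewrite (unsplitK (inr j)) mevalC.
Qed.

Lemma lift_fst k (p : {mpoly K[m]}) : subring k -> over k p ->
  exists P : {mpoly K[m + q]}, over k P /\ forall (x : 'rV[K]_m) (y : 'rV[K]_q), P.@[(row_mx x y) 0] = p.@[x 0].
Proof.
move=> hk hp; have [|P [Pk hP]] := @comp_poly k _ (m + q) p (fun i => 'X_(lshift q i)) hk hp.
  by move=> i; exact: overX.
by exists P; split=> // x y; rewrite hP; apply: meval_eq => i; rewrite mevalXU row_mxEl.
Qed.

Lemma lift_snd k (p : {mpoly K[q]}) : subring k -> over k p ->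
  exists P : {mpoly K[m + q]}, over k P /\ forall (x : 'rV[K]_m) (y : 'rV[K]_q), P.@[(row_mx x y) 0] = p.@[y 0].
Proof.
move=> hk hp; have [|P [Pk hP]] := @comp_poly k _ (m + q) p (fun i => 'X_(rshift m i)) hk hp.
  by move=> i; exact: overX.
by exists P; split=> // x y; rewrite hP; apply: meval_eq => i; rewrite mevalXU row_mxEr.
Qed.

Lemma lift_adj_left k (Q : {mpoly K[q]}) (x : 'rV[K]_m) : subring k -> over (adj k x) Q ->
  exists P : {mpoly K[m + q]}, over k P /\ forall y : 'rV[K]_q, P.@[(row_mx x y) 0] = Q.@[y 0].
Proof.
move=> hk hQ; rewrite [Q]mpolyE.
elim: (msupp Q) => [|l s [P [Pk hP]]].
  by exists 0; split=> [|y]; rewrite ?big_nil ?meval0 //; exact: over0.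
have [c [ck cE]] := hQ l; have [C [Ck hC]] := lift_fst hk ck.
have [M [Mk hM]] := lift_snd hk (overX l hk).
exists (C * M + P); split; first by apply: overD => //; exact: overM.
by move=> y; rewrite big_cons !mevalD hP mevalM mevalZ hC hM cE.
Qed.

Lemma lift_adj_right k (Q : {mpoly K[m]}) (y : 'rV[K]_q) : subring k -> over (adj k y) Q ->
  exists P : {mpoly K[m + q]}, over k P /\ forall x : 'rV[K]_m, P.@[(row_mx x y) 0] = Q.@[x 0].
Proof.
move=> hk hQ; rewrite [Q]mpolyE.
elim: (msupp Q) => [|l s [P [Pk hP]]].
  by exists 0; split=> [|y']; rewrite ?big_nil ?meval0 //; exact: over0.
have [c [ck cE]] := hQ l; have [C [Ck hC]] := lift_snd hk ck.
have [M [Mk hM]] := lift_fst hk (overX l hk).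
exists (C * M + P); split; first by apply: overD => //; exact: overM.
by move=> x; rewrite big_cons !mevalD hP mevalM mevalZ hC hM cE.
Qed.

Lemma subring_setT : subring [set: K].
Proof. by split. Qed.

Lemma prodset_closed A B : algclosed A -> algclosed B -> algclosed (prodset A B).
Proof.
move=> hA hB w hw; have wE : w = row_mx (lsubmx w) (rsubmx w) by rewrite hsubmxK.
split.
  apply: hA => p hp; have [P [_ hP]] := @lift_fst [set: K] p subring_setT (fun _ => I).
  rewrite -(hP _ (rsubmx w)) -wE; apply: hw => v [vA _].
  by rewrite -[v]hsubmxK hP; exact: hp.
apply: hB => p hp; have [P [_ hP]] := @lift_snd [set: K] p subring_setT (fun _ => I).
rewrite -(hP (lsubmx w) _) -wE; apply: hw => v [_ vB].
by rewrite -[v]hsubmxK hP; exact: hp.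
Qed.

Lemma algprime_cover A (F G : set {mpoly K[m]}) : algprime A ->
  (forall v, A v -> zeros F v \/ zeros G v) -> A `<=` zeros F \/ A `<=` zeros G.
Proof.
move=> [_ pr] h; have [?|nF] := pselect (A `<=` zeros F); first by left.
right=> w Aw g Gg.
have [f [Ff nf]] : exists f, F f /\ ~ vanish A f.
  apply: contrapT => no; apply: nF => v Av f Ff; apply: contrapT => fv.
  by apply: no; exists f; split=> // hf; apply: fv; exact: hf.
case: (pr f g) => [v Av|//|]; last by apply.
by rewrite mevalM; case: (h v Av) => [/(_ f Ff) ->|/(_ g Gg) ->]; rewrite ?mul0r ?mulr0.
Qed.

(** For fixed [v] in [A], primality of [B] makes [P] or [Q] vanish on all of [v] times [B]; each
    alternative is a closed condition on [v], and one of them holds on all of [A]. *)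
Lemma prodset_prime A B : algprime A -> algprime B -> algprime (prodset A B).
Proof.
move=> pA pB; have [[a0 Aa0] _] := pA; have [[b0 Bb0] prB] := pB.
split; first by exists (row_mx a0 b0); apply/prodset_row.
move=> P Q PQ.
pose F (P : {mpoly K[m + q]}) := [set f : {mpoly K[m]} | exists2 y, B y & forall x : 'rV[K]_m, f.@[x 0] = P.@[(row_mx x y) 0]].
have FE (P' : {mpoly K[m + q]}) x : zeros (F P') x <-> forall y, B y -> P'.@[(row_mx x y) 0] = 0.
  split=> [h y By|h f [y By ->]]; last exact: h.
  have [f [_ fE]] := @plug_right [set: K] P' y subring_setT (fun _ => I).
  by rewrite -fE; apply: h; exists y.
have conc P' : A `<=` zeros (F P') -> vanish (prodset A B) P'.
  by move=> h w [wA wB]; rewrite -[w]hsubmxK; move/h: wA => /FE; apply.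
have [v Av||] := @algprime_cover A (F P) (F Q) pA; [|by left; exact: conc|by right; exact: conc].
have [p [_ pE]] := @plug_left [set: K] P v subring_setT (fun _ => I).
have [p' [_ pE']] := @plug_left [set: K] Q v subring_setT (fun _ => I).
case: (prB p p') => [y By|hp|hp].
- by rewrite mevalM pE pE' -mevalM; apply: PQ; apply/prodset_row.
- by left; apply/FE => y By; rewrite -pE; exact: hp.
- by right; apply/FE => y By; rewrite -pE'; exact: hp.
Qed.

Lemma generic_prod k A B x y : subring k -> generic k (prodset A B) (row_mx x y) ->
  [/\ generic k A x, generic (adj k x) B y, generic k B y & generic (adj k y) A x].
Proof.
move=> hk [/prodset_row[Ax By] h].
have g1 : generic (adj k x) B y.
  split=> // p /(lift_adj_left hk)[P [Pk PE]]; rewrite -PE => /(h _ Pk) hP y' By'.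
  by rewrite -PE; apply: hP; apply/prodset_row.
have g2 : generic (adj k y) A x.
  split=> // p /(lift_adj_right hk)[P [Pk PE]]; rewrite -PE => /(h _ Pk) hP x' Ax'.
  by rewrite -PE; apply: hP; apply/prodset_row.
by split=> //; [apply: generic_sub g2 | apply: generic_sub g1]; exact: sub_adj.
Qed.

(** Adding a derivation over [k1] alters the velocity of [y] but not the values of [D] on [k1]. *)
Lemma ext_der k k1 D (y w : 'rV[K]_q) : k `<=` k1 -> Der k D ->
  w - vder D y \in tsp k1 y ->
  exists D', [/\ Der k D', forall c, k1 c -> D' c = D c & vder D' y = w].
Proof.
move=> kk1 [dD kD] /tspP[E [[dE kE] Ey]]; exists (fun a => D a + E a); split.
- split; first exact: der_add.
  by move=> c kc; rewrite kD // kE ?addr0 //; exact: kk1.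
- by move=> c kc; rewrite kE // addr0.
- have -> : vder (fun a => D a + E a) y = vder D y + vder E y by apply/rowP => i; rewrite !mxE.
  by rewrite -Ey addrC subrK.
Qed.

(** The means of moving several points independently: a point generic over [k1] can be given any
    tangent velocity, whatever the derivation does on [k1]. *)
Lemma ext_gen k k1 B D (y w : 'rV[K]_q) : subring k1 -> ratl k B -> k `<=` k1 -> generic k1 B y ->
  w \in tang B y -> Der k D ->
  exists D', [/\ Der k D', forall c, k1 c -> D' c = D c & vder D' y = w].
Proof.
move=> hk1 rB kk1 gy wT hD; apply: ext_der => //.
rewrite (generic_tsp hk1 (kdef_sub kk1 (ratl_kdef rB)) gy) memvB //.
by apply: (vder_tang (ratl_kdef rB) hD); case: gy.
Qed.

End Pair.

Lemma pair_tsp m q k A B (x : 'rV[K]_m) (y : 'rV[K]_q) : subring k -> ratl k A -> ratl k B ->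
  generic k A x -> generic (adj k x) B y ->
  \dim (tsp k (row_mx x y)) = (\dim (tang A x) + \dim (tang B y))%N.
Proof.
move=> hk rA rB gx gy; set U := tang A x; set W := tang B y.
pose M := block_mx (bmx U) 0 0 (bmx W).
have fM : row_free M.
  by rewrite /row_free rank_diag_block_mx (eqP (bmx_free U)) (eqP (bmx_free W)).
rewrite -(dim_rowvs fM); congr (\dim _); apply/vspaceP => v.
have vE D : vder D (row_mx x y) = row_mx (vder D x) (vder D y) by rewrite /vder map_row_mx.
have ME (c : 'rV_(\dim U)) (c' : 'rV_(\dim W)) : row_mx c c' *m M = row_mx (c *m bmx U) (c' *m bmx W).
  by rewrite mul_row_block !mulmx0 addr0 add0r.
apply/idP/idP.
  move=> /tspP[D [hD ->]]; rewrite vE.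
  have /bmxP[c ->] : vder D x \in U by apply: (vder_tang (ratl_kdef rA) hD); case: gx.
  have /bmxP[c' ->] : vder D y \in W by apply: (vder_tang (ratl_kdef rB) hD); case: gy.
  by apply/rowvsP; exists (row_mx c c').
case/rowvsP => c ->; rewrite -[c]hsubmxK ME.
have : lsubmx c *m bmx U \in tsp k x.
  by rewrite (generic_tsp hk (ratl_kdef rA) gx); apply/bmxP; exists (lsubmx c).
case/tspP => D [hD ->].
have hW : rsubmx c *m bmx W \in W by apply/bmxP; exists (rsubmx c).
have [D' [hD' D'x D'y]] := ext_gen (adj_subring x hk) rB (sub_adj x hk) gy hW hD.
apply/tspP; exists D'; split=> //; rewrite vE D'y; congr (row_mx _ _).
by apply/rowP => i; rewrite !mxE D'x //; exact: mem_adj.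
Qed.

(** The pair has a velocity space of the same dimension as a generic point of the product, so
    [generic_of_dim] applies. *)
Lemma generic_pair m q k A B (x : 'rV[K]_m) (y : 'rV[K]_q) : csubring k ->
  algclosed A -> algclosed B -> algprime A -> algprime B ->
  ratl k A -> ratl k B -> generic k A x -> generic (adj k x) B y ->
  generic k (prodset A B) (row_mx x y).
Proof.
move=> hk cA cB pA pB rA rB gx gy; have [rk _] := hk.
have [w gw] := exists_generic Kunc hk (prodset_closed cA cB) (prodset_prime pA pB).
apply: (generic_of_dim rk gw); first by apply/prodset_row; split; [case: gx | case: gy].
move: gw; rewrite -[w]hsubmxK; set x' := lsubmx w; set y' := rsubmx w => gw.
have [gx' gy' gy'' _] := generic_prod rk gw.
rewrite !(pair_tsp rk rA rB) // leq_eqVlt; apply/orP; left; apply/eqP; congr (_ + _)%N.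
  rewrite -(generic_tsp rk (ratl_kdef rA) gx) -(generic_tsp rk (ratl_kdef rA) gx').
  exact: generic_dim gx' gx.
have gy0 : generic k B y by apply: generic_sub gy; exact: sub_adj.
rewrite -(generic_tsp rk (ratl_kdef rB) gy0) -(generic_tsp rk (ratl_kdef rB) gy'').
exact: generic_dim gy'' gy0.
Qed.

Lemma setT_closed q : algclosed [set: 'rV[K]_q].
Proof. by []. Qed.

Lemma setT_prime q : algprime [set: 'rV[K]_q].
Proof.
split; first by exists 0.
move=> p p' h; apply: contrapT => no.
have [u pu] : exists u : 'rV_q, p.@[u 0] != 0.
  apply: contrapT => n; apply: no; left=> u _; apply/eqP/negPn/negP => hu; by apply: n; exists u.
have [v pv] : exists v : 'rV_q, p'.@[v 0] != 0.
  apply: contrapT => n; apply: no; right=> v _; apply/eqP/negPn/negP => hv; by apply: n; exists v.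
have [Q1 hQ1] := line_poly p u (v - u); have [Q2 hQ2] := line_poly p' u (v - u).
have /eqP : Q1 * Q2 = 0.
  apply: poly_nat_roots => t; rewrite hornerM; have [<- _] := hQ1 t%:R; have [<- _] := hQ2 t%:R.
  by rewrite -mevalM; exact: h.
rewrite mulf_eq0 => /orP[] /eqP Q0.
  by have [e _] := hQ1 0; move: e pu; rewrite Q0 horner0 scale0r addr0 => ->; rewrite eqxx.
by have [e _] := hQ2 1; move: e pv; rewrite Q0 horner0 scale1r addrC subrK => ->; rewrite eqxx.
Qed.

Lemma vanish_setT q (p : {mpoly K[q]}) : vanish [set: 'rV[K]_q] p -> p = 0.
Proof.
move=> h; apply/eqP; rewrite -msize_poly_eq0 -leqn0; move: (leqnn (msize p)); move: {2}(msize p) => s.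
elim: s p h => [//|s IH] p h sp.
have dp j : p^`M(j) = 0.
  apply/eqP; rewrite -msize_poly_eq0 -leqn0; apply: IH; last exact: msize_deriv.
  move=> a _; have [Q hQ] := line_poly p a (delta_mx 0 j).
  have Q0 : Q = 0 by apply: poly_nat_roots => t; have [<- _] := hQ t%:R; exact: h.
  have [_] := hQ 0; rewrite Q0 deriv0 horner0 scale0r addr0 => <-.
  rewrite /dot (bigD1 j) //= [X in _ + X]big1 ?addr0; first by rewrite !mxE !eqxx mulr1.
  by move=> i ij; rewrite [X in _ * X]mxE (negPf ij) andbF mulr0.
have pE : p = (p@_0)%:MP.
  apply/mpolyP => l; rewrite mcoeffC; have [->|l0] := eqVneq l 0%MM; first by rewrite mulr1.
  rewrite mulr0; have [j lj] : exists j, (0 < l j)%N.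
    apply: contrapT => no; move/eqP: l0; apply; apply/mnmP => j; rewrite mnmE.
    by apply/eqP; rewrite -leqn0 leqNgt; apply/negP => lj; apply: no; exists j.
  have lE : l = (l - U_(j) + U_(j))%MM.
    by rewrite submK //; apply/mnm_lepP => i; rewrite mnm1E; case: eqP => [<-|_].
  have := congr1 (mcoeff (l - U_(j))%MM) (dp j); rewrite mcoeff_deriv -lE mcoeff0 => /eqP.
  by rewrite mulrn_eq0 /= => /eqP.
have := h 0 I; rewrite pE mevalC => ->.
by rewrite mpolyC0 msize0.
Qed.

Lemma tang_setT q (v : 'rV[K]_q) : tang [set: 'rV[K]_q] v = fullv.
Proof.
apply/vspaceP => w; rewrite memvf; apply/tangP => p /vanish_setT ->.
by rewrite -dird_dot -mpolyC0 dirdC.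
Qed.

Lemma ratl_setT q k : subring k -> ratl k [set: 'rV[K]_q].
Proof.
move=> hk p /vanish_setT ->; exists 0%N, (fun=> 0), (fun=> 0).
by split; [case | rewrite big_ord0].
Qed.

End Products.

(** * Second fundamental form, secant and dual varieties *)

Section SecondFundamentalForm.
Variables (K : numClosedFieldType) (m : nat).
Hypothesis Kunc : ~ countable [set: K].
Implicit Types (k : set K) (D : K -> K) (p : {mpoly K[m]}) (a u v w x y : 'rV[K]_m) (A : set 'rV[K]_m).

(** The affine cone over a nonsingular non-degenerate variety of dimension [d - 1]. *)
Record smooth_cone A (d : nat) : Prop := SmoothCone {
  sc_cone : ccone A;
  sc_prime : algprime A;
  sc_smooth : forall v, A v -> v != 0 -> \dim (tang A v) = d;
  sc_nondeg : forall h : 'rV[K]_m, h != 0 -> exists2 v, A v & dot h v != 0 }.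

Definition grads r (F : 'I_r -> {mpoly K[m]}) x : 'M[K]_(r, m) := \matrix_i grad (F i) x.

(** The gradients of [F] at [x] form a basis of the conormal space, so that [mu] gives coordinates
    for the conormal vector [mu *m grads F x]. *)
Record frame A k x r (F : 'I_r -> {mpoly K[m]}) : Prop := Frame {
  fr_sub : csubring k;
  fr_ratl : ratl k A;
  fr_gen : generic k A x;
  fr_over : forall i, over k (F i) /\ vanish A (F i);
  fr_free : row_free (grads F x);
  fr_orth : orth (tang A x) = rowvs (grads F x) }.

Lemma generic_neq0 A k x d : smooth_cone A d -> (0 < m)%N -> csubring k -> generic k A x -> x != 0.
Proof.
move=> [_ _ _ nd] m0 [hk _] [_ h]; apply/eqP => x0.
have [|v Av] := nd (delta_mx 0 (Ordinal m0)).
  by apply/matrix0Pn; exists 0, (Ordinal m0); rewrite mxE !eqxx oner_eq0.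
rewrite dotC /dot (bigD1 (Ordinal m0)) //= !mxE !eqxx mulr1 big1 ?addr0; last first.
  by move=> i i0; rewrite mxE (negPf i0) andbF mulr0.
have /(h _ (overX _ hk))/(_ v Av) : ('X_(Ordinal m0) : {mpoly K[m]}).@[x 0] = 0.
  by rewrite mevalXU x0 mxE.
by rewrite mevalXU => ->; rewrite eqxx.
Qed.

Lemma exists_frame A d k : smooth_cone A d -> (0 < m)%N -> csubring k -> ratl k A ->
  exists x (F : 'I_(m - d) -> {mpoly K[m]}), frame A k x F.
Proof.
move=> sc m0 hk rA; have [[Acl A0 Asc] Apr sm nd] := sc.
have [x gx] := exists_generic Kunc hk Acl Apr; have [Ax _] := gx; have [rk _] := hk.
have x0 := generic_neq0 sc m0 hk gx.
have [f [e [fk _ ff fo]]] := equations_at (sc_cone sc) rk rA sm Ax x0.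
by exists x, f; split.
Qed.

Definition hess p a : 'M[K]_m := \matrix_(i, j) ((p^`M(i))^`M(j)).@[a 0].

Lemma hess_sym p a : (hess p a)^T = hess p a.
Proof. by apply/matrixP => i j; rewrite !mxE mderiv_comm. Qed.

Lemma vder_grad k D p a : Der k D -> subring k -> over k p -> vder D (grad p a) = vder D a *m hess p a.
Proof.
move=> hD hk hp; apply/rowP => i; rewrite !mxE.
rewrite (der_eval_grad_over a hD (over_deriv i hk hp)); apply: eq_bigr => j _.
by rewrite !mxE mderiv_comm mulrC.
Qed.

(** On tangent vectors this is the second fundamental form in the conormal direction
    [mu *m grads F x]; its other values depend on the choice of [F]. *)
Definition sff r (F : 'I_r -> {mpoly K[m]}) x (mu : 'rV[K]_r) : 'M[K]_m := \sum_i mu 0 i *: hess (F i) x.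

Section Sff.
Variables (r : nat) (F : 'I_r -> {mpoly K[m]}).
Implicit Types (mu nu : 'rV[K]_r).

Lemma sff_sym x mu : (sff F x mu)^T = sff F x mu.
Proof.
rewrite /sff raddf_sum; apply: eq_bigr => i _ /=.
by rewrite linearZ /= hess_sym.
Qed.

Lemma dot_mulmx u (M : 'M[K]_m) v : dot (u *m M) v = dot u (v *m M^T).
Proof.
rewrite /dot; under eq_bigr => i _ do rewrite mxE mulr_suml.
rewrite exchange_big /=; apply: eq_bigr => j _; rewrite mxE mulr_sumr.
by apply: eq_bigr => i _; rewrite mxE; ring.
Qed.

Lemma sffC x mu u v : dot (u *m sff F x mu) v = dot (v *m sff F x mu) u.
Proof. by rewrite dot_mulmx sff_sym dotC. Qed.

Lemma sffDm x mu nu : sff F x (mu + nu) = sff F x mu + sff F x nu.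
Proof. by rewrite /sff -big_split; apply: eq_bigr => i _; rewrite mxE scalerDl. Qed.

Lemma sffZm x c mu : sff F x (c *: mu) = c *: sff F x mu.
Proof. by rewrite /sff scaler_sumr; apply: eq_bigr => i _; rewrite mxE scalerA. Qed.

Lemma sff0 x : sff F x 0 = 0.
Proof. by rewrite -(scale0r 0) sffZm scale0r. Qed.

Lemma vder_mulmx D (q : nat) (c : 'rV[K]_q) (M : 'M[K]_(q, m)) : derivation D ->
  vder D (c *m M) = vder D c *m M + c *m map_mx D M.
Proof.
move=> hD; apply/rowP => j; rewrite !mxE der_sum // -big_split; apply: eq_bigr => i _.
by rewrite !mxE; case: hD => _ ->.
Qed.

Lemma der_normal k D x mu : Der k D -> subring k -> (forall i, over k (F i)) ->
  vder D (mu *m grads F x) = vder D mu *m grads F x + vder D x *m sff F x mu.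
Proof.
move=> hD hk Fk; have [dD _] := hD; rewrite vder_mulmx //; congr (_ + _).
rewrite mulmx_sum_row /sff mulmx_sumr; apply: eq_bigr => i _.
rewrite -scalemxAr -(vder_grad _ hD hk (Fk i)); congr (_ *: _).
by apply/rowP => j; rewrite !mxE.
Qed.

Section AtFrame.
Variables (A : set 'rV[K]_m) (k : set K) (x : 'rV[K]_m).
Hypotheses (fr : frame A k x F) (Asc : forall c v, A v -> A (c *: v)).

Local Notation T := (tang A x).
Local Notation G := (grads F x).
Local Notation S := (sff F x).

Let Ax : A x. Proof. by case: (fr_gen fr). Qed.
Let hk : subring k. Proof. by case: (fr_sub fr). Qed.
Let Fk i : over k (F i). Proof. by case: (fr_over fr i). Qed.

Lemma normal_dot mu w : w \in T -> dot (mu *m G) w = 0.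
Proof.
move=> wT; have : mu *m G \in orth T by rewrite (fr_orth fr); apply/rowvsP; exists mu.
by move/orthP => /(_ w wT); rewrite dotC.
Qed.

Lemma normal_coef h : (forall w, w \in T -> dot h w = 0) -> exists mu, h = mu *m G.
Proof.
move=> hT; apply/rowvsP; rewrite -/(grads F x) -(fr_orth fr); apply/orthP => w wT.
by rewrite dotC; exact: hT.
Qed.

Lemma tangent_of w : (forall mu, dot (mu *m G) w = 0) -> w \in T.
Proof.
move=> h; rewrite -[tang A x]orthK (fr_orth fr); apply/orthP => _ /rowvsP[mu ->].
exact: h.
Qed.

Lemma tangent_velocity D : Der k D -> vder D x \in T.
Proof. by move=> hD; exact: (vder_tang (ratl_kdef (fr_ratl fr)) hD). Qed.

Lemma velocity u : u \in T -> exists D, Der k D /\ vder D x = u.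
Proof.
by rewrite -(generic_tsp hk (ratl_kdef (fr_ratl fr)) (fr_gen fr)) => /tspP[D [hD ->]]; exists D.
Qed.

Lemma der_normal_dot D mu w : Der k D -> w \in T ->
  dot (vder D (mu *m G)) w = dot (vder D x *m S mu) w.
Proof. by move=> hD wT; rewrite (der_normal _ _ hD hk Fk) dotDl normal_dot // add0r. Qed.

(* Differentiating [dot (mu G) w = 0] for a tangent field [w]. *)
Lemma normal_der_field D mu w : Der k D -> w \in T -> dot (vder D (mu *m G)) w + dot (mu *m G) (vder D w) = 0.
Proof.
move=> hD wT; have [dD _] := hD; rewrite -vder_dot // normal_dot // der0 //.
Qed.

Lemma x_tangent : x \in T.
Proof. exact: tang_cone. Qed.

Lemma sff_euler mu u : u \in T -> dot (u *m S mu) x = 0.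
Proof.
move=> uT; have [D [hD Dx]] := velocity uT.
have := normal_der_field mu hD x_tangent; rewrite der_normal_dot ?x_tangent // Dx.
by rewrite normal_dot // addr0.
Qed.

Definition sker mu : {vspace 'rV[K]_m} :=
  vs [set e | e \in T /\ forall v, v \in T -> dot (e *m S mu) v = 0].

Lemma skerP mu e : e \in sker mu <-> (e \in T /\ forall v, v \in T -> dot (e *m S mu) v = 0).
Proof.
apply: vsP; split=> [|c u v [uT hu] [vT hv]]; first by split=> [|v _]; rewrite ?mem0v // mul0mx dot0l.
split=> [|w wT]; first by rewrite memvD // memvZ.
by rewrite mulmxDl -scalemxAl dotDl dotZl hu // hv // mulr0 addr0.
Qed.

Lemma x_sker mu : x \in sker mu.
Proof. by apply/skerP; split; [exact: x_tangent | move=> v vT; rewrite sffC; exact: sff_euler]. Qed.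

Lemma sker_normal mu e : e \in sker mu -> exists nu, e *m S mu = nu *m G.
Proof. by move=> /skerP[_ h]; exact: normal_coef. Qed.

(** Because [e] is in the kernel, moving [x] by [e] changes the conormal vector only by a conormal
    vector [nu *m G], and moving [mu] by [- nu] cancels this change. *)
Lemma sker_der mu e : generic (adj k x) [set: 'rV[K]_r] mu -> e \in sker mu ->
  exists D, [/\ Der k D, vder D x = e & vder D (mu *m G) = 0].
Proof.
move=> gmu he; have [eT _] := (iffLR (skerP mu e)) he; have [D [hD Dx]] := velocity eT.
have [nu nuE] := sker_normal he.
have hkx := adj_subring x hk.
have [|D' [hD' D'x D'mu]] := @ext_gen K r k (adj k x) _ D mu (- nu) hkx (ratl_setT hk) (sub_adj x hk) gmu _ hD.
  by rewrite tang_setT memvf.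
have D'xE : vder D' x = e.
  by rewrite -Dx; apply/rowP => i; rewrite !mxE D'x //; exact: mem_adj.
exists D'; split=> //; rewrite (der_normal _ _ hD' hk Fk) D'mu D'xE nuE mulNmx addNr //.
Qed.

(** The velocities of [mu *m G] are the sums of [nu *m G], with [nu] arbitrary, and [u *m S mu],
    with [u] tangent. Orthogonality to the former means tangency, to the latter membership in the
    kernel. This yields both the dimension of the dual variety and reflexivity. *)
Lemma orth_tsp_normal mu : generic (adj k x) [set: 'rV[K]_r] mu ->
  orth (tsp k (mu *m G)) = sker mu.
Proof.
move=> gmu; apply/vspaceP => e; apply/idP/idP.
  move=> /orthP h.
  have key nu u : u \in T -> dot (nu *m G + u *m S mu) e = 0.
    move=> uT; apply: h; have [D [hD Dx]] := velocity uT; have hkx := adj_subring x hk.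
    have [|D' [hD' D'x D'mu]] := @ext_gen K r k (adj k x) _ D mu nu hkx (ratl_setT hk) (sub_adj x hk) gmu _ hD.
      by rewrite tang_setT memvf.
    apply/tspP; exists D'; split=> //; rewrite (der_normal _ _ hD' hk Fk) D'mu; congr (_ + _ *m _).
    by rewrite -Dx; apply/rowP => i; rewrite !mxE D'x //; exact: mem_adj.
  apply/skerP; split.
    by apply: tangent_of => nu; rewrite -(key nu 0 (mem0v _)) mul0mx addr0.
  by move=> v vT; rewrite sffC -(key 0 v vT) mul0mx add0r.
move=> /skerP[eT he]; apply/orthP => w /tspP[D [hD ->]].
by rewrite der_normal_dot // sffC he // tangent_velocity.
Qed.

End AtFrame.
End Sff.
End SecondFundamentalForm.

(** * The secant cone and Terracini's lemma *)

Section Secant.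
Variables (K : numClosedFieldType) (m : nat).
Hypothesis Kunc : ~ countable [set: K].
Implicit Types (k : set K) (D : K -> K) (p : {mpoly K[m]}) (a u v w x y : 'rV[K]_m) (A : set 'rV[K]_m).

Definition secant_cone A : set 'rV[K]_m :=
  zeros [set p : {mpoly K[m]} | forall u v, A u -> A v -> p.@[(u + v) 0] = 0].

Lemma secant_sum A u v : A u -> A v -> secant_cone A (u + v).
Proof. by move=> Au Av p; apply. Qed.

Lemma vanish_secant A p : vanish (secant_cone A) p <-> forall u v, A u -> A v -> p.@[(u + v) 0] = 0.
Proof. by split=> [h u v Au Av|h z]; [apply: h; exact: secant_sum | apply]. Qed.

Lemma sum_poly k p : subring k -> over k p -> exists P : {mpoly K[m + m]}, over k P /\
  forall u v, P.@[(row_mx u v) 0] = p.@[(u + v) 0].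
Proof.
move=> hk hp; have [|P [Pk hP]] := @comp_poly K k _ (m + m) p (fun i => 'X_(lshift m i) + 'X_(rshift m i)) hk hp.
  by move=> i; apply: overD => //; exact: overX.
by exists P; split=> // u v; rewrite hP; apply: meval_eq => i; rewrite mevalD !mevalXU row_mxEl row_mxEr mxE.
Qed.

Lemma secant_ccone A : ccone A -> ccone (secant_cone A).
Proof.
move=> [_ A0 Asc]; split; first exact: zeros_algclosed.
  by rewrite -(addr0 0); exact: secant_sum.
move=> c z hz p hp; have [P [_ hP]] := @comp_poly K [set: K] _ m p (fun i => c *: 'X_i) (@subring_setT K) (fun _ => I)
  (fun _ _ => I).
have PE v : P.@[v 0] = p.@[(c *: v) 0] by rewrite hP; apply: meval_eq => i; rewrite mevalZ mevalXU mxE.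
by rewrite -PE; apply: hz => u v Au Av; rewrite PE scalerDr; apply: hp; exact: Asc.
Qed.

Lemma secant_prime A : algprime A -> algprime (secant_cone A).
Proof.
move=> pA; have [[a Aa] _] := pA; split; first by exists (a + a); exact: secant_sum.
move=> p q /vanish_secant pq; have [_ pr] := prodset_prime pA pA.
have [P [_ hP]] := @sum_poly [set: K] p (@subring_setT K) (fun _ => I).
have [Q [_ hQ]] := @sum_poly [set: K] q (@subring_setT K) (fun _ => I).
case: (pr P Q) => [w [wl wr]|h|h].
- by rewrite -[w]hsubmxK mevalM hP hQ -mevalM; exact: pq.
- by left; apply/vanish_secant => u v Au Av; rewrite -hP; apply: h; apply/prodset_row.
- by right; apply/vanish_secant => u v Au Av; rewrite -hQ; apply: h; apply/prodset_row.
Qed.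

Lemma generic_secant k A x y : csubring k -> algclosed A -> algprime A -> ratl k A ->
  generic k A x -> generic (adj k x) A y -> generic k (secant_cone A) (x + y).
Proof.
move=> hk cA pA rA gx gy; have [Ax _] := gx; have [Ay _] := gy; have [rk _] := hk.
split; first exact: secant_sum.
move=> p hp pxy; apply/vanish_secant => u v Au Av; have [P [Pk hP]] := sum_poly rk hp.
have [_ h] := generic_pair Kunc hk cA cA pA pA rA rA gx gy.
by rewrite -hP; apply: (h P Pk); [rewrite hP | apply/prodset_row].
Qed.

Lemma secant_tsp k A x y : csubring k -> ratl k A -> generic k A x -> generic (adj k x) A y ->
  tsp k (x + y) = (tang A x + tang A y)%VS.
Proof.
move=> [hk _] rA gx gy; have [Ax _] := gx; have [Ay _] := gy.
apply/vspaceP => w; apply/idP/idP.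
  move=> /tspP[D [hD ->]]; have [dD _] := hD; rewrite vderD //.
  by apply: memv_add; apply: (vder_tang (ratl_kdef rA) hD).
move=> /memv_addP[u uT [v vT ->]].
move: uT; rewrite -(generic_tsp hk (ratl_kdef rA) gx) => /tspP[D [hD Dx]].
have [D' [hD' D'x D'y]] := ext_gen (adj_subring x hk) rA (sub_adj x hk) gy vT hD.
apply/tspP; exists D'; split=> //; have [dD' _] := hD'; rewrite vderD // D'y Dx; congr (_ + _).
by apply/rowP => i; rewrite !mxE D'x //; exact: mem_adj.
Qed.

Lemma orth_tsp_grads k h : subring k -> forall w, w \in orth (tsp k h) ->
  exists r (F : 'I_r -> {mpoly K[m]}) (c : 'rV[K]_r), (forall i, over k (F i) /\ (F i).@[h 0] = 0) /\ w = c *m grads F h.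
Proof.
move=> hk w wo; have [r [F [Fk F0 Ff _ Fs]]] := tsp_rows h hk.
exists r, F; suff /rowvsP[c ->] : w \in rowvs (grads F h) by exists c; split=> // i; split.
rewrite -[rowvs _]orthK; move: wo; apply: (subvP (orthS _)).
apply/subvP => u /orth_rowvs hu; apply/(tsp_prescribe _ _ hk) => p pk ph.
have /rowvsP[c ->] := Fs p pk ph; rewrite mulmx_sum_row dot_suml big1 // => i _.
by rewrite dotZl hu mulr0.
Qed.

End Secant.

(** * The kernel and a second tangent space *)

Section Inequality.
Variables (K : numClosedFieldType) (m d : nat).
Hypothesis Kunc : ~ countable [set: K].
Variables (A : set 'rV[K]_m) (k : set K) (x : 'rV[K]_m) (F : 'I_(m - d) -> {mpoly K[m]}).
Hypotheses (sc : smooth_cone A d) (fr : frame A k x F).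
Local Notation T := (tang A x).
Local Notation G := (grads F x).

Let Asc : forall c v, A v -> A (c *: v). Proof. by case: (sc_cone sc). Qed.
Let Acl : algclosed A. Proof. by case: (sc_cone sc). Qed.
Let Ax : A x. Proof. by case: (fr_gen fr). Qed.
Let hk : subring k. Proof. by case: (fr_sub fr). Qed.
Let rA := fr_ratl fr.

Lemma nondeg_generic k1 (h y : 'rV[K]_m) : subring k1 -> (forall i, k1 (h 0 i)) -> h != 0 ->
  generic k1 A y -> dot h y != 0.
Proof.
move=> hk1 kh h0 [_ g]; apply/eqP => hy; have [v Av] := sc_nondeg sc h0.
have /g hv : over k1 (lin_form h) by exact: lin_form_over.
by rewrite -lin_form_eval hv ?eqxx // lin_form_eval.
Qed.

Lemma generic_normal_neq0 mu : (0 < m - d)%N -> generic (adj k x) [set: 'rV[K]_(m - d)] mu ->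
  mu *m G != 0.
Proof.
move=> r0 [_ g]; apply/eqP => h; have hkx := adj_subring x hk.
have mu0 : mu = 0 by apply: (row_free_inj (fr_free fr)); rewrite h mul0mx.
have := g 'X_(Ordinal r0) (overX _ hkx); rewrite mevalXU mu0 mxE => /(_ erefl) /(_ (const_mx 1) I).
by rewrite mevalXU mxE => /eqP; rewrite oner_eq0.
Qed.

Variables (mu : 'rV[K]_(m - d)) (y : 'rV[K]_m).
Hypothesis r0 : (0 < m - d)%N.
Hypothesis gmu : generic (adj k x) [set: 'rV[K]_(m - d)] mu.
Local Notation k1 := (adj (adj k x) mu).
Hypothesis gy : generic k1 A y.
Local Notation h := (mu *m G).
Local Notation L := (sker F A x mu).

Let hkx : subring (adj k x). Proof. exact: adj_subring. Qed.
Let hk1 : subring k1. Proof. exact: adj_subring. Qed.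
Let kk1 : k `<=` k1. Proof. by move=> c kc; apply: sub_adj => //; exact: sub_adj. Qed.

Lemma normal_in_k1 i : k1 (h 0 i).
Proof.
rewrite mxE; apply: subring_sum => // j _; case: (hk1) => _ _; apply; first exact: mem_adj.
apply: sub_adj => //; rewrite !mxE; apply: over_eval => //; last by move=> a; exact: mem_adj.
by apply: over_deriv => // l; apply: sub_adj => //; case: (fr_over fr j) => Fk _; exact: Fk.
Qed.

Lemma sker_der2 e w : e \in L -> w \in tang A y ->
  exists D, [/\ Der k D, vder D x = e, vder D h = 0 & vder D y = w].
Proof.
move=> eL wT; have [D [hD Dx Dh]] := sker_der fr gmu eL.
have [D' [hD' D'k D'y]] := ext_gen hk1 rA kk1 gy wT hD.
exists D'; split=> //; apply/rowP => i; rewrite vderE D'k -?vderE ?Dx ?Dh //; last exact: normal_in_k1.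
by apply: sub_adj => //; exact: mem_adj.
Qed.

Lemma sker_cap : (L :&: tang A y = 0)%VS.
Proof.
apply/eqP; rewrite -subv0; apply/subvP => e; rewrite memv_cap memv0 => /andP[eL eT].
have [D [hD Dx Dh Dy]] := sker_der2 eL eT; rewrite -Dx; apply/eqP.
apply: (tangency Kunc (sc_cone sc) hk rA (sc_smooth sc) hD Ax (y := y) (eta := h)) => //.
- by case: gy.
- by move=> w wT; exact: (normal_dot fr).
- by have [dD _] := hD; rewrite vderB // Dx Dy subrr.
- exact: (nondeg_generic hk1 normal_in_k1 (generic_normal_neq0 r0 gmu) gy).
Qed.

Hypothesis rS : ratl k (secant_cone A).
Hypothesis nS : secant_cone A <> [set: 'rV[K]_m].

Let gyx : generic (adj k x) A y.
Proof. by apply: generic_sub gy; exact: sub_adj. Qed.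

Theorem sker_sum_proper : (\dim (L + tang A y) < \dim (T + tang A y))%N.
Proof.
have LT : (L <= T)%VS by apply/subvP => e /(skerP F A)[].
rewrite ltnNge; apply/negP => le.
have LE : (L + tang A y = T + tang A y)%VS.
  by apply/eqP; rewrite eqEdim le addvS.
have [ck1 _] := fr_sub fr; have hck := fr_sub fr.
have tz := secant_tsp hck rA (fr_gen fr) gyx.
have gz := generic_secant Kunc hck Acl (sc_prime sc) rA (fr_gen fr) gyx.
have [SAcl _ _] := secant_ccone (sc_cone sc).
have chk : csubring (adj k h) by exact: adj_csubring.
have gz' : generic (adj k h) (secant_cone A) (x + y).
  apply: (generic_extend Kunc SAcl (secant_prime (sc_prime sc)) hk chk (sub_adj h hk) (ratl_kdef rS) gz).
  rewrite tz -LE; apply: dimvS; apply/subvP => _ /memv_addP[e eL [w wT ->]].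
  have [D [hD Dx Dh Dy]] := sker_der2 eL wT; apply/tspP; exists D; split; first exact/Der_adj.
  by have [dD _] := hD; rewrite vderD // Dx Dy.
have xL : x \in L := x_sker fr Asc mu.
have Lh : L = orth (tsp k h) by rewrite (orth_tsp_normal fr gmu).
(* Reflexivity: [x] is normal to the dual cone at [h], so it is a combination of gradients at [h] of
   polynomials over [k] that vanish at [h]. *)
rewrite Lh in xL; have [r1 [P [c [Pk xE]]]] := orth_tsp_grads hk xL.
(* [grad (P i) h] lies in [L], so it is tangent to the secant cone at [x + y]. This is a condition
   with coefficients in [adj k h], over which [x + y] is generic; hence it holds at every [z]. *)
have Pz i (g : {mpoly K[m]}) : over k g -> vanish (secant_cone A) g -> forall z, secant_cone A z ->
    dot (grad g z) (grad (P i) h) = 0.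
  move=> gk gS.
  pose q : {mpoly K[m]} := \sum_(j < m) grad (P i) h 0 j *: g^`M(j).
  have qE (z : 'rV[K]_m) : q.@[z 0] = dot (grad g z) (grad (P i) h).
    by rewrite /q raddf_sum; apply: eq_bigr => j _ /=; rewrite mevalZ !mxE mulrC.
  suff qS : vanish (secant_cone A) q by move=> z Sz; rewrite -qE; exact: qS.
  have [_ gz2] := gz'; apply: gz2.
    apply: over_sum => [|j _]; first by case: chk.
    apply: overZ; [by case: chk| |by apply: over_deriv => [|l]; [case: chk | apply: sub_adj]].
    rewrite mxE; apply: over_eval; [by case: chk | | by move=> a; exact: mem_adj].
    by move=> l; apply: sub_adj => //; apply: over_deriv => //; case: (Pk i).
  rewrite qE; have : grad (P i) h \in tang (secant_cone A) (x + y).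
    rewrite -(generic_tsp hk (ratl_kdef rS) gz) tz.
    apply: (subvP (addvSl _ _)); apply: (subvP LT); rewrite Lh; apply/orthP => v.
    by move=> /(tsp_prescribe _ _ hk) hv; rewrite dotC; have [P1 P2] := Pk i; exact: hv.
  by move/tangP => /(_ g gS).
(* At a point [z] generic over [adj k x], [Pz] and [xE] give [dot (grad g z) x = 0]. The pair
   [(x, z)] being generic, [x] may be replaced by any vector of [A] and [z] by [x + y], and
   non-degeneracy kills the gradient. *)
have grad0 (g : {mpoly K[m]}) : over k g -> vanish (secant_cone A) g -> grad g (x + y) = 0.
  move=> gk gS; apply/eqP/negPn/negP => g0; have [v Av] := sc_nondeg sc g0.
  move/negP; apply; apply/eqP.
  have [z2 gz2] := exists_generic Kunc (adj_csubring x hck) SAcl (secant_prime (sc_prime sc)).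
  have [_ gen2] := generic_pair Kunc hck Acl SAcl (sc_prime sc) (secant_prime (sc_prime sc)) rA rS (fr_gen fr) gz2.
  have /choice[X hX] (j : 'I_m) := @lift_fst K m m k 'X_j hk (overX _ hk).
  have /choice[Z hZ] (j : 'I_m) := @lift_snd K m m k g^`M(j) hk (over_deriv j hk gk).
  pose Q := \sum_j Z j * X j.
  have QE (u z : 'rV[K]_m) : Q.@[(row_mx u z) 0] = dot (grad g z) u.
    rewrite /Q raddf_sum; apply: eq_bigr => j _ /=.
    by rewrite mevalM; have [_ ->] := hX j; have [_ ->] := hZ j; rewrite mevalXU !mxE.
  have Qk : over k Q.
    by apply: over_sum => // j _; apply: overM => //; [case: (hZ j) | case: (hX j)].
  rewrite -QE; apply: (gen2 Q Qk); last by apply/prodset_row; split=> //; case: gz.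
  rewrite QE xE mulmx_sum_row dot_sumr big1 // => i _; rewrite dotZr rowK Pz ?mulr0 //.
  by case: gz2.
apply: nS; rewrite eqEsubset; split=> // v _; apply: SAcl => p /rS[n [a [g [hg ->]]]].
rewrite raddf_sum big1 // => i _ /=; rewrite mevalZ; have [gk gS] := hg i.
suff -> : g i = 0 by rewrite meval0 mulr0.
apply: (over_partials_indep (x := x + y) hk _ gk); last by apply: gS; case: gz.
rewrite (generic_tsp hk (ratl_kdef rS) gz); apply/vspaceP => w; rewrite memvf.
apply/tangP => q /rS[n' [a' [g' [hg' ->]]]].
rewrite (_ : grad _ _ = 0) ?dot0l //; elim/big_rec: _ => [|j q' _ IH].
  by apply/rowP => j; rewrite !mxE mderiv0 meval0.
by rewrite grad_is_additive IH gradZ addr0; have [? ?] := hg' j; rewrite grad0 ?scaler0.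
Qed.

End Inequality.

(** * The dual cone *)

Section DualCone.
Variables (K : numClosedFieldType) (m d : nat).
Hypothesis Kunc : ~ countable [set: K].
Variable A : set 'rV[K]_m.
Hypotheses (sc : smooth_cone A d) (m0 : (0 < m)%N).
Implicit Types (k : set K) (h x v : 'rV[K]_m).

Let cA := sc_cone sc.
Let Asc : forall c v, A v -> A (c *: v). Proof. by case: cA. Qed.
Let Acl : algclosed A. Proof. by case: cA. Qed.

Definition dual_cone : set 'rV[K]_m :=
  [set h | exists x, [/\ A x, x != 0 & forall v, v \in tang A x -> dot h v = 0]].

Lemma ratl_full (B : set 'rV[K]_m) : ratl [set: K] B.
Proof.
move=> p hp; exists 1%N, (fun=> 1), (fun=> p); split=> //.
by rewrite big_ord1 scale1r.
Qed.

Lemma cone_nonzero : exists2 x, A x & x != 0.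
Proof.
have [|v Av hv] := sc_nondeg sc (h := delta_mx 0 (Ordinal m0)).
  by apply/matrix0Pn; exists 0, (Ordinal m0); rewrite mxE !eqxx oner_eq0.
by exists v => //; apply: contraNneq hv => ->; rewrite dot0r.
Qed.

(** Closedness comes from elimination of [x]. The equations are those of [A] and the minors of size
    [1 + r] of the matrix with rows [a] and gradients of equations: at a nonzero [x] of [A] they
    vanish exactly when [a] is conormal there, the gradients spanning a space of dimension [r]. *)
Lemma dual_cone_ccone : ccone dual_cone.
Proof.
have [x1 Ax1 x1n] := cone_nonzero.
have D0 : dual_cone 0 by exists x1; split=> // v _; rewrite dot0l.
split=> // [a0 ha|c h [x [Ax x0 hx]]]; last first.
  by exists x; split=> // v vT; rewrite dotZl hx ?mulr0.
apply: contrapT => nD.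
pose r := (m - d)%N.
pose Mx (f : 'I_(1 + r) -> {mpoly K[m]}) (g : 'I_(1 + r) -> 'I_m) : 'M[{mpoly K[m]}]_(1 + r) :=
  \matrix_(i, j) (f i)^`M(g j).
pose i0 : 'I_(1 + r) := lshift r 0.
pose mn f g (a : 'rV[K]_m) := \det (repl_row (Mx f g) i0 (fun j => (a 0 (g j))%:MP)).
pose G := [set q : nat * ('rV[K]_m -> {mpoly K[m]}) |
  (exists e, [/\ e \is q.1.-homog, vanish A e & q.2 = fun=> e]) \/
  exists f (e : 'I_(1 + r) -> nat) g, [/\ forall i, vanish A (f i), forall i, f i \is (e i).-homog,
    q.1 = (\sum_i (if i == i0 then 0 else (e i).-1))%N & q.2 = mn f g]].
have mnE f g (a x : 'rV[K]_m) : (mn f g a).@[x 0] =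
   \det (colsub g (\matrix_i (if i == i0 then a else grad (f i) x))).
  rewrite /mn -det_map_mx; congr (\det _); apply/matrixP => i j; rewrite !mxE.
  by case: eqP => _; rewrite ?mxE //= mevalC.
have [q|x hx|P [[P' hP] Pa P0]] := @elimination K m m Kunc G a0.
- case=> [[e [he _ ->]]|[f [e [g [fA fe -> ->]]]]].
    by split=> // l; exists (e@_l)%:MP => a; rewrite mevalC.
  split=> [a|l].
    apply: det_homog => i j; rewrite mxE; case: eqP => _; last by rewrite mxE; exact: mderiv_homog.
    by rewrite -[X in X \is _]mulr1 mul_mpolyC; apply: rpredZ; exact: dhomog1.
  exists (\sum_j (cofactor (Mx f g) i0 j)@_l *: 'X_(g j)) => a.
  rewrite /mn det_repl_row !raddf_sum /=; apply: eq_bigr => j _.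
  by rewrite mul_mpolyC mcoeffZ mevalZ mevalXU mulrC.
- have Ax : A x.
    apply: Acl => p hp; rewrite (pihomog_partitionE (leqnn (mmeasure mdeg p))) raddf_sum big1 // => e _.
    apply: (hx (val e, fun=> pihomog mdeg e p)); left; exists (pihomog mdeg e p).
    by split=> //=; [exact: pihomogP | exact: vanish_homog].
  apply/eqP/negPn/negP => x0.
  have [f [e [fk fe ff fo]]] := equations_at cA (@subring_setT K) (@ratl_full A) (sc_smooth sc) Ax x0.
  have [v vT av] : exists2 v, v \in tang A x & dot a0 v != 0.
    apply: contrapT => no; apply: nD; exists x; split=> // v vT.
    by apply/eqP/negPn/negP => av; apply: no; exists v.
  pose M := col_mx a0 (\matrix_i grad (f i) x).
  have Mf : row_free M.
    rewrite -kermx_eq0; apply/rowV0P => c /sub_kermxP; rewrite -[c]hsubmxK mul_row_col => h.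
    have c0 : lsubmx c = 0.
      have : dot (lsubmx c *m a0 + rsubmx c *m \matrix_i grad (f i) x) v = 0 by rewrite h dot0l.
      rewrite dotDl [X in _ + X](_ : _ = 0) ?addr0; last first.
        have : rsubmx c *m (\matrix_i grad (f i) x) \in orth (tang A x).
          by rewrite fo; apply/rowvsP; exists (rsubmx c).
        by move/orthP => /(_ v vT); rewrite dotC.
      rewrite [lsubmx c]mx11_scalar mul_scalar_mx dotZl => /eqP; rewrite mulf_eq0 (negPf av) orbF.
      by move/eqP => ->; rewrite raddf0.
    rewrite c0 mul0mx add0r in h; have -> : rsubmx c = 0 by apply: (row_free_inj ff); rewrite h mul0mx.
    by rewrite c0 row_mx0.
  have [g hg] := row_free_cols Mf.
  pose f' (i : 'I_(1 + r)) := if fintype.split i is inr j then f j else 0.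
  pose e' (i : 'I_(1 + r)) := if fintype.split i is inr j then e j else 0%N.
  have : (mn f' g a0).@[x 0] = 0.
    apply: (hx (_, mn f' g)); right; exists f', e', g; split=> // i; rewrite /f' /e'.
      by case: fintype.split => j; [move=> w _; rewrite meval0 | case: (fk j)].
    by case: fintype.split => j; [exact: dhomog0 | exact: fe].
  rewrite mnE (_ : \matrix_i _ = M) => [h|]; first by move: hg; rewrite unitmxE unitfE h eqxx.
  apply/row_matrixP => i; rewrite rowK /f'; case: (split_ordP i) => j ->.
    by rewrite (ord1 j) eqxx rowKu; apply/rowP => b; rewrite !mxE.
  by rewrite eq_rlshift rowKd rowK.
- move/eqP: Pa; apply; rewrite hP; apply: ha => h [x [Ax x0 hx]]; rewrite -hP.
  apply: (P0 _ x x0) => q [[e [_ eA ->]]|[f [e [g [fA _ _ ->]]]]]; first exact: eA.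
  rewrite mnE; apply/eqP/negPn/negP => dn.
  set M := \matrix_i _ in dn.
  have Mf : row_free M by apply: (unit_cols_row_free (f := g)); rewrite unitmxE unitfE.
  have : (\dim (rowvs M) <= \dim (orth (tang A x)))%N.
    apply/dimvS/subvP => _ /rowvsP[c ->]; apply/orthP => w wT.
    rewrite dotC mulmx_sum_row dot_suml big1 // => i _; rewrite dotZl rowK.
    by case: eqP => _; [rewrite hx // mulr0 | move/tangP: wT => -> //; rewrite mulr0].
  by rewrite dim_rowvs // dim_orth (sc_smooth sc Ax x0) ltnn.
Qed.

Lemma frame_transfer k x x' r (F : 'I_r -> {mpoly K[m]}) : frame A k x F -> generic k A x' -> frame A k x' F.
Proof.
move=> fr gx'; have [hk rA gx Fk Ff fo] := fr; have [rk _] := hk; have [Ax' _] := gx'.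
have Ff' : row_free (grads F x').
  have [g hg] := row_free_cols Ff; apply: (unit_cols_row_free (f := g)).
  move: hg; rewrite !unitmxE !unitfE; apply: contraNneq => h.
  have jk : over k (jac F g) by apply: jac_over => // i; case: (Fk i).
  have [_ gen'] := gx'; have := gen' _ jk; rewrite jac_eval h => /(_ erefl) hv.
  by rewrite -jac_eval hv //; case: gx.
split=> //; apply/esym/eqP; rewrite eqEdim; apply/andP; split.
  apply/subvP => _ /rowvsP[c ->]; apply/orthP => w /tangP wT.
  rewrite dotC mulmx_sum_row dot_suml big1 // => i _; rewrite dotZl rowK wT ?mulr0 //.
  by case: (Fk i).
rewrite dim_rowvs // -(dim_rowvs Ff) -fo !dim_orth.
rewrite -(generic_tsp rk (ratl_kdef rA) gx) -(generic_tsp rk (ratl_kdef rA) gx').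
by rewrite (generic_dim rk gx gx').
Qed.

Lemma grads_poly k r (F : 'I_r -> {mpoly K[m]}) (p : {mpoly K[m]}) : subring k -> over k p ->
  (forall i, over k (F i)) -> exists P : {mpoly K[m + r]}, over k P /\
    forall (x : 'rV[K]_m) (c : 'rV[K]_r), P.@[(row_mx x c) 0] = p.@[(c *m grads F x) 0].
Proof.
move=> hk hp Fk.
have /choice[C hC] (i : 'I_r) := @lift_snd K m r k 'X_i hk (overX _ hk).
have /choice[Z hZ] (ij : 'I_r * 'I_m) := @lift_fst K m r k (F ij.1)^`M(ij.2) hk (over_deriv ij.2 hk (Fk ij.1)).
have [j|P [Pk hP]] := @comp_poly K k _ (m + r) p (fun j => \sum_i C i * Z (i, j)) hk hp.
  by apply: over_sum => // i _; apply: overM => //; [case: (hC i) | case: (hZ (i, j))].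
exists P; split=> // x c; rewrite hP; apply: meval_eq => j; rewrite raddf_sum mxE.
apply: eq_bigr => i _ /=; have [_ e1] := hC i; have [_ e2] := hZ (i, j).
by rewrite mevalM e1 e2 mevalXU !mxE.
Qed.

Lemma generic_dual k x (F : 'I_(m - d) -> {mpoly K[m]}) mu : frame A k x F ->
  generic (adj k x) [set: 'rV[K]_(m - d)] mu -> generic k dual_cone (mu *m grads F x).
Proof.
move=> fr gmu; have [hk rA gx Fk Ff fo] := fr; have [rk _] := hk; have [Ax _] := gx.
have x0 := generic_neq0 sc m0 hk gx.
split; first by exists x; split=> // v vT; exact: (normal_dot fr).
move=> p hp pm h [x' [Ax' x'0 hx']].
have Fo i : over k (F i) by case: (Fk i).
have [P [Pk hP]] := grads_poly rk hp Fo.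
have [_ gen] := generic_pair Kunc hk Acl (@setT_closed K _) (sc_prime sc) (@setT_prime K _) rA (ratl_setT rk) gx gmu.
have Pv : vanish (prodset A [set: 'rV[K]_(m - d)]) P.
  by apply: gen => //; rewrite hP.
(* The gradients of [F] may become dependent at [x']. So [h] is written with equations [f] adapted
   to [x'], and the same coefficients [c] are carried to a generic [y], where [F] is again a
   frame. *)
have [f [e [fk fe ff fo']]] := equations_at cA rk rA (sc_smooth sc) Ax' x'0.
have [c hE] : exists c, h = c *m grads f x'.
  by apply/rowvsP; rewrite -/(grads f x') -fo'; apply/orthP => v vT; rewrite dotC; exact: hx'.
have fo'' i : over k (f i) by case: (fk i).
have [Q [Qk hQ]] := grads_poly rk hp fo''.
have [q [qk qE]] := plug_right c rk Qk.
have hkc := adj_csubring c hk.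
have [y gy] := exists_generic Kunc hkc Acl (sc_prime sc); have [Ay _] := gy.
have fry := frame_transfer fr (generic_sub (sub_adj c rk) gy).
have qA : vanish A q.
  have [_ geny] := gy; apply: geny => //; rewrite qE hQ.
  have [b ->] : exists b, c *m grads f y = b *m grads F y.
    apply: (normal_coef fry) => v vT; rewrite mulmx_sum_row dot_suml big1 // => i _.
    by rewrite dotZl rowK; move/tangP: vT => ->; [rewrite mulr0 | case: (fk i)].
  by rewrite -hP; apply: Pv; apply/prodset_row.
by rewrite hE -hQ -qE; exact: qA.
Qed.

Lemma exists_csubring_over k q (n : nat) (f : 'I_n -> {mpoly K[q]}) : csubring k ->
  exists k', [/\ csubring k', k `<=` k' & forall i, over k' (f i)].
Proof.
move=> [rk ck].
have [k' [hk' Sk']] : exists k', csubring k' /\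
    k `|` \bigcup_(i in [set: 'I_n]) [set (f i)@_x | x in [set` msupp (f i)]] `<=` k'.
  apply: exists_csubring; apply: countableU => //; apply: bigcup_countable => // i _.
  exact/countable_image/finite_set_countable/finite_seq.
exists k'; split=> // [c kc|i x]; first by apply: Sk'; left.
have [xf|xf] := boolP (x \in msupp (f i)).
  by apply: Sk'; right; exists i => //; exists x.
by rewrite memN_msupp_eq0 //; apply: subring0; case: hk'.
Qed.

Lemma exists_csubring_ratl (B : set 'rV[K]_m) k : csubring k ->
  exists k', [/\ csubring k', k `<=` k' & ratl k' B].
Proof.
move=> [rk ck]; have [C [cC hC]] := exists_ratl B.
have [k' [hk' Sk']] : exists k', csubring k' /\ k `|` C `<=` k'.
  by apply: exists_csubring; apply: countableU.
exists k'; split=> // [c kc|]; first by apply: Sk'; left.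
by apply: hC => [|c Cc]; [case: hk' | apply: Sk'; right].
Qed.

Lemma dual_cone_prime : algprime dual_cone.
Proof.
have [x1 Ax1 x1n] := cone_nonzero.
split; first by exists 0; exists x1; split=> // v _; rewrite dot0l.
move=> p q pq.
have [k0 [hk0 _]] := exists_csubring (@countable0 K).
have [k1 [hk1 _ pk]] := exists_csubring_over (fun i : 'I_2 => if val i == 0%N then p else q) hk0.
have [k [hk k1k rA]] := exists_csubring_ratl A hk1; have [rk _] := hk.
have [x [F fr]] := exists_frame Kunc sc m0 hk rA.
have [mu gmu] := exists_generic Kunc (adj_csubring x hk) (@setT_closed K (m - d)) (@setT_prime K _).
have [Dh gen] := generic_dual fr gmu.
have /eqP := pq _ Dh; rewrite mevalM mulf_eq0 => /orP[] /eqP h0; [left | right]; apply: gen => //.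
  by move=> l; apply: k1k; exact: (pk ord0 l).
by move=> l; apply: k1k; exact: (pk (Ordinal (isT : (1 < 2)%N)) l).
Qed.

End DualCone.

(** * From projective varieties to cones *)

Section Bridge.
Variables (K : numClosedFieldType) (N : nat).
Hypothesis Kunc : ~ countable [set: K].
Local Notation pt := (pspace K N).
Local Notation m := N.+1.
Implicit Types (x y : pt) (v w : 'rV[K]_m) (A : set 'rV[K]_m) (p q : {mpoly K[m]}) (k : set K).

Lemma tang_homog A a w : ccone A ->
  (forall p e, p \is e.-homog -> vanish A p -> dot (grad p a) w = 0) -> w \in tang A a.
Proof.
move=> [_ _ Asc] h; apply/tangP => p hp.
rewrite (pihomog_partitionE (leqnn (mmeasure mdeg p))).
elim/big_ind: _ => [|p1 p2 h1 h2|e _].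
- by rewrite -dird_dot -mpolyC0 dirdC.
- by rewrite grad_is_additive dotDl h1 h2 addr0.
- by apply: (h _ e); [exact: pihomogP | exact: vanish_homog].
Qed.

Lemma tang_scale A c a : ccone A -> c != 0 -> tang A (c *: a) = tang A a.
Proof.
move=> cA; suff h c' a' : c' != 0 -> (tang A a' <= tang A (c' *: a'))%VS.
  move=> c0; apply/eqP; rewrite eqEsubv h // andbT.
  by rewrite -{2}[a]scale1r -(mulVf c0) -scalerA h // invr_eq0.
move=> c0; apply/subvP => w /tangP wT; apply: tang_homog => // p e pe pA.
have -> : grad p (c' *: a') = c' ^+ e.-1 *: grad p a'.
  by apply/rowP => i; rewrite !mxE (meval_homog_scale _ _ (mderiv_homog i pe)).
by rewrite dotZl wT // mulr0.
Qed.

Variable X : set pt.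
Hypotheses (hX : manifold X) (ndX : non_degenerate X) (N0 : (0 < N)%N).
Hypothesis SX : secant_variety X <> setT.
Local Notation A := (cone X).
Local Notation d := (krull_dim X).+1.

Let Xcl : zariski_closed X. Proof. by case: hX. Qed.
Let Xirr : irreducible X. Proof. by case: hX. Qed.
Let cA : ccone A. Proof. exact: closed_ccone. Qed.

Lemma vanish_cone p : homogeneous p -> (forall z, X z -> zero_at p z) ->
  forall z, X z -> forall v, v \in val z -> p.@[v 0] = 0.
Proof.
move=> [e he] hp z Xz v; rewrite val_coords => /vlineP[c ->].
by rewrite (meval_homog_scale _ _ he) (hp z Xz) mulr0.
Qed.

Lemma tangent_spaceE x : X x -> tangent_space X x = [set y | coords y \in tang A (coords x)].
Proof.
move=> Xx; rewrite eqEsubset; split=> y hy.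
  apply: tang_homog => // p e pe pA; rewrite -[RHS](hy p).
  - by apply: eq_bigr => i _; rewrite mxE.
  - by exists e.
  - by move=> z Xz; apply: pA; apply/cone_coords.
move=> p hp pX; have [e he] := hp; move/tangP: hy => hy.
have dz v : A v -> v != 0 -> p.@[v 0] = 0.
  by case=> [->|[z Xz vz]]; [rewrite eqxx | move=> _; exact: (vanish_cone hp pX Xz vz)].
(* A constant that vanishes on the nonempty [X] is zero; in positive degree vanishing extends to the
   vertex. *)
have [e0|e0] := posnP e.
  have pc : p = 0.
    have pE : (msize p <= 1)%N by have := msize_homog he; rewrite e0.
    have [c cE] : exists c, p = c%:MP by exists p@_0; exact: msize1_polyC.
    by have := pX x Xx; rewrite /zero_at cE mevalC => ->.
  by rewrite big1 // => i _; rewrite pc mderiv0 meval0 mul0r.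
rewrite -[RHS](hy p).
  by apply: eq_bigr => i _; rewrite mxE.
move=> v Av; have [->|v0] := eqVneq v 0; last exact: dz.
by rewrite -(scale0r (coords x)) (meval_homog_scale _ _ he) expr0n gtn_eqF // mul0r.
Qed.

Lemma smooth_cone_of_manifold : smooth_cone A d.
Proof.
have [pA _] := irreducible_cone Xcl Xirr.
split; [exact: cA | exact: pA | move=> v Av v0 | move=> h h0].
  have [v00|[x Xx vx]] := Av; first by rewrite v00 eqxx in v0.
  have [c [c0 cE]] := coords_of (point_eq vx v0) v0.
  rewrite -(tang_scale v cA c0) -cE.
  have [_ _ /(_ x Xx)[U dU UE]] := hX; rewrite -dU; congr (\dim _).
  apply/vspaceP => w; have [->|w0] := eqVneq w 0; first by rewrite !mem0v.
  have [y yw] := point_of w0; have [b [b0 bE]] := coords_of yw w0.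
  have : tangent_space X x y <-> (val y <= U)%VS by rewrite UE.
  rewrite tangent_spaceE //= bE val_coords bE -memvE.
  have sc (W : {vspace 'rV[K]_m}) : (b *: w \in W) = (w \in W).
    apply/idP/idP => [/(memvZ b^-1)|/memvZ]; last exact.
    by rewrite scalerA mulVf // scale1r.
  by rewrite !sc => -[h1 h2]; apply/idP/idP.
have [a ah] := point_of h0; have [b [b0 bE]] := coords_of ah h0.
have [x [Xx xh]] : exists x, X x /\ ~ hyperplane a x.
  by apply: contrapT => no; apply: (ndX (a := a)) => x Xx; apply: contrapT => nx; apply: no; exists x.
exists (coords x); first by apply/cone_coords.
apply/eqP => h1; apply: xh; rewrite /hyperplane /= -/(dot _ _) bE dotZl h1 mulr0 //.
Qed.

Lemma dual_varietyE : dual_variety X = proj (dual_cone A).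
Proof.
rewrite eqEsubset; split=> a.
  move=> [x Xx]; rewrite tangent_spaceE // => h.
  exists (coords x); split; [by apply/cone_coords | exact: coords_neq0 |].
  move=> v vT; have [->|v0] := eqVneq v 0; first by rewrite dot0r.
  have [y yv] := point_of v0; have [b [b0 bE]] := coords_of yv v0.
  have /h : coords y \in tang A (coords x) by rewrite bE memvZ.
  rewrite /hyperplane /= -/(dot _ _) bE dotZr => /eqP.
  by rewrite mulf_eq0 (negPf b0) => /eqP.
move=> [v [[->|[x Xx vx]] v0 hv]]; first by rewrite eqxx in v0.
exists x => // y; have [c [c0 cE]] := coords_of (point_eq vx v0) v0.
by rewrite tangent_spaceE //= cE tang_scale // => /hv.
Qed.

Lemma two_points : exists x y, [/\ X x, X y & x <> y].
Proof.
have [[x Xx] _] := Xirr; apply: contrapT => no.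
have oneX y : X y -> y = x by move=> Xy; apply: contrapT => yx; apply: no; exists y, x.
have : orth <[coords x]> != 0%VS.
  by rewrite -dimv_eq0 dim_orth dim_vline coords_neq0 subSS subn0 -lt0n.
move=> o0; have := memv_pick (orth <[coords x]>); have : vpick (orth <[coords x]>) != 0 by rewrite vpick0.
set h := vpick _ => h0 /orthP ho; have [v [->|[y Xy vy]] hv] := sc_nondeg smooth_cone_of_manifold h0.
  by rewrite dot0r eqxx in hv.
by move: vy hv; rewrite (oneX y Xy) val_coords => vx; rewrite dotC ho ?eqxx.
Qed.

Lemma secant_varietyE : secant_variety X = proj (secant_cone A).
Proof.
have [x1 [x2 [Xx1 Xx2 x12]]] := two_points.
have cS := secant_ccone cA.
rewrite /secant_variety; set S0 := [set z | _].
have sums u v : A u -> A v -> cone S0 (u + v).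
  (* A second point of [X] is needed here: a point of [X] lies on a secant line once there is
     another one to join it to. *)
  have one w : A w -> cone S0 w.
    case=> [->|[x Xx wx]]; [by left | right; exists x => //].
    have [y [Xy xy]] : exists y, X y /\ x <> y.
      by have [xx1|nx] := pselect (x = x1); [exists x2; rewrite xx1 | exists x1].
    by exists x, y; split=> //; rewrite /join_line /= addvSl.
  case=> [->|[x Xx ux]]; first by rewrite add0r; exact: one.
  case=> [->|[y Xy vy]]; first by rewrite addr0; apply: one; right; exists x.
  have [xy|xy] := pselect (x = y); first by apply: one; right; exists x => //; rewrite memvD // xy.
  have [->|uv0] := eqVneq (u + v) 0; first by left.
  have [z zE] := point_of uv0; right; exists z; last by rewrite zE memv_line.
  by exists x, y; split=> //; rewrite /join_line /= zE -memvE memv_add.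
rewrite eqEsubset; split.
  apply: bigcap_inf; split; first exact: proj_closed.
  move=> z [x [y [Xx Xy xy]]]; rewrite /join_line /= => zxy; rewrite /proj /=.
  have : coords z \in (val x + val y)%VS by apply: (subvP zxy); rewrite val_coords memv_line.
  by move=> /memv_addP[u ux [v vy ->]]; apply: secant_sum; right; [exists x | exists y].
move=> z Sz C [cC SC]; have cC' := closed_ccone cC; have [Ccl _ _] := cC'.
apply/cone_coords; apply: Ccl => p hp; apply: Sz => u v Au Av.
by apply: hp; apply: (cone_mono SC); exact: sums.
Qed.

Lemma krull_proj (B : set 'rV[K]_m) k a : ccone B -> algprime B -> (exists2 v, B v & v != 0) -> csubring k ->
  ratl k B -> generic k B a -> (krull_dim (proj B)).+1 = \dim (tsp k a).
Proof.
move=> cB pB B0 hk rB gB; apply: krull_dimE => //; rewrite ?projK //; first exact: proj_closed.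
exact: proj_irreducible.
Qed.

Lemma full_tsp_setT (B : set 'rV[K]_m) k a : algclosed B -> csubring k -> ratl k B -> generic k B a ->
  tsp k a = fullv -> B = [set: 'rV[K]_m].
Proof.
move=> Bcl [rk _] rB [Bx _] tf; rewrite eqEsubset; split=> // v _.
apply: Bcl => q /rB[n [b [g [hg ->]]]]; rewrite raddf_sum big1 // => i _ /=; rewrite mevalZ.
have [gk gB] := hg i; rewrite (over_partials_indep rk tf gk) ?meval0 ?mulr0 //.
exact: gB.
Qed.

Let sc := smooth_cone_of_manifold.

Lemma secant_proper : secant_cone A <> [set: 'rV[K]_m].
Proof.
by move=> h; apply: SX; rewrite secant_varietyE h eqEsubset.
Qed.

Lemma codim_pos : (0 < m - d)%N.
Proof.
rewrite subn_gt0 ltnNge; apply/negP => md; apply: secant_proper.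
have [k0 [hk0 _]] := exists_csubring (@countable0 K).
have [k [hk _ rA]] := exists_csubring_ratl A hk0; have [rk _] := hk.
have [Acl _ _] := cA.
have [x gx] := exists_generic Kunc hk Acl (sc_prime sc); have [Ax _] := gx.
have x0 := generic_neq0 sc (ltn0Sn _) hk gx.
have tf : tsp k x = fullv.
  apply/eqP; rewrite eqEdim subvf dim_full_row (generic_tsp rk (ratl_kdef rA) gx).
  by rewrite (sc_smooth sc Ax x0).
have AT := full_tsp_setT Acl hk rA gx tf.
by rewrite eqEsubset; split=> // v _ p hp; rewrite -(addr0 v); apply: hp; rewrite AT.
Qed.

Theorem cone_data : exists k (x y : 'rV[K]_m) (F : 'I_(m - d) -> {mpoly K[m]}) mu,
  [/\ frame A k x F, generic (adj k x) [set: 'rV[K]_(m - d)] mu, generic (adj (adj k x) mu) A y,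
      ratl k (secant_cone A) &
      (krull_dim (secant_variety X)).+1 = \dim (tang A x + tang A y) /\
      ((krull_dim (dual_variety X)).+1 + \dim (sker F A x mu) = m)%N].
Proof.
have [k0 [hk0 _]] := exists_csubring (@countable0 K).
have [k1 [hk1 _ rA1]] := exists_csubring_ratl A hk0.
have [k2 [hk2 k12 rS2]] := exists_csubring_ratl (secant_cone A) hk1.
have [k [hk k2k rD]] := exists_csubring_ratl (dual_cone A) hk2.
have rA : ratl k A by apply: ratl_sub rA1 => c /k12 /k2k.
have rS : ratl k (secant_cone A) by exact: ratl_sub rS2.
have [Acl _ _] := cA; have pA := sc_prime sc; have [rk _] := hk.
have [x [F fr]] := exists_frame Kunc sc (ltn0Sn _) hk rA.
have gx := fr_gen fr.
have [mu gmu] := exists_generic Kunc (adj_csubring x hk) (@setT_closed K (m - d)) (@setT_prime K _).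
have [y gy] := exists_generic Kunc (adj_csubring mu (adj_csubring x hk)) Acl pA.
have gyx : generic (adj k x) A y by apply: generic_sub gy; apply: sub_adj; exact: adj_subring.
exists k, x, y, F, mu; split=> //; split.
  rewrite secant_varietyE -(secant_tsp hk rA gx gyx).
  apply: krull_proj => //; [exact: secant_ccone | exact: secant_prime | | exact: generic_secant].
  have [v Av v0] := cone_nonzero sc (ltn0Sn _); exists v => //.
  by rewrite -(addr0 v); apply: secant_sum => //; case: cA.
rewrite dual_varietyE (krull_proj (dual_cone_ccone Kunc sc (ltn0Sn _)) (dual_cone_prime Kunc sc (ltn0Sn _)) _ hk rD (generic_dual Kunc sc (ltn0Sn _) fr gmu)).
  by rewrite -(orth_tsp_normal fr gmu) dim_orth subnKC // dim_leq.
exists (mu *m grads F x); last exact: (generic_normal_neq0 fr codim_pos gmu).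
by case: (generic_dual Kunc sc (ltn0Sn _) fr gmu).
Qed.

End Bridge.

(** * Second fundamental form in the equality case *)

Section KernelBound.
Variables (K : numClosedFieldType) (m d : nat).
Hypothesis Kunc : ~ countable [set: K].
Implicit Types (u v w x y e : 'rV[K]_m) (k : set K).

(** The coefficients of the linear equations of the tangent space at [y] are gradients at [y], and
    these are constant along with [y]. *)
Lemma tang_der_stable k (A : set 'rV[K]_m) D y w : subring k -> ratl k A -> Der k D -> vder D y = 0 ->
  w \in tang A y -> vder D w \in tang A y.
Proof.
move=> hk rA hD Dy /tangP wT; have [dD _] := hD; apply/tangP => p /rA[n [c [g [hg ->]]]].
rewrite (_ : grad _ y = \sum_i c i *: grad (g i) y); last first.
  elim/big_rec2: _ => [|i y1 y2 _ <-]; last by rewrite grad_is_additive gradZ.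
  by apply/rowP => j; rewrite !mxE mderiv0 meval0.
rewrite dot_suml big1 // => i _; rewrite dotZl; have [gk gA] := hg i.
have := vder_dot (grad (g i) y) w dD; rewrite wT // der0 // (vder_grad y hD hk gk) Dy mul0mx dot0l add0r.
by move=> <-; rewrite mulr0.
Qed.

(** The last hypothesis makes [v] algebraic over [k], and adjoining algebraic elements leaves the
    velocity space unchanged. *)
Lemma generic_const k (A : set 'rV[K]_m) q (v : 'rV[K]_q) y : csubring k -> algclosed A -> algprime A ->
  ratl k A -> generic k A y -> (forall D, Der k D -> vder D v = 0) -> generic (adj k v) A y.
Proof.
move=> hk Acl Apr rA gy hv; have [rk _] := hk.
apply: (generic_extend Kunc Acl Apr rk (adj_csubring v hk) (sub_adj v rk) (ratl_kdef rA) gy).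
apply/dimvS/subvP => _ /tspP[D [hD ->]]; apply/tspP; exists D; split=> //.
by apply/Der_adj => //; split=> //; exact: hv.
Qed.

Lemma orth_der_stable (U : {vspace 'rV[K]_m}) D : derivation D ->
  (forall u, u \in U -> vder D u \in U) -> forall v, v \in orth U -> vder D v \in orth U.
Proof.
move=> dD hU v /orthP hv; apply/orthP => u uU.
have := vder_dot u v dD; rewrite hv // der0 // hv; last exact: hU.
by rewrite add0r => <-.
Qed.

Variables (A : set 'rV[K]_m) (k : set K) (dS : nat).
Hypotheses (sc : smooth_cone A d) (hk : csubring k) (rA : ratl k A) (m0 : (0 < m)%N).
Hypothesis dimS : forall x y, generic k A x -> generic (adj k x) A y ->
  \dim (tang A x + tang A y) = dS.
Hypothesis dSm : (dS < m)%N.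

Let Acl : algclosed A. Proof. by case: (sc_cone sc). Qed.
Let Asc : forall c v, A v -> A (c *: v). Proof. by case: (sc_cone sc). Qed.
Let Apr := sc_prime sc.
Let rk : subring k. Proof. by case: hk. Qed.

Lemma generic_swap x y : generic k A x -> generic (adj k x) A y ->
  generic k A y /\ generic (adj k y) A x.
Proof.
move=> gx gy; have := generic_pair Kunc hk Acl Acl Apr Apr rA rA gx gy.
by case/(generic_prod rk).
Qed.

Lemma dim_tang_generic x : generic k A x -> \dim (tang A x) = d.
Proof.
by move=> gx; have [Ax _] := gx; apply: (sc_smooth sc) => //; exact: (generic_neq0 sc m0 hk gx).
Qed.

Lemma dim_cap x y : generic k A x -> generic (adj k x) A y ->
  (\dim (tang A x :&: tang A y) + dS = d + d)%N.
Proof.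
move=> gx gy; have [gy' _] := generic_swap gx gy.
by rewrite -(dimS gx gy) addnC dimv_sum_cap !dim_tang_generic.
Qed.

(** [y] remains generic after [v] is adjoined, so [dot v] vanishes on the whole of [A], which is
    non-degenerate. *)
Lemma normal_perp_eq0 k1 y v : k `<=` k1 -> csubring k1 -> generic k1 A y ->
  (forall D, Der k1 D -> vder D v = 0) -> dot v y = 0 -> v = 0.
Proof.
move=> kk1 hk1 gy hv vy; apply/eqP/negPn/negP => v0; move/eqP: vy; apply/negP.
have gv := generic_const hk1 Acl Apr (ratl_sub kk1 rA) gy hv.
have hkv := adj_csubring v hk1; have [rk1 _] := hk1.
apply: (nondeg_generic sc _ _ v0 gv); [by case: hkv | by move=> i; exact: mem_adj].
Qed.

Section Pair.
Variables (x y : 'rV[K]_m) (F : 'I_(m - d) -> {mpoly K[m]}).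
Hypotheses (fr : frame A k x F) (gy : generic (adj k x) A y).
Local Notation T := (tang A x).
Local Notation G := (grads F x).
Local Notation Q := (orth (tang A x + tang A y)).

Let gx := fr_gen fr.

(** Move [x] by [e] and [y] by [- e]. Then [x + y] is fixed, and so are the gradients there of which
    the normal [nu *m G] is a combination; its velocity is therefore again normal to [T]. *)
Lemma cap_sker nu e : nu *m G \in Q -> e \in T -> e \in tang A y -> e \in sker F A x nu.
Proof.
move=> hQ eT eTy; apply/skerP; split=> // v vT.
have [Ax _] := gx; have [Ay _] := gy.
have [D [hD Dx]] := velocity fr eT.
have [|D' [hD' D'x D'y]] := ext_gen (w := - e) (adj_subring x rk) rA (sub_adj x rk) gy _ hD.
  by rewrite memvN.
have D'xE : vder D' x = e by rewrite -Dx; apply/rowP => i; rewrite !vderE D'x //; exact: mem_adj.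
have [dD' _] := hD'.
have Dz : vder D' (x + y) = 0 by rewrite vderD // D'xE D'y subrr.
rewrite -D'xE -(der_normal_dot fr nu hD' vT).
have zT : (tsp k (x + y)) = (T + tang A y)%VS by exact: secant_tsp.
rewrite -zT in hQ; have [r1 [P [c [Pk ->]]]] := orth_tsp_grads rk hQ.
rewrite vder_mulmx // dotDl.
have PT i : dot (grad (P i) (x + y)) v = 0.
  have [p1 p2] := Pk i; apply: (iffLR (tsp_prescribe (x + y) v rk)) p1 p2.
  by rewrite zT; apply: (subvP (addvSl _ _)).
rewrite mulmx_sum_row dot_suml big1 ?add0r => [|i _]; last by rewrite dotZl rowK PT mulr0.
rewrite (_ : map_mx D' _ = 0) ?mulmx0 ?dot0l //.
apply/row_matrixP => i; rewrite row0 -[RHS](mul0mx _ (hess (P i) (x + y))) -Dz.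
have [p1 _] := Pk i; rewrite -(vder_grad _ hD' rk p1); apply/rowP => j; rewrite !mxE.
by [].
Qed.

(** [eta] has generic coefficients in a basis of [Q] that is constant for the derivations fixing [x]
    and [y], so its motion inside [Q] can be prescribed. For [e] in the kernel and in the tangent
    space at [y'], fix [y], move [x] and [y'] by [e] and keep [eta] fixed: [tangency] then gives
    [e = 0]. *)
Lemma kernel_bound k0 : csubring k0 -> adj k x `<=` k0 -> generic k0 A y ->
  exists nu k1, [/\ csubring k1, k0 `<=` k1 /\ (forall i, k1 (y 0 i)) /\ (forall i, k1 ((nu *m G) 0 i)),
    nu *m G \in Q, nu *m G != 0 &
    forall y', generic k1 A y' -> (sker F A x nu :&: tang A y' = 0)%VS].
Proof.
move=> hk0 kx0 gy0; have [rk0 _] := hk0.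
pose k2 := adj (adj k x) y.
have [rkx ckx] := adj_csubring x hk; have ck2 : csubring k2 by exact: adj_csubring.
have k2Der D : Der k2 D -> [/\ Der k D, vder D x = 0 & vder D y = 0].
  by move=> /(Der_adj _ _ rkx)[/(Der_adj _ _ rk)[h1 h2] h3].
have [|D v hD vQ|B [Bf BQ BD]] := @stable_const_basis K m Q (Der k2).
- by move=> D [].
- have [hD' Dx Dy] := k2Der D hD; have [dD _] := hD.
  apply: orth_der_stable => // _ /memv_addP[u uT [w wT ->]].
  by rewrite vderD // memv_add // (tang_der_stable rk rA hD').
pose k3 := adj (adj k0 y) (mxvec B).
have hk0y := adj_csubring y hk0; have [rk0y _] := hk0y.
have hk3 : csubring k3 by exact: adj_csubring.
have [rk3 _] := hk3.
have k0k3 : k0 `<=` k3 by move=> c kc; do 2 apply: sub_adj => //.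
have k2k3 : k2 `<=` k3.
  move=> c [p [pk ->]]; apply: over_eval => // [l|i]; first exact/k0k3/kx0/pk.
  by apply: sub_adj => //; exact: mem_adj.
have BK3 i j : k3 (B i j).
  by rewrite -(mxvecE B i j); exact: mem_adj.
have [c gc] := exists_generic Kunc hk3 (@setT_closed K (\dim Q)) (@setT_prime K _).
pose eta := c *m B.
have etaQ : eta \in Q by apply/BQ; exists c.
have [nu nuE] : exists nu, eta = nu *m G.
  apply: (normal_coef fr) => w wT; rewrite dotC; move/orthP: etaQ; apply.
  exact: (subvP (addvSl _ _)).
have eta0 : eta != 0.
  have dQ : (0 < \dim Q)%N by rewrite dim_orth dimS // subn_gt0.
  apply/eqP => h; have c0 : c = 0 by apply: (row_free_inj Bf); rewrite -/eta h mul0mx.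
  have [_ gen] := gc; have := gen 'X_(Ordinal dQ) (overX _ rk3); rewrite mevalXU c0 mxE => /(_ erefl).
  by move=> /(_ (const_mx 1) I); rewrite mevalXU mxE => /eqP; rewrite oner_eq0.
pose k4 := adj k3 c; have hk4 : csubring k4 by exact: adj_csubring.
have [rk4 _] := hk4.
have etak i : k4 (eta 0 i).
  rewrite mxE; apply: subring_sum => // j _; case: (rk4) => _ _; apply; first exact: mem_adj.
  exact: sub_adj.
exists nu, k4; rewrite -nuE; split=> //.
  split; first by move=> b /k0k3; exact: sub_adj.
  by split=> // i; apply: sub_adj => //; apply: sub_adj => //; exact: mem_adj.
move=> y' gy'; apply/eqP; rewrite -subv0; apply/subvP => e; rewrite memv_cap memv0 => /andP[/skerP[eT he] eTy].
have [gky gxy] := generic_swap gx gy.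
have [Ax _] := gx; have [Ay _] := gy.
have : e \in tsp (adj k y) x.
  by rewrite (generic_tsp (adj_subring y rk) (kdef_sub (sub_adj y rk) (ratl_kdef rA)) gxy).
case/tspP => D0 [hD0 D0x].
have [hD0k D0y] := iffLR (Der_adj y D0 rk) hD0; have [dD0 _] := hD0k.
(* The velocity of [eta] is normal to [T] because [e] is in the kernel, and to the tangent space at
   [y] because [y] is fixed. *)
have D0eta : vder D0 eta \in Q.
  apply/orthP => _ /memv_addP[w wT [w' w'T ->]]; rewrite dotDl.
  have -> : dot w (vder D0 eta) = 0.
    by rewrite dotC nuE (der_normal_dot fr nu hD0k wT) -D0x he.
  have := vder_dot w' eta dD0; move/orthP: etaQ => eQ.
  have yQ v : v \in tang A y -> dot v eta = 0 by move=> vT; apply: eQ; exact: (subvP (addvSr _ _)).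
  rewrite yQ // der0 // yQ ?add0r; last exact: (tang_der_stable rk rA hD0k D0y).
  by move=> <-.
have [b bE] := iffLR (BQ _) D0eta.
have : - b \in tsp k3 c.
  by rewrite (generic_tsp rk3 (ratl_kdef (ratl_setT rk3)) gc) tang_setT memvf.
case/tspP => D1 [hD1 D1c].
have kk3 : k `<=` k3 by move=> a ka; apply: k2k3; do 2 apply: sub_adj => //.
(* [D1] moves the coefficients [c] by [- b], which cancels the velocity of [eta] and leaves that of
   [x] unchanged. *)
pose D2 a := D0 a + D1 a.
have hD2 : Der k D2.
  have [dD1 kD1] := hD1; split; first exact: der_add.
  by move=> a ka; rewrite /D2 kD1 ?addr0 //; [case: hD0k => _; apply | exact: kk3].
have vD2 q (v : 'rV[K]_q) : vder D2 v = vder D0 v + vder D1 v by apply/rowP => i; rewrite !mxE.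
have [dD1 kD1] := hD1.
have D2x : vder D2 x = e.
  rewrite vD2 -D0x [X in _ + X](_ : _ = 0) ?addr0 //; apply/rowP => i; rewrite !mxE kD1 //.
  by apply: k2k3; apply: sub_adj => //; exact: mem_adj.
have D2eta : vder D2 eta = 0.
  rewrite vD2 bE vder_mulmx // -D1c mulNmx addrA addrN add0r (_ : map_mx D1 B = 0) ?mulmx0 //.
  by apply/matrixP => i j; rewrite !mxE kD1.
have kk4 : k `<=` k4 by move=> a ka; apply: sub_adj => //; exact: kk3.
have [D [hD Dk4 Dy']] := ext_gen rk4 rA kk4 gy' eTy hD2; have [dD _] := hD.
have Dx : vder D x = e.
  rewrite -D2x; apply/rowP => i; rewrite !vderE Dk4 //; apply: sub_adj => //; apply: k2k3.
  by apply: sub_adj => //; exact: mem_adj.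
have De : vder D eta = 0 by rewrite -D2eta; apply/rowP => i; rewrite !vderE Dk4.
rewrite -Dx; apply/eqP; apply: (tangency Kunc (sc_cone sc) rk rA (sc_smooth sc) hD Ax (y := y') (eta := eta)) => //.
- by case: gy'.
- by move=> w wT; rewrite nuE; exact: (normal_dot fr).
- by rewrite vderB // Dx Dy' subrr.
- exact: (nondeg_generic sc rk4 etak eta0 gy').
Qed.

Lemma dim_sker_le nu k1 : csubring k1 -> adj k x `<=` k1 ->
  (forall y', generic k1 A y' -> (sker F A x nu :&: tang A y' = 0)%VS) ->
  (\dim (sker F A x nu) + d <= dS)%N.
Proof.
move=> hk1 kk1 h; have [y' gy'] := exists_generic Kunc hk1 Acl Apr.
have gy2 := generic_sub kk1 gy'.
have gy3 : generic k A y' by apply: generic_sub gy2; exact: sub_adj.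
have e := dimv_disjoint_sum (h y' gy'); rewrite (dim_tang_generic gy3) in e.
rewrite -e -(dimS gx gy2).
by apply: dimvS; apply: addvS => //; apply/subvP => v /skerP[].
Qed.

End Pair.
End KernelBound.

(** * How the kernel moves with the conormal direction *)

Section Isotropy.
Variables (K : numClosedFieldType) (m r : nat).
Hypothesis Kunc : ~ countable [set: K].
Variables (A : set 'rV[K]_m) (k : set K) (x : 'rV[K]_m) (F : 'I_r -> {mpoly K[m]}) (mu : 'rV[K]_r).
Hypotheses (fr : frame A k x F) (gmu : generic (adj k x) [set: 'rV[K]_r] mu).
Implicit Types (u v w e l : 'rV[K]_m) (nu : 'rV[K]_r) (D : K -> K).
Local Notation T := (tang A x).
Local Notation L := (sker F A x mu).
Local Notation kx := (adj k x).

Definition form nu u v : K := dot (u *m sff F x nu) v.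

Lemma formC nu u v : form nu u v = form nu v u.
Proof. exact: sffC. Qed.

Lemma formDl nu u u' v : form nu (u + u') v = form nu u v + form nu u' v.
Proof. by rewrite /form mulmxDl dotDl. Qed.

Lemma formZl nu c u v : form nu (c *: u) v = c * form nu u v.
Proof. by rewrite /form -scalemxAl dotZl. Qed.

Lemma formDr nu u v v' : form nu u (v + v') = form nu u v + form nu u v'.
Proof. exact: dotDr. Qed.

Lemma formZr nu c u v : form nu u (c *: v) = c * form nu u v.
Proof. exact: dotZr. Qed.

Lemma formDm nu nu' u v : form (nu + nu') u v = form nu u v + form nu' u v.
Proof. by rewrite /form sffDm mulmxDr dotDl. Qed.

Lemma formZm c nu u v : form (c *: nu) u v = c * form nu u v.
Proof. by rewrite /form sffZm -scalemxAr dotZl. Qed.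

Lemma form0r nu u : form nu u 0 = 0. Proof. exact: dot0r. Qed.
Lemma form0l nu v : form nu 0 v = 0. Proof. by rewrite /form mul0mx dot0l. Qed.
Lemma formNl nu u v : form nu (- u) v = - form nu u v.
Proof. by rewrite /form mulNmx dotNl. Qed.
Lemma formNr nu u v : form nu u (- v) = - form nu u v.
Proof. exact: dotNr. Qed.
Lemma formBl nu u u' v : form nu (u - u') v = form nu u v - form nu u' v.
Proof. by rewrite formDl formNl. Qed.
Lemma formBr nu u v v' : form nu u (v - v') = form nu u v - form nu u v'.
Proof. by rewrite formDr formNr. Qed.

Let rk : subring k. Proof. by case: (fr_sub fr). Qed.
Let rkx : subring kx. Proof. exact: adj_subring. Qed.
Let Fk i : over k (F i). Proof. by case: (fr_over fr i). Qed.

Lemma Der_kx D : Der kx D -> Der k D /\ vder D x = 0.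
Proof. by move=> /(Der_adj _ _ rk). Qed.

Lemma sff_const D nu : Der kx D -> map_mx D (sff F x nu) = sff F x (vder D nu).
Proof.
move=> hD; have [[dD _] [_ kD]] := (hD, hD); apply/matrixP => i j; rewrite !mxE !summxE der_sum //.
apply: eq_bigr => a _; rewrite !mxE; case: (dD) => _ ->.
rewrite (kD _ (_ : kx ((F a)^`M(i))^`M(j).@[x 0])) ?mulr0 ?addr0 //.
by exists ((F a)^`M(i))^`M(j); split=> //; do 2 apply: over_deriv => //.
Qed.

Lemma der_form D nu u v : Der kx D ->
  D (form nu u v) = form (vder D nu) u v + form nu (vder D u) v + form nu u (vder D v).
Proof.
move=> hD; have [dD _] := hD; rewrite /form vder_dot // vder_mulmx // sff_const // dotDl.
by congr (_ + _); rewrite addrC.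
Qed.

Lemma tang_stable D w : Der kx D -> w \in T -> vder D w \in T.
Proof. by move=> /Der_kx[hD Dx]; exact: (tang_der_stable rk (fr_ratl fr) hD Dx). Qed.

Lemma sker_sub l : l \in L -> l \in T.
Proof. by case/skerP. Qed.

Lemma sker_form l v : l \in L -> v \in T -> form mu l v = 0.
Proof. by move=> /skerP[_ h]; exact: h. Qed.

Lemma der_mu nu : exists D, Der kx D /\ vder D mu = nu.
Proof.
have : nu \in tsp kx mu by rewrite (generic_tsp rkx (ratl_kdef (ratl_setT rkx)) gmu) tang_setT memvf.
by move=> /tspP[D [hD ->]]; exists D.
Qed.

Lemma der_sker D l v : Der kx D -> l \in L -> v \in T ->
  form mu (vder D l) v = - form (vder D mu) l v.
Proof.
move=> hD lL vT; have [dD _] := hD; have := der_form mu l v hD.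
rewrite sker_form // der0 // (sker_form lL (tang_stable hD vT)) addr0 => /esym/eqP.
by rewrite addrC addr_eq0 => /eqP.
Qed.

(** Bertini's theorem for the linear system of quadrics [form nu]: the vertex of a generic member
    lies in the base locus. It is obtained by moving [mu] in the direction [nu]. *)
Lemma sker_isotropic nu l l' : l \in L -> l' \in L -> form nu l l' = 0.
Proof.
move=> lL l'L; have [D [hD <-]] := der_mu nu; have [dD _] := hD.
have := der_sker hD lL (sker_sub l'L); rewrite formC sker_form //; last exact: tang_stable (sker_sub lL).
by move/esym/eqP; rewrite oppr_eq0 => /eqP.
Qed.

Lemma der_sker_swap D D' l l' : Der kx D -> Der kx D' -> l \in L -> l' \in L ->
  form mu (vder D l) (vder D' l') = - form mu (vder D l') (vder D' l).
Proof.
move=> hD hD' lL l'L; have [dD' _] := hD'.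
rewrite !der_sker //; try by apply: tang_stable => //; exact: sker_sub.
have := der_form (vder D mu) l l' hD'.
have iso nu := sker_isotropic nu lL l'L.
rewrite !iso (der0 dD') add0r (formC _ (vder D' l)) addrC => /esym/eqP.
by rewrite addr_eq0 => /eqP ->; rewrite opprK.
Qed.

Lemma der_sker_iso1 D D' l : Der kx D -> Der kx D' -> l \in L -> form mu (vder D l) (vder D' l) = 0.
Proof.
move=> hD hD' lL; have /eqP := der_sker_swap hD hD' lL lL.
by rewrite -addr_eq0 -mulr2n mulrn_eq0 /= => /eqP.
Qed.

Lemma der_sker_iso2 D l l' : Der kx D -> l \in L -> l' \in L -> form mu (vder D l) (vder D l') = 0.
Proof.
move=> hD lL l'L; have /eqP := der_sker_swap hD hD lL l'L.
by rewrite (formC _ (vder D l')) -addr_eq0 -mulr2n mulrn_eq0 /= => /eqP.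
Qed.

(** By [repr_der], [- e] is modulo [L] the velocity of the kernel vector [l] when [mu] moves in the
    direction [nu]. *)
Definition repr nu l e : Prop := e \in T /\ forall v, v \in T -> form mu e v = form nu l v.

Lemma repr_der D l : Der kx D -> l \in L -> repr (vder D mu) l (- vder D l).
Proof.
move=> hD lL; split; first by rewrite memvN; apply: tang_stable => //; exact: sker_sub.
by move=> v vT; rewrite formNl der_sker // opprK.
Qed.

Lemma repr_exists nu l : l \in L -> exists e, repr nu l e.
Proof. by move=> lL; have [D [hD <-]] := der_mu nu; exists (- vder D l); exact: repr_der. Qed.

Lemma repr_iso1 nu nu' l e e' : l \in L -> repr nu l e -> repr nu' l e' -> form mu e e' = 0.
Proof.
move=> lL [eT he] [e'T he']; have [D [hD Dm]] := der_mu nu; have [D' [hD' Dm']] := der_mu nu'.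
have [aT ha] := repr_der hD lL; have [bT hb] := repr_der hD' lL; rewrite Dm in ha; rewrite Dm' in hb.
rewrite he // -ha // formC he' // -hb // formNl formNr opprK.
exact: der_sker_iso1.
Qed.

Lemma repr_iso2 nu l l' e e' : l \in L -> l' \in L -> repr nu l e -> repr nu l' e' -> form mu e e' = 0.
Proof.
move=> lL l'L [eT he] [e'T he']; have [D [hD Dm]] := der_mu nu.
have [aT ha] := repr_der hD lL; have [bT hb] := repr_der hD l'L; rewrite Dm in ha hb.
rewrite he // -ha // formC he' // -hb // formNl formNr opprK.
exact: der_sker_iso2.
Qed.

Lemma form0m u v : form 0 u v = 0.
Proof. by rewrite /form sff0 mulmx0 dot0l. Qed.

(** With [a = vder D l], differentiating [form mu a a = - form nu l a] gives
    [form mu (vder D a) a = - 2 form nu a a], and differentiating [form mu a a = 0] gives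
    [form nu a a + 2 form mu (vder D a) a = 0]. Hence [3 form nu a a = 0]; and [e + a] lies in
    [L]. *)
Lemma repr_const nu l e : (forall i, kx (nu 0 i)) -> l \in L -> repr nu l e -> form nu e e = 0.
Proof.
move=> knu lL [eT he]; have [D [hD Dm]] := der_mu nu; have [dD kD] := hD.
have Dnu : vder D nu = 0 by apply/rowP => i; rewrite vderE mxE kD.
have DT v : v \in T -> vder D v \in T by exact: tang_stable.
have lT := sker_sub lL.
have [aT ha] := repr_der hD lL; rewrite Dm in ha.
set a := vder D l in ha aT.
have aT' : a \in T by rewrite -memvN.
have l0L : e + a \in L.
  apply/skerP; split=> [|v vT]; first exact: memvD.
  have := ha v vT; rewrite formNl => h; rewrite -/(form mu _ _) formDl he // -h addNr //.
have scal1 (s t z : K) : - (s + z - t) = 0 + s + t -> z = - (s *+ 2).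
  move=> h; have -> : z = - (- (s + z - t)) - s + t by ring.
  by rewrite h; ring.
have scal2 (s : K) : 0 = s - s *+ 2 - s *+ 2 -> s = 0.
  move=> h; have /eqP : s *+ 3 = 0 by rewrite -[RHS]oppr0 h; ring.
  by rewrite mulrn_eq0 => /eqP.
have naa : form nu a a = 0.
  have h1 : form mu (vder D a) a = - (form nu a a *+ 2).
    have := congr1 D (ha _ aT'); rewrite formNl (derN _ dD) (der_form mu a a hD) (der_form nu l a hD) Dm Dnu.
    have e1 : form mu a (vder D a) = - form nu l (vder D a).
      by rewrite -ha; [rewrite formNl opprK | exact: DT].
    rewrite e1 -/a form0m; exact: scal1.
  have := der_form mu a a hD; rewrite (der_sker_iso1 hD hD lL) (der0 dD) Dm (formC mu a) h1.
  exact: scal2.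
have -> : e = (e + a) - a by rewrite addrK.
have nl0 : form nu (e + a) a = 0.
  have [_ h] := repr_der hD l0L; rewrite Dm in h.
  by rewrite -h // formNl der_sker_iso2 // oppr0.
by rewrite formBl !formBr (formC nu a) nl0 naa sker_isotropic // !subrr.
Qed.

End Isotropy.

Section LinePolynomial.
Variables (K : numClosedFieldType) (m : nat) (a w : 'rV[K]_m).
Implicit Types (p : {mpoly K[m]}).

(** The restriction to a line is written out so that its size and its top coefficient, the value of
    a form in the direction [w], can be read off. *)
Definition on_line p : {poly K} :=
  \sum_(l <- msupp p) p@_l *: \prod_i ((a 0 i)%:P + w 0 i *: 'X) ^+ l i.

Lemma on_lineE p s : (on_line p).[s] = p.@[(a + s *: w) 0].
Proof.
rewrite mevalE horner_sum; apply: eq_bigr => l _; rewrite hornerZ horner_prod; congr (_ * _).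
by apply: eq_bigr => i _; rewrite horner_exp !hornerE !mxE mulrC.
Qed.

Lemma coefM_top (P Q : {poly K}) i j : (size P <= i.+1)%N -> (size Q <= j.+1)%N ->
  (P * Q)`_(i + j) = P`_i * Q`_j.
Proof.
move=> hP hQ; have hi : (i < (i + j).+1)%N by rewrite ltnS leq_addr.
rewrite coefM (bigD1 (Ordinal hi)) //= addKn big1 ?addr0 // => b bi.
have [lt|le] := ltnP i b; first by rewrite nth_default ?mul0r // (leq_trans hP).
rewrite [X in _ * X]nth_default ?mulr0 // (leq_trans hQ) //.
have bi' : (b < i)%N by rewrite ltn_neqAle le andbT; apply: contra bi => /eqP e; apply/eqP/val_inj.
by rewrite ltn_subRL ltn_add2r.
Qed.

Lemma line_monomial (l : 'X_{1..m}) :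
  (size (\prod_i ((a 0 i)%:P + w 0 i *: 'X) ^+ l i)%R <= (mdeg l).+1)%N /\
  (\prod_i ((a 0 i)%:P + w 0 i *: 'X) ^+ l i)`_(mdeg l) = \prod_i w 0 i ^+ l i.
Proof.
pose R (P : {poly K}) (D : nat) c := (size P <= D.+1)%N /\ P`_D = c.
have RM P D c P' D' c' : R P D c -> R P' D' c' -> R (P * P') (D + D')%N (c * c').
  move=> [s1 e1] [s2 e2]; split; last by rewrite coefM_top // e1 e2.
  by apply: leq_trans (size_polyMleq _ _) _; move: s1 s2; clear; lia.
have R1 : R 1 0%N 1 by split; [rewrite size_poly1 | rewrite coef1].
have Rx i : R ((a 0 i)%:P + w 0 i *: 'X) 1%N (w 0 i).
  split; last by rewrite coefD coefC coefZ coefX mulr1 add0r.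
  apply: leq_trans (size_polyD _ _) _; rewrite geq_max (leq_trans (size_polyC_leq1 _)) //.
  by rewrite (leq_trans (size_scale_leq _ _)) // size_polyX.
have RX i e : R (((a 0 i)%:P + w 0 i *: 'X) ^+ e) e (w 0 i ^+ e).
  by elim: e => [//|e IH]; rewrite !exprS; exact: (RM _ _ _ _ _ _ (Rx i) IH).
rewrite mdegE; elim/big_rec3: _ => [//|i P D c _ h]; exact: RM.
Qed.

Lemma on_line_size p : (size (on_line p) <= msize p)%N.
Proof.
apply: leq_trans (size_sum _ _ _) _; apply/bigmax_leqP_seq => l lp _.
apply: leq_trans (size_scale_leq _ _) _; have [h _] := line_monomial l.
by apply: leq_trans h _; exact: msize_mdeg_lt.
Qed.

Lemma on_line_top p e : p \is e.-homog -> (on_line p)`_e = p.@[w 0].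
Proof.
move=> /dhomogP hp; rewrite mevalE coef_sum !big_seq; apply: eq_bigr => l lp.
by rewrite coefZ -[in LHS](hp l lp) /=; have [_ ->] := line_monomial l.
Qed.

End LinePolynomial.

(** * Degenerate Gauss maps *)

Section GaussMap.
Variables (K : numClosedFieldType) (m r : nat).
Hypothesis Kunc : ~ countable [set: K].
Variables (A : set 'rV[K]_m) (k : set K) (x : 'rV[K]_m) (F : 'I_r -> {mpoly K[m]}).
Hypotheses (fr : frame A k x F) (cA : ccone A).
Hypothesis smooth : forall v, A v -> v != 0 -> \dim (tang A v) = \dim (tang A x).
Implicit Types (u v w e : 'rV[K]_m) (nu : 'rV[K]_r) (D : K -> K).
Local Notation T := (tang A x).
Local Notation G := (grads F x).
Local Notation form := (form x F).

Let rk : subring k. Proof. by case: (fr_sub fr). Qed.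
Let Fk i : over k (F i). Proof. by case: (fr_over fr i). Qed.
Let rA := fr_ratl fr.
Let Asc : forall c v, A v -> A (c *: v). Proof. by case: cA. Qed.

Definition bracket D D' (a : K) : K := D (D' a) - D' (D a).

Lemma Der_bracket D D' : Der k D -> Der k D' -> Der k (bracket D D').
Proof.
move=> [dD kD] [dD' kD']; split; first exact: der_bracket.
by move=> c kc; rewrite /bracket (kD' c kc) (kD c kc) (der0 dD) (der0 dD') subrr.
Qed.

Lemma vder_bracket D D' q (v : 'rV[K]_q) : vder (bracket D D') v = vder D (vder D' v) - vder D' (vder D v).
Proof. by apply/rowP => i; rewrite !mxE. Qed.

Lemma normal_der D nu w : Der k D -> w \in T -> dot (nu *m G) (vder D w) = - form nu (vder D x) w.
Proof.
move=> hD wT; have := normal_der_field fr nu hD wT; rewrite (der_normal_dot fr nu hD wT) => /eqP.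
by rewrite addrC addr_eq0 => /eqP.
Qed.

Lemma tang_der D w : Der k D -> w \in T -> (forall nu, form nu (vder D x) w = 0) -> vder D w \in T.
Proof. by move=> hD wT h; apply: (tangent_of fr) => nu; rewrite normal_der // h oppr0. Qed.

Lemma tang_by_forms v w : (forall p (e : nat), over k p -> p \is e.-homog -> vanish A p -> dot (grad p v) w = 0) ->
  w \in tang A v.
Proof.
move=> h; apply/tangP => p /rA[n [c [g [hg ->]]]].
elim/big_ind: _ => [|p1 p2 h1 h2|i _].
- by rewrite -dird_dot -mpolyC0 dirdC.
- by rewrite grad_is_additive dotDl h1 h2 addr0.
rewrite gradZ dotZl; have [gk gA] := hg i.
rewrite (pihomog_partitionE (leqnn (mmeasure mdeg (g i)))).
elim/big_ind: _ => [|p1 p2 h1 h2|e _].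
- by rewrite -dird_dot -mpolyC0 dirdC mulr0.
- by rewrite grad_is_additive dotDl mulrDr h1 h2 addr0.
rewrite (h _ (val e)) ?mulr0 //; [exact: over_pihomog | exact: pihomogP | exact: vanish_homog].
Qed.

(* A subspace of [T] through [x] stable under the velocities in its own
   directions is swept out by generic points. *)
Section StableSubspace.
Variable U : {vspace 'rV[K]_m}.
Hypotheses (UT : (U <= T)%VS) (xU : x \in U).
Definition along : set (K -> K) := [set D | Der k D /\ vder D x \in U].
Hypothesis Ust : forall D u, along D -> u \in U -> vder D u \in U.

Definition along_const : set K := [set c | forall D, along D -> D c = 0].

Lemma along_const_subring : subring along_const.
Proof.
split=> [D [[dD _] _]|a b ha hb D hD|a b ha hb D hD]; first exact: der1.
  by have [[dD _] _] := hD; rewrite derB // (ha D hD) (hb D hD) subrr.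
by have [[[_ dM] _] _] := hD; rewrite dM (ha D hD) (hb D hD) mul0r mulr0 addr0.
Qed.

Lemma sub_along_const : k `<=` along_const.
Proof. by move=> c kc D [[_ h] _]; exact: h. Qed.

(** [U] has a basis over the constants, and the coordinates of [x] in it can be moved in all
    directions; they are thus independent, and a relation satisfied by [x] holds on all of [U]. *)
Lemma vanish_along p : over along_const p -> p.@[x 0] = 0 -> forall u, u \in U -> p.@[u 0] = 0.
Proof.
move=> pc px u uU; have sk := along_const_subring.
have [||B [Bf BU BD]] := @stable_const_basis K m U along; [by move=> D [[]] | exact: Ust |].
have [j|P [Pk PE]] := @comp_poly K along_const _ (\dim U) p (fun j => \sum_i B i j *: 'X_i) sk pc.
  by apply: over_sum => // i _; apply: overZ => //; [move=> D hD; exact: BD | exact: overX].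
have PE' (c : 'rV[K]_(\dim U)) : P.@[c 0] = p.@[(c *m B) 0].
  rewrite PE; apply: meval_eq => j; rewrite raddf_sum mxE; apply: eq_bigr => i _ /=.
  by rewrite mevalZ mevalXU mulrC.
have [c0 xE] := iffLR (BU x) xU; have [c uE] := iffLR (BU u) uU.
suff P0 : P = 0 by rewrite uE -PE' P0 meval0.
apply: (over_partials_indep sk (x := c0) _ Pk); last by rewrite PE' -xE.
apply/vspaceP => s; rewrite memvf; apply/tspP.
have sU : s *m B \in U by apply/BU; exists s.
have [D [hD Dx]] := velocity fr (subvP UT _ sU).
have Da : along D by split; rewrite ?Dx.
have [dD _] := hD; exists D; split; first by split=> // b; apply.
apply: (row_free_inj Bf); rewrite -Dx xE vder_mulmx // (_ : map_mx D B = 0) ?mulmx0 ?addr0 //.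
by apply/matrixP => i j; rewrite !mxE (BD D Da).
Qed.

Lemma along_sub u : u \in U -> A u.
Proof.
move=> uU; apply: (ratl_homog rk rA cA) => g e gk _ gA; apply: vanish_along => //.
  by move=> l; apply: (sub_along_const (gk l)).
by apply: gA; case: (fr_gen fr).
Qed.

End StableSubspace.

(** * Tangent space constant along the contact locus *)

Section ConstantTangent.
Variable mu : 'rV[K]_r.
Local Notation L := (sker F A x mu).
Hypothesis formL : forall nu l v, l \in L -> v \in T -> form nu l v = 0.
Hypothesis dimL : (1 < \dim L)%N.
Hypothesis x0 : x != 0.

Let LT : (L <= T)%VS. Proof. by apply/subvP => l; exact: sker_sub. Qed.
Let xL : x \in L. Proof. exact: (x_sker fr Asc). Qed.

Lemma along_tang D w : along L D -> w \in T -> vder D w \in T.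
Proof. by move=> [hD DL] wT; apply: tang_der => // nu; exact: formL. Qed.

(** Take [W] moving [x] by [w] and apply [normal_der] to the bracket of [W] and [D], which moves [x]
    tangentially: all terms vanish except [form mu (vder D l) w]. *)
Lemma along_sker D l : along L D -> l \in L -> vder D l \in L.
Proof.
move=> aD lL; have [hD DL] := aD; have lT := subvP LT _ lL.
have DlT := along_tang aD lT.
apply/skerP; split=> // w wT; rewrite -/(form mu (vder D l) w) formC.
have [W [hW Wx]] := velocity fr wT.
have WlT : vder W l \in T by apply: tang_der => // nu; rewrite formC formL // Wx.
have bT : vder (bracket W D) x \in T by exact: (tangent_velocity fr (Der_bracket hW hD)).
have := normal_der mu (Der_bracket hW hD) lT; rewrite formC formL // oppr0.
rewrite vder_bracket dotBr normal_der // Wx => /eqP.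
rewrite (normal_dot fr mu (along_tang aD WlT)) subr0 oppr_eq0 => /eqP //.
Qed.

Lemma tang_along e : e \in L -> e != 0 -> tang A e = T.
Proof.
move=> eL e0; have Ae := along_sub LT xL along_sker eL.
apply/esym/eqP; rewrite eqEdim (smooth Ae e0) leqnn andbT.
have [||C [Cf CT CD]] := @stable_const_basis K m T (along L).
- by move=> D [[]].
- by move=> D v; exact: along_tang.
apply/subvP => w /CT[c ->]; rewrite mulmx_sum_row; apply: memv_suml => i _; apply: memvZ.
apply: tang_by_forms => p d pk _ pA.
pose q : {mpoly K[m]} := \sum_j C i j *: p^`M(j).
have qE (v : 'rV[K]_m) : q.@[v 0] = dot (grad p v) (row i C).
  by rewrite /q raddf_sum; apply: eq_bigr => j _ /=; rewrite mevalZ !mxE mulrC.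
rewrite -qE; apply: (vanish_along LT xL along_sker) eL.
  have sk := along_const_subring L; apply: over_sum => // j _; apply: overZ => //.
    by move=> D hD; exact: CD.
  by apply: over_deriv => // l; apply: sub_along_const; exact: pk.
rewrite qE; have : row i C \in T by apply/CT; exists (delta_mx 0 i); rewrite rowE.
by move/tangP => /(_ p pA).
Qed.

Lemma hess_normal p nu u v : over k p -> grad p x = nu *m G -> u \in T -> v \in T ->
  dot (u *m hess p x) v = form nu u v.
Proof.
move=> pk pE uT vT; have [D [hD Dx]] := velocity fr uT.
by rewrite -Dx -(vder_grad x hD rk pk) pE (der_normal_dot fr nu hD vT).
Qed.

(* Along a line in [L] the second fundamental form is a regular section of
   degree -1, hence zero. *)
Theorem gauss_form nu u1 u2 : u1 \in T -> u2 \in T -> form nu u1 u2 = 0.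
Proof.
have [||C [Cf CT CD]] := @stable_const_basis K m T (along L).
- by move=> D [[]].
- by move=> D w; exact: along_tang.
have CTi i : row i C \in T by apply/CT; exists (delta_mx 0 i); rewrite rowE.
suff key i j : forall a, dot (row i C *m hess (F a) x) (row j C) = 0.
  move=> /CT[c ->] /CT[c' ->]; rewrite !mulmx_sum_row /form mulmx_suml dot_suml big1 // => i _.
  rewrite dot_sumr big1 // => j _; rewrite -scalemxAl dotZl dotZr /sff mulmx_sumr dot_suml.
  by rewrite big1 ?mulr0 // => a _; rewrite -scalemxAr dotZl key mulr0.
pose sk := along_const_subring L.
have kc := @sub_along_const L.
pose b (f : {mpoly K[m]}) : {mpoly K[m]} := \sum_s \sum_t (C i s * C j t) *: (f^`M(s))^`M(t).
have bE f (e : 'rV[K]_m) : (b f).@[e 0] = dot (row i C *m hess f e) (row j C).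
  rewrite /b raddf_sum /dot /=; under [RHS]eq_bigr => t _ do rewrite mxE mulr_suml.
  rewrite [RHS]exchange_big /=; apply: eq_bigr => s _; rewrite raddf_sum; apply: eq_bigr => t _ /=.
  by rewrite mevalZ !mxE; ring.
have bk f : over k f -> over (along_const L) (b f).
  move=> fk; apply: over_sum => // s _; apply: over_sum => // t _; apply: overZ => //.
    by case: sk => _ _ sM; apply: sM => D hD; exact: CD.
  by do 2 apply: over_deriv => //; move=> l; exact: kc (fk l).
have [g hg] := row_free_cols (fr_free fr).
pose J : 'M[{mpoly K[m]}]_r := \matrix_(a, c) (F a)^`M(g c).
have JE : map_mx (meval (x 0)) J = colsub g G by apply/matrixP => a c; rewrite !mxE.
have Jk a c : over (along_const L) (J a c).
  by rewrite mxE; apply: over_deriv => // l; exact: kc (Fk a l).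
pose n c : {mpoly K[m]} := \sum_a (\adj J) c a * b (F a).
have adjk c a : over (along_const L) ((\adj J) c a).
  rewrite mxE /cofactor; apply: overM => //.
    by apply: over_exp => //; apply: overN => //; exact: over1.
  by apply: det_over => // s t; rewrite !mxE; apply: over_deriv => // l; exact: kc (Fk _ l).
(* At [x] the gradient of [f] is a combination of the rows of [G], and [b f] is the same combination
   of the [b (F a)]. Cleared of denominators by the adjugate, this is a relation over the constants
   and so holds on all of [L]. *)
have ident f : over k f -> vanish A f -> forall e, e \in L ->
   (\det J).@[e 0] * (b f).@[e 0] = \sum_c (f^`M(g c)).@[e 0] * (n c).@[e 0].
  move=> fk fA e eL; pose p := \det J * b f - \sum_c f^`M(g c) * n c.
  have pE (v : 'rV[K]_m) : p.@[v 0] = (\det J).@[v 0] * (b f).@[v 0] - \sum_c (f^`M(g c)).@[v 0] * (n c).@[v 0].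
    rewrite /p mevalB mevalM; congr (_ - _); rewrite raddf_sum.
    by apply: eq_bigr => c _; rewrite /= mevalM.
  apply/eqP; rewrite -subr_eq0 -pE; apply/eqP.
  apply: (vanish_along LT xL along_sker) eL.
    apply: overB => //; first by apply: overM => //; [exact: det_over | exact: bk].
    apply: over_sum => // c _; apply: overM => //; first by apply: over_deriv => // l; exact: kc (fk l).
    by apply: over_sum => // a _; apply: overM => //; apply: bk; exact: Fk.
  rewrite pE; have [nuf nufE] : exists nuf, grad f x = nuf *m G.
    by apply: (normal_coef fr) => w /tangP; apply.
  have -> : (b f).@[x 0] = \sum_a nuf 0 a * (b (F a)).@[x 0].
    rewrite bE (hess_normal fk nufE) // /form mulmx_sumr dot_suml; apply: eq_bigr => a _.
    by rewrite bE -scalemxAr dotZl.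
  apply/eqP; rewrite subr_eq0; apply/eqP.
  have -> : \sum_c (f^`M(g c)).@[x 0] * (n c).@[x 0] =
    (nuf *m colsub g G *m (\adj (colsub g G)) *m \col_a (b (F a)).@[x 0]) 0 0.
    rewrite -mulmxA mxE; apply: eq_bigr => c _; congr (_ * _).
      have := congr1 (fun M : 'rV[K]_m => M 0 (g c)) nufE; rewrite mxE => ->.
      by rewrite !mxE; apply: eq_bigr => a _; rewrite !mxE.
    rewrite /n raddf_sum mxE; apply: eq_bigr => a _; rewrite /= mevalM -JE -map_mx_adj.
    by congr (_ * _); rewrite [RHS]mxE.
  rewrite -[nuf *m _ *m _]mulmxA mul_mx_adj mul_mx_scalar -scalemxAl mxE -JE det_map_mx; congr (_ * _).
  by rewrite mxE; apply: eq_bigr => a _; rewrite !mxE.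
have [l1 l1L l1x] : exists2 l1, l1 \in L & l1 \notin <[x]>%VS.
  apply: contrapT => no; move: dimL; rewrite ltnNge => /negP; apply.
  apply: leq_trans (_ : \dim <[x]> <= _)%N; last by rewrite dim_vline; case: (x != 0).
  by apply/dimvS/subvP => l lL; apply: contrapT => /negP nl; apply: no; exists l.
have l10 : l1 != 0 by apply: contraNneq l1x => ->; rewrite mem0v.
pose e s := x + s *: l1.
have eL s : e s \in L by rewrite memvD // memvZ.
have e0 s : e s != 0.
  have [->|s0] := eqVneq s 0.
    by rewrite /e scale0r addr0.
  apply: contraNneq l1x => /eqP; rewrite addr_eq0 => /eqP h.
  have -> : l1 = - s^-1 *: x by rewrite h scalerN scaleNr opprK scalerA mulVf // scale1r.
  by rewrite memvZ // memv_line.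
pose vec (z : 'I_r -> K) : 'rV[K]_m := \sum_c z c *: delta_mx 0 (g c).
have vecE p (v : 'rV[K]_m) z : dot (grad p v) (vec z) = \sum_c (p^`M(g c)).@[v 0] * z c.
  rewrite dot_sumr; apply: eq_bigr => c _; rewrite dotZr mulrC; congr (_ * _).
  rewrite /dot (bigD1 (g c)) //= [X in _ + X]big1 ?addr0; first by rewrite !mxE !eqxx mulr1.
  by move=> t tc; rewrite [X in _ * X]mxE (negPf tc) andbF mulr0.
(* At every nonzero vector of [L], including [l1], the tangent space is [T], for which the columns
   [g] of the gradients are independent. *)
have vec0 v z : v \in L -> v != 0 -> (forall f d, over k f -> f \is d.-homog -> vanish A f ->
    \sum_c (f^`M(g c)).@[v 0] * z c = 0) -> forall c, z c = 0.
  move=> vL v0 h; have : vec z \in T.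
    by rewrite -(tang_along vL v0); apply: tang_by_forms => f d fk fd fA; rewrite vecE (h f d).
  move/tangP => vT; have zz : (\row_c z c) *m (colsub g G)^T = 0.
    apply/rowP => a; rewrite [RHS]mxE -(vT (F a)); last by case: (fr_over fr a).
    by rewrite vecE !mxE; apply: eq_bigr => c _; rewrite !mxE mulrC.
  have z0 : \row_c z c = 0.
    have hgT : (colsub g G)^T \in unitmx by rewrite unitmx_tr.
    by rewrite -(mulmxK hgT (\row_c z c)) zz mul0mx.
  by move=> c; have := congr1 (fun M : 'rV[K]_r => M 0 c) z0; rewrite !mxE.
(* The quotients [z c / q] express the second fundamental form along the line. If [q] of least size
   had a root, all [z c] would vanish there by [vec0] and a factor could be cancelled; so [q] is
   constant. *)
pose good (q : {poly K}) (z : 'I_r -> {poly K}) := q != 0 /\ forall f d, over k f -> f \is d.-homog ->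
  vanish A f -> q * on_line x l1 (b f) = \sum_c on_line x l1 f^`M(g c) * z c.
have good0 : good (on_line x l1 (\det J)) (fun c => on_line x l1 (n c)).
  split.
    apply/eqP => h; have := on_lineE x l1 (\det J) 0; rewrite h horner0 scale0r addr0 => /esym/eqP.
    by rewrite -det_map_mx JE; apply/negP; rewrite -unitfE -unitmxE.
  move=> f d fk fd fA; apply/eqP; rewrite -subr_eq0; apply/eqP; apply: poly_nat_roots => s.
  rewrite hornerD hornerN hornerM !on_lineE horner_sum (ident f fk fA (x + s%:R *: l1) (eL s%:R)).
  apply/eqP; rewrite subr_eq0; apply/eqP; apply: eq_bigr => c _.
  by rewrite hornerM !on_lineE.
pose sizes N := `[< exists q z, good q z /\ size q = N >].
have exs : exists N, sizes N.
  by exists (size (on_line x l1 (\det J))); apply/asboolP; exists (on_line x l1 (\det J)), (fun c => on_line x l1 (n c)).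
have [N /asboolP[q [z [[q0 qz] qN]]] Nmin] := ex_minnP exs.
have [q1|/closed_rootP[s0 /rootP q_s0]] := eqVneq (size q) 1%N; last first.
  have zr c : (z c).[s0] = 0.
    apply: (vec0 (e s0) (fun c => (z c).[s0])) => // f d fk fd fA.
    have := congr1 (fun P : {poly K} => P.[s0]) (qz f d fk fd fA).
    rewrite /= hornerM q_s0 mul0r horner_sum => /esym h; rewrite -[RHS]h.
    by apply: eq_bigr => c' _; rewrite hornerM on_lineE.
  have [q' qE] := factor_theorem q s0 (introT rootP q_s0).
  have /choice[z' zE] c : exists z', z c = z' * ('X - s0%:P).
    by apply/factor_theorem/rootP.
  exfalso; have X0 : ('X - s0%:P : {poly K}) != 0 by rewrite polyXsubC_eq0.
  have q'0 : q' != 0 by apply: contraNneq q0 => h; rewrite qE h mul0r.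
  have : sizes (size q').
    apply/asboolP; exists q', z'; split=> //; split=> // f d fk fd fA.
    apply: (mulIf X0); rewrite mulrAC -qE (qz f d) // mulr_suml; apply: eq_bigr => c _.
    by rewrite zE mulrA.
  by move/Nmin; rewrite -qN qE size_mul // size_XsubC addn2 /= ltnn.
pose M := \max_c size (z c).
have [M0|Mp] := posnP M.
  move=> a; have [Fa FA] := fr_over fr a.
  have b0 f d : over k f -> f \is d.-homog -> vanish A f -> (b f).@[x 0] = 0.
    move=> fk fd fA; have /eqP := qz f d fk fd fA; rewrite big1.
      rewrite mulf_eq0 (negPf q0) /= => /eqP h.
      by have := on_lineE x l1 (b f) 0; rewrite h horner0 scale0r addr0.
    move=> c _; have : (size (z c) <= M)%N by exact: leq_bigmax.
    by rewrite M0 leqn0 size_poly_eq0 => /eqP ->; rewrite mulr0.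
  rewrite -bE; have bl f1 f2 : b (f1 + f2) = b f1 + b f2.
    rewrite /b -big_split; apply: eq_bigr => s _; rewrite -big_split; apply: eq_bigr => t _.
    by rewrite !mderivD scalerDr.
  rewrite (pihomog_partitionE (leqnn (mmeasure mdeg (F a)))).
  have b00 : b 0 = 0 by rewrite /b big1 // => s _; rewrite big1 // => t _; rewrite !mderiv0 scaler0.
  rewrite (big_morph b bl b00) raddf_sum big1 // => d _ /=.
  by apply: (b0 _ d); [exact: over_pihomog | exact: pihomogP | exact: vanish_homog].
exfalso; have zM c : (size (z c) <= M.-1.+1)%N by rewrite prednK //; exact: leq_bigmax.
(* The point at infinity of the line is [l1]. As [b f] has degree two less than [f] and the partial
   derivatives only one less, comparing coefficients in degree [d.-1 + M.-1] shows that the top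
   coefficients of [z] satisfy the equations of [vec0] at [l1]. *)
have top0 : forall c, (z c)`_M.-1 = 0.
  apply: (vec0 l1 (fun c => (z c)`_M.-1)) => // f d fk fd fA.
  have := congr1 (fun P : {poly K} => P`_(d.-1 + M.-1)) (qz f d fk fd fA).
  rewrite /= [X in X = _ -> _](_ : _ = 0); last first.
    have [c cE] : exists c, q = c%:P by exists q`_0; apply: size1_polyC; rewrite q1.
    rewrite cE coefCM nth_default ?mulr0 //; apply: leq_trans (leq_addr _ _).
    apply: leq_trans (on_line_size _ _ _) _.
    apply: (leq_trans (msize_sum _ _ _)); apply/bigmax_leqP => s _.
    apply: (leq_trans (msize_sum _ _ _)); apply/bigmax_leqP => t _.
    apply: (leq_trans (msizeZ_le _ _)); apply: msize_deriv; exact: (msize_homog (mderiv_homog s fd)).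
  move/esym; rewrite coef_sum => h; rewrite -[RHS]h; apply: eq_bigr => c _.
  rewrite coefM_top //; last first.
    by apply: leq_trans (on_line_size _ _ _) _; exact: (msize_homog (mderiv_homog (g c) fd)).
  by rewrite (on_line_top _ _ (mderiv_homog (g c) fd)).
have : (M <= M.-1)%N.
  apply/bigmax_leqP => c _; rewrite leqNgt; apply/negP => lt.
  have sE : size (z c) = M.-1.+1 by apply/eqP; rewrite eqn_leq zM.
  have : lead_coef (z c) = 0 by rewrite lead_coefE sE top0.
  by move/eqP; rewrite lead_coef_eq0 => /eqP z0; rewrite z0 size_poly0 in sE.
by rewrite -ltnS prednK // ltnn.
Qed.

End ConstantTangent.
End GaussMap.

(** * Positive dual defect *)

Section PositiveDefect.
Variables (K : numClosedFieldType) (m d : nat).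
Hypothesis Kunc : ~ countable [set: K].
Variables (A : set 'rV[K]_m) (k : set K) (dS l : nat).
Hypotheses (sc : smooth_cone A d) (hk : csubring k) (rA : ratl k A) (m0 : (0 < m)%N) (r0 : (0 < m - d)%N).
Hypothesis dimS : forall x y, generic k A x -> generic (adj k x) A y ->
  \dim (tang A x + tang A y) = dS.
Hypothesis dSm : (dS < m)%N.
Hypothesis dimL : forall x (F : 'I_(m - d) -> {mpoly K[m]}) mu, frame A k x F ->
  generic (adj k x) [set: 'rV[K]_(m - d)] mu -> \dim (sker F A x mu) = l.
Hypothesis extremal : (l + d + 1 = dS)%N.
Implicit Types (u v w e : 'rV[K]_m).

Let Acl : algclosed A. Proof. by case: (sc_cone sc). Qed.
Let Asc : forall c v, A v -> A (c *: v). Proof. by case: (sc_cone sc). Qed.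
Let Apr := sc_prime sc.
Let rk : subring k. Proof. by case: hk. Qed.

Lemma dim_cap_orth (U : {vspace 'rV[K]_m}) a : (\dim U <= (\dim (U :&: orth <[a]>)).+1)%N.
Proof.
have h1 := dimv_sum_cap U (orth <[a]>).
have h2 := dim_leq (U + orth <[a]>)%VS; rewrite dim_orth dim_vline in h1.
have h3 : (((a != 0)%R : nat) <= 1)%N by case: (a != 0).
by move: h1 h2 h3; clear; move: (\dim _) (\dim _) (\dim _) (nat_of_bool _) => p q s t; lia.
Qed.

Lemma dim_add_line (U : {vspace 'rV[K]_m}) v : v \notin U -> \dim (U + <[v]>) = (\dim U).+1.
Proof.
move=> vU; have v0 : v != 0 by apply: contraNneq vU => ->; rewrite mem0v.
rewrite dimv_disjoint_sum ?dim_vline ?v0 ?addn1 //; apply/eqP; rewrite -subv0.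
apply/subvP => w; rewrite memv_cap memv0 => /andP[wU /vlineP[c wc]]; rewrite wc in wU *.
have [->|c0] := eqVneq c 0; first by rewrite scale0r.
by move: (memvZ c^-1 wU); rewrite scalerA mulVf // scale1r (negPf vU).
Qed.

Lemma full_of_dim (U W : {vspace 'rV[K]_m}) : (U <= W)%VS -> (\dim W <= \dim U)%N -> (W <= U)%VS.
Proof. by move=> UW; rewrite (geq_leqif (dimv_leqif_sup UW)). Qed.

Section AtPoint.
Variables (x : 'rV[K]_m) (F : 'I_(m - d) -> {mpoly K[m]}) (mu : 'rV[K]_(m - d)).
Hypotheses (fr : frame A k x F) (gmu : generic (adj k x) [set: 'rV[K]_(m - d)] mu).
Hypothesis l2 : (1 < l)%N.
Local Notation T := (tang A x).
Local Notation L := (sker F A x mu).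
Local Notation form := (form x F).
Local Notation repr := (repr A x F mu).

Let gx := fr_gen fr.
Let x0 : x != 0. Proof. exact: (generic_neq0 sc m0 hk gx). Qed.
Let dT : \dim T = d. Proof. exact: (dim_tang_generic sc hk m0 gx). Qed.
Let dL : \dim L = l. Proof. exact: dimL. Qed.
Let LT : (L <= T)%VS. Proof. by apply/subvP => v; exact: sker_sub. Qed.
Let skf v u : v \in L -> u \in T -> form mu v u = 0. Proof. exact: sker_form. Qed.

Lemma cap_dimE y : generic (adj k x) A y -> (\dim (T :&: tang A y) + l + 1 = d)%N.
Proof.
move=> gy; have := dim_cap Kunc sc hk rA m0 dimS gx gy; rewrite -extremal; clear.
by move: (\dim _) => p; lia.
Qed.

Let exists_y : exists y, generic (adj (adj k x) mu) A y.
Proof. by apply: (exists_generic Kunc _ Acl Apr); do 2 apply: adj_csubring. Qed.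

Let ld : (l < d)%N.
Proof.
have [y gy] := exists_y; have gyx : generic (adj k x) A y.
  by apply: generic_sub gy; apply: sub_adj; exact: adj_subring.
by have := cap_dimE gyx; move: (\dim _) => p; clear; lia.
Qed.

Lemma repr_not_sker nu e0 e : repr nu e0 e -> e \notin L <-> exists2 v, v \in T & form nu e0 v != 0.
Proof.
move=> [eT he]; split=> [eL|[v vT]].
  apply: contrapT => no; move/negP: eL; apply; apply/skerP; split=> // v vT.
  rewrite -/(form mu e v) he //; apply/eqP/negPn/negP => h; by apply: no; exists v.
by rewrite -he //; apply: contraNN => eL; rewrite skf.
Qed.

(** Otherwise every form vanishes on [L], the tangent space is constant along it, and [gauss_form]
    makes the kernel all of [T], against [l < d]. *)
Lemma nonconstant_tangent : exists nu e0 e, [/\ e0 \in L, repr nu e0 e & e \notin L].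
Proof.
apply: contrapT => no.
have H nu e0 v : e0 \in L -> v \in T -> form nu e0 v = 0.
  move=> e0L vT; apply/eqP/negPn/negP => h; apply: no.
  have [e he] := repr_exists fr gmu nu e0L; exists nu, e0, e; split=> //.
  by apply/(repr_not_sker he); exists v.
have sm v : A v -> v != 0 -> \dim (tang A v) = \dim T by move=> Av v0; rewrite dT (sc_smooth sc).
have TL : (T <= L)%VS.
  apply/subvP => u uT; apply/skerP; split=> // v vT.
  by apply: (gauss_form fr (sc_cone sc) sm H _ x0 mu uT vT); rewrite dL.
by have := dimvS TL; rewrite dT dL leqNgt ld.
Qed.

Section SecondPoint.
Variables (y : 'rV[K]_m) (k0 : set K).
Hypotheses (hk0 : csubring k0) (k00 : adj (adj k x) mu `<=` k0) (gy : generic k0 A y).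
Local Notation W := (T :&: tang A y)%VS.

Let kx0 : adj k x `<=` k0.
Proof. by move=> c kc; apply: k00; apply: sub_adj => //; exact: adj_subring. Qed.
Let gyx : generic (adj k x) A y. Proof. exact: generic_sub gy. Qed.
Let gymu : generic (adj (adj k x) mu) A y. Proof. exact: generic_sub gy. Qed.

Lemma sker_cap_y : (L :&: W = 0)%VS.
Proof.
apply/eqP; rewrite -subv0 -(sker_cap Kunc sc fr r0 gmu gymu).
by apply: capvS => //; exact: capvSr.
Qed.

(** [L + W] is a hyperplane of [T] on which [L] pairs to zero under [form nu]. So one linear
    condition, the pairing with a vector [t] outside it, decides which vectors of [L] belong to the
    kernel of [nu]. *)
Lemma normal_kernel : exists nu k1, [/\ csubring k1 /\ k0 `<=` k1,
    forall y', generic k1 A y' -> (sker F A x nu :&: tang A y' = 0)%VS,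
    (W <= sker F A x nu)%VS,
    (\dim (sker F A x nu) <= l + 1)%N &
    ((exists2 e0, e0 \in L & e0 \notin sker F A x nu) /\ (l + \dim W <= (\dim (sker F A x nu)).+1)%N
    \/ (L + W <= sker F A x nu)%VS)].
Proof.
have [nu [k1 [hk1 [k01 [ky keta]] etaQ eta0 hy']]] := kernel_bound Kunc sc hk rA dimS dSm fr gyx hk0 kx0 gy.
exists nu, k1; have Wn : (W <= sker F A x nu)%VS.
  by apply/subvP => w; rewrite memv_cap => /andP[w1 w2]; exact: (cap_sker hk rA fr gyx).
split=> //.
  have kx1 : adj k x `<=` k1 by move=> c /kx0 /k01.
  have := dim_sker_le Kunc sc hk m0 dimS fr hk1 kx1 hy'; rewrite -extremal.
  by move: (\dim _) => p; clear; lia.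
have [Ln|] := pselect (L <= sker F A x nu)%VS.
  by right; rewrite subv_add Ln.
move=> nLn; left.
have [e0 e0L e0n] : exists2 e0, e0 \in L & e0 \notin sker F A x nu.
  by apply: contrapT => no; apply: nLn; apply/subvP => e eL; apply: contrapT => /negP en; apply: no; exists e.
split; first by exists e0.
have LW u e : u \in (L + W)%VS -> e \in L -> form nu e u = 0.
  move=> /memv_addP[u1 u1L [u2 u2W ->]] eL; rewrite formDr (sker_isotropic fr gmu nu eL u1L) add0r formC.
  by have /skerP[_ h] := subvP Wn _ u2W; apply: h; exact: (subvP LT).
have dLW : \dim (L + W) = (l + \dim W)%N.
  by rewrite dimv_disjoint_sum ?dL //; exact: sker_cap_y.
have LWT : (L + W <= T)%VS by rewrite subv_add LT capvSl.
have [t tT tn] : exists2 t, t \in T & t \notin (L + W)%VS.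
  apply: contrapT => no; have : (T <= L + W)%VS.
    by apply/subvP => t tT; apply: contrapT => /negP tn; apply: no; exists t.
  move/dimvS; rewrite dT dLW; have := cap_dimE gyx.
  by move: (\dim _) => p; clear; lia.
have TE : (T <= L + W + <[t]>)%VS.
  apply: full_of_dim; first by rewrite subv_add LWT -memvE.
  by rewrite dim_add_line // dT dLW -(cap_dimE gyx); move: (\dim _) => p; clear; lia.
have sub : (L :&: orth <[t *m sff F x nu]> + W <= sker F A x nu)%VS.
  rewrite subv_add Wn andbT; apply/subvP => e; rewrite memv_cap => /andP[eL /orthP eo].
  apply/skerP; split=> [|v vT]; first exact: (subvP LT).
  have /memv_addP[u uLW [_ /vlineP[c ->] ->]] := subvP TE _ vT.
  rewrite -/(form nu _ _) formDr LW // add0r formZr formC (_ : form nu t e = 0) ?mulr0 //.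
  by apply: eo; exact: memv_line.
apply: leq_trans (_ : (\dim (L :&: orth <[t *m sff F x nu]>)).+1 + \dim W <= _)%N.
  by rewrite leq_add2r -dL; exact: dim_cap_orth.
rewrite addSn ltnS -dimv_disjoint_sum ?dimvS //.
apply/eqP; rewrite -subv0 -sker_cap_y; apply: capvS => //; exact: capvSl.
Qed.

End SecondPoint.

(** If the intersection were [0], then [T = L + <[e]>] with [e] isotropic, and [e] would be in [L].
    If its dimension were at least [2], the bounds on the kernels would give [d = l + 3], and two
    choices of the second point would lead to subspaces too large for a hyperplane of [T]. *)
Lemma cap_dim1 y : generic (adj k x) A y -> \dim (T :&: tang A y) = 1%N.
Proof.
move=> gy0; have := cap_dimE gy0; have [y1 gy1] := exists_y.
have ck0 : csubring (adj (adj k x) mu) by do 2 apply: adj_csubring.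
have rkx : subring (adj k x) by exact: adj_subring.
have gy1x : generic (adj k x) A y1 by apply: generic_sub gy1; exact: sub_adj.
have [nu [k1 [[hk1 k01] hy1 Wn dn alt]]] := normal_kernel ck0 (fun c h => h) gy1.
have [nu0 [e0 [e [e0L he eL]]]] := nonconstant_tangent.
have [eT heT] := he; have ee := repr_iso1 fr gmu e0L he he.
have e_nz : exists2 v, v \in T & form mu e v != 0.
  have [v vT hv] := iffLR (repr_not_sker he) eL; exists v => //; by rewrite heT.
move=> dc; have dW1 := cap_dimE gy1x.
have [d0|dpos] := posnP (\dim (T :&: tang A y)).
  exfalso; have : (L + <[e]> <= T)%VS by rewrite subv_add LT -memvE.
  move=> sub; have Tsub : (T <= L + <[e]>)%VS.
    by apply: full_of_dim => //; rewrite dT dim_add_line // dL; move: dc d0; move: (\dim _) => p; clear; lia.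
  have [v vT] := e_nz.
  have /memv_addP[u uL [_ /vlineP[c ->] ->]] := subvP Tsub _ vT.
  by rewrite formDr formZr ee mulr0 addr0 formC skf ?eqxx.
have [d1|dgt] := leqP (\dim (T :&: tang A y)) 1%N.
  by apply/eqP; rewrite eqn_leq d1.
exfalso; have dW1' : \dim (T :&: tang A y1) = \dim (T :&: tang A y).
  by move: dW1 dc; move: (\dim _) (\dim _) => p q; clear; lia.
have nosub nu' y' : (\dim (sker F A x nu') <= l + 1)%N -> (L :&: (T :&: tang A y') = 0)%VS ->
    \dim (T :&: tang A y') = \dim (T :&: tang A y) ->
    ~ (L + (T :&: tang A y') <= sker F A x nu')%VS.
  move=> dn' c0 dd /dimvS; rewrite dimv_disjoint_sum // dL dd.
  by move: dn' dgt; move: (\dim _) (\dim _) => p q; clear; lia.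
case: alt => [[[a aL an] dsk]|sub]; last first.
  exact: (nosub nu y1 dn (sker_cap_y (fun c h => h) gy1) dW1' sub).
have [y2 gy2] := exists_generic Kunc hk1 Acl Apr.
have [nu2 [k2 [[hk2 k12] hy2 Wn2 dn2 alt2]]] := normal_kernel hk1 k01 gy2.
have gy2x : generic (adj k x) A y2 by apply: generic_sub gy2 => c kc; apply: k01; exact: sub_adj.
have dW2 : \dim (T :&: tang A y2) = \dim (T :&: tang A y).
  by have := cap_dimE gy2x; move: dc; move: (\dim _) (\dim _) => p q; clear; lia.
case: alt2 => [[[a2 a2L a2n] dsk2]|sub]; last first.
  exact: (nosub nu2 y2 dn2 (sker_cap_y k01 gy2) dW2 sub).
have notin nu' b : b \in L -> b \notin sker F A x nu' -> exists2 v, v \in T & form nu' b v != 0.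
  move=> bL bn; apply: contrapT => no; move/negP: bn; apply; apply/skerP; split=> [|v vT].
    exact: (subvP LT).
  by apply/eqP/negPn/negP => h; apply: no; exists v.
have [b [bL bn bn2]] : exists b, [/\ b \in L, b \notin sker F A x nu & b \notin sker F A x nu2].
  have [an2|/negPn an2] := boolP (a \notin sker F A x nu2); first by exists a.
  have [a2n'|/negPn a2n'] := boolP (a2 \notin sker F A x nu); first by exists a2.
  exists (a + a2); split; first exact: memvD.
    by apply: contra an => h; rewrite -(addrK a2 a) memvB.
  by apply: contra a2n => h; rewrite -(addKr a a2) memvD // memvN.
have [e1 he1] := repr_exists fr gmu nu bL; have [e2 he2] := repr_exists fr gmu nu2 bL.
have e1L : e1 \notin L by apply/(repr_not_sker he1); exact: notin.
have e2L : e2 \notin L by apply/(repr_not_sker he2); exact: notin.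
have [e1T he1T] := he1; have [e2T he2T] := he2.
have q11 := repr_iso1 fr gmu bL he1 he1; have q12 := repr_iso1 fr gmu bL he1 he2.
have q22 := repr_iso1 fr gmu bL he2 he2.
pose H := (T :&: orth <[e1 *m sff F x mu]>)%VS.
have HP v : v \in H <-> v \in T /\ form mu e1 v = 0.
  rewrite memv_cap; split=> [/andP[vT /orthP h]|[vT h]].
    by split=> //; apply: h; exact: memv_line.
  by rewrite vT; apply/orthP => _ /vlineP[c ->]; rewrite dotZl -/(form mu e1 v) h mulr0.
have [f fT hf] := iffLR (repr_not_sker he1) e1L; rewrite -he1T // in hf.
have dH : (\dim H < d)%N.
  rewrite -dT ltnNge; apply/negP => le; have : (T <= H)%VS.
    by rewrite -(geq_leqif (dimv_leqif_sup _)) // capvSl.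
  by move/subvP => /(_ f fT) /HP[_ h]; rewrite h eqxx in hf.
(* Otherwise [L], [e1], [e2] and [w] would span [T], since [d = l + 3]; [e2] is orthogonal to all of
   them and would be in [L]. *)
have H2 w : w \in T -> form mu e2 w = 0 -> form mu e1 w = 0.
  move=> wT h2; apply/eqP/negPn/negP => h1.
  have e2n : e2 \notin (L + <[e1]>)%VS.
    apply/negP => /memv_addP[u uL [_ /vlineP[c ->] e2E]].
    move: h2; rewrite e2E formDl formZl skf // add0r => /eqP.
    rewrite mulf_eq0 (negPf h1) orbF => /eqP c0.
    by rewrite e2E c0 scale0r addr0 uL in e2L.
  have wn : w \notin (L + <[e1]> + <[e2]>)%VS.
    apply: contra h1 => /memv_addP[_ /memv_addP[u uL [_ /vlineP[c ->] ->]] [_ /vlineP[c' ->] ->]].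
    by rewrite !formDr !formZr q11 q12 !mulr0 !addr0 formC skf.
  have Tsub : (T <= L + <[e1]> + <[e2]> + <[w]>)%VS.
    apply: full_of_dim; first by rewrite !subv_add LT -!memvE e1T e2T wT.
    rewrite !dim_add_line // dT dL; move: dsk dn dW1' dc.
    by move: (\dim _) (\dim _) (\dim _) => p p' q; clear; lia.
  have [v vT] := iffLR (repr_not_sker he2) e2L; rewrite -he2T // => /negP; apply; apply/eqP.
  have /memv_addP[_ /memv_addP[_ /memv_addP[u uL [_ /vlineP[c ->] ->]] [_ /vlineP[c1 ->] ->]] [_ /vlineP[c2 ->] ->]] := subvP Tsub _ vT.
  rewrite !formDr !formZr h2 q22 (formC _ _ _ e2 e1) q12 !mulr0 !addr0.
  by rewrite formC skf.
(* These two subspaces meet only in [0], and their dimensions add up to at least [d], more than that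
   of [H]. *)
have : (sker F A x nu + (T :&: tang A y2) <= H)%VS.
  rewrite subv_add; apply/andP; split; apply/subvP => w.
    move=> /skerP[wT hw]; apply/HP; split=> //; rewrite he1T // formC; apply: hw; exact: (subvP LT).
  move=> wW; have wT : w \in T by move: wW; rewrite memv_cap => /andP[].
  apply/HP; split=> //; apply: H2 => //; rewrite he2T // formC.
  by have /skerP[_ h] := subvP Wn2 _ wW; apply: h; exact: (subvP LT).
move/dimvS; rewrite dimv_disjoint_sum; last first.
  by apply/eqP; rewrite -subv0 -(hy1 y2 gy2); apply: capvS => //; exact: capvSr.
move: dH dsk dW1' dgt dc; rewrite dW2.
by move: (\dim _) (\dim _) (\dim _) (\dim _) => p p' q q'; clear; lia.
Qed.

End AtPoint.
End PositiveDefect.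

(** * A linear relation from commutators *)

Section Cocycle.
Variables (K : numClosedFieldType) (V : lmodType K) (P : V -> Prop) (tau : V -> V -> K) (b1 b2 : V -> K) (p p' : V).
Hypotheses (PL : forall s a c, P a -> P c -> P (s *: a + c)) (Pp : P p) (Pp' : P p').
Hypotheses (tauL : forall s a a' c, P a -> P a' -> P c -> tau (s *: a + a') c = s * tau a c + tau a' c)
  (tauR : forall s a c c', P a -> P c -> P c' -> tau a (s *: c + c') = s * tau a c + tau a c').
Hypotheses (b1L : forall s a c, b1 (s *: a + c) = s * b1 a + b1 c)
  (b2L : forall s a c, b2 (s *: a + c) = s * b2 a + b2 c).
Hypotheses (b1p : b1 p = 0) (b1p' : b1 p' = 1) (b2p : b2 p = 1) (b2p' : b2 p' = 0).
Hypothesis rel1 : forall a b c, P a -> P b -> P c ->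
  tau b c * b1 a - tau a c * b1 b = (tau a b - tau b a) * b1 c.
Hypothesis rel2 : forall a b c, P a -> P b -> P c ->
  tau b c * b2 a - tau a c * b2 b = (tau a b - tau b a) * b2 c.

(** Vectors killed by both functionals are eliminated by testing the relations against [p] and [p'];
    on the span of [p] and [p'] the relations reduce to [3 tau p p' = 0]. *)
Lemma cocycle_zero a c : P a -> P c -> tau a c = 0.
Proof.
have N1 n : P n -> b1 n = 0 -> b2 n = 0 -> forall c, P c -> tau n c = 0 /\ tau c n = 0.
  move=> Pn n1 n2; have np' : tau n p' = 0.
    by have := rel2 Pn Pp Pp'; rewrite n2 b2p b2p' !mulr0 mulr1 sub0r => /eqP; rewrite oppr_eq0 => /eqP.
  have np : tau n p = 0.
    by have := rel1 Pn Pp' Pp; rewrite n1 b1p b1p' !mulr0 mulr1 sub0r => /eqP; rewrite oppr_eq0 => /eqP.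
  have left e : P e -> tau n e = 0.
    move=> Pe; pose e0 := - b1 e *: p' + (- b2 e *: p + e).
    have Pe1 : P (- b2 e *: p + e) by exact: PL.
    have Pe0 : P e0 by exact: PL.
    have h1 : b1 e0 = 0 by rewrite /e0 !b1L b1p b1p'; ring.
    have h2 : b2 e0 = 0 by rewrite /e0 !b2L b2p b2p'; ring.
    have : tau n e0 = 0.
      by have := rel2 Pn Pp Pe0; rewrite n2 h2 b2p !mulr0 mulr1 sub0r => /eqP; rewrite oppr_eq0 => /eqP.
    by rewrite /e0 !tauR // np np' !mulr0 !add0r.
  move=> e Pe; split; first exact: left.
  have := rel2 Pn Pe Pp; rewrite n2 !left // b2p mulr0 mul0r subr0 mulr1 sub0r => /esym/eqP.
  by rewrite oppr_eq0 => /eqP.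
have pp : tau p p = 0.
  by have := rel1 Pp Pp' Pp; rewrite b1p b1p' !mulr0 mulr1 sub0r => /eqP; rewrite oppr_eq0 => /eqP.
have p'p' : tau p' p' = 0.
  by have := rel2 Pp Pp' Pp'; rewrite b2p b2p' !mulr0 mulr1 subr0.
have e1 : tau p' p = tau p p' - tau p' p.
  by have := rel2 Pp Pp' Pp; rewrite b2p b2p' !mulr0 !mulr1 subr0.
have e2 : - tau p p' = tau p p' - tau p' p.
  by have := rel1 Pp Pp' Pp'; rewrite b1p b1p' !mulr0 !mulr1 sub0r.
have e3 : tau p p' = 0.
  have /eqP : tau p p' *+ 3 = 0.
    have e4 : tau p' p = tau p p' *+ 2 by apply: oppr_inj; apply: (addrI (tau p p')); rewrite -e2; ring.
    by move: e1; rewrite e4 => e5; apply/eqP; rewrite -subr_eq0; apply/eqP; transitivity (tau p p' *+ 2 - (tau p p' - tau p p' *+ 2)); [ring | rewrite -e5 subrr].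
  by rewrite mulrn_eq0 => /eqP.
have e4 : tau p' p = 0.
  by apply: oppr_inj; rewrite oppr0; have := e2; rewrite e3 oppr0 sub0r.
have dec e : P e -> exists n, [/\ P n, b1 n = 0, b2 n = 0 & e = b1 e *: p' + (b2 e *: p + n)].
  move=> Pe; exists (- b1 e *: p' + (- b2 e *: p + e)); split.
  - by do 2 apply: PL => //.
  - by rewrite !b1L b1p b1p'; ring.
  - by rewrite !b2L b2p b2p'; ring.
  - by rewrite addrCA (addrA (b1 e *: p')) -scalerDl subrr scale0r add0r addrA -scalerDl subrr scale0r add0r.
move=> Pa Pc; have [n [Pn n1 n2 ->]] := dec a Pa; have [n' [Pn' n1' n2' ->]] := dec c Pc.
have Q1 : P (b2 a *: p + n) by exact: PL.
have Q2 : P (b2 c *: p + n') by exact: PL.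
have Q3 : P (b1 c *: p' + (b2 c *: p + n')) by exact: PL.
rewrite tauL // tauL //; have [-> _] := N1 n Pn n1 n2 _ Q3.
by rewrite !tauR //; have [_ z] := N1 n' Pn' n1' n2' _ Pp; have [_ z'] := N1 n' Pn' n1' n2' _ Pp';
  rewrite z z' pp p'p' e3 e4 !mulr0 !addr0 !mulr0 addr0.
Qed.

End Cocycle.

(** * Linear spaces swept out by the contact loci *)

Section DefectOne.
Variables (K : numClosedFieldType) (m d : nat).
Hypothesis Kunc : ~ countable [set: K].
Variables (A : set 'rV[K]_m) (k : set K) (dS l : nat).
Hypotheses (sc : smooth_cone A d) (hk : csubring k) (rA : ratl k A) (m0 : (0 < m)%N) (r0 : (0 < m - d)%N).
Hypothesis dimS : forall x y, generic k A x -> generic (adj k x) A y ->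
  \dim (tang A x + tang A y) = dS.
Hypothesis dSm : (dS < m)%N.
Hypothesis dimL : forall x (F : 'I_(m - d) -> {mpoly K[m]}) mu, frame A k x F ->
  generic (adj k x) [set: 'rV[K]_(m - d)] mu -> \dim (sker F A x mu) = l.
Hypothesis extremal : (l + d + 1 = dS)%N.
Hypothesis l2 : (1 < l)%N.
Implicit Types (u v w e : 'rV[K]_m).

Let Acl : algclosed A. Proof. by case: (sc_cone sc). Qed.
Let Asc (s : K) v : A v -> A (s *: v). Proof. by case: (sc_cone sc) => _ _; apply. Qed.
Let Apr := sc_prime sc.
Let rk : subring k. Proof. by case: hk. Qed.

Section Sweep.
Variables (x : 'rV[K]_m) (F : 'I_(m - d) -> {mpoly K[m]}).
Hypothesis fr : frame A k x F.
Local Notation T := (tang A x).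
Local Notation S := (form x F).

(** [U = L + <[e]>] is the hyperplane of [T] orthogonal to [e], and all forms vanish on it.
    Derivatives along [U] of vectors of [U] stay tangent and can leave [U] only by a scalar [tau];
    commutators of derivations give the relations of [cocycle_zero], so [tau = 0] and [U] is
    contained in [A]. *)
Lemma linear_sweep : exists U : {vspace 'rV[K]_m},
  [/\ (U <= tang A x)%VS, \dim U = (l + 1)%N, forall u, u \in U -> A u &
   forall y, generic (adj k x) A y -> (tang A x :&: tang A y <= U)%VS].
Proof.
have gx := fr_gen fr.
have [mu gmu] := exists_generic Kunc (adj_csubring x hk) (@setT_closed K (m - d)) (@setT_prime K _).
pose L := sker F A x mu.
have rkx : subring (adj k x) by exact: adj_subring.
have dT : \dim T = d := dim_tang_generic sc hk m0 gx.
have dL : \dim L = l by exact: dimL.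
have LT v : v \in L -> v \in T by exact: sker_sub.
have LS v u : v \in L -> u \in T -> S mu v u = 0 by exact: sker_form.
have iso nu v u : v \in L -> u \in L -> S nu v u = 0 by exact: (sker_isotropic fr gmu).
have [y1 gy1] := exists_generic Kunc (adj_csubring x hk) Acl Apr.
have dE : d = (l + 2)%N.
  have := cap_dimE Kunc sc hk rA m0 dimS extremal fr gy1.
  by rewrite (cap_dim1 Kunc sc hk rA m0 r0 dimS dSm dimL extremal fr gmu l2 gy1); clear; lia.
have [nu0 [l0 [e [l0L he eL]]]] := nonconstant_tangent Kunc sc hk rA m0 dimS dimL extremal fr gmu l2.
have [eT heT] := he; have ee : S mu e e = 0 := repr_iso1 fr gmu l0L he he.
pose U := (L + <[e]>)%VS.
have dU : \dim U = (l + 1)%N by rewrite dim_add_line // dL addn1.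
have UT : (U <= T)%VS by rewrite subv_add -memvE eT andbT; apply/subvP => v; exact: LT.
have UTv v : v \in U -> v \in T by exact: (subvP UT).
have UE u : u \in U -> exists2 v, v \in L & exists c, u = v + c *: e.
  by move=> /memv_addP[v vL [_ /vlineP[c ->] ->]]; exists v => //; exists c.
have LU v : v \in L -> v \in U by exact: (subvP (addvSl _ _)).
have eU : e \in U by apply: (subvP (addvSr _ _)); exact: memv_line.
have [t tT wt] : exists2 t, t \in T & S mu e t = 1.
  have [v vT hv] := iffLR (repr_not_sker he) eL; exists ((S mu e v)^-1 *: v); first exact: memvZ.
  by rewrite formZr mulVf // heT.
have Uiso u u' : u \in U -> u' \in U -> S mu u u' = 0.
  move=> /UE[v vL [c ->]] /UE[v' v'L [c' ->]].
  rewrite formDl !formDr !formZl !formZr ee (LS v) ?LT // (LS v e) //.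
  by rewrite formC LS // !mulr0 !addr0.
have wU u : u \in U -> S mu e u = 0 by exact: Uiso.
have tU : t \notin U by apply/negP => /wU; rewrite wt => /eqP; rewrite oner_eq0.
have TE v : v \in T -> exists2 u, u \in U & exists s, v = u + s *: t.
  have sub : (T <= U + <[t]>)%VS.
    apply: full_of_dim; first by rewrite subv_add UT -memvE.
    by rewrite dim_add_line // dU dT dE; clear; lia.
  by move=> /(subvP sub)/memv_addP[u uU [_ /vlineP[s ->] ->]]; exists u => //; exists s.
have Uchar v : v \in T -> S mu e v = 0 -> v \in U.
  move=> /TE[u uU [s ->]]; rewrite formDr formZr wU // wt mulr1 add0r => ->.
  by rewrite scale0r addr0.
(* Polarization of [repr_iso2] for the direction [nu0 + nu]: of the four terms, those other than
   [form mu e e'] vanish. *)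
have stepA nu v e' : v \in L -> repr A x F mu nu v e' -> e' \in U.
  move=> vL he'; have [e'T he'T] := he'; apply: (Uchar) => //.
  have [a ha] := repr_exists fr gmu nu l0L; have [b hb] := repr_exists fr gmu nu0 vL.
  have [aT haT] := ha; have [bT hbT] := hb.
  have aU : a \in U by apply: (Uchar) => //; exact: (repr_iso1 fr gmu l0L he ha).
  have eb : S mu e b = 0 := repr_iso2 fr gmu l0L vL he hb.
  have bU : b \in U by exact: (Uchar).
  have r1 : repr A x F mu (nu0 + nu) l0 (e + a).
    by split; [exact: memvD | move=> w wT; rewrite formDl formDm heT // haT].
  have r2 : repr A x F mu (nu0 + nu) v (b + e').
    by split; [exact: memvD | move=> w wT; rewrite formDl formDm hbT // he'T].
  have := repr_iso2 fr gmu l0L vL r1 r2; rewrite formDl !formDr eb.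
  rewrite (Uiso a b) // (_ : S mu a e' = 0) ?addr0 ?add0r //.
  exact: (repr_iso2 fr gmu l0L vL ha he').
have SLe nu v : v \in L -> S nu v e = 0.
  move=> vL; have [e' he'] := repr_exists fr gmu nu vL; have [e'T he'T] := he'.
  by rewrite -he'T // Uiso //; exact: (stepA _ _ _ vL he').
have See1 (nu : 'rV[K]_(m - d)) v w : (forall i, adj k x (nu 0 i)) -> v \in L -> w \in T -> S nu v w != 0 -> S nu e e = 0.
  move=> knu vL wT h; have [e' he'] := repr_exists fr gmu nu vL; have [e'T he'T] := he'.
  have := repr_const fr gmu knu vL he'; have /UE[v' v'L [c e'E]] := stepA _ _ _ vL he'.
  rewrite e'E formDl !formDr !formZl !formZr iso // SLe //.
  rewrite (_ : S nu e v' = 0) ?mulr0 ?add0r; last by rewrite formC; exact: (SLe).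
  move/eqP; rewrite !mulf_eq0 orbA orbb => /orP[/eqP c0|/eqP //].
  by move: h; rewrite -he'T // e'E c0 scale0r addr0 LS ?eqxx.
have Ssum nu v w : S nu v w = \sum_i nu 0 i * S (delta_mx 0 i) v w.
  rewrite {1}(row_sum_delta nu); elim/big_rec2: _ => [|i y z _ <-]; first exact: form0m.
  by rewrite formDm formZm.
have kdelta i j : adj k x ((delta_mx 0 i : 'rV[K]_(m - d)) 0 j).
  by rewrite mxE; exact: subring_nat.
have [nu1 [k1 h1]] : exists nu1 : 'rV[K]_(m - d), (forall i, adj k x (nu1 0 i)) /\ S nu1 l0 t != 0.
  apply: contrapT => no; have : S nu0 l0 t = 0.
    rewrite Ssum big1 // => i _; rewrite (_ : S _ _ _ = 0) ?mulr0 //.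
    by apply/eqP/negPn/negP => h; apply: no; exists (delta_mx 0 i).
  by rewrite -heT // wt => /eqP; rewrite oner_eq0.
(* By linearity unit vectors suffice. One that pairs [l0] and [t] to zero is handled by adding
   [nu1], for which this pairing is nonzero. *)
have See nu : S nu e e = 0.
  rewrite Ssum big1 // => i _; rewrite (_ : S _ _ _ = 0) ?mulr0 //.
  have [h|h] := eqVneq (S (delta_mx 0 i) l0 t) 0; last exact: (See1 _ _ _ (kdelta i) l0L tT h).
  have z1 := See1 _ _ _ k1 l0L tT h1.
  have : S (delta_mx 0 i + nu1) e e = 0.
    apply: (See1 _ l0 t) => //; first by move=> j; rewrite mxE; exact: subringD.
    by rewrite formDm h add0r.
  by rewrite formDm z1 addr0.
have SU nu u u' : u \in U -> u' \in U -> S nu u u' = 0.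
  move=> /UE[v vL [s ->]] /UE[v' v'L [s' ->]].
  rewrite !formDr !formZr !formDl !formZl See iso // SLe // (formC _ _ _ e) SLe //.
  by rewrite !(mulr0, addr0).
have stU D u : Der (adj k x) D -> u \in U -> vder D u \in U.
  move=> hD; have [dD _] := hD; move=> /UE[v vL [s ->]].
  rewrite vderD // vderZ //; apply: memvD.
    by rewrite -memvN; apply: (stepA _ _ _ vL (repr_der fr hD vL)).
  apply: memvD; apply: memvZ => //; apply: (Uchar); first exact: (tang_stable fr hD eT).
  have := der_form fr mu e e hD; rewrite ee (der0 dD) See add0r.
  rewrite formC -mulr2n => /esym/eqP; rewrite mulrn_eq0 => /eqP //.
(* Since [U] is isotropic for every form, pairing with a vector of [U] factors through the single
   functional [S mu e]. *)
have bw nu (a : 'rV[K]_m) v : a \in U -> v \in T -> S nu a v = S nu a t * S mu e v.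
  move=> aU /TE[u uU [s ->]]; rewrite !formDr !formZr SU // wU // wt.
  by rewrite !add0r mulr1 mulrC.
have /choice[Dof hDof] (a : 'rV[K]_m) : exists D, a \in U -> Der k D /\ vder D x = a.
  have [aU|nU] := boolP (a \in U); last by exists (fun=> 0).
  by have [D hD] := velocity fr (UTv _ aU); exists D.
pose tau (a c : 'rV[K]_m) := S mu e (vder (Dof a) c).
have DT D (c : 'rV[K]_m) : Der k D -> vder D x \in U -> c \in U -> vder D c \in T.
  by move=> hD DU cU; apply: (tang_der fr hD (UTv _ cU)) => nu; exact: SU.
have tau_wd D (a c : 'rV[K]_m) : Der k D -> vder D x = a -> a \in U -> c \in U -> S mu e (vder D c) = tau a c.
  move=> hD Dx aU cU; have [hD' D'x] := hDof a aU; have [dD kD] := hD; have [dD' kD'] := hD'.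
  pose E b := D b - Dof a b.
  have Ev (v : 'rV[K]_m) : vder E v = vder D v - vder (Dof a) v by apply/rowP => i; rewrite !mxE.
  have hE : Der (adj k x) E.
    apply/Der_adj => //; split; last by rewrite Ev Dx D'x subrr.
    split; last by move=> b kb; rewrite /E kD // kD' // subrr.
    split=> b b'; rewrite /E; first by case: dD => -> _; case: dD' => -> _; ring.
    by case: dD => _ ->; case: dD' => _ ->; ring.
  have := wU _ (stU E c hE cU); rewrite Ev.
  by rewrite formBr => /eqP; rewrite subr_eq0 => /eqP.
have ar (p q r s z u : K) : - (p * q) - - (r * s) = - (z * u) -> q * p - s * r = u * z.
  by move=> h; transitivity (- (- (p * q) - - (r * s))); [ring | rewrite h; ring].
(* [normal_der] for the bracket of the derivations moving [x] by [a] and by [b]: the bracket moves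
   [x] by the difference of [vder (Dof a) b] and [vder (Dof b) a]. *)
have rel nu (a b c : 'rV[K]_m) : a \in U -> b \in U -> c \in U ->
    tau b c * S nu a t - tau a c * S nu b t = (tau a b - tau b a) * S nu c t.
  move=> aU bU cU; have [hD Dx] := hDof a aU; have [hD' D'x] := hDof b bU.
  have hE := Der_bracket hD hD'.
  have DbT : vder (Dof b) c \in T by apply: (DT) => //; rewrite D'x.
  have DaT : vder (Dof a) c \in T by apply: (DT) => //; rewrite Dx.
  have e1 := normal_der fr nu hD DbT; rewrite Dx (bw nu a _ aU DbT) in e1.
  have e2 := normal_der fr nu hD' DaT; rewrite D'x (bw nu b _ bU DaT) in e2.
  have fT := tangent_velocity fr hE; rewrite vder_bracket Dx D'x in fT.
  have := normal_der fr nu hE (UTv _ cU).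
  rewrite !vder_bracket Dx D'x formC (bw nu c _ cU fT) dotBr e1 e2 formBr; exact: ar.
have aff D D' s q (v : 'rV[K]_q) : vder (fun b => s * D b + D' b) v = s *: vder D v + vder D' v.
  by apply/rowP => i; rewrite !mxE.
have tau0 a c : a \in U -> c \in U -> tau a c = 0.
  pose s0 := S nu0 e t.
  (* The functionals come from [mu] and [nu0]; subtracting [s0] times the first makes them dual to
     the pair [e], [l0]. *)
  apply: (@cocycle_zero K _ (fun u => u \in U) tau (fun u => S mu u t) (fun u => S nu0 u t - s0 * S mu u t) l0 e).
  - by move=> s b b' bU b'U; rewrite memvD // memvZ.
  - exact: LU.
  - exact: eU.
  - move=> s b b' b'' bU b'U b''U; have [hD Dx] := hDof b bU; have [hD' D'x] := hDof b' b'U.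
    rewrite -(tau_wd (fun y => s * Dof b y + Dof b' y) (s *: b + b') b'') //.
    + by rewrite aff formDr formZr.
    + have [dD kD] := hD; have [dD' kD'] := hD'; split; first by apply: der_add => //; exact: der_scale.
      by move=> y ky; rewrite kD // kD' // mulr0 addr0.
    + by rewrite aff Dx D'x.
    + by rewrite memvD // memvZ.
  - move=> s b b' b'' bU b'U b''U; have [[dD _] _] := hDof b bU.
    by rewrite /tau vderD // vderZ // !formDr !formZr wU // mulr0 add0r.
  - by move=> s b b'; rewrite formDl formZl.
  - by move=> s b b'; rewrite !formDl !formZl; ring.
  - exact: LS.
  - exact: wt.
  - by rewrite -heT // (LS l0 t) // mulr0 subr0.
  - by rewrite /s0 wt mulr1 subrr.
  - by move=> b b' b'' bU b'U b''U; exact: rel.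
  - move=> b b' b'' bU b'U b''U; have r1 := rel mu b b' b'' bU b'U b''U; have r2 := rel nu0 b b' b'' bU b'U b''U.
    transitivity ((tau b' b'' * S nu0 b t - tau b b'' * S nu0 b' t) - s0 * (tau b' b'' * S mu b t - tau b b'' * S mu b' t)).
      by ring.
    by rewrite r1 r2; ring.
have Ust D u : along k x U D -> u \in U -> vder D u \in U.
  move=> [hD DU] uU; apply: (Uchar); first exact: (DT).
  by rewrite (tau_wd D (vder D x) u) // tau0.
exists U; split=> //; first exact: (along_sub fr (sc_cone sc) UT (LU _ (x_sker fr Asc mu)) Ust).
(* A common tangent vector outside [U] would lie in the kernel of [nu] and, with [U] isotropic,
   force that kernel to be all of [T], against [dim_sker_le]. *)
move=> y gy; apply/subvP => w; rewrite memv_cap => /andP[wT wTy]; apply: contrapT => /negP wU'.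
have [nu [k2 [hk2 [k02 _] etaQ _ hy']]] := kernel_bound Kunc sc hk rA dimS dSm fr gy (adj_csubring x hk) (fun c h => h) gy.
have ws := cap_sker hk rA fr gy etaQ wT wTy.
have le := dim_sker_le Kunc sc hk m0 dimS fr hk2 k02 hy'.
have sub : (T <= U + <[w]>)%VS.
  apply: full_of_dim; first by rewrite subv_add UT -memvE.
  by rewrite dim_add_line // dU dT dE; clear; lia.
have : (T <= sker F A x nu)%VS.
  apply/subvP => v vT; apply/skerP; split=> // v' v'T; rewrite -/(form x F nu v v').
  have /memv_addP[u uU [_ /vlineP[s ->] ->]] := subvP sub _ vT.
  have /memv_addP[u' u'U [_ /vlineP[s' ->] ->]] := subvP sub _ v'T.
  have wv v0 : v0 \in T -> S nu w v0 = 0 by case/skerP: ws => _; apply.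
  rewrite formDl formZl formDr formZr SU // wv; last by rewrite memvD ?memvZ // UTv.
  by rewrite formC wv ?UTv // !mulr0 !addr0.
move/dimvS; rewrite dT; move: le dE extremal; move: (\dim _) => q; clear; lia.
Qed.

End Sweep.

Lemma tang_linear (U : {vspace 'rV[K]_m}) t : (forall u, u \in U -> A u) -> t \in U -> (U <= tang A t)%VS.
Proof.
move=> hU tU; apply/subvP => u uU; apply/tangP => p pA; have [Q hQ] := line_poly p t u.
have Q0 : Q = 0.
  by apply: poly_nat_roots => s; have [<- _] := hQ s%:R; apply: pA; apply: hU; rewrite memvD // memvZ.
by have [_] := hQ 0; rewrite Q0 deriv0 horner0 scale0r addr0.
Qed.

Theorem defect_absurd : False.
Proof.
have [x [F fr]] := exists_frame Kunc sc m0 hk rA; have gx := fr_gen fr.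
have [y gy] := exists_generic Kunc (adj_csubring x hk) Acl Apr.
have [gy' gx'] := generic_swap Kunc sc hk rA gx gy.
have fr' := frame_transfer fr gy'.
have [U [UT dU UA UW]] := linear_sweep fr; have [U' [UT' dU' UA' UW']] := linear_sweep fr'.
have [mu gmu] := exists_generic Kunc (adj_csubring x hk) (@setT_closed K (m - d)) (@setT_prime K _).
have d1 := cap_dim1 Kunc sc hk rA m0 r0 dimS dSm dimL extremal fr gmu l2 gy.
have dE := cap_dimE Kunc sc hk rA m0 dimS extremal fr gy; rewrite d1 in dE.
set W := (tang A x :&: tang A y)%VS in d1 dE *.
have tW : vpick W \in W by exact: memv_pick.
have t0 : vpick W != 0 by rewrite vpick0 -dimv_eq0 d1.
set t := vpick W in tW t0.
have tU : t \in U by exact: (subvP (UW y gy)).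
have tU' : t \in U' by apply: (subvP (UW' x gx')); rewrite capvC.
have At := UA _ tU.
have sub : (U + U' <= tang A t)%VS by rewrite subv_add !tang_linear.
have capW : (U :&: U' <= W)%VS by apply: capvS.
(* [U + U'] has dimension at least [2 (l + 1) - 1], but the tangent space at [t] has dimension
   [d = l + 2], and [l > 1]. *)
have := dimvS sub; rewrite (sc_smooth sc At t0); move: (dimvS capW) (dimv_sum_cap U U').
rewrite d1 dU dU'; move: dE l2; move: (\dim _) (\dim _) => p q; clear; lia.
Qed.

End DefectOne.

(** * Surfaces and conics *)

Section Conic.
Variables (K : numClosedFieldType) (m d : nat).
Hypothesis Kunc : ~ countable [set: K].
Variables (A : set 'rV[K]_m) (k : set K) (dS : nat).
Hypotheses (sc : smooth_cone A d) (hk : csubring k) (rA : ratl k A) (m0 : (0 < m)%N) (r0 : (0 < m - d)%N).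
Hypothesis dimS : forall x y, generic k A x -> generic (adj k x) A y ->
  \dim (tang A x + tang A y) = dS.
Hypothesis dSm : (dS < m)%N.
Hypothesis extremal : (1 + d + 1 = dS)%N.
Hypothesis d2 : (2 < d)%N.
Implicit Types (u v w e : 'rV[K]_m).

Let Acl : algclosed A. Proof. by case: (sc_cone sc). Qed.
Let Asc (s : K) v : A v -> A (s *: v). Proof. by case: (sc_cone sc) => _ _; apply. Qed.
Let Apr := sc_prime sc.
Let rk : subring k. Proof. by case: hk. Qed.

Section AtPoint.
Variables (x : 'rV[K]_m) (F : 'I_(m - d) -> {mpoly K[m]}).
Hypothesis fr : frame A k x F.
Local Notation T := (tang A x).
Local Notation G := (grads F x).
Local Notation S := (form x F).
Local Notation kx := (adj k x).

Let gx := fr_gen fr.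
Let x0 : x != 0. Proof. exact: (generic_neq0 sc m0 hk gx). Qed.
Let dT : \dim T = d. Proof. exact: (dim_tang_generic sc hk m0 gx). Qed.
Let ckx : csubring kx. Proof. exact: adj_csubring. Qed.
Let rkx : subring kx. Proof. by case: ckx. Qed.
Let xT : x \in T. Proof. exact: (x_tangent fr Asc). Qed.
Let Tst D w : Der kx D -> w \in T -> vder D w \in T. Proof. exact: (tang_stable fr). Qed.
Let Sx nu u : u \in T -> S nu x u = 0. Proof. by move=> uT; rewrite formC; exact: (sff_euler fr Asc). Qed.

Let cdE y : generic kx A y -> (\dim (T :&: tang A y) + 1 + 1 = d)%N.
Proof. exact: (cap_dimE Kunc sc hk rA m0 dimS extremal fr). Qed.

Lemma grads_const D : Der kx D -> map_mx D G = 0.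
Proof.
move=> hD; have [hDk Dx] := Der_kx fr hD; apply/row_matrixP => i; rewrite row0.
have [Fk _] := fr_over fr i.
by rewrite -(mul0mx _ (hess (F i) x)) -Dx -(vder_grad x hDk rk Fk); apply/rowP => j; rewrite !mxE.
Qed.

Lemma normal_const D nu : Der kx D -> vder D (nu *m G) = vder D nu *m G.
Proof. by move=> hD; have [dD _] := hD; rewrite vder_mulmx // grads_const // mulmx0 addr0. Qed.

Lemma not_x_tang mu y : generic kx [set: 'rV[K]_(m - d)] mu -> generic (adj kx mu) A y -> x \notin tang A y.
Proof.
move=> gmu gy; apply: contra x0 => xTy; have := sker_cap Kunc sc fr r0 gmu gy.
have : x \in (sker F A x mu :&: tang A y)%VS by rewrite memv_cap xTy (x_sker fr Asc).
by move=> h1 h2; move: h1; rewrite h2 memv0.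
Qed.

Variables (mu : 'rV[K]_(m - d)) (y : 'rV[K]_m) (nu : 'rV[K]_(m - d)) (k1 : set K).
Hypothesis gmu : generic kx [set: 'rV[K]_(m - d)] mu.
Hypothesis gy : generic (adj kx mu) A y.
Local Notation Q := (orth (T + tang A y)).
Hypotheses (hk1 : csubring k1) (k01 : adj kx mu `<=` k1) (etaQ : nu *m G \in Q) (eta0 : nu *m G != 0).
Hypothesis hy' : forall y', generic k1 A y' -> (sker F A x nu :&: tang A y' = 0)%VS.
Local Notation t := (vpick (T :&: tang A y)%VS).

Let gyx : generic kx A y. Proof. by apply: generic_sub gy; exact: sub_adj. Qed.
Let kx1 : kx `<=` k1. Proof. by move=> c kc; apply: k01; exact: sub_adj. Qed.
Let tW : t \in (T :&: tang A y)%VS. Proof. exact: memv_pick. Qed.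
Let tT : t \in T. Proof. by move: tW; rewrite memv_cap => /andP[]. Qed.
Let tTy : t \in tang A y. Proof. by move: tW; rewrite memv_cap => /andP[]. Qed.
Let t0 : t != 0.
Proof. by rewrite vpick0 -dimv_eq0; have := cdE gyx; move: d2; move: (\dim _) => p; clear; lia. Qed.
Let xTy : x \notin tang A y. Proof. exact: (not_x_tang gmu gy). Qed.
Let yTy : y \in tang A y. Proof. by apply: tang_cone => //; case: gy. Qed.
Let t_sker nu' : nu' *m G \in Q -> t \in sker F A x nu'.
Proof. by move=> h; exact: (cap_sker hk rA fr gyx h tT tTy). Qed.
Let orthT v : v \in Q -> v \in orth T. Proof. exact: (subvP (orthS (addvSl _ _))). Qed.

(** The kernel of [nu] contains the common tangents, of dimension [d - 2], and also [x], whereas its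
    dimension is at most [dS - d = 2]. *)
Lemma cone_dim3 : d = 3%N.
Proof.
have le := dim_sker_le Kunc sc hk m0 dimS fr hk1 kx1 hy'.
have sub : ((T :&: tang A y) + <[x]> <= sker F A x nu)%VS.
  rewrite subv_add -memvE (x_sker fr Asc) andbT; apply/subvP => w; rewrite memv_cap => /andP[w1 w2].
  exact: (cap_sker hk rA fr gyx).
have := dimvS sub; rewrite dim_add_line; last by rewrite memv_cap xT (negPf xTy).
by move: le (cdE gyx) d2 extremal; move: (\dim _) (\dim _) => p q; clear; lia.
Qed.

Let dim_plane : \dim (<[t]> + <[x]>) = 2%N.
Proof.
rewrite dim_add_line ?dim_vline ?t0 //; apply: contra xTy => /vlineP[c ->].
exact: memvZ.
Qed.

Let planeT : (<[t]> + <[x]> <= T)%VS. Proof. by rewrite subv_add -!memvE tT xT. Qed.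

(** Otherwise [Q] has a basis of vectors algebraic over [k(x)]. They are orthogonal to [y], which is
    generic over that ring, and would be zero by [normal_perp_eq0]. *)
Lemma normals_unstable : exists D v, [/\ Der kx D, v \in Q & vder D v \notin Q].
Proof.
apply: contrapT => no.
have st D v : Der kx D -> v \in Q -> vder D v \in Q.
  by move=> hD vQ; apply: contrapT => /negP h; apply: no; exists D, v.
have [||B [Bf BQ BD]] := @stable_const_basis K m Q (Der kx); [by move=> D [] | exact: st |].
have dQ : (0 < \dim Q)%N by rewrite dim_orth dimS // subn_gt0.
pose i := Ordinal dQ; have BiQ : row i B \in Q by apply/BQ; exists (delta_mx 0 i); rewrite rowE.
have : row i B = 0.
  apply: (normal_perp_eq0 Kunc sc rA (k1 := kx) (y := y)) => //.
  - by move=> c; exact: sub_adj.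
  - by move=> D hD; apply/rowP => j; rewrite !mxE (BD D hD).
  - by rewrite dotC; move/orthP: BiQ; apply; exact: (subvP (addvSr _ _)).
rewrite rowE => h; have := row_free_inj Bf (etrans h (esym (mul0mx _ B))).
by move/rowP => /(_ i); rewrite !mxE !eqxx => /eqP; rewrite oner_eq0.
Qed.

(** Both sides are linear in [nu'] and vanish on [Q] and on the derivative of a vector of [Q] that
    leaves [Q]. As [Q] has codimension [2] in the conormal space, these span a hyperplane of it, so
    the two sides are proportional. *)
Lemma contact_form : exists kap, forall nu', S nu' t t = kap * dot (nu' *m G) y.
Proof.
have [D [v [hD vQ Dv]]] := normals_unstable; have [dD _] := hD.
have [hDk Dx] := Der_kx fr hD.
have vT := orthT vQ; have DvT : vder D v \in orth T.
  by apply: orth_der_stable => // u; exact: Tst.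
have [psi psiT psiy] : exists2 psi, psi \in orth T & dot psi y != 0.
  apply: contrapT => no; have rr : row (Ordinal r0) G = 0.
    apply: (normal_perp_eq0 Kunc sc rA (k1 := kx) (y := y)) => //.
    - by move=> c; exact: sub_adj.
    - move=> E hE; rewrite rowE normal_const //; rewrite (_ : vder E _ = 0) ?mul0mx //.
      by apply/rowP => j; rewrite !mxE; have [dE _] := hE; exact: der_nat.
    apply/eqP/negPn/negP => h; apply: no; exists (row (Ordinal r0) G) => //.
    by rewrite (fr_orth fr) row_in_rowvs.
  have := row_free_inj (fr_free fr) (etrans (esym (rowE (Ordinal r0) G)) (etrans rr (esym (mul0mx _ G)))).
  by move/rowP => /(_ (Ordinal r0)); rewrite !mxE !eqxx => /eqP; rewrite oner_eq0.
have Qy w : w \in Q -> dot w y = 0.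
  by move/orthP => h; rewrite dotC; apply: h; exact: (subvP (addvSr _ _)).
have Dvy : dot (vder D v) y = 0.
  have := vder_dot v y dD; rewrite Qy // der0 // => /esym.
  have -> : dot v (vder D y) = 0; last by rewrite addr0.
  rewrite dotC; move/orthP: vQ; apply; apply: (subvP (addvSr _ _)).
  by apply: (vder_tang (ratl_kdef rA) hDk); case: gy.
have Yy w : w \in (Q + <[vder D v]>)%VS -> dot w y = 0.
  by move=> /memv_addP[a aQ [_ /vlineP[c ->] ->]]; rewrite dotDl dotZl Qy // Dvy mulr0 addr0.
have sub : (orth T <= Q + <[vder D v]> + <[psi]>)%VS.
  apply: full_of_dim; first by rewrite !subv_add -!memvE psiT DvT !andbT; exact: orthS (addvSl _ _).
  rewrite !dim_add_line //; last by apply: contraNN psiy => /Yy ->.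
  rewrite !dim_orth dT dimS //; move: extremal dSm; clear; lia.
have [npsi psiE] : exists npsi, psi = npsi *m G.
  by apply: (normal_coef fr) => w wT; rewrite dotC; move/orthP: psiT; apply.
have [nv vE] : exists nv, v = nv *m G.
  by apply: (normal_coef fr) => w wT; rewrite dotC; move/orthP: vT; apply.
exists (S npsi t t / dot psi y) => nu'.
have : nu' *m G \in orth T by rewrite (fr_orth fr); apply/rowvsP; exists nu'.
move/(subvP sub)/memv_addP => [_ /memv_addP[a aQ [_ /vlineP[c ->] ->]] [_ /vlineP[s ->] nE]].
have [na aE] : exists na, a = na *m G.
  by apply: (normal_coef fr) => w wT; rewrite dotC; move/orthP: (orthT aQ); apply.
have nuE : nu' = na + c *: vder D nv + s *: npsi.
  by apply: (row_free_inj (fr_free fr)); rewrite nE !mulmxDl -!scalemxAl -aE -psiE vE normal_const.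
rewrite nE !dotDl !dotZl (Qy a aQ) Dvy mulr0 !add0r nuE !formDm !formZm.
have -> : S na t t = 0 by rewrite aE in aQ; have /skerP[_ h] := t_sker aQ; exact: h.
have -> : S (vder D nv) t t = 0.
  rewrite vE in vQ; have /skerP[_ h] := t_sker vQ.
  have := der_form fr nv t t hD; rewrite {1}/form h // der0 // (formC _ _ _ (vder D t)) {2 3}/form !h ?addr0 //.
  exact: Tst.
by rewrite mulr0 !add0r mulrCA divfK.
Qed.

(** If [kap = 0], the plane [Pi] through [t] and [x] is defined by vectors algebraic over [k(x)].
    Then meeting [Pi] is a closed condition on tangent spaces that holds at the generic [y], hence
    also at [y2]; but [Pi] lies in the kernel of [nu], which meets the tangent space at [y2] only in
    [0]. *)
Lemma contact_form_neq0 kap : (forall nu', S nu' t t = kap * dot (nu' *m G) y) -> kap != 0.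
Proof.
move=> hkap; apply/eqP => kap0.
have Stt nu' : S nu' t t = 0 by rewrite hkap kap0 mul0r.
pose Pi := (<[t]> + <[x]>)%VS.
have dPi : \dim Pi = 2%N := dim_plane.
have xPi : x \in Pi by apply: (subvP (addvSr _ _)); exact: memv_line.
have tPi : t \in Pi by apply: (subvP (addvSl _ _)); exact: memv_line.
have Pist D u : Der kx D -> u \in Pi -> vder D u \in Pi.
  move=> hD; have [dD _] := hD; have [hDk Dx] := Der_kx fr hD.
  (* Otherwise [Pi] and [vder D t] span [T], all of it orthogonal to [t]; then [t] would be in the
     kernel of [mu] and tangent at [y], against [sker_cap]. *)
  have DtPi : vder D t \in Pi.
    apply: contrapT => /negP Dt.
    have sub : (T <= Pi + <[vder D t]>)%VS.
      apply: full_of_dim; first by rewrite subv_add planeT -memvE Tst.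
      by rewrite dim_add_line // dPi dT cone_dim3.
    have SDt nu' : S nu' t (vder D t) = 0.
      have := der_form fr nu' t t hD; rewrite !Stt der0 // add0r (formC _ _ _ (vder D t)) -mulr2n => /esym/eqP.
      by rewrite mulrn_eq0 => /eqP.
    have : t \in (sker F A x mu :&: tang A y)%VS.
      rewrite memv_cap tTy andbT; apply/skerP; split=> // v vT; rewrite -/(form x F mu t v).
      have /memv_addP[_ /memv_addP[_ /vlineP[a ->] [_ /vlineP[b ->] ->]] [_ /vlineP[c ->] ->]] := subvP sub _ vT.
      by rewrite !formDr !formZr Stt SDt formC Sx // !mulr0 !addr0.
    by rewrite (sker_cap Kunc sc fr r0 gmu gy) memv0 (negPf t0).
  move=> /memv_addP[_ /vlineP[a ->] [_ /vlineP[b ->] ->]].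
  by rewrite vderD // !vderZ // Dx scaler0 addr0 !memvD ?memvZ.
have [||B [Bf BPi BD]] := @stable_const_basis K m Pi (Der kx); [by move=> D [] | exact: Pist |].
have [b bPi [bx hb]] : exists2 b, b \in Pi & b \notin <[x]>%VS /\ forall D, Der kx D -> vder D b = 0.
  apply: contrapT => no; have : (Pi <= <[x]>)%VS.
    apply/subvP => _ /BPi[c ->]; rewrite mulmx_sum_row; apply: memv_suml => i _; apply: memvZ.
    apply: contrapT => /negP ni; apply: no; exists (row i B).
      by apply/BPi; exists (delta_mx 0 i); rewrite rowE.
    by split=> // D hD; apply/rowP => j; rewrite !mxE (BD D hD).
  by move/dimvS; rewrite dPi dim_vline x0.
have gB := generic_const Kunc ckx Acl Apr (ratl_sub (sub_adj x rk) rA) gyx hb.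
have [rk2 _] := adj_csubring b ckx.
have kk2 : k `<=` adj kx b by move=> c kc; apply: sub_adj => //; exact: sub_adj.
have [c [gam tE]] : exists c gam, t = c *: b + gam *: x.
  have sub : (Pi <= <[b]> + <[x]>)%VS.
    apply: full_of_dim; first by rewrite subv_add -!memvE bPi xPi.
    by rewrite dPi (addvC <[b]>%VS) dim_add_line // dim_vline x0.
  by have /memv_addP[_ /vlineP[c ->] [_ /vlineP[gam ->] ->]] := subvP sub _ tPi; exists c, gam.
have c0 : c != 0.
  by apply: contraNneq xTy => cz; move: tTy t0; rewrite tE cz scale0r add0r scaler_eq0 negb_or =>
     /(memvZ gam^-1) h /andP[g0 _]; move: h; rewrite scalerA mulVf // scale1r.
pose pl (z : 'rV[K]_m) (g : {mpoly K[m]}) : {mpoly K[m]} := \sum_j z 0 j *: g^`M(j).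
have plE z g (v : 'rV[K]_m) : (pl z g).@[v 0] = dot (grad g v) z.
  by rewrite /pl raddf_sum; apply: eq_bigr => j _ /=; rewrite mevalZ !mxE mulrC.
have plk (z : 'rV[K]_m) (g : {mpoly K[m]}) : (forall j, adj kx b (z 0 j)) -> over k g -> over (adj kx b) (pl z g).
  move=> kz gk; apply: over_sum => // j _; apply: overZ => //; apply: over_deriv => // l; exact: kk2 (gk l).
have kb j : adj kx b (b 0 j) by exact: mem_adj.
have kxx j : adj kx b (x 0 j) by apply: sub_adj => //; exact: mem_adj.
(* The gradients, restricted to the basis [b], [x] of [Pi], have rank at most one at [y] because [t]
   is tangent there; this passes to all of [A]. *)
have minors (g g' : {mpoly K[m]}) v : over k g -> over k g' -> vanish A g -> vanish A g' -> A v ->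
    dot (grad g v) b * dot (grad g' v) x = dot (grad g v) x * dot (grad g' v) b.
  move=> gk g'k gA g'A Av; apply/eqP; rewrite -subr_eq0 -!plE -!mevalM -mevalB; apply/eqP.
  have [_ gen] := gB; apply: gen => //; first by apply: overB => //; apply: overM => //; exact: plk.
  rewrite mevalB !mevalM !plE.
  have prop (h : {mpoly K[m]}) : vanish A h -> dot (grad h y) b = - (gam / c) * dot (grad h y) x.
    move=> hA; move: tTy; rewrite tE => /tangP/(_ h hA); rewrite dotDr !dotZr => /eqP.
    rewrite addr_eq0 => /eqP e; apply: (mulfI c0); rewrite e.
    by rewrite mulrA mulrN mulrCA divff // mulr1 mulNr.
  by rewrite (prop g gA) (prop g' g'A); ring.
have [y2 gy2] := exists_generic Kunc hk1 Acl Apr; have [Ay2 _] := gy2.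
have PiS : (Pi <= sker F A x nu)%VS by rewrite subv_add -!memvE (x_sker fr Asc) t_sker.
have none w : w \in Pi -> w != 0 -> w \notin tang A y2.
  move=> wPi; apply: contra => wT; rewrite -memv0 -(hy' gy2) memv_cap wT andbT.
  exact: (subvP PiS).
have [[g [gk gA gx']]|no] := pselect (exists g, [/\ over k g, vanish A g & dot (grad g y2) x != 0]); last first.
  move/negP: (none x xPi x0); apply; apply: (tang_by_forms fr (sc_cone sc)) => p e pk _ pA.
  by apply/eqP/negPn/negP => h; apply: no; exists p.
pose w := b - (dot (grad g y2) b / dot (grad g y2) x) *: x.
have w0 : w != 0.
  by apply: contra bx; rewrite subr_eq0 => /eqP ->; rewrite memvZ // memv_line.
have wPi : w \in Pi by rewrite memvB // memvZ.
move/negP: (none w wPi w0); apply; apply: (tang_by_forms fr (sc_cone sc)) => p e pk _ pA.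
rewrite /w dotBr dotZr; apply/eqP; rewrite subr_eq0; apply/eqP; apply: (mulIf gx').
by rewrite mulrAC divfK // mulrC (minors g p y2) // mulrC.
Qed.

(** The directions with zero form make up a space with a basis constant over [k(x)]. As [kap] is
    nonzero, [contact_form] makes the corresponding normals orthogonal to the generic [y], so they
    are zero. *)
Lemma form_injective nu' : (forall u v, u \in T -> v \in T -> S nu' u v = 0) -> nu' = 0.
Proof.
have [kap hkap] := contact_form; have kap0 := contact_form_neq0 hkap.
pose P := [set n : 'rV[K]_(m - d) | forall u v, u \in T -> v \in T -> S n u v = 0].
have sP : is_subspace P.
  by split=> [u v _ _|c n n' hn hn' u v uT vT]; rewrite ?form0m // formDm formZm hn // hn' // mulr0 addr0.
move=> h; have nP : nu' \in vs P by apply/vsP.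
have [|D n hD /(vsP _ sP) nP'|B [Bf BP BD]] := @stable_const_basis K (m - d) (vs P) (Der kx); [by move=> D [] | |].
  apply/vsP => // u v uT vT; have := der_form fr n u v hD; have [dD _] := hD.
  by rewrite !nP' ?Tst // der0 // !addr0 => <-.
have [c ->] := iffLR (BP nu') nP; rewrite mulmx_sum_row big1 // => i _.
have riP : P (row i B) by apply/(vsP _ sP)/BP; exists (delta_mx 0 i); rewrite rowE.
have Dr D : Der kx D -> vder D (row i B) = 0 by move=> hD; apply/rowP => j; rewrite !mxE (BD D hD).
suff : row i B *m G = 0 by move=> h0; rewrite (row_free_inj (fr_free fr) (etrans h0 (esym (mul0mx _ G)))) scaler0.
apply: (normal_perp_eq0 Kunc sc rA (k1 := kx) (y := y)) => //.
- by move=> a; exact: sub_adj.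
- by move=> D hD; rewrite normal_const // Dr // mul0mx.
by apply: (mulfI kap0); rewrite mulr0 -hkap riP.
Qed.

Lemma const_complement : exists t1 t2 : 'rV[K]_m, [/\ t1 \in T, t2 \in T, (T <= <[x]> + <[t1]> + <[t2]>)%VS &
  forall D, Der kx D -> vder D t1 = 0 /\ vder D t2 = 0].
Proof.
have [|D v|B [Bf BT BD]] := @stable_const_basis K m T (Der kx); [by move=> D [] | exact: Tst |].
have BiT i : row i B \in T by apply/BT; exists (delta_mx 0 i); rewrite rowE.
have Dr D i : Der kx D -> vder D (row i B) = 0 by move=> hD; apply/rowP => j; rewrite !mxE (BD D hD).
have pick (W : {vspace 'rV[K]_m}) : (\dim W < d)%N -> exists i, row i B \notin W.
  move=> dW; apply: contrapT => no; have : (T <= W)%VS.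
    apply/subvP => _ /BT[c ->]; rewrite mulmx_sum_row; apply: memv_suml => i _; apply: memvZ.
    by apply: contrapT => /negP h; apply: no; exists i.
  by move/dimvS; rewrite dT leqNgt dW.
have d1 : \dim <[x]> = 1%N by rewrite dim_vline x0.
have [|i hi] := pick <[x]>%VS; first by rewrite d1 cone_dim3.
have d2' := dim_add_line hi; rewrite d1 in d2'.
have [|j hj] := pick (<[x]> + <[row i B]>)%VS; first by rewrite d2' cone_dim3.
exists (row i B), (row j B); split=> // [|D hD]; last by rewrite !Dr.
apply: full_of_dim; first by rewrite !subv_add -!memvE xT !BiT.
by rewrite dim_add_line // d2' dT cone_dim3.
Qed.

(* The conic consists of the squares: by [contact_form] the point [y] is sent
   to the square of the vector spanning the common tangent. *)
Lemma conic_forms : m = 6%N /\ exists Phi : 'M[K]_(3, m), [/\ row_free Phi, rowvs Phi = orth T &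
  forall v, A v -> dot (row 0 Phi) v * dot (row (inord 2) Phi) v = dot (row (inord 1) Phi) v ^+ 2].
Proof.
have [kap hkap] := contact_form; have kap0 := contact_form_neq0 hkap.
have [t1 [t2 [t1T t2T sub tD]]] := const_complement.
pose c3 (f : K * K * K) : 'rV[K]_3 := \row_j [:: f.1.1; f.1.2; f.2]`_j.
(* The middle entry is doubled so that [form n t t], with [t = al x + b t1 + c t2], is the
   combination of the entries with coefficients [b^2], [b c], [c^2]. *)
pose vals n := c3 (S n t1 t1, S n t1 t2 *+ 2, S n t2 t2).
pose M : 'M[K]_(m - d, 3) := \matrix_i vals (delta_mx 0 i).
have valsE n : n *m M = vals n.
  rewrite mulmx_sum_row; transitivity (\sum_i n 0 i *: vals (delta_mx 0 i)).
    by apply: eq_bigr => i _; rewrite rowK.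
  have vD c a b : vals (c *: a + b) = c *: vals a + vals b.
    apply/rowP => -[[|[|[|//]]] hj]; rewrite !mxE /= formDm formZm //.
    by rewrite mulrnDl -mulrnAr.
  have v0 : vals 0 = 0 by apply/rowP => -[[|[|[|//]]] hj]; rewrite !mxE /= form0m // mul0rn.
  rewrite [in RHS](row_sum_delta n); elim/big_rec2: _ => [//|i a b _ ->].
  by rewrite vD.
have TE u : u \in T -> exists a b c, u = a *: x + b *: t1 + c *: t2.
  move=> /(subvP sub)/memv_addP[_ /memv_addP[_ /vlineP[a ->] [_ /vlineP[b ->] ->]] [_ /vlineP[c ->] ->]].
  by exists a, b, c.
have formE n a b c a' b' c' : S n (a *: x + b *: t1 + c *: t2) (a' *: x + b' *: t1 + c' *: t2) =
   b * b' * S n t1 t1 + (b * c' + c * b') * S n t1 t2 + c * c' * S n t2 t2.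
  rewrite !formDl !formDr !formZl !formZr (formC _ _ _ t1 x) (formC _ _ _ t2 x) !Sx // (formC _ _ _ t2 t1).
  by ring.
have Minj (n : 'rV[K]_(m - d)) : n *m M = 0 -> n = 0.
  rewrite valsE => h; apply: form_injective => u v /TE[a [b [c ->]]] /TE[a' [b' [c' ->]]]; rewrite formE.
  have := congr1 (fun r : 'rV_3 => r 0 0) h; have := congr1 (fun r : 'rV_3 => r 0 (inord 1)) h.
  have := congr1 (fun r : 'rV_3 => r 0 (inord 2)) h; rewrite !mxE !inordK //= => -> /eqP.
  by rewrite mulrn_eq0 /= => /eqP -> ->; rewrite !mulr0 !addr0.
have Mf : row_free M by rewrite -kermx_eq0; apply/rowV0P => n /sub_kermxP; exact: Minj.
(* The forms are quadratic forms in two variables, so [m - d] is at most [3], while [m > dS = 5]. *)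
have m6 : m = 6%N.
  have le : (m - d <= 3)%N by rewrite -(eqP Mf) rank_leq_col.
  by move: le dSm extremal; rewrite cone_dim3; clear; lia.
have rM : (m - d = 3)%N by rewrite cone_dim3 m6.
split=> //.
have Mfull : row_full M by rewrite /row_full (eqP Mf) rM.
have [N NM] : exists N : 'M_(3, m - d), N *m M = 1%:M.
  by exists (pinvmx M); rewrite -[RHS](mulmxKpV (submx_full (1%:M : 'M_3) Mfull)) mul1mx.
have Nf : row_free N by apply/row_freeP; exists M.
have dE := der_form fr.
have MD D : Der kx D -> map_mx D M = 0.
  move=> hD; have [t1D t2D] := tD D hD; have [dD _] := hD.
  have SD i u v : vder D u = 0 -> vder D v = 0 -> D (S (delta_mx 0 i) u v) = 0.
    move=> Du Dv; rewrite dE // Du Dv form0l form0r !addr0 (_ : vder D _ = 0) ?form0m //.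
    by apply/rowP => j; rewrite !mxE; exact: der_nat.
  apply/matrixP => i -[[|[|[|//]]] hj]; rewrite !mxE /= ?SD //.
  by rewrite mulr2n; case: dD => -> _; rewrite SD // addr0.
have ND D : Der kx D -> map_mx D N = 0.
  move=> hD; have [dD _] := hD; have [dA dM] := dD; apply: (row_free_inj (m := 3) Mf); rewrite mul0mx.
  have : map_mx D (N *m M) = map_mx D N *m M + N *m map_mx D M.
    apply/matrixP => i j; rewrite !mxE der_sum // -big_split; apply: eq_bigr => a _.
    by rewrite !mxE dM.
  rewrite NM MD // mulmx0 addr0 => <-; apply/matrixP => i j; rewrite !mxE; exact: der_nat.
exists (N *m G).
have Phif : row_free (N *m G).
  by rewrite -kermx_eq0; apply/rowV0P => c /sub_kermxP; rewrite mulmxA => h; apply: (row_free_inj Nf);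
    rewrite mul0mx; apply: (row_free_inj (fr_free fr)); rewrite h mul0mx.
split=> //.
  apply/eqP; rewrite eqEdim; apply/andP; split.
    by apply/subvP => _ /rowvsP[c ->]; rewrite (fr_orth fr); apply/rowvsP; exists (c *m N); rewrite mulmxA.
  by rewrite dim_rowvs // dim_orth dT rM.
have rowE' i : row i (N *m G) = row i N *m G by rewrite row_mul.
have [al [b [c tE]]] := TE t tT.
have key i : kap * dot (row i (N *m G)) y = (\row_j [:: b * b; b * c; c * c]`_j : 'rV[K]_3) 0 i.
  rewrite rowE' -hkap tE formE.
  have h : vals (row i N) = delta_mx 0 i by rewrite -valsE -row_mul NM rowE mulmx1.
  have e (j : 'I_3) : [:: S (row i N) t1 t1; S (row i N) t1 t2 *+ 2; S (row i N) t2 t2]`_j = (j == i)%:R.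
    by have := congr1 (fun r : 'rV_3 => r 0 j) h; rewrite !mxE /=.
  have := e 0; have := e (Ordinal (isT : (1 < 3)%N)); have := e (Ordinal (isT : (2 < 3)%N)) => /= e2 e1 e0.
  transitivity (b * b * S (row i N) t1 t1 + b * c * (S (row i N) t1 t2 *+ 2) + c * c * S (row i N) t2 t2); first by ring.
  rewrite e0 e1 e2 mxE; clear; case: i => -[|[|[|//]]] hi; rewrite -!val_eqE /=; ring.
have sq : dot (row 0 (N *m G)) y * dot (row (inord 2) (N *m G)) y = dot (row (inord 1) (N *m G)) y ^+ 2.
  apply: (mulfI kap0); apply: (mulfI kap0).
  have := key 0; have := key (inord 1); have := key (inord 2); rewrite !mxE !inordK //= => k2 k1' k0.
  transitivity ((kap * dot (row 0 (N *m G)) y) * (kap * dot (row (inord 2) (N *m G)) y)); first by ring.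
  rewrite k0 k2; transitivity ((kap * dot (row (inord 1) (N *m G)) y) ^+ 2); last by ring.
  by rewrite k1'; ring.
have PhiD D : Der kx D -> vder D (mxvec (N *m G)) = 0.
  move=> hD; have [dD _] := hD; apply/rowP => j; case/mxvec_indexP: j => i j; rewrite mxE mxvecE mxE mxE.
  have [_ dM] := dD; rewrite der_sum // big1 // => a _; rewrite dM.
  have := congr1 (fun B : 'M_(_, _) => B i a) (ND D hD); have := congr1 (fun B : 'M_(_, _) => B a j) (grads_const hD).
  by rewrite !mxE => -> ->; rewrite mulr0 mul0r addr0.
(* The matrix [N *m G] is algebraic over [k(x)], so [y] is still generic and the relation found at
   [y] holds on [A]. *)
have gP := generic_const Kunc ckx Acl Apr (ratl_sub (sub_adj x rk) rA) gyx PhiD.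
have rkP : subring (adj kx (mxvec (N *m G))) by case: (adj_csubring (mxvec (N *m G)) ckx).
have Pk i : over (adj kx (mxvec (N *m G))) (lin_form (row i (N *m G))).
  by apply: lin_form_over => // j; rewrite mxE -mxvecE; exact: mem_adj.
move=> v Av; apply/eqP; rewrite -subr_eq0 -!lin_form_eval -mevalM -rmorphXn -mevalB; apply/eqP.
have [_ gen] := gP; apply: gen => //; first by apply: overB => //; [exact: overM | exact: over_exp].
by rewrite mevalB mevalM rmorphXn /= !lin_form_eval sq subrr.
Qed.

End AtPoint.
End Conic.

(** * Tangents and chords of a conic *)

Section Pencil.
Variables (K : numClosedFieldType) (m : nat).
Implicit Types (u v w : 'rV[K]_m).

Lemma square_param (p q r : K) : p * r = q ^+ 2 -> (p != 0) || (r != 0) ->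
  exists a b c, [/\ c != 0, c * p = a ^+ 2, c * q = a * b & c * r = b ^+ 2].
Proof.
move=> h; have [p0|p0] := eqVneq p 0 => /= pr.
  have q0 : q = 0 by move/eqP: h; rewrite p0 mul0r eq_sym expf_eq0 /= => /eqP.
  by exists 0, r, r; split=> //; rewrite ?p0 ?q0; ring.
by exists p, q, p; split=> //; rewrite h.
Qed.

Lemma dird_lin_form c u w : dird (lin_form c) (u 0) (w 0) = dot c w.
Proof.
rewrite /lin_form dird_sum; apply: eq_bigr => i _; by rewrite dirdZ dirdXU.
Qed.

(** [phi a b] is the tangent of the conic [p r = q^2] at [(a^2 : a b : b^2)]; differentiating the
    relation shows that the tangent at the image of [y] is a common normal, hence proportional to
    [be], and similarly for [z] and [ga]. Modulo the conic, the product of two tangents is the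
    square of the chord joining their points of contact, here [mu']. *)
Lemma conic_pencil (A : set 'rV[K]_m) (T : {vspace 'rV[K]_m}) (Phi : 'M[K]_(3, m)) y z be ga :
  row_free Phi -> rowvs Phi = orth T ->
  (forall v, A v -> dot (row 0 Phi) v * dot (row (inord 2) Phi) v = dot (row (inord 1) Phi) v ^+ 2) ->
  A y -> A z -> y \notin T -> z \notin T ->
  (forall w, w \in orth T -> w \in orth (tang A y) -> w \in <[be]>%VS) ->
  (forall w, w \in orth T -> w \in orth (tang A z) -> w \in <[ga]>%VS) ->
  (forall w, w \in <[be]>%VS -> w \in <[ga]>%VS -> w = 0) ->
  exists mu, (forall v, A v -> dot be v * dot ga v = dot mu v ^+ 2) /\
    (orth T <= <[be]> + <[ga]> + <[mu]>)%VS.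
Proof.
move=> Pf PT rel Ay Az yT zT hbe hga ind.
set f0 := row 0 Phi in rel *; set f1 := row (inord 1) Phi in rel *; set f2 := row (inord 2) Phi in rel *.
have PE (c : 'rV[K]_3) : c *m Phi = c 0 0 *: f0 + c 0 (inord 1) *: f1 + c 0 (inord 2) *: f2.
  have e1 : lift ord0 ord0 = inord 1 :> 'I_3 by apply/val_inj; rewrite /= inordK.
  have e2 : lift ord0 (lift ord0 ord0) = inord 2 :> 'I_3 by apply/val_inj; rewrite /= inordK.
  by rewrite mulmx_sum_row !big_ord_recl big_ord0 addr0 addrA e1 e2.
have fT : [/\ f0 \in orth T, f1 \in orth T & f2 \in orth T] by rewrite -PT !row_in_rowvs.
have [f0T f1T f2T] := fT.
have comb a b c : a *: f0 + b *: f1 + c *: f2 = 0 -> [/\ a = 0, b = 0 & c = 0].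
  pose cc : 'rV[K]_3 := \row_j [:: a; b; c]`_j; move=> h.
  have c0 : cc = 0 by apply: (row_free_inj Pf); rewrite mul0mx PE !mxE !inordK.
  have := congr1 (fun r : 'rV_3 => r 0 0) c0; have := congr1 (fun r : 'rV_3 => r 0 (inord 1)) c0.
  by have := congr1 (fun r : 'rV_3 => r 0 (inord 2)) c0; rewrite !mxE !inordK.
pose phi a b := b ^+ 2 *: f0 - (a * b *+ 2) *: f1 + a ^+ 2 *: f2.
have phiT a b : phi a b \in orth T by rewrite memvD ?memvB ?memvZ.
have at_pt p : A p -> p \notin T -> exists a b, [/\ phi a b \in orth (tang A p) & (a != 0) || (b != 0)].
  move=> Ap pT.
  have nz : (dot f0 p != 0) || (dot f2 p != 0).
    apply: contraNT pT; rewrite negb_or !negbK => /andP[/eqP e0 /eqP e2].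
    have e1 : dot f1 p = 0 by have := rel p Ap; rewrite e0 mul0r => /esym/eqP; rewrite expf_eq0 => /= /eqP.
    rewrite -[T]orthK -PT; apply/orthP => _ /rowvsP[c ->].
    by rewrite PE !dotDl !dotZl e0 e1 e2 !mulr0 !addr0.
  have [a [b [c [c0 e0 e1 e2]]]] := square_param (rel p Ap) nz.
  exists a, b; split.
    apply/orthP => w /tangP wT; pose q := lin_form f0 * lin_form f2 - lin_form f1 * lin_form f1.
    have qA : vanish A q by move=> v Av; rewrite /q mevalB !mevalM !lin_form_eval rel // expr2 subrr.
    have := congr1 (fun s => c * s) (wT q qA); rewrite mulr0 -dird_dot dirdB !dirdM !dird_lin_form !lin_form_eval => <-.
    rewrite /phi dotDr dotBr !dotZr !(dotC w) mulr2n -e0 -e1 -e2; ring.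
  by apply: contraTT nz; rewrite !negb_or !negbK => /andP[/eqP a0 /eqP b0];
    rewrite -(mulrI_eq0 _ (mulfI c0)) -(mulrI_eq0 (dot f2 p) (mulfI c0)) e0 e2 a0 b0 expr0n eqxx.
have [a [b [ph ab]]] := at_pt y Ay yT; have [a' [b' [ph' ab']]] := at_pt z Az zT.
have /vlineP[s sE] := hbe _ (phiT a b) ph; have /vlineP[s' sE'] := hga _ (phiT a' b') ph'.
have phi0 p q : (p != 0) || (q != 0) -> phi p q != 0.
  apply: contraTN => /eqP; rewrite /phi -scaleNr => /comb[/eqP h1 _ /eqP h2].
  by move: h1 h2; rewrite !expf_eq0 /= negb_or !negbK => -> ->.
have s0 : s != 0 by apply: contraNneq (phi0 a b ab) => e; rewrite sE e scale0r.
have s0' : s' != 0 by apply: contraNneq (phi0 a' b' ab') => e; rewrite sE' e scale0r.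
have del : a * b' - a' * b != 0.
  apply/negP; rewrite subr_eq0 => /eqP e.
  have van p p' : p ^+ 2 *: phi a b = p' ^+ 2 *: phi a' b' -> p == 0.
    move=> h; have := ind (p ^+ 2 *: phi a b); rewrite {1}sE {1}h {1}sE' !scalerA.
    rewrite !memvZ ?memv_line // => /(_ isT isT)/eqP.
    by rewrite scaler_eq0 (negPf (phi0 a b ab)) orbF expf_eq0.
  have a'0 : a' == 0.
    apply: (van a' a); rewrite /phi !scalerDr !scalerN !scalerA; congr (_ *: _ - _ *: _ + _ *: _).
    + by rewrite -!exprMn e mulrC.
    + by transitivity (a' * b * (a * a') *+ 2); [ring | rewrite -e; ring].
    by rewrite mulrC.
  have b'0 : b' == 0.
    apply: (van b' b); rewrite /phi !scalerDr !scalerN !scalerA; congr (_ *: _ - _ *: _ + _ *: _).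
    + by rewrite mulrC.
    + by transitivity (a * b' * (b * b') *+ 2); [ring | rewrite e; ring].
    by rewrite -!exprMn mulrC e mulrC.
  by move: ab'; rewrite a'0 b'0.
have [sg sgE] : exists sg, sg ^+ 2 = s * s' by exists (sqrtC (s * s')); rewrite sqrtCK.
have sg0 : sg != 0 by have : sg ^+ 2 != 0 by [rewrite sgE mulf_neq0]; rewrite expf_eq0.
pose mu' := (b * b') *: f0 - (a * b' + a' * b) *: f1 + (a * a') *: f2.
exists (sg^-1 *: mu'); split.
  move=> v Av; rewrite dotZl exprMn; apply: (mulfI (expf_neq0 2 sg0)).
  rewrite mulrA mulrA -exprMn divff // expr1n mul1r sgE.
  transitivity (dot (phi a b) v * dot (phi a' b') v); first by rewrite sE sE' !dotZl; ring.
  rewrite /mu' /phi !dotDl !dotNl !dotZl.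
  have := rel v Av; move: (dot f0 v) (dot f1 v) (dot f2 v) => p q r pr.
  have -> : (b ^+ 2 * p - a * b *+ 2 * q + a ^+ 2 * r) * (b' ^+ 2 * p - a' * b' *+ 2 * q + a' ^+ 2 * r) =
    (b * b' * p - (a * b' + a' * b) * q + a * a' * r) ^+ 2 + (a * b' - a' * b) ^+ 2 * (p * r - q ^+ 2) by ring.
  by rewrite pr subrr mulr0 addr0.
set W := (_ + _ + _)%VS.
have W1 : phi a b \in W by rewrite sE memvZ //; apply: (subvP (addvSl _ _)); apply: (subvP (addvSl _ _)); exact: memv_line.
have W2 : phi a' b' \in W by rewrite sE' memvZ //; apply: (subvP (addvSl _ _)); apply: (subvP (addvSr _ _)); exact: memv_line.
have W3 : mu' \in W.
  have -> : mu' = sg *: (sg^-1 *: mu') by rewrite scalerA divff // scale1r.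
  by rewrite memvZ //; apply: (subvP (addvSr _ _)); exact: memv_line.
have WD e c1 c2 c3 : (a * b' - a' * b) ^+ 2 *: e = c1 *: phi a b + c2 *: mu' + c3 *: phi a' b' -> e \in W.
  move=> h; have -> : e = ((a * b' - a' * b) ^- 2) *: (c1 *: phi a b + c2 *: mu' + c3 *: phi a' b').
    by rewrite -h scalerA mulVf ?scale1r // expf_neq0.
  by rewrite memvZ // !memvD // memvZ.
rewrite -PT; apply/subvP => _ /rowvsP[c ->]; rewrite PE !memvD // memvZ //.
- by apply: (WD _ (a' ^+ 2) (- (a * a' *+ 2)) (a ^+ 2)); apply/rowP => j; rewrite !mxE; ring.
- by apply: (WD _ (a' * b') (- (a * b' + a' * b)) (a * b)); apply/rowP => j; rewrite !mxE; ring.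
by apply: (WD _ (b' ^+ 2) (- (b * b' *+ 2)) (b ^+ 2)); apply/rowP => j; rewrite !mxE; ring.
Qed.

End Pencil.

Section SixForms.
Variables (K : numClosedFieldType) (m : nat).
Implicit Types (u v w : 'rV[K]_m).

(** A symmetric 3 by 3 matrix with diagonal [p], [q], [l] and vanishing 2 by 2 minors is the square
    of a vector. The cases follow the first nonzero diagonal entry. *)
Lemma symmetric_rank1 (p q r s t l : K) : p * q = r ^+ 2 -> p * l = s ^+ 2 -> q * l = t ^+ 2 ->
  r * s = p * t -> r * t = q * s -> s * t = l * r ->
  exists a b c, [/\ p = a ^+ 2, r = a * b, s = a * c & [/\ q = b ^+ 2, t = b * c & l = c ^+ 2]].
Proof.
have sq x : exists2 a : K, x = a ^+ 2 & (x != 0 -> a != 0).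
  exists (sqrtC x); first by rewrite sqrtCK.
  by rewrite sqrtC_eq0.
have z x : x ^+ 2 = 0 -> x = 0 :> K by move/eqP; rewrite expf_eq0 => /= /eqP.
move=> h1 h2 h3 h4 h5 h6.
have [p0|p0] := eqVneq p 0.
  have r0 : r = 0 by apply: z; rewrite -h1 p0 mul0r.
  have s0 : s = 0 by apply: z; rewrite -h2 p0 mul0r.
  have [q0|q0] := eqVneq q 0.
    have t0 : t = 0 by apply: z; rewrite -h3 q0 mul0r.
    have [c lE _] := sq l; exists 0, 0, c.
    by rewrite p0 r0 s0 q0 t0 -lE expr0n !mul0r.
  have [b qE] := sq q; move=> /(_ q0) b0; exists 0, b, (t / b).
  rewrite p0 r0 s0 expr0n !mul0r qE; split=> //; split=> //; first by rewrite mulrC divfK.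
  by apply: (mulfI q0); rewrite h3 expr_div_n qE mulrC divfK // expf_neq0.
have [a pE] := sq p; move=> /(_ p0) a0; exists a, (r / a), (s / a).
split=> //; try by rewrite mulrC divfK.
have e x : a ^+ 2 * (x / a) ^+ 2 = x ^+ 2 by rewrite expr_div_n mulrC divfK // expf_neq0.
split.
- by apply: (mulfI p0); rewrite h1 pE e.
- by apply: (mulfI p0); rewrite -h4 pE; field.
by apply: (mulfI p0); rewrite h2 pE e.
Qed.

Variables (A : set 'rV[K]_m) (d : nat).
Hypothesis sc : smooth_cone A d.

Lemma vanish_form_eq0 w : (forall v, A v -> dot w v = 0) -> w = 0.
Proof.
move=> h; apply/eqP/negPn/negP => w0; have [v Av] := sc_nondeg sc w0.
by rewrite h // eqxx.
Qed.

Lemma cancel_form w (p q : {mpoly K[m]}) : w != 0 ->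
  (forall v, A v -> dot w v * p.@[v 0] = dot w v * q.@[v 0]) -> forall v, A v -> p.@[v 0] = q.@[v 0].
Proof.
move=> w0 h; have [_ pr] := sc_prime sc.
have /pr[h1|h1] : vanish A (lin_form w * (p - q)).
  by move=> v Av; rewrite mevalM mevalB lin_form_eval mulrBr h // subrr.
  by move: w0; rewrite (vanish_form_eq0 (w := w)) ?eqxx // => v /h1; rewrite lin_form_eval.
by move=> v /h1; rewrite mevalB => /eqP; rewrite subr_eq0 => /eqP.
Qed.

(** The forms are the entries of a symmetric matrix with diagonal [b12], [b13], [b23] and
    off-diagonal [m1], [m2], [m3], which has rank at most one on [A]. They are coordinates on the
    whole space because a common zero lies in all three subspaces [T1], [T2], [T3]. *)
Lemma six_forms (T1 T2 T3 : {vspace 'rV[K]_m}) (b12 b13 b23 m1 m2 m3 : 'rV[K]_m) : m = 6%N ->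
  b12 != 0 -> b13 != 0 -> b23 != 0 ->
  (forall v, A v -> dot b12 v * dot b13 v = dot m1 v ^+ 2) ->
  (forall v, A v -> dot b12 v * dot b23 v = dot m2 v ^+ 2) ->
  (forall v, A v -> dot b13 v * dot b23 v = dot m3 v ^+ 2) ->
  (orth T1 <= <[b12]> + <[b13]> + <[m1]>)%VS ->
  (orth T2 <= <[b12]> + <[b23]> + <[m2]>)%VS ->
  (orth T3 <= <[b13]> + <[b23]> + <[m3]>)%VS ->
  (forall v, v \in T1 -> v \in T2 -> v \in T3 -> v = 0) ->
  exists M : 'M[K]_(6, m), [/\ row_free M, row_full M &
    forall v, A v -> exists u : 'rV[K]_3, v = conics_at u *m M].
Proof.
move=> m6 b120 b130 b230 r1 r2 r3 s1 s2 s3 T0.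
have [_ pr] := sc_prime sc.
have prl w w' : (forall v, A v -> dot w v * dot w' v = 0) -> w = 0 \/ w' = 0.
  move=> h; have /pr[h1|h1] : vanish A (lin_form w * lin_form w').
  - by move=> v Av; rewrite mevalM !lin_form_eval h.
  - by left; apply: vanish_form_eq0 => v /h1; rewrite lin_form_eval.
  by right; apply: vanish_form_eq0 => v /h1; rewrite lin_form_eval.
have nz w w' w'' : (forall v, A v -> dot w v * dot w' v = dot w'' v ^+ 2) -> w != 0 -> w' != 0 -> w'' != 0.
  move=> h w0; apply: contraNneq => e; have [|w1|->//] := prl w w'; last by rewrite w1 eqxx in w0.
  by move=> v /h ->; rewrite e dot0l expr0n.
have m10 := nz _ _ _ r1 b120 b130; have m20 := nz _ _ _ r2 b120 b230; have m30 := nz _ _ _ r3 b130 b230.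
(* The square roots [m1], [m2], [m3] are determined up to sign. The squares of the two triple
   products agree, so, [A] being prime, a change of sign of [m3] makes the products equal; the
   remaining minors follow by cancellation. *)
wlog cube : m3 r3 s3 m30 / forall v, A v -> dot m1 v * dot m2 v * dot m3 v = dot b12 v * dot b13 v * dot b23 v.
  move=> W; pose L (w : 'rV[K]_m) := lin_form w.
  have /pr[h|h] : vanish A ((L m1 * L m2 * L m3 - L b12 * L b13 * L b23) * (L m1 * L m2 * L m3 + L b12 * L b13 * L b23)).
  - move=> v Av; rewrite /L mevalM mevalB mevalD !mevalM !lin_form_eval.
    transitivity ((dot m1 v) ^+ 2 * (dot m2 v) ^+ 2 * (dot m3 v) ^+ 2 - (dot b12 v * dot b13 v * dot b23 v) ^+ 2); first by ring.
    by rewrite -r1 // -r2 // -r3 //; ring.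
  - apply: (W m3 r3 s3 m30) => v Av; have := h v Av; rewrite /L mevalB !mevalM !lin_form_eval => /eqP.
    by rewrite subr_eq0 => /eqP.
  apply: (W (- m3)).
  - by move=> v Av; rewrite dotNl sqrrN r3.
  - by apply: (subv_trans s3); apply: addvS => //; rewrite -memvE; apply/vlineP; exists (-1); rewrite scaleN1r opprK.
  - by apply: contraNneq m30 => e; rewrite -[m3]opprK e oppr0.
  move=> v Av; have := h v Av; rewrite /L mevalD !mevalM !lin_form_eval dotNl mulrN => /eqP.
  by rewrite addrC addr_eq0 => /eqP ->.
have cancel w (p q : 'rV[K]_m * 'rV[K]_m) : w != 0 ->
    (forall v, A v -> dot w v * (dot p.1 v * dot p.2 v) = dot w v * (dot q.1 v * dot q.2 v)) ->
    forall v, A v -> dot p.1 v * dot p.2 v = dot q.1 v * dot q.2 v.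
  move=> w0 h v Av.
  have H := @cancel_form w (lin_form p.1 * lin_form p.2) (lin_form q.1 * lin_form q.2) w0.
  have := H _ v Av; rewrite !mevalM !lin_form_eval; apply=> v' Av'.
  by rewrite !mevalM !lin_form_eval h.
have e12 : forall v, A v -> dot m1 v * dot m2 v = dot b12 v * dot m3 v.
  apply: (cancel m3 (m1, m2) (b12, m3)) => //= v Av; rewrite mulrC cube // mulrCA -expr2 -r3 //; ring.
have e13 : forall v, A v -> dot m1 v * dot m3 v = dot b13 v * dot m2 v.
  apply: (cancel m2 (m1, m3) (b13, m2)) => //= v Av; rewrite mulrC mulrAC cube // mulrCA -expr2 -r2 //; ring.
have e23 : forall v, A v -> dot m2 v * dot m3 v = dot b23 v * dot m1 v.
  apply: (cancel m1 (m2, m3) (b23, m1)) => //= v Av; rewrite mulrA cube // mulrCA -expr2 -r1 //; ring.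
pose B : 'M[K]_(m, 6) := (\matrix_i [:: b12; m1; m2; b13; m3; b23]`_i)^T.
have BE v : v *m B = \row_i dot ([:: b12; m1; m2; b13; m3; b23]`_i) v.
  by apply/rowP => i; rewrite !mxE; apply: eq_bigr => j _; rewrite !mxE mulrC.
have Binj v : v *m B = 0 -> v = 0.
  move=> vB; have z (i : 'I_6) : dot ([:: b12; m1; m2; b13; m3; b23]`_i) v = 0.
    by have := congr1 (fun r : 'rV_6 => r 0 i) vB; rewrite BE !mxE.
  have [z0 z1 z2] := And3 (z (inord 0)) (z (inord 1)) (z (inord 2)); have [z3 z4 z5] := And3 (z (inord 3)) (z (inord 4)) (z (inord 5)).
  rewrite !inordK //= in z0 z1 z2 z3 z4 z5.
  have inT (T : {vspace 'rV[K]_m}) p q r : (orth T <= <[p]> + <[q]> + <[r]>)%VS -> dot p v = 0 -> dot q v = 0 -> dot r v = 0 -> v \in T.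
    move=> sub pv qv rv; rewrite -[T]orthK; apply/orthP => w /(subvP sub)/memv_addP[_ /memv_addP[_ /vlineP[a ->] [_ /vlineP[b ->] ->]] [_ /vlineP[c ->] ->]].
    by rewrite !dotDl !dotZl pv qv rv !mulr0 !addr0.
  by apply: T0; [exact: inT s1 _ _ _ | exact: inT s2 _ _ _ | exact: inT s3 _ _ _].
have Bf : row_free B by rewrite -kermx_eq0; apply/rowV0P => c /sub_kermxP; exact: Binj.
have Bfull : row_full B by rewrite /row_full (eqP Bf) m6.
have [C BC] := row_freeP Bf; have [C' CB] := row_fullP Bfull.
have CE : C' = C by rewrite -[C']mulmx1 -BC mulmxA CB mul1mx.
rewrite {}CE in CB; exists C; split.
- by apply/row_freeP; exists B.
- by apply/row_fullP; exists B.
move=> v Av; have [a [b [c [h0 h1 h2 [h3 h4 h5]]]]] := symmetric_rank1 (r1 v Av) (r2 v Av) (r3 v Av) (e12 v Av) (e13 v Av) (e23 v Av).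
exists (\row_j [:: a; b; c]`_j).
have -> : conics_at (\row_j [:: a; b; c]`_j) = v *m B; last by rewrite -mulmxA BC mulmx1.
rewrite BE; apply/rowP => -[[|[|[|[|[|[|//]]]]]] hi]; rewrite !mxE /= !inordK //=.
Qed.

End SixForms.

(** * Three general points *)

Section VeroneseCone.
Variables (K : numClosedFieldType) (m d : nat).
Hypothesis Kunc : ~ countable [set: K].
Variables (A : set 'rV[K]_m) (k : set K) (dS : nat).
Hypotheses (sc : smooth_cone A d) (hk : csubring k) (rA : ratl k A) (m0 : (0 < m)%N) (r0 : (0 < m - d)%N).
Hypothesis dimS : forall x y, generic k A x -> generic (adj k x) A y ->
  \dim (tang A x + tang A y) = dS.
Hypothesis dSm : (dS < m)%N.
Hypothesis extremal : (1 + d + 1 = dS)%N.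
Hypothesis d2 : (2 < d)%N.
Implicit Types (u v w x y : 'rV[K]_m).

Let Acl : algclosed A. Proof. by case: (sc_cone sc). Qed.
Let Apr := sc_prime sc.
Let rk : subring k. Proof. by case: hk. Qed.

Lemma contact_data x (F : 'I_(m - d) -> {mpoly K[m]}) : frame A k x F -> exists mu y nu k1,
  [/\ generic (adj k x) [set: 'rV[K]_(m - d)] mu, generic (adj (adj k x) mu) A y, csubring k1 &
   [/\ adj (adj k x) mu `<=` k1, (forall i, k1 (y 0 i)) /\ (forall i, k1 ((nu *m grads F x) 0 i)),
     nu *m grads F x \in orth (tang A x + tang A y), nu *m grads F x != 0 &
     forall y', generic k1 A y' -> (sker F A x nu :&: tang A y' = 0)%VS]].
Proof.
move=> fr; have ckx := adj_csubring x hk; have [rkx _] := ckx.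
have [mu gmu] := exists_generic Kunc ckx (@setT_closed K _) (@setT_prime K (m - d)).
have ckm := adj_csubring mu ckx.
have [y gy] := exists_generic Kunc ckm Acl Apr.
have sub : adj k x `<=` adj (adj k x) mu by move=> c; exact: sub_adj.
have [nu [k1 [hk1 [k01 [ky keta]] etaQ eta0 hy']]] := kernel_bound Kunc sc hk rA dimS dSm fr (generic_sub sub gy) ckm sub gy.
by exists mu, y, nu, k1.
Qed.

Lemma conic_at x (F : 'I_(m - d) -> {mpoly K[m]}) : frame A k x F -> [/\ m = 6%N, d = 3%N & exists Phi : 'M[K]_(3, m),
  [/\ row_free Phi, rowvs Phi = orth (tang A x) &
  forall v, A v -> dot (row 0 Phi) v * dot (row (inord 2) Phi) v = dot (row (inord 1) Phi) v ^+ 2]].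
Proof.
move=> fr; have [mu [y [nu [k1 [gmu gy hk1 [k01 [ky keta] etaQ eta0 hy']]]]]] := contact_data fr.
have [m6 P] := conic_forms Kunc sc hk rA m0 r0 dimS dSm extremal d2 fr gmu gy hk1 k01 etaQ hy'.
have d3 := cone_dim3 Kunc sc hk rA m0 r0 dimS extremal d2 fr gmu gy hk1 k01 etaQ hy'.
by split.
Qed.

Lemma generic_notin_tang x y (F : 'I_(m - d) -> {mpoly K[m]}) : frame A k x F -> generic (adj k x) A y -> y \notin tang A x.
Proof.
move=> fr gy; apply/negP => yT; have ckx := adj_csubring x hk.
have : row (Ordinal r0) (grads F x) = 0.
  apply: (normal_perp_eq0 Kunc sc rA (k1 := adj k x) (y := y)) => //.
  - by move=> c; exact: sub_adj.
  - move=> D hD; have := congr1 (row (Ordinal r0)) (grads_const hk fr hD).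
    by rewrite row0 => <-; apply/rowP => j; rewrite !mxE.
  rewrite dotC; have : row (Ordinal r0) (grads F x) \in orth (tang A x) by rewrite (fr_orth fr) row_in_rowvs.
  by move/orthP; apply.
move=> h; have := row_free_inj (fr_free fr) (etrans (esym (rowE (Ordinal r0) _)) (etrans h (esym (mul0mx _ _)))).
by move/rowP => /(_ (Ordinal r0)); rewrite !mxE !eqxx => /eqP; rewrite oner_eq0.
Qed.

Lemma common_normal x y (F : 'I_(m - d) -> {mpoly K[m]}) : frame A k x F -> generic (adj k x) A y -> exists be,
  [/\ be != 0, be \in orth (tang A x), be \in orth (tang A y) &
   forall w, w \in orth (tang A x) -> w \in orth (tang A y) -> w \in <[be]>%VS].
Proof.
move=> fr gy; have gx := fr_gen fr; have [m6 d3 _] := conic_at fr; pose Q := orth (tang A x + tang A y).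
have dQ : \dim Q = 1%N by rewrite dim_orth dimS //; rewrite -extremal m6 d3.
have b0 : vpick Q != 0 by rewrite vpick0 -dimv_eq0 dQ.
exists (vpick Q); split=> //.
- by apply: (subvP (orthS (addvSl _ _))); exact: memv_pick.
- by apply: (subvP (orthS (addvSr _ _))); exact: memv_pick.
move=> w /orthP w1 /orthP w2; have wQ : w \in Q.
  by apply/orthP => _ /memv_addP[a aT [b bT ->]]; rewrite dotDl w1 // w2 // addr0.
have : (<[vpick Q]> == Q)%VS by rewrite eqEdim dim_vline b0 dQ -memvE memv_pick.
by move/eqP ->.
Qed.

Lemma sub_veronese_cone : exists M : 'M[K]_(6, m), [/\ row_free M, row_full M &
  forall v, A v -> exists u : 'rV[K]_3, v = conics_at u *m M].
Proof.
have [x1 [F fr1]] := exists_frame Kunc sc m0 hk rA.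
have gx1 := fr_gen fr1.
have [mu [x2 [nu [k1 [gmu gy hk1 [k01 [ky keta] etaQ eta0 hy']]]]]] := contact_data fr1.
have ckx := adj_csubring x1 hk; have [rkx _] := ckx.
have g12 : generic (adj k x1) A x2 by apply: generic_sub gy => c; exact: sub_adj.
have [gx2 g21] := generic_swap Kunc sc hk rA gx1 g12.
have [x3 gx3] := exists_generic Kunc hk1 Acl Apr.
have g13 : generic (adj k x1) A x3 by apply: generic_sub gx3 => c kc; apply: k01; exact: sub_adj.
have kk1 : k `<=` k1 by move=> c kc; apply: k01; apply: sub_adj => //; exact: sub_adj.
have g23 : generic (adj k x2) A x3.
  apply: generic_sub gx3 => _ [p [pk ->]]; apply: over_eval => //; [by case: hk1 | by move=> e; exact: kk1 (pk e)].
have [gx3' g31] := generic_swap Kunc sc hk rA gx1 g13.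
have [_ g32] := generic_swap Kunc sc hk rA gx2 g23.
have fr2 := frame_transfer fr1 gx2; have fr3 := frame_transfer fr1 gx3'.
have [m6 d3 [P1 [P1f P1T P1c]]] := conic_at fr1.
have [_ _ [P2 [P2f P2T P2c]]] := conic_at fr2.
have [_ _ [P3 [P3f P3T P3c]]] := conic_at fr3.
have [b12 [b120 b12x b12y b12m]] := common_normal fr1 g12.
have [b13 [b130 b13x b13y b13m]] := common_normal fr1 g13.
have [b23 [b230 b23x b23y b23m]] := common_normal fr2 g23.
(* The common normals at [x1] and [x2] form the line spanned by [nu *m grads F x1], whose
   coordinates are in [k1]; it cannot be orthogonal to [x3], which is generic over [k1]. *)
have no3 w : w \in orth (tang A x1) -> w \in orth (tang A x2) -> w \in orth (tang A x3) -> w = 0.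
  move=> w1 w2 w3; apply: contrapT => /eqP w0.
  have e0 : dot (nu *m grads F x1) x3 = 0.
    have := b12m _ (subvP (orthS (addvSl _ _)) _ etaQ) (subvP (orthS (addvSr _ _)) _ etaQ).
    have /vlineP[c wE] := b12m _ w1 w2; have c0 : c != 0 by apply: contraNneq w0 => c0; rewrite wE c0 scale0r.
    move=> /vlineP[e ->]; rewrite (_ : b12 = c^-1 *: w); last by rewrite wE scalerA mulVf // scale1r.
    rewrite !dotZl dotC; move/orthP: w3 => ->; rewrite ?mulr0 //.
    by apply: tang_cone; [case: (sc_cone sc) | case: gx3].
  move: eta0; rewrite (normal_perp_eq0 Kunc sc rA kk1 hk1 gx3 _ e0) ?eqxx // => D [dD kD].
  by apply/rowP => j; rewrite mxE (kD _ (keta j)) mxE.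
have i1 w : w \in <[b12]>%VS -> w \in <[b13]>%VS -> w = 0.
  by move=> /vlineP[a wE] /vlineP[b wE']; apply: no3; [rewrite wE; exact: memvZ b12x | rewrite wE; exact: memvZ b12y | rewrite wE'; exact: memvZ b13y].
have i2 w : w \in <[b12]>%VS -> w \in <[b23]>%VS -> w = 0.
  by move=> /vlineP[a wE] /vlineP[b wE']; apply: no3; [rewrite wE; exact: memvZ b12x | rewrite wE; exact: memvZ b12y | rewrite wE'; exact: memvZ b23y].
have i3 w : w \in <[b13]>%VS -> w \in <[b23]>%VS -> w = 0.
  by move=> /vlineP[a wE] /vlineP[b wE']; apply: no3; [rewrite wE; exact: memvZ b13x | rewrite wE'; exact: memvZ b23x | rewrite wE; exact: memvZ b13y].
have [Ax1 _] := gx1; have [Ax2 _] := gx2; have [Ax3 _] := gx3.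
have n12 := generic_notin_tang fr1 g12; have n13 := generic_notin_tang fr1 g13.
have n21 := generic_notin_tang fr2 g21; have n23 := generic_notin_tang fr2 g23.
have n31 := generic_notin_tang fr3 g31; have n32 := generic_notin_tang fr3 g32.
have [m1 [c1 s1]] := conic_pencil P1f P1T P1c Ax2 Ax3 n12 n13 b12m b13m i1.
have [m2 [c2 s2]] := conic_pencil P2f P2T P2c Ax1 Ax3 n21 n23 (fun w h h' => b12m w h' h) b23m i2.
have [m3 [c3 s3]] := conic_pencil P3f P3T P3c Ax1 Ax2 n31 n32 (fun w h h' => b13m w h' h) (fun w h h' => b23m w h' h) i3.
apply: (six_forms sc m6 b120 b130 b230 c1 c2 c3 s1 s2 s3) => v v1 v2 v3.
(* Common tangents at [x1] and [x2] are in the kernel of [nu], which meets the tangent space at [x3]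
   only in [0]. *)
have vs : v \in sker F A x1 nu by exact: (cap_sker hk rA fr1 g12 etaQ v1 v2).
by apply/eqP; rewrite -memv0 -(hy' x3 gx3) memv_cap vs.
Qed.

End VeroneseCone.

Section VeroneseEquality.
Variables (K : numClosedFieldType) (m : nat).
Hypothesis Kunc : ~ countable [set: K].
Variables (A : set 'rV[K]_m) (k : set K).
Hypotheses (sc : smooth_cone A 3) (hk : csubring k) (rA : ratl k A) (m0 : (0 < m)%N).

Definition conics_jac (u : 'rV[K]_3) : 'M[K]_(3, 6) :=
  let u0 := u 0 (inord 0) in let u1 := u 0 (inord 1) in let u2 := u 0 (inord 2) in
  let e (i : 'I_3) a : K := (i == inord a)%:R in
  \matrix_(i, j) [:: u0 * e i 0 *+ 2; u0 * e i 1 + u1 * e i 0; u0 * e i 2 + u2 * e i 0;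
    u1 * e i 1 *+ 2; u1 * e i 2 + u2 * e i 1; u2 * e i 2 *+ 2]`_j.

Lemma conics_jacE u w : w *m conics_jac u =
  let w0 := w 0 (inord 0) in let w1 := w 0 (inord 1) in let w2 := w 0 (inord 2) in
  let u0 := u 0 (inord 0) in let u1 := u 0 (inord 1) in let u2 := u 0 (inord 2) in
  \row_j [:: u0 * w0 *+ 2; u0 * w1 + u1 * w0; u0 * w2 + u2 * w0; u1 * w1 *+ 2; u1 * w2 + u2 * w1; u2 * w2 *+ 2]`_j.
Proof.
have s (f : 'I_3 -> K) : \sum_i f i = f (inord 0) + f (inord 1) + f (inord 2).
  rewrite !big_ord_recl big_ord0 addr0 addrA; congr (f _ + f _ + f _); by apply/val_inj; rewrite /= inordK.
apply/rowP => j; rewrite !mxE s !mxE.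
have E a b : (a < 3)%N -> (b < 3)%N -> ((inord a : 'I_3) == inord b) = (a == b).
  by move=> ha hb; rewrite -val_eqE /= !inordK.
rewrite !E //=; case: j => -[|[|[|[|[|[|//]]]]]] hj /=; ring.
Qed.

Lemma vder_conics D u : derivation D -> vder D (conics_at u) = vder D u *m conics_jac u.
Proof.
move=> [dD dM]; rewrite conics_jacE; apply/rowP => -[[|[|[|[|[|[|//]]]]]] hj]; rewrite !mxE /= ?expr2 dM; ring.
Qed.

(** The parameter [u] of a generic point of [A] has all of ['rV[K]_3] as velocities, because its
    image already has a velocity space of dimension [3]. An equation of [A] pulled back to the
    parameters vanishes at [u], hence identically. *)
Lemma veronese_cone_eq (M : 'M[K]_(6, m)) :
  (forall v, A v -> exists u : 'rV[K]_3, v = conics_at u *m M) ->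
  forall u, A (conics_at u *m M).
Proof.
move=> sub u'; have [Acl _ _] := sc_cone sc; have Apr := sc_prime sc.
have [rk _] := hk; have ck' := adj_csubring (mxvec M) hk; set k' := adj k (mxvec M) in ck'; have [rk' _] := ck'.
have kk' : k `<=` k' by exact: sub_adj.
have rA' := ratl_sub kk' rA.
have [x gx] := exists_generic Kunc ck' Acl Apr.
have dx : \dim (tsp k' x) = 3%N by rewrite (generic_tsp rk' (ratl_kdef rA') gx) (dim_tang_generic sc ck' m0 gx).
have [Ax gen] := gx; have [u uE] := sub x Ax.
have kM i j : k' (M i j) by rewrite -mxvecE; exact: mem_adj.
have full : tsp k' u = fullv.
  apply/eqP; rewrite eqEdim subvf dim_full_row /=.
  pose f := linfun (mulmxr (conics_jac u *m M) : 'rV[K]_3 -> 'rV[K]_m).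
  have le : (\dim (tsp k' x) <= \dim (f @: tsp k' u))%N.
    apply/dimvS/subvP => _ /tspP[D [hD ->]]; have [dD kD] := hD.
    apply/memv_imgP; exists (vder D u); first by apply/tspP; exists D.
    rewrite lfunE /= uE vder_mulmx // (_ : map_mx D M = 0) ?mulmx0 ?addr0; last first.
      by apply/matrixP => i j; rewrite !mxE kD.
    by rewrite vder_conics // mulmxA.
  have := limg_ker_dim f (tsp k' u); rewrite dx in le => h; apply: (leq_trans le).
  by rewrite -h leq_addl.
apply: Acl => p /rA'[r [c [g [hg ->]]]].
rewrite raddf_sum big1 // => i _ /=; rewrite mevalZ; have [gk gA] := hg i.
have gk' : over k' (g i) by move=> e; exact: gk.
pose X a : {mpoly K[3]} := 'X_(inord a).
have Xk a : over k' (X a) by exact: overX.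
pose t j : {mpoly K[3]} := \sum_l M l j *: [:: X 0%N * X 0%N; X 0%N * X 1%N; X 0%N * X 2%N; X 1%N * X 1%N; X 1%N * X 2%N; X 2%N * X 2%N]`_l.
have tE j (w : 'rV[K]_3) : (t j).@[w 0] = (conics_at w *m M) 0 j.
  rewrite /t raddf_sum mxE; apply: eq_bigr => l _ /=; rewrite mevalZ mxE mulrC; congr (_ * _).
  by case: l => -[|[|[|[|[|[|//]]]]]] hl /=; rewrite mevalM !mevalXU ?expr2.
have tk j : over k' (t j).
  apply: over_sum => // l _; apply: overZ => //.
  by case: l => -[|[|[|[|[|[|//]]]]]] hl /=; exact: overM.
have [Q [Qk QE]] := comp_poly rk' gk' tk.
have gE w : (g i).@[(conics_at w *m M) 0] = Q.@[w 0].
  by rewrite QE; congr (g i).@[_]; apply/funext => j; rewrite tE.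
have Q0 : Q = 0 by apply: (over_partials_indep rk' full Qk); rewrite -gE -uE gA.
by rewrite gE Q0 meval0 mulr0.
Qed.
End VeroneseEquality.

(** * The bound and its equality case *)

Section Assembly.
Variables (K : numClosedFieldType) (N : nat).
Hypothesis Kunc : ~ countable [set: K].
Variable X : set (pspace K N).
Hypotheses (hX : manifold X) (ndX : non_degenerate X) (N0 : (0 < N)%N).
Hypothesis SX : secant_variety X <> setT.
Local Notation A := (cone X).
Local Notation m := N.+1.
Local Notation d := (krull_dim X).+1.

Let sc : smooth_cone A d. Proof. exact: smooth_cone_of_manifold. Qed.
Let Acl : algclosed A. Proof. by case: (sc_cone sc). Qed.
Let Asc (s : K) v : A v -> A (s *: v). Proof. by case: (sc_cone sc) => _ _; apply. Qed.
Let Apr := sc_prime sc.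
Let m0 : (0 < m)%N. Proof. by []. Qed.
Let r0 : (0 < m - d)%N. Proof. exact: codim_pos. Qed.

Lemma vline_scale (s : K) (v : 'rV[K]_m) : s != 0 -> (<[s *: v]> = <[v]>)%VS.
Proof.
move=> s0; apply/eqP; rewrite eqEsubv -!memvE memvZ ?memv_line //=; apply/vlineP; exists s^-1.
by rewrite scalerA mulVf // scale1r.
Qed.

Lemma conicsZ (s : K) u : conics_at (s *: u) = s ^+ 2 *: conics_at u.
Proof. by apply/rowP => -[[|[|[|[|[|[|//]]]]]] hj]; rewrite !mxE /=; ring. Qed.

Lemma conics_eq0 (u : 'rV[K]_3) : conics_at u = 0 -> u = 0.
Proof.
move=> h; have z (j : 'I_6) : conics_at u 0 j = 0 by rewrite h mxE.
have [z0 z3 z5] := And3 (z (inord 0)) (z (inord 3)) (z (inord 5)).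
rewrite !mxE !inordK //= in z0 z3 z5.
have sq (a : K) : a ^+ 2 = 0 -> a = 0 by move/eqP; rewrite expf_eq0 => /= /eqP.
apply/rowP => j; rewrite mxE -(inord_val j); case: j => -[|[|[|//]]] hj /=; exact: sq.
Qed.

Lemma veronese_of_cone (M : 'M[K]_(6, m)) : row_free M -> row_full M ->
  (forall v, A v -> exists u : 'rV[K]_3, v = conics_at u *m M) ->
  (forall u : 'rV[K]_3, A (conics_at u *m M)) -> veronese_surface X.
Proof.
move=> Mf Mfull sub sup; exists M; split=> //; rewrite eqEsubset; split=> y.
  move/cone_coords/sub => [u uE].
  have u0 : u != 0.
    apply: contraNneq (coords_neq0 y) => u0; rewrite uE u0 (_ : conics_at 0 = 0) ?mul0mx //.
    by rewrite -(scale0r (0 : 'rV[K]_3)) conicsZ expr0n scale0r.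
  have [w wu] := point_of u0; have [c [c0 cE]] := coords_of wu u0.
  have cu0 : conics_at (coords w) != 0.
    by apply: contraNneq (coords_neq0 w) => /conics_eq0 ->.
  have [x xE] := point_of cu0; have [e [e0 eE]] := coords_of xE cu0.
  exists x; first by exists w.
  by rewrite eE cE conicsZ scalerA -scalemxAl -uE vline_scale ?mulf_neq0 ?expf_neq0 // val_coords.
move=> [x [w xE] yE]; apply/cone_coords.
have : coords y \in val y by rewrite val_coords memv_line.
rewrite yE => /vlineP[c ->]; have : coords x \in val x by rewrite val_coords memv_line.
by rewrite xE => /vlineP[e ->]; rewrite -scalemxAl; do 2 apply: (Asc).
Qed.

Theorem dual_variety_bound :
  let n := krull_dim X in
  let c := (N - krull_dim (secant_variety X))%N in
  let nstar := krull_dim (dual_variety X) in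
  (n + c + 1 <= nstar)%N /\
  (nstar = (n + c + 1)%N <-> n = 1%N \/ (N = 5%N /\ veronese_surface X)).
Proof.
move=> n c nstar; have [k [x [y [F [mu [fr gmu gy rS [SE DE]]]]]]] := cone_data Kunc hX ndX N0 SX.
have hk := fr_sub fr; have rA := fr_ratl fr; have gx := fr_gen fr; have [rk _] := hk.
have rkx : subring (adj k x) by exact: adj_subring.
have gyx : generic (adj k x) A y by apply: generic_sub gy; exact: sub_adj.
have nS : secant_cone A <> setT by exact: secant_proper.
have x0 : x != 0 by exact: (generic_neq0 sc m0 hk gx).
have dT : \dim (tang A x) = d by exact: (dim_tang_generic sc hk m0 gx).
have dTy : \dim (tang A y) = d.
  by apply: (dim_tang_generic sc _ m0 gyx); exact: adj_csubring.
have dL1 : (0 < \dim (sker F A x mu))%N.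
  rewrite lt0n dimv_eq0; apply: contraNneq x0 => s0; rewrite -memv0 -s0; exact: (x_sker fr Asc).
have dsum : (\dim (tang A x + tang A y) <= d + d)%N by rewrite (leq_trans (dimv_add_leqif _ _)) // dT dTy.
have lower : (\dim (sker F A x mu) + d < \dim (tang A x + tang A y))%N.
  have := sker_sum_proper Kunc sc fr gmu gy rS nS.
  by rewrite dimv_disjoint_sum ?dTy //; exact: (sker_cap Kunc sc fr r0 gmu gy).
have dSm : (\dim (tang A x + tang A y) < m)%N.
  rewrite ltn_neqAle dim_leq andbT; apply/eqP => h; apply: nS.
  apply: (full_tsp_setT _ hk rS (generic_secant Kunc hk Acl Apr rA gx gyx)); first by case: (secant_ccone (sc_cone sc)).
  by rewrite (secant_tsp hk rA gx gyx); apply/eqP; rewrite eqEdim subvf dim_full_row h leqnn.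
have dimS x' y' : generic k A x' -> generic (adj k x') A y' ->
    \dim (tang A x' + tang A y') = \dim (tang A x + tang A y).
  move=> gx' gy'; rewrite -(secant_tsp hk rA gx' gy') -(secant_tsp hk rA gx gyx).
  exact: (generic_dim rk (generic_secant Kunc hk Acl Apr rA gx' gy') (generic_secant Kunc hk Acl Apr rA gx gyx)).
have dimL x' (F' : 'I_(m - d) -> {mpoly K[m]}) mu' : frame A k x' F' -> generic (adj k x') [set: 'rV[K]_(m - d)] mu' ->
    \dim (sker F' A x' mu') = \dim (sker F A x mu).
  move=> fr' gmu'; rewrite -(orth_tsp_normal fr gmu) -(orth_tsp_normal fr' gmu') !dim_orth; congr (_ - _)%N.
  exact: (generic_dim rk (generic_dual Kunc sc m0 fr' gmu') (generic_dual Kunc sc m0 fr gmu)).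
have core : (\dim (sker F A x mu) + d + 1)%N = \dim (tang A x + tang A y) -> (2 < d)%N ->
    N = 5%N /\ veronese_surface X.
  move=> ext d2.
  have [l1|l1] := ltnP 1 (\dim (sker F A x mu)).
    by have := defect_absurd Kunc sc hk rA m0 r0 dimS dSm dimL ext l1.
  have {}ext : (1 + d + 1)%N = \dim (tang A x + tang A y).
    by rewrite -ext; congr (_ + _ + _)%N; apply/eqP; rewrite eqn_leq l1 dL1.
  have [[m6] d3 _] := conic_at Kunc sc hk rA m0 r0 dimS dSm ext d2 fr; split=> //.
  have [M [Mf Mfull sub]] := sub_veronese_cone Kunc sc hk rA m0 r0 dimS dSm ext d2.
  apply: (veronese_of_cone Mf Mfull sub); apply: (veronese_cone_eq Kunc _ hk rA m0 sub).
  by rewrite -d3; exact: sc.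
(* Only arithmetic is left: [S + 1 = s], [ns + 1 + l = N + 1] and [l + n + 1 < s < N + 1]. The last
   bound makes the truncated difference [N - S] a true one, and equality in the theorem amounts to
   [l + n + 2 = s]. *)
move: SE DE dsum lower dSm core dL1; rewrite /c /n /nstar.
move: (\dim (sker F A x mu)) (\dim (tang A x + tang A y)) (krull_dim (secant_variety X)) (veronese_surface X).
move: (krull_dim X) (krull_dim (dual_variety X)); clear => n ns l s S V SE DE dsum lower dSm core dL1.
split; first by lia.
split; last first.
  (* With [d = n + 1], the bounds [0 < l], [l + d < s] and [s <= 2 d] give [l = 1], [s = 4] for
     [n = 1]; together with [s < 6] for [N = 5] they leave [(d, l, s) = (2, 1, 4)] or [(3, 1, 5)].
     Each time [l + d + 1 = s]. *)
  case=> [e|[e _]]; lia.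
move=> e; have [n1|n1] := leqP n 1; first by left; lia.
by right; apply: core; lia.
Qed.
End Assembly.

(** * Uncountability of the complex numbers *)

Section Uncountable.
Variable R : realType.
Implicit Types (I : R * R) (r : R).

(** A closed subinterval missing [r]. On the right only the upper quarter is kept, so that [r] is
    missed also when it is the midpoint. *)
Definition avoid r I : R * R :=
  let c := (I.1 + I.2) / 2 in if r <= c then ((c + I.2) / 2, I.2) else (I.1, c).

Lemma avoidP r I : I.1 < I.2 -> [/\ I.1 <= (avoid r I).1, (avoid r I).2 <= I.2, (avoid r I).1 < (avoid r I).2 &
  (r < (avoid r I).1) || ((avoid r I).2 < r)].
Proof.
by rewrite /avoid; set c := (_ + _) / 2 => h; have [rc|rc] := lerP r c; split=> /=; rewrite ?rc ?orbT //;
  rewrite /c in rc *; try (apply/orP; left); lra.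
Qed.

Lemma complex_uncountable : ~ countable [set: R[i]].
Proof.
move/countable_injP => [f finj].
(* [e n] is the real number with code [n], or [0] if there is none. The nested intervals [J] avoid
   all the [e n], but their common point [x] has a code. *)
pose e n : R := xget 0 [set r | f (r%:C)%C = n].
pose J n := iteri n (fun i I => avoid (e i) I) (0, 1).
have Jlt n : (J n).1 < (J n).2 by elim: n => [|n IH] /=; [exact: ltr01 | have [] := avoidP (e n) IH].
have Jmono p n : (p <= n)%N -> (J p).1 <= (J n).1 /\ (J n).2 <= (J p).2.
  elim: n => [|n IH]; first by rewrite leqn0 => /eqP ->.
  rewrite leq_eqVlt => /predU1P[-> //|/IH[h1 h2]]; have [a1 a2 _ _] := avoidP (e n) (Jlt n).
  by split; [exact: le_trans h1 a1 | exact: le_trans a2 h2].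
have ub n : ubound [set r | exists p, r = (J p).1] (J n).2.
  move=> _ [p ->]; apply: ltW; have [pn|/ltnW np] := leqP p n.
    by have [h _] := Jmono _ _ pn; exact: le_lt_trans h (Jlt n).
  by have [_ h] := Jmono _ _ np; exact: lt_le_trans (Jlt p) h.
pose E := [set r | exists p, r = (J p).1]; pose x := sup E.
have E0 : E !=set0 by exists (J 0).1, 0%N.
have xl n : (J n).1 <= x by apply: sup_upper_bound; [split=> //; exists (J 0%N).2; exact: ub | exists n].
have xr n : x <= (J n).2 by apply: ge_sup => //; exact: ub.
pose n := f (x%:C)%C.
have en : e n = x.
  have : f ((e n)%:C)%C = n by rewrite /e; case: xgetP => [r _ //|/(_ x)]; case.
  by move=> h; have := finj _ _ (mem_setT _) (mem_setT _) h => -[].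
have [_ _ _] := avoidP (e n) (Jlt n); rewrite en -/(J n.+1).
have := xl n.+1; have := xr n.+1; rewrite /= en => h1 h2.
by rewrite !ltNge h1 h2.
Qed.

End Uncountable.

Theorem theorem2 (R : realType) (N n : nat) (X : set (pspace R[i] N)) :
  (0 < N)%N ->
  manifold X -> non_degenerate X -> krull_dim X = n ->
  secant_variety X <> setT ->
  let c := (N - krull_dim (secant_variety X))%N in
  let nstar := krull_dim (dual_variety X) in
  (n + c + 1 <= nstar)%N /\
  (nstar = (n + c + 1)%N <->
     n = 1%N \/ (N = 5%N /\ veronese_surface X)).
Proof.
move=> N0 hX ndX <- SX.
exact: (dual_variety_bound (@complex_uncountable R) hX ndX N0 SX).
Qed.
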